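(* Assume, in addition to the standing assumptions of the context, that $q_1$ is constant on each of the intervals $(0,\alpha)$ and $(\beta,l)$, that $q_2$ is constant on $(l,L)$, that $b,q_1\in C([\alpha,\beta])$, and that $q_2(l)\ge q_1(l)$. Then the $C_0$-semigroup $e^{t\mathcal A_1}$ generated by $\mathcal A_1$ on $\mathcal H_1$ is exponentially stable, i.e. there exist $\mu>0$ and $C_\mu>0$ such that $$\|e^{t\mathcal A_1}\|_{\mathcal L(\mathcal H_1)}\le C_\mu e^{-\mu t}\qquad\text{for all } t\ge 0 .$$
   Context: All function spaces consist of complex-valued functions; a prime denotes $d/dx$. Let $0\le\alpha<\beta\le l<L$ and $c_0>0$. Let $q_1\in L^\infty(0,l)$, $q_2\in L^\infty(l,L)$ be real-valued with $q_1,q_2\ge c_0$, and let $D_b=b\,\chi_{(\alpha,\beta)}\in L^\infty(0,l)$, where $b$ is real-valued with $b\ge c_0$ on $(\alpha,\beta)$ and $\chi_{(\alpha,\beta)}$ is the characteristic function of $(\alpha,\beta)$. In the claim, $q_1(l)$ and $q_2(l)$ denote the one-sided limits of $q_1$ (from the left) and $q_2$ (from the right) at $l$. $H=L^2(0,l)\times L^2(l,L)$ with its usual norm $\|(v_1,v_2)\|_H^2=\int_0^l|v_1|^2dx+\int_l^L|v_2|^2dx$. $V_1=\{(w_1,w_2)\in H^2(0,l)\times H^2(l,L): w_1(l)=w_2(l),\ w_1'(l)=w_2'(l),\ w_1(0)=w_1'(0)=0,\ w_2(L)=w_2'(L)=0\}$ with norm $\|w\|_{V_1}^2=\int_0^l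 q_1|w_1''|^2dx+\int_l^L q_2|w_2''|^2dx$. $\mathcal H_1=V_1\times H$ with $\|(w,v)\|_{\mathcal H_1}^2=\|w\|_{V_1}^2+\|v\|_H^2$. The operator $\mathcal A_1$ on $\mathcal H_1$ has domain $\mathcal D(\mathcal A_1)$ consisting of all $(w,v)=((w_1,w_2),(v_1,v_2))\in\mathcal H_1$ such that $v\in V_1$, $S_1:=q_1w_1''+D_bv_1''\in H^2(0,l)$, $S_2:=q_2w_2''\in H^2(l,L)$, $S_1(l)=S_2(l)$ and $S_1'(l)=S_2'(l)$; and $$\mathcal A_1(w,v)=\big((v_1,v_2),\,(-(q_1w_1''+D_bv_1'')'',\,-(q_2w_2'')'')\big).$$ It models the transmission Euler–Bernoulli beam $\ddot w_1+(q_1w_1''+D_b\dot w_1'')''=0$ in $(0,l)$, $\ddot w_2+(q_2w_2'')''=0$ in $(l,L)$, with $v=\dot w$, and it generates a $C_0$-semigroup of contractions on $\mathcal H_1$. *)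

(* Defs.v *)
From HB Require Import structures.
From mathcomp Require Import all_boot all_order all_algebra ring_quotient.
From mathcomp Require Import ring lra.
From mathcomp Require Export complex.
From mathcomp Require Import all_classical all_reals all_analysis.
From mathcomp Require Import measurable_realfun.

Set Implicit Arguments.
Unset Strict Implicit.
Unset Printing Implicit Defensive.

Import Order.TTheory GRing.Theory Num.Theory.
Import numFieldNormedType.Exports.
Local Open Scope classical_set_scope.
Local Open Scope ring_scope.
Local Open Scope quotient_scope.
Local Open Scope complex_scope.

Local Notation Re := (@complex.Re _).
Local Notation Im := (@complex.Im _).

Section SquareIntegrable.
Variable R : realType.
Local Notation mu := (@lebesgue_measure R).
Implicit Types (a b : R) (f g : R -> R[i]).

Definition sqmod (z : R[i]) : R := Re z ^+ 2 + Im z ^+ 2.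

Definition cmeasurable a b f :=
  measurable_fun `]a, b[%classic (Re \o f) /\
  measurable_fun `]a, b[%classic (Im \o f).

Definition sqintegrable a b f := cmeasurable a b f /\
  mu.-integrable `]a, b[%classic (EFin \o (sqmod \o f)).

Lemma sqmod_ge0 z : 0 <= sqmod z.
Proof. by rewrite /sqmod addr_ge0 ?sqr_ge0. Qed.

Lemma sqmod_comb k u v :
  sqmod (k * u + v) <= 2 * sqmod k * sqmod u + 2 * sqmod v.
Proof.
move: k u v => [k1 k2] [u1 u2] [v1 v2].
have -> : sqmod ((k1 +i* k2) * (u1 +i* u2) + (v1 +i* v2)) =
    (k1 * u1 - k2 * u2 + v1) ^+ 2 + (k1 * u2 + k2 * u1 + v2) ^+ 2 by [].
rewrite -subr_ge0 /sqmod /= [leRHS](_ : _ =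
  (k1 * u1 - k2 * u2 - v1) ^+ 2 + (k1 * u2 + k2 * u1 - v2) ^+ 2); last by ring.
by rewrite addr_ge0 ?sqr_ge0.
Qed.

Lemma sqintegrable_comb a b (k : R[i]) f g :
  sqintegrable a b f -> sqintegrable a b g -> sqintegrable a b (k *: f + g).
Proof.
move=> [[mf1 mf2] If] [[mg1 mg2] Ig].
have mfg : cmeasurable a b (k *: f + g).
  split.
    apply: (eq_measurable_fun (fun x => Re k * (Re \o f) x
      - Im k * (Im \o f) x + (Re \o g) x)).
      move=> x _ /=; rewrite /GRing.scale /GRing.add /=.
      by case: k (f x) (g x) => [k1 k2] [f1 f2] [g1 g2].
    apply: measurable_funD => //; apply: measurable_funB;
      exact: measurable_funM.
  apply: (eq_measurable_fun (fun x => Re k * (Im \o f) x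
    + Im k * (Re \o f) x + (Im \o g) x)).
    move=> x _ /=; rewrite /GRing.scale /GRing.add /=.
    by case: k (f x) (g x) => [k1 k2] [f1 f2] [g1 g2].
  apply: measurable_funD => //; apply: measurable_funD;
    exact: measurable_funM.
split=> //.
have msq : measurable_fun `]a, b[%classic
    (EFin \o (sqmod \o (k *: f + g))).
  apply/measurable_EFinP; have [m1 m2] := mfg.
  by apply: measurable_funD; apply: measurable_funX.
have mD : measurable (`]a, b[%classic : set (measurableTypeR R)).
  exact: measurable_itv.
have I := integrableD mD (integrableZl mD (2 * sqmod k) If)
  (integrableZl mD 2 Ig).
apply: le_integrable I => // x _ /=; rewrite lee_fin.
have B := sqmod_comb k (f x) (g x).
have B0 := sqmod_ge0 (k * f x + g x).
by rewrite (ger0_norm B0) ger0_norm ?(le_trans B0 B).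

Qed.

End SquareIntegrable.

Section L2Space.
Variables (R : realType) (a b : R).
Local Notation mu := (@lebesgue_measure R).

Definition sqint_pred : {pred R -> R[i]} := mem [set f | sqintegrable a b f].

Fact sqint_submod_closed : submod_closed sqint_pred.
Proof.
split=> [|k f g]; rewrite !inE; last exact: sqintegrable_comb.
have -> : (0 : R -> R[i]) = cst 0 by [].
split; first by split; exact: measurable_cst.
apply: eq_integrable (integrable0 mu _) => // x _ /=.
by rewrite /sqmod /= expr0n addr0.
Qed.

HB.instance Definition _ :=
  GRing.isSubmodClosed.Build R[i] (R -> R[i]) sqint_pred sqint_submod_closed.

Record L2fun := MkL2fun {
  L2fun_val :> R -> R[i];
  _ : L2fun_val \in sqint_pred }.

HB.instance Definition _ := [isSub for L2fun_val].
HB.instance Definition _ := [Choice of L2fun by <:].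
HB.instance Definition _ := [SubChoice_isSubLmodule of L2fun by <:].

Definition null_pred : {pred L2fun} :=
  mem [set f : L2fun | {ae mu, forall x, `]a, b[%classic x -> f x = 0}].

Fact null_submod_closed : submod_closed null_pred.
Proof.
have FF : Filter (almost_everywhere mu) := ae_filter_ringOfSetsType _.
split=> [|k f g]; rewrite !inE /=; first exact: aeW.
apply: filterS2 => x f0 g0 xab.
have E : val (k *: f + g) = k *: val f + val g by [].
rewrite -[LHS]/(val (k *: f + g) x) E /= -[LHS]/(k * f x + g x).
have -> : k * f x + g x = k * 0 + 0 by congr (k * _ + _); [exact: f0|exact: g0].
by rewrite mulr0 addr0.
Qed.

HB.instance Definition _ :=
  GRing.isSubmodClosed.Build R[i] L2fun null_pred null_submod_closed.

(* Square integrable functions up to equality a.e. on ]a, b[. *)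
Definition L2 : Type := Quotient.quot null_pred.
HB.instance Definition _ := GRing.Zmodule.on L2.
HB.instance Definition _ := EqQuotient.on L2.

Definition scaleL2 (k : R[i]) (F : L2) : L2 := \pi_L2 (k *: repr F).

Fact piL2_surj F : exists f, F = \pi_L2 f.
Proof. by exists (repr F); rewrite reprK. Qed.

Fact pi_scaleL2 k f : scaleL2 k (\pi_L2 f) = \pi_L2 (k *: f).
Proof.
apply/eqP; rewrite -Quotient.idealrBE -scalerBr rpredZ //.
by rewrite Quotient.idealrBE reprK.
Qed.

Fact pi_addL2 f g : \pi_L2 f + \pi_L2 g = \pi_L2 (f + g).
Proof. exact: (esym (Quotient.pi_add _ f g)). Qed.

Fact scaleL2A k1 k2 F : scaleL2 k1 (scaleL2 k2 F) = scaleL2 (k1 * k2) F.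
Proof. by have [f ->] := piL2_surj F; rewrite !pi_scaleL2 scalerA. Qed.

Fact scale1L2 : left_id 1 scaleL2.
Proof. by move=> F; have [f ->] := piL2_surj F; rewrite pi_scaleL2 scale1r. Qed.

Fact scaleL2Dr : right_distributive scaleL2 +%R.
Proof.
move=> k F G; have [f ->] := piL2_surj F; have [g ->] := piL2_surj G.
by rewrite !(pi_addL2, pi_scaleL2) scalerDr.
Qed.

Fact scaleL2Dl F : {morph scaleL2^~ F : k1 k2 / k1 + k2}.
Proof.
have [f ->] := piL2_surj F => k1 k2.
by rewrite !(pi_addL2, pi_scaleL2) scalerDl.
Qed.

HB.instance Definition _ := GRing.Zmodule_isLmodule.Build R[i] L2
  scaleL2A scale1L2 scaleL2Dr scaleL2Dl.

End L2Space.

Section Sobolev.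
Variables (R : realType) (a b : R).
Local Notation mu := (@lebesgue_measure R).
Implicit Types (F G : L2 a b) (phi q : R -> R).

Definition ess_bounded q := measurable_fun `]a, b[%classic q /\
  exists M : R, {ae mu, forall x, `]a, b[%classic x -> `|q x| <= M}.

Definition ess_ge (c : R) q :=
  {ae mu, forall x, `]a, b[%classic x -> c <= q x}.

(* The class of q f, for f of class F; the default value 0 of insubd is not
   reached when q is essentially bounded. *)
Definition mulL2 q F : L2 a b :=
  \pi_(L2 a b) (insubd 0 (fun x => (q x)%:C * repr F x)).

Definition sqnormL2 q F : R :=
  \int[mu]_(x in `]a, b[) (q x * sqmod (repr F x)).

Definition cintegral (f : R -> R[i]) : R[i] :=
  (\int[mu]_(x in `]a, b[) Re (f x)) +i* (\int[mu]_(x in `]a, b[) Im (f x)).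

(* Real-valued C^1 test functions with compact support in ]a, b[. *)
Definition C1c phi := [/\ forall x, derivable phi x 1, continuous (derive1 phi) &
  exists c d, [/\ a < c, d < b & forall x, phi x != 0 -> c <= x <= d]].

Definition is_wderiv F G := forall phi, C1c phi ->
  cintegral (fun x => repr F x * (derive1 phi x)%:C) =
  - cintegral (fun x => repr G x * (phi x)%:C).

(* Weak derivatives in L^2 are unique, so xget returns the weak derivative
   whenever there is one. *)
Definition wderiv F : L2 a b := xget 0 [set G | is_wderiv F G].

Definition sobolev1 F := exists G, is_wderiv F G.

Definition sobolev2 F := sobolev1 F /\ sobolev1 (wderiv F).

(* The value at x of the representative of F that is continuous on [a, b]. *)
Definition trace F (x : R) : R[i] :=
  xget 0 [set z | exists f : R -> R[i],
    [/\ {within `[a, b], continuous (Re \o f)},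
        {within `[a, b], continuous (Im \o f)},
        {ae mu, forall y, `]a, b[%classic y -> f y = repr F y} & f x = z]].

End Sobolev.

(* Semigroups of bounded operators on the subspace E of X, normed by N. *)
Section Semigroup.
Variables (R : realType) (X : lmodType R[i]) (E : set X) (N : X -> R).
Implicit Types (S : X -> X) (T : R -> X -> X).

Definition opnorm S : \bar R :=
  ereal_sup [set (N (S x))%:E | x in [set x | E x /\ N x <= 1]].

Definition bounded_operator S :=
  [/\ forall x, E x -> E (S x),
      forall (k : R[i]) x y, E x -> E y -> S (k *: x + y) = k *: S x + S y &
      (opnorm S < +oo)%E].

Definition C0_semigroup T :=
  [/\ forall t, 0 <= t -> bounded_operator (T t),
      forall x, E x -> T 0 x = x,
      forall s t x, 0 <= s -> 0 <= t -> E x -> T (s + t) x = T s (T t x) &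
      forall x, E x -> N (T t x - x) @[t --> 0^'+] --> 0].

(* T is generated by the operator A of domain D. *)
Definition generates (D : set X) (A : X -> X) T :=
  forall x y, E x -> E y ->
    (D x /\ A x = y) <->
    N ((h^-1)%:C *: (T h x - x) - y) @[h --> 0^'+] --> 0.

Definition exponentially_stable T :=
  exists mu C : R, [/\ 0 < mu, 0 < C &
    forall t, 0 <= t -> (opnorm (T t) <= (C * expR (- mu * t))%:E)%E].

End Semigroup.

Notation Hsp l L := (L2 0 l * L2 l L)%type.

(* The energy space is V1 * H, seen as a subset of Hsp * Hsp; (q1, D, q2) are the
   coefficients of w1'', v1'' and w2''. *)
Section Beam.
Variables (R : realType) (l L : R) (q1 q2 D : R -> R).

Local Notation Hsp := (Hsp l L).
Implicit Types (w v : Hsp) (x : Hsp * Hsp).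

Definition normH v : R :=
  Num.sqrt (sqnormL2 (fun=> 1) v.1 + sqnormL2 (fun=> 1) v.2).

Definition V1 : set Hsp := [set w |
  [/\ sobolev2 w.1, sobolev2 w.2,
      trace w.1 l = trace w.2 l /\
      trace (wderiv w.1) l = trace (wderiv w.2) l,
      trace w.1 0 = 0 /\ trace (wderiv w.1) 0 = 0 &
      trace w.2 L = 0 /\ trace (wderiv w.2) L = 0]].

Definition normV1 w : R :=
  Num.sqrt (sqnormL2 q1 (wderiv (wderiv w.1)) +
            sqnormL2 q2 (wderiv (wderiv w.2))).

Definition energy_space : set (Hsp * Hsp) := [set x | V1 x.1].

Definition energy_norm x : R := Num.sqrt (normV1 x.1 ^+ 2 + normH x.2 ^+ 2).

Definition S1 x : L2 0 l :=
  mulL2 q1 (wderiv (wderiv x.1.1)) + mulL2 D (wderiv (wderiv x.2.1)).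

Definition S2 x : L2 l L := mulL2 q2 (wderiv (wderiv x.1.2)).

Definition domA1 : set (Hsp * Hsp) := [set x |
  [/\ energy_space x, V1 x.2, sobolev2 (S1 x), sobolev2 (S2 x) &
      trace (S1 x) l = trace (S2 x) l /\
      trace (wderiv (S1 x)) l = trace (wderiv (S2 x)) l]].

Definition A1 x : Hsp * Hsp :=
  (x.2, (- wderiv (wderiv (S1 x)), - wderiv (wderiv (S2 x)))).

End Beam.

Arguments energy_space {R} l L.

Definition damping (R : realType) (alpha beta : R) (b : R -> R) : R -> R :=
  fun x => b x * \1_(`]alpha, beta[%classic) x.

(* Main.v *)
(* Glue both pieces into functions on (0, L): q is bounded and bounded below, D >= 0 is
   bounded below on (alpha, beta), V1 becomes H^2_0(0, L), and the transmission conditions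
   say that S = q w'' + D v'' belongs to H^2(0, L).  The proof is by the resolvent
   criterion of Gearhart and Pruess: on a Hilbert space it suffices to bound
   |U| by M |(i om - A) U| for all real om, which follows for a dissipative, densely defined A
   from a discrete Fourier transform of the orbit truncated in time.

   Let X = |U|^2 and d = |(i om - A) U|^2, and compare up to constants.  Dissipation bounds
   int D |v''|^2 by sqrt (d X), and the goal is to bound X by sqrt (d X).  Low frequencies
   follow from the coercivity of int q |w''|^2.  For large |om| = k^4, an integration by parts
   of S'' = g - i om v against v on (alpha, beta), together with interpolation of the boundary
   values on intervals of length theta / k, bounds v, S and their traces at alpha and beta,
   except that |S|^2 is only bounded by k sqrt (d X).  In the adjacent undamped medium
   u = S - i sgn(om) sqrt q v solves u'' = kap^2 u + F with F small, and testing with a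
   decaying exponential improves the bound of |S|^2 to sqrt (d X) + X / k^2.  Finally the
   multiplier p w' with p = x on (0, alpha) and p = x - L on (beta, L) propagates the smallness
   to the undamped parts; its jump at l has the right sign because q1 <= q2 there. *)
Require Import Defs.
From HB Require Import structures.
From mathcomp Require Import all_boot all_order all_algebra ring_quotient.
From mathcomp Require Import all_classical all_reals all_analysis.
From mathcomp Require Import ring lra measurable_realfun.

Set Implicit Arguments.
Unset Strict Implicit.
Unset Printing Implicit Defensive.

Import Order.TTheory GRing.Theory Num.Theory.
Import numFieldNormedType.Exports.
Local Open Scope classical_set_scope.
Local Open Scope ring_scope.
Local Open Scope quotient_scope.
Local Open Scope complex_scope.

Local Notation Re := (@complex.Re _).
Local Notation Im := (@complex.Im _).

(** * Integrals and absolutely continuous functions *)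

Section IntervalIntegrals.
Variable R : realType.
Local Notation mu := (@lebesgue_measure R).
Implicit Types (a b c x y : R) (f g p q P Q : R -> R).

(** The length [1 / k] is forced by the damped interval. There |v''|^2 is of the size of the small
    quantity, |v|^2 is to be [k^-4] times that, and S'' is [om v] up to data, so that v and S are
    both interpolated at the length [1 / k] and the powers of [k] in the boundary products S' v and
    S v' cancel. An L^2 bound of S over such a length costs a factor [k] at the boundary. The
    exponentials of the undamped side live on the shorter length [k^-2], which is why they can
    repair this loss. What they leave, [X / k^2], is absorbed for large [k]; for bounded [k] the
    bound with the loss is good enough.

    Every product of a solution factor and a data factor is split with one weight t, so the outcome
    is X <= C (t X + d / t) with C independent of t, and t is fixed only at the end.

    The semigroup is given by its generator and a bound at each single time; that it is a
    contraction must be derived before orbits can be compared at different times. The resolvent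
    estimate is used purely a priori, applied to Fourier sums of domain elements. *)

Definition L1 a b f := mu.-integrable `]a, b[ (EFin \o f).
Definition II a b f : R := \int[mu]_(x in `]a, b[) f x.
(** Integrability and value travel together, so that an integrand built by linearity yields both at
    once. *)
Definition HI a b f v := L1 a b f /\ II a b f = v.

Lemma mitv (i : interval R) : measurable ([set` i] : set (measurableTypeR R)).
Proof. exact: measurable_itv. Qed.

Lemma L1_HI a b f : L1 a b f -> HI a b f (II a b f).
Proof. by []. Qed.

Lemma L1_meas a b f : L1 a b f -> measurable_fun `]a, b[ f.
Proof. by move=> /measurable_int/measurable_EFinP. Qed.

Lemma HI_eq a b f g v : (forall x, a < x < b -> f x = g x) ->
  HI a b f v -> HI a b g v.
Proof.
move=> fg [If <-]; split.
  apply: eq_integrable If; first exact: mitv.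
  by move=> x; rewrite inE /= in_itv /= => xab; rewrite fg.
by apply: eq_Rintegral => x; rewrite inE /= in_itv /= => xab; rewrite fg.
Qed.

Lemma L1_eq a b f g : (forall x, a < x < b -> f x = g x) -> L1 a b f -> L1 a b g.
Proof. by move=> fg If; have [] := HI_eq fg (L1_HI If). Qed.

Lemma II_eq a b f g : (forall x, a < x < b -> f x = g x) -> II a b f = II a b g.
Proof.
move=> fg; apply: eq_Rintegral => x; rewrite inE /= in_itv /= => xab.
by rewrite fg.
Qed.

Lemma HI_add a b f g u v : HI a b f u -> HI a b g v ->
  HI a b (fun x => f x + g x) (u + v).
Proof.
move=> [If <-] [Ig <-]; split; last by rewrite /II RintegralD //; exact: mitv.
exact: (integrableD (mitv _) If Ig).
Qed.

Lemma HI_scale a b f u k : HI a b f u -> HI a b (fun x => k * f x) (k * u).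
Proof.
move=> [If <-]; split; last by rewrite /II RintegralZl //; exact: mitv.
exact: (integrableZl (mitv _) k If).
Qed.

Lemma HI_opp a b f u : HI a b f u -> HI a b (fun x => - f x) (- u).
Proof.
move=> /(HI_scale (-1)); rewrite mulN1r; apply: HI_eq => x _.
by rewrite mulN1r.
Qed.

Lemma HI_sub a b f g u v : HI a b f u -> HI a b g v ->
  HI a b (fun x => f x - g x) (u - v).
Proof. by move=> hf /HI_opp hg; exact: HI_add. Qed.

Lemma HI_le a b f g u v : HI a b f u -> HI a b g v ->
  (forall x, a < x < b -> f x <= g x) -> u <= v.
Proof.
move=> [If <-] [Ig <-] fg; exact: le_Rintegral.
Qed.

Lemma HI_ge0 a b f u : HI a b f u -> (forall x, a < x < b -> 0 <= f x) -> 0 <= u.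
Proof.
by move=> [_ <-] f0; apply: Rintegral_ge0 => x /=; rewrite in_itv /=; exact: f0.
Qed.

Lemma II_ge0 a b f : (forall x, a < x < b -> 0 <= f x) -> 0 <= II a b f.
Proof.
by move=> f0; apply: Rintegral_ge0 => x /=; rewrite in_itv /=; exact: f0.
Qed.

Lemma HI_abs a b f u : HI a b f u -> HI a b (fun x => `|f x|) (II a b (fun x => `|f x|)).
Proof. by move=> [If _]; split=> //; exact: integrable_norm. Qed.

Lemma II_normr a b f : L1 a b f -> `|II a b f| <= II a b (fun x => `|f x|).
Proof. by move=> If; exact: le_normr_Rintegral. Qed.

Lemma L1S a b c d f : a <= c -> d <= b -> L1 a b f -> L1 c d f.
Proof.
move=> ac db; apply: integrableS; [exact: mitv|exact: mitv|].
move=> x /=; rewrite !in_itv /= => /andP[cx xd].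
by rewrite (le_lt_trans ac cx) (lt_le_trans xd db).
Qed.

Lemma II_cat a b c f : a <= c -> c <= b -> L1 a b f ->
  II a b f = II a c f + II c b f.
Proof.
move=> ac cb If; have Iac := L1S (lexx a) cb If; have Icb := L1S ac (lexx b) If.
move: (ac); rewrite le_eqVlt => /predU1P[<-|ac'].
  rewrite /II [X in X + _](_ : _ = 0) ?add0r //.
  by rewrite set_itv_ge ?Rintegral_set0// bnd_simp ltxx.
move: (cb); rewrite le_eqVlt => /predU1P[->|cb'].
  rewrite /II [X in _ + X](_ : _ = 0) ?addr0 //.
  by rewrite set_itv_ge ?Rintegral_set0// bnd_simp ltxx.
have e1 : \int[mu]_(x in `]a, c]) f x = II a c f.
  by rewrite -Rintegral_itv_bndo_bndc.
rewrite -e1 /II.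
have -> : (\int[mu]_(x in `]a, b[) f x) = (\int[mu]_(x in `]a, b[) f x)
  - (\int[mu]_(x in `]a, c]) f x) + (\int[mu]_(x in `]a, c]) f x) by rewrite subrK.
have l1 : (BRight a <= BRight c)%O by rewrite bnd_simp.
have l2 : (BRight c <= BLeft b)%O by rewrite bnd_simp.
by rewrite (Rintegral_itvB If l1 l2) addrC.
Qed.

(** The open pieces miss only the null set {c}, which is inserted as a third piece. *)
Lemma L1_cat a b c f : a <= c -> c <= b -> L1 a c f -> L1 c b f -> L1 a b f.
Proof.
move=> ac cb Iac Icb.
have [/eqP->//|nac] := boolP (a == c).
have [/eqP<-//|ncb] := boolP (c == b).
have aac : (a < c) by rewrite lt_neqAle nac.
have accb : (c < b) by rewrite lt_neqAle ncb.
rewrite /L1; have -> : `]a, b[%classic = `]a, c[ `|` ([set c] `|` `]c, b[) :> set R.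
  apply/seteqP; split=> x /=; rewrite !in_itv /=.
    by move=> /andP[ax xb]; case: (ltgtP x c) => xc; [left; rewrite ax|right; right|right; left].
  move=> [/andP[-> xc]|[->|/andP[cx ->]]] /=; first exact: lt_trans accb.
    by rewrite aac accb.
  by rewrite (lt_trans _ cx).
apply/integrableP; split.
  apply/measurable_EFinP/measurable_funU; [exact: mitv| |split].
  - by apply: measurableU; [exact: measurable_set1|exact: mitv].
  - exact: L1_meas.
  - apply/measurable_funU; [exact: measurable_set1|exact: mitv|split].
      exact: measurable_fun_set1.
    exact: L1_meas.
have m1 : measurable_fun (`]a, c[ `|` ([set c] `|` `]c, b[)) (fun x => `|(EFin \o f) x|%E).
  apply: measurableT_comp => //.
  apply/measurable_EFinP/measurable_funU; [exact: mitv| |split].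
  - by apply: measurableU; [exact: measurable_set1|exact: mitv].
  - exact: L1_meas.
  - apply/measurable_funU; [exact: measurable_set1|exact: mitv|split].
      exact: measurable_fun_set1.
    exact: L1_meas.
rewrite ge0_integral_setU //=.
- rewrite ge0_integral_setU //=.
  + rewrite integral_set1 add0e lte_add_pinfty //; [by move/integrableP: Iac => []|by move/integrableP: Icb => []].
  + apply: measurable_funS m1; last by move=> x; right.
    by do !apply: measurableU => //; exact: mitv.
  + by apply/disj_setPRL => x /=; rewrite in_itv /= => /andP[cx _] /= xc; rewrite xc ltxx in cx.
- by apply: measurableU => //; exact: mitv.
- apply/disj_setPRL => x /= [->|]; rewrite /= ?in_itv /=; first by rewrite ltxx andbF.
  by move=> /andP[cx _] /andP[_ xc]; have := lt_trans cx xc; rewrite ltxx.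
Qed.

Lemma II_nil a f : II a a f = 0.
Proof. by rewrite /II set_itv_ge ?Rintegral_set0// bnd_simp ltxx. Qed.

Lemma mu_oo a b : a <= b -> mu `]a, b[%classic = (b - a)%:E.
Proof.
move=> ab; have := @lebesgue_measure_itv R `]a, b[; rewrite /= lte_fin => ->.
by move: ab; rewrite le_eqVlt => /predU1P[->|->] //; rewrite ltxx subrr.
Qed.

Lemma mu_oo_fin a b : (mu `]a, b[%classic < +oo)%E.
Proof.
by have := @lebesgue_measure_itv R `]a, b[ => /= ->; case: ifPn => _; rewrite ltry.
Qed.

Lemma L1_bnd a b f (M : R) : measurable_fun `]a, b[ f ->
  (forall x, a < x < b -> `|f x| <= M) -> L1 a b f.
Proof.
move=> mf fM; apply: measurable_bounded_integrable => //.
  exact: mu_oo_fin.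
exists M; split; first exact: num_real.
move=> y My x /=; rewrite in_itv /= => xab.
by rewrite (le_trans (fM _ xab)) // ltW.
Qed.

Lemma L1_mulr a b f (h : R -> R) (M : R) : L1 a b f -> measurable_fun `]a, b[ h ->
  (forall x, a < x < b -> `|h x| <= M) -> L1 a b (fun x => f x * h x).
Proof.
move=> If mh hM; apply: (integrableMl _ If mh); first exact: mitv.
exists M; split; first exact: num_real.
move=> y My x /=; rewrite in_itv /= => xab.
by rewrite (le_trans (hM _ xab)) // ltW.
Qed.

Lemma HI_ae_eq a b f g v : measurable_fun `]a, b[ g ->
  {ae mu, forall x, `]a, b[%classic x -> f x = g x} -> HI a b f v -> HI a b g v.
Proof.
move=> mg fg [If <-].
have mf : measurable_fun `]a, b[ f := L1_meas If.
have E : ae_eq mu (`]a, b[%classic : set R) (EFin \o f) (EFin \o g).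
  have FF : Filter (almost_everywhere mu) := ae_filter_ringOfSetsType _.
  by apply: filterS fg => x h /= /h ->.
have mf' : measurable_fun `]a, b[ (EFin \o f) by exact/measurable_EFinP.
have mg' : measurable_fun `]a, b[ (EFin \o g) by exact/measurable_EFinP.
have ef : (\int[mu]_(x in `]a, b[) (f x)%:E = \int[mu]_(x in `]a, b[) (g x)%:E)%E.
  by apply: ae_eq_integral => //; exact: mitv.
split; last by rewrite /II /Rintegral ef.
move/integrableP : If => [_ If]; apply/integrableP; split => //.
rewrite -(@ae_eq_integral _ _ _ mu `]a, b[ (fun x => `|(EFin \o g) x|%E) (fun x => `|(EFin \o f) x|%E)) //.
- exact: measurableT_comp.
- exact: measurableT_comp.
- exact: ae_eq_abse.
Qed.

Lemma HI_cst a b k : a <= b -> HI a b (fun=> k) (k * (b - a)).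
Proof.
move=> ab; split; first by apply: (@L1_bnd _ _ _ `|k|) => //; exact: measurable_cst.
rewrite /II Rintegral_cst; last exact: mitv.
by congr (k * _); rewrite -[RHS]/(fine (b - a)%:E); congr fine; exact: mu_oo.
Qed.

Lemma L1_ae a b f g : measurable_fun `]a, b[ g ->
  {ae mu, forall x, `]a, b[%classic x -> f x = g x} -> L1 a b f -> L1 a b g.
Proof. by move=> mg fg /L1_HI /(HI_ae_eq mg fg) []. Qed.

Lemma II_ae a b f g : measurable_fun `]a, b[ g ->
  {ae mu, forall x, `]a, b[%classic x -> f x = g x} -> L1 a b f -> II a b f = II a b g.
Proof. by move=> mg fg /L1_HI /(HI_ae_eq mg fg) []. Qed.

Lemma aeS (A B : R -> Prop) : (forall x, A x -> B x) ->
  {ae mu, forall x, A x} -> {ae mu, forall x, B x}.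
Proof.
have FF : Filter (almost_everywhere mu) := ae_filter_ringOfSetsType _.
exact: filterS.
Qed.

Lemma aeS2 (A B C : R -> Prop) : (forall x, A x -> B x -> C x) ->
  {ae mu, forall x, A x} -> {ae mu, forall x, B x} -> {ae mu, forall x, C x}.
Proof.
have FF : Filter (almost_everywhere mu) := ae_filter_ringOfSetsType _.
exact: filterS2.
Qed.

(** Absolute continuity in integrated form: [p] matters only up to null sets, while [P] has definite
    values on the closed interval, and these serve as boundary values. *)
Definition acont a b P p :=
  L1 a b p /\ forall x, a <= x <= b -> P x = P a + II a x p.

(** Cutting [p] off at both endpoints turns an integrand on the open interval into one on the closed
    interval, to which the continuity of parameterized integrals applies. *)
Lemma L1_closed_patch a b p : L1 a b p ->
  mu.-integrable `[a, b] (EFin \o (p \_ `]a, b[)).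
Proof.
move=> Ip.
have -> : EFin \o (p \_ `]a, b[) = (EFin \o p) \_ `]a, b[.
  by rewrite restrict_EFin.
apply/integrable_restrict; [exact: mitv|exact: mitv|].
by rewrite setIidr //; exact: subset_itv_oo_cc.
Qed.

Lemma II_closed_patch a b p x : L1 a b p -> a <= x <= b ->
  II a x p = \int[mu]_(t in `[a, x]) (p \_ `]a, b[) t.
Proof.
move=> Ip /andP[ax xb]; have Ip' := L1_closed_patch Ip.
rewrite -Rintegral_itv_obnd_cbnd; last first.
  apply: integrableS Ip'; [exact: mitv|exact: mitv|].
  move=> t /=; rewrite !in_itv /= => /andP[at_ tx].
  by rewrite (ltW at_) (le_trans tx).
rewrite -Rintegral_itv_bndo_bndc; last first.
  apply: integrableS Ip'; [exact: mitv|exact: mitv|].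
  move=> t /=; rewrite !in_itv /= => /andP[at_ tx].
  by rewrite (ltW at_) (le_trans (ltW tx)).
apply: eq_Rintegral => t; rewrite inE /= in_itv /= => /andP[at_ tx].
by rewrite patchE mem_set //= in_itv /= at_ (lt_le_trans tx).
Qed.

Lemma AC_continuous a b P p : a <= b -> acont a b P p -> {within `[a, b], continuous P}.
Proof.
move=> ab [Ip HP].
have C := parameterized_integral_continuous ab (L1_closed_patch Ip).
apply: (@subspace_eq_continuous _ _ _ (fun x => P a + parameterized_integral mu a x (p \_ `]a, b[))).
  move=> x; rewrite inE /= in_itv /= => xab.
  by rewrite /from_subspace (HP x) // (II_closed_patch Ip).
by move=> x; apply: cvgD; [exact: cvg_cst|exact: C].
Qed.

Lemma AC_meas a b P p : a <= b -> acont a b P p -> measurable_fun `]a, b[ P.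
Proof.
move=> ab /(AC_continuous ab) cP.
apply: (@measurable_funS _ _ _ _ `[a, b]); [exact: mitv|exact: subset_itv_oo_cc|].
apply: subspace_continuous_measurable_fun => //; exact: mitv.
Qed.

Lemma within_bounded a b P : a <= b -> {within `[a, b], continuous P} ->
  exists M : R, forall x, a <= x <= b -> `|P x| <= M.
Proof.
move=> ab cP.
have cN : {within `[a, b], continuous (fun x => `|P x|)}.
  by move=> x; apply: cvg_norm; exact: cP.
have [c _ h] := EVT_max ab cN.
by exists `|P c| => x xab; apply: h; rewrite in_itv.
Qed.

Lemma AC_bounded a b P p : a <= b -> acont a b P p ->
  exists M : R, forall x, a <= x <= b -> `|P x| <= M.
Proof. by move=> ab /(AC_continuous ab); exact: within_bounded. Qed.

Lemma AC_diff a b P p x y : acont a b P p -> a <= x -> x <= y -> y <= b ->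
  P y - P x = II x y p.
Proof.
move=> [Ip HP] ax xy yb.
rewrite (HP y) ?(le_trans ax) // (HP x) ?ax ?(le_trans xy) //.
rewrite (II_cat ax xy); first by ring.
exact: L1S Ip.
Qed.

Lemma ACS a b c d P p : a <= c -> d <= b -> acont a b P p -> acont c d P p.
Proof.
move=> ac db h; split; first by case: h => Ip _; exact: L1S Ip.
move=> x /andP[cx xd]; rewrite -(AC_diff h ac cx (le_trans xd db)); ring.
Qed.

Lemma AC_HI a b P p : a <= b -> acont a b P p -> HI a b p (P b - P a).
Proof.
move=> ab h; split; first by case: h.
by rewrite (AC_diff h).
Qed.

Lemma AC_add a b P p Q q : acont a b P p -> acont a b Q q ->
  acont a b (fun x => P x + Q x) (fun x => p x + q x).
Proof.
move=> [Ip HP] [Iq HQ]; split.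
  by have [] := HI_add (L1_HI Ip) (L1_HI Iq).
move=> x /andP[ax xb]; have xx : a <= x <= b by rewrite ax.
have [_ ->] := HI_add (L1_HI (L1S (lexx a) xb Ip)) (L1_HI (L1S (lexx a) xb Iq)).
by rewrite HP // HQ //; ring.
Qed.

Lemma AC_scale a b P p k : acont a b P p ->
  acont a b (fun x => k * P x) (fun x => k * p x).
Proof.
move=> [Ip HP]; split.
  by have [] := HI_scale k (L1_HI Ip).
move=> x /andP[ax xb]; have xx : a <= x <= b by rewrite ax.
have [_ ->] := HI_scale k (L1_HI (L1S (lexx a) xb Ip)).
by rewrite HP //; ring.
Qed.

Lemma AC_cst a b k : a <= b -> acont a b (fun=> k) (fun=> 0).
Proof.
move=> ab; split; first by have [] := HI_cst 0 ab.
by move=> x /andP[ax _]; have [_ ->] := HI_cst 0 ax; rewrite mul0r addr0.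
Qed.

Lemma AC_ext a b P p P' p' : (forall x, a <= x <= b -> P x = P' x) ->
  (forall x, a < x < b -> p x = p' x) -> acont a b P p -> acont a b P' p'.
Proof.
move=> PP pp [Ip HP]; split; first exact: L1_eq Ip.
move=> x /andP[ax xb]; rewrite -PP ?ax // -PP ?lexx ?(le_trans ax) // HP ?ax //.
congr (_ + _); apply: II_eq => y /andP[ay yx]; apply: pp.
by rewrite ay (lt_le_trans yx).
Qed.

Lemma AC_opp a b P p : acont a b P p -> acont a b (fun x => - P x) (fun x => - p x).
Proof.
by move=> /(AC_scale (-1)); apply: AC_ext => x _; rewrite mulN1r.
Qed.

Lemma AC_sub a b P p Q q : acont a b P p -> acont a b Q q ->
  acont a b (fun x => P x - Q x) (fun x => p x - q x).
Proof. by move=> h /AC_opp; exact: AC_add. Qed.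

Lemma AC_ae a b P p p' : measurable_fun `]a, b[ p' ->
  {ae mu, forall x, `]a, b[%classic x -> p x = p' x} -> acont a b P p -> acont a b P p'.
Proof.
move=> mp pp [Ip HP]; split; first by have [] := HI_ae_eq mp pp (L1_HI Ip).
move=> x /andP[ax xb]; rewrite HP ?ax //; congr (_ + _).
have sub : `]a, x[ `<=` `]a, b[%classic.
  by move=> t /=; rewrite !in_itv /= => /andP[-> tx]; rewrite (lt_le_trans tx).
have [||] // := @HI_ae_eq a x p p' _ _ _ (L1_HI (L1S (lexx a) xb Ip)).
  by apply: measurable_funS mp => //; exact: mitv.
have FF : Filter (almost_everywhere mu) := ae_filter_ringOfSetsType _.
by apply: filterS pp => t h /sub /h.
Qed.

Lemma AC_prim a b p : L1 a b p -> acont a b (fun x => II a x p) p.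
Proof. by move=> Ip; split=> // x _; rewrite II_nil add0r. Qed.

(* If Z moves at most like the square of m, halving the m-increments shows
   that Z is constant. *)
Lemma quadratic_increments_cst a b (Z m : R -> R) : a <= b ->
  {within `[a, b], continuous m} ->
  (forall x y, a <= x -> x <= y -> y <= b -> `|Z y - Z x| <= (m y - m x) ^+ 2) ->
  Z b = Z a.
Proof.
move=> ab cm hZ.
have claim n : forall x y, a <= x -> x <= y -> y <= b ->
    2 ^+ n * `|Z y - Z x| <= (m y - m x) ^+ 2.
  elim: n => [|n IH] x y ax xy yb; first by rewrite expr0 mul1r hZ.
  have cm' : {within `[x, y], continuous m}.
    apply: continuous_subspaceW cm => t /=; rewrite !in_itv /= => /andP[xt ty].
    by rewrite (le_trans ax) // (le_trans ty).
  have /(IVT xy cm')[c] : Num.min (m x) (m y) <= (m x + m y) / 2 <= Num.max (m x) (m y).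
    apply/andP; rewrite ge_min le_max.
    by case: (lerP (m x) (m y)) => h; split; apply/orP; [left|right|right|left]; lra.
  rewrite in_itv /= => /andP[xc cy] mc.
  have h1 := IH x c ax xc (le_trans cy yb).
  have h2 := IH c y (le_trans ax xc) cy yb.
  have h3 : `|Z y - Z x| <= `|Z y - Z c| + `|Z c - Z x|.
    by rewrite (_ : Z y - Z x = (Z y - Z c) + (Z c - Z x)) ?ler_normD //; ring.
  have p2 : 0 <= (2 : R) ^+ n by rewrite exprn_ge0.
  have h4 := ler_wpM2l p2 h3.
  rewrite mc in h1 h2; rewrite exprS; nra.
have [//|nZ] := eqVneq (Z b) (Z a).
have d0 : 0 < `|Z b - Z a| by rewrite normr_gt0 subr_eq0.
pose M := (m b - m a) ^+ 2.
have M0 : 0 <= M by exact: sqr_ge0.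
have := claim (Num.bound (M / `|Z b - Z a|)) _ _ (lexx a) ab (lexx b).
have := archi_boundP (divr_ge0 M0 (ltW d0)).
rewrite ltr_pdivrMr // -/M; set n := Num.bound _ => h1.
have h2 : (n%:R : R) <= 2 ^+ n.
  by rewrite -natrX ler_nat ltnW // ltn_expl.
have h3 := ler_wpM2r (ltW d0) h2.
move=> h4; have := lt_le_trans h1 (le_trans h3 h4); by rewrite ltxx.
Qed.

(** The function Z = P Q - int (p Q + P q) has increments bounded by the squared increments of m =
    int (|p| + |q|), hence is constant. No pointwise derivative is used. *)
Lemma AC_mul a b P p Q q : a <= b -> acont a b P p -> acont a b Q q ->
  acont a b (fun x => P x * Q x) (fun x => p x * Q x + P x * q x).
Proof.
move=> ab hP hQ.
have [M PM] := AC_bounded ab hP; have [N QN] := AC_bounded ab hQ.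
have [Ip _] := hP; have [Iq _] := hQ.
have mP := AC_meas ab hP; have mQ := AC_meas ab hQ.
have IpQ : L1 a b (fun x => p x * Q x).
  by apply: (L1_mulr (M := N)) => // x /andP[ax xb]; rewrite QN // !ltW.
have IPq : L1 a b (fun x => P x * q x).
  apply: (@L1_eq _ _ (fun x => q x * P x)); first by move=> x _; rewrite mulrC.
  by apply: (L1_mulr (M := M)) => // x /andP[ax xb]; rewrite PM // !ltW.
have Id := HI_add (L1_HI IpQ) (L1_HI IPq).
split; first by case: Id.
have Iabs : L1 a b (fun x => `|p x| + `|q x|).
  by have [] := HI_add (HI_abs (L1_HI Ip)) (HI_abs (L1_HI Iq)).
pose m x := II a x (fun x => `|p x| + `|q x|).
have hm : acont a b m (fun x => `|p x| + `|q x|) := AC_prim Iabs.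
have inc u v : a <= u -> u <= v -> v <= b ->
    `|P v - P u| <= m v - m u /\ `|Q v - Q u| <= m v - m u.
  move=> au uv vb; rewrite (AC_diff hm) // (AC_diff hP) // (AC_diff hQ) //.
  have Iup := L1S au vb Ip; have Iuq := L1S au vb Iq.
  have J := L1_HI (L1S au vb Iabs).
  split; [apply: le_trans (II_normr Iup) _|apply: le_trans (II_normr Iuq) _].
    by apply: HI_le (HI_abs (L1_HI Iup)) J _ => x _; rewrite lerDl.
  by apply: HI_le (HI_abs (L1_HI Iuq)) J _ => x _; rewrite lerDr.
move=> x /andP[ax xb].
pose D := fun x => p x * Q x + P x * q x.
pose Z y := P y * Q y - II a y D.
suff : Z x = Z a by rewrite /Z II_nil subr0 => /eqP; rewrite subr_eq => /eqP.
apply: (@quadratic_increments_cst a x Z m) => //.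
  apply: continuous_subspaceW (AC_continuous ab hm) => t /=.
  by rewrite !in_itv /= => /andP[-> tx]; rewrite (le_trans tx).
move=> u v au uv vx; have vb := le_trans vx xb.
have Iuv := L1S au vb.
(* The increment of Z over [u, v] is the integral of p (Q(v) - Q) + (P(u) - P) q, and both
   differences are bounded by increments of m. *)
have K1 : HI u v (fun s => p s * (Q v - Q s) + (P u - P s) * q s)
    (Q v * (P v - P u) + P u * (Q v - Q u) - (II u v D)).
  have e1 := HI_scale (Q v) (AC_HI uv (ACS au vb hP)).
  have e2 := HI_scale (P u) (AC_HI uv (ACS au vb hQ)).
  have e3 : HI u v D (II u v D) by apply: L1_HI; apply: Iuv; case: Id.
  apply: HI_eq (HI_sub (HI_add e1 e2) e3) => s _; rewrite /D; ring.
have -> : Z v - Z u = Q v * (P v - P u) + P u * (Q v - Q u) - II u v D.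
  rewrite /Z (II_cat au uv); first by ring.
  by apply: (L1S (lexx a) vb); case: Id.
have [IK EK] := K1; rewrite -EK; apply: le_trans (II_normr IK) _.
have mono s t : a <= s -> s <= t -> t <= b -> m s <= m t.
  by move=> as_ st tb; rewrite -subr_ge0 (AC_diff hm) // II_ge0 // => y _; rewrite addr_ge0.
have K2 := HI_scale (m v - m u) (AC_HI uv (ACS au vb hm)).
rewrite expr2; apply: HI_le (HI_abs K1) K2 _ => s /andP[us sv].
have as_ := le_trans au (ltW us); have sb := le_trans (ltW sv) vb.
have [_ i1] := inc s v as_ (ltW sv) vb; have [i2 _] := inc u s au (ltW us) sb.
rewrite distrC in i2.
have g1 := mono _ _ au (ltW us) sb; have g2 := mono _ _ as_ (ltW sv) vb.
apply: le_trans (ler_normD _ _) _; rewrite !normrM mulrDr.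
by apply: lerD; [rewrite mulrC|]; apply: ler_wpM2r => //; [apply: (le_trans i1); rewrite lerD2l lerN2|apply: (le_trans i2); rewrite lerD2r].
Qed.

Lemma continuous_L1 a b (c : R -> R) : a <= b -> {within `[a, b], continuous c} -> L1 a b c.
Proof.
move=> ab hc; apply: (@integrableS _ _ _ mu `[a, b]); [exact: mitv|exact: mitv|exact: subset_itv_oo_cc|].
by apply: continuous_compact_integrable => //; exact: segment_compact.
Qed.

Lemma AC_C1_within a b F f : a <= b -> (forall x, a <= x <= b -> is_derive x 1 F (f x)) ->
  {within `[a, b], continuous f} -> acont a b F f.
Proof.
move=> ab dF cf; split; first exact: continuous_L1.
move=> x /andP[ax xb]; move: ax; rewrite le_eqVlt => /predU1P[<-|ax]; first by rewrite II_nil addr0.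
have cfx : {within `[a, x], continuous f}.
  apply: continuous_subspaceW cf => y /=; rewrite !in_itv /= => /andP[-> /= h]; exact: le_trans h xb.
have dF' y : a <= y <= x -> is_derive y 1 F (f y).
  by move=> /andP[ay yx]; apply: dF; rewrite ay (le_trans yx).
have cF y : a <= y <= x -> {for y, continuous F}.
  by move=> h; apply: differentiable_continuous; rewrite -derivable1_diffP; have [] := dF' y h.
have E : (\int[mu]_(y in `[a, x]) (f y)%:E = (F x)%:E - (F a)%:E)%E.
  apply: (continuous_FTC2 ax) => //.
  - split; first by move=> y; rewrite in_itv /= => /andP[h1 h2]; have [|] := dF' y; rewrite ?ltW.
    + by apply: cvg_at_right_filter; apply: cF; rewrite lexx ltW.
    + by apply: cvg_at_left_filter; apply: cF; rewrite lexx ltW.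
  - move=> y; rewrite in_itv /= => /andP[h1 h2]; rewrite derive1E.
    by have h : is_derive y 1 F (f y) by [apply: dF'; rewrite !ltW]; exact: derive_val.
have -> : II a x f = F x - F a; last by ring.
have h : II a x f = \int[mu]_(y in `[a, x]) f y.
  rewrite -Rintegral_itv_obnd_cbnd; last first.
    apply: (@integrableS _ _ _ mu `[a, x]); [exact: mitv|exact: mitv|exact: subset_itv_oc_cc|].
    by apply: continuous_compact_integrable => //; exact: segment_compact.
  by rewrite -Rintegral_itv_bndo_bndc //; apply: continuous_L1 => //; exact: ltW.
by rewrite h /Rintegral E.
Qed.

Lemma within_of_for a b (c : R -> R) : (forall x, a <= x <= b -> {for x, continuous c}) -> {within `[a, b], continuous c}.
Proof.
move=> hc; apply: continuous_in_subspaceT => x; rewrite inE /= in_itv /=; exact: hc.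
Qed.

Lemma AC_C1 a b F f : a <= b -> (forall x, is_derive x 1 F (f x)) -> continuous f ->
  acont a b F f.
Proof.
by move=> ab dF cf; apply: AC_C1_within => //; exact: continuous_subspaceT.
Qed.

End IntervalIntegrals.

(** * Square integrable functions *)

Section SquareIntegrableFunctions.
Variable R : realType.
Local Notation mu := (@lebesgue_measure R).
Implicit Types (a b c x y : R) (f g p q P Q : R -> R).

Definition L2r a b f :=
  measurable_fun `]a, b[ f /\ L1 a b (fun x => f x ^+ 2).

Lemma L2_mul_L1 a b f g : L2r a b f -> L2r a b g -> L1 a b (fun x => f x * g x).
Proof.
move=> [mf If] [mg Ig].
have [J _] := HI_add (L1_HI If) (L1_HI Ig).
apply: le_integrable J; first exact: mitv.
  by apply/measurable_EFinP; exact: measurable_funM.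
move=> x _ /=; rewrite lee_fin normrM (ger0_norm (addr_ge0 _ _)) ?sqr_ge0 //.
rewrite -(real_normK (num_real (f x))) -(real_normK (num_real (g x))).
by have := normr_ge0 (f x); have := normr_ge0 (g x); nra.
Qed.

Lemma L2_ext a b f g : (forall x, a < x < b -> f x = g x) -> L2r a b f -> L2r a b g.
Proof.
move=> fg [mf If]; split; last by apply: L1_eq If => x xab; rewrite fg.
by apply: eq_measurable_fun mf => x; rewrite inE /= in_itv /= => /fg.
Qed.

Lemma L2S a b c d f : a <= c -> d <= b -> L2r a b f -> L2r c d f.
Proof.
move=> ac db [mf If]; split; last exact: L1S If.
apply: measurable_funS mf; first exact: mitv.
move=> x /=; rewrite !in_itv /= => /andP[cx xd].
by rewrite (le_lt_trans ac cx) (lt_le_trans xd db).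
Qed.

Lemma L2_bnd a b f (M : R) : measurable_fun `]a, b[ f ->
  (forall x, a < x < b -> `|f x| <= M) -> L2r a b f.
Proof.
move=> mf fM; split=> //; apply: (@L1_bnd _ _ _ _ (M ^+ 2)).
  exact: measurable_funX.
move=> x /fM h; rewrite normrX ler_sqr ?nnegrE //.
by rewrite (le_trans _ h).
Qed.

Lemma L2_cst a b k : L2r a b (fun=> k).
Proof. by apply: (@L2_bnd _ _ _ `|k|) => //; exact: measurable_cst. Qed.

Lemma L2_L1 a b f : L2r a b f -> L1 a b f.
Proof.
move=> h; apply: L1_eq (L2_mul_L1 h (L2_cst a b 1)) => x _; by rewrite mulr1.
Qed.

Lemma L2_add a b f g : L2r a b f -> L2r a b g -> L2r a b (fun x => f x + g x).
Proof.
move=> hf hg; split; first by apply: measurable_funD; [case: hf|case: hg].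
have h := HI_add (HI_add (L1_HI (L2_mul_L1 hf hf)) (L1_HI (L2_mul_L1 hg hg)))
  (HI_scale 2 (L1_HI (L2_mul_L1 hf hg))).
by apply: L1_eq (proj1 h) => x _; ring.
Qed.

Lemma L2_scale a b f k : L2r a b f -> L2r a b (fun x => k * f x).
Proof.
move=> hf; split; first by apply: measurable_funM => //; case: hf.
have h := HI_scale (k ^+ 2) (L1_HI (L2_mul_L1 hf hf)).
by apply: L1_eq (proj1 h) => x _; ring.
Qed.

Lemma L2_opp a b f : L2r a b f -> L2r a b (fun x => - f x).
Proof. by move=> /(L2_scale (-1)); apply: L2_ext => x _; rewrite mulN1r. Qed.

Lemma L2_sub a b f g : L2r a b f -> L2r a b g -> L2r a b (fun x => f x - g x).
Proof. by move=> hf /L2_opp; exact: L2_add. Qed.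

Lemma L2_mulb a b f (h : R -> R) (M : R) : L2r a b f -> measurable_fun `]a, b[ h ->
  (forall x, a < x < b -> `|h x| <= M) -> L2r a b (fun x => h x * f x).
Proof.
move=> [mf If] mh hM; split; first exact: measurable_funM.
apply: (@L1_eq _ _ _ (fun x => f x ^+ 2 * (h x ^+ 2))).
  by move=> x _; rewrite exprMn mulrC.
apply: (L1_mulr (M := M ^+ 2)) => //; first exact: measurable_funX.
move=> x /hM h'; rewrite normrX ler_sqr ?nnegrE //.
by rewrite (le_trans _ h').
Qed.

Lemma L2_AC a b P p : a <= b -> acont a b P p -> L2r a b P.
Proof.
move=> ab h; have [M HM] := AC_bounded ab h.
apply: (@L2_bnd _ _ _ M); first exact: AC_meas h.
by move=> x /andP[ax xb]; rewrite HM // !ltW.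
Qed.

Lemma L2_mulAC a b f P p : a <= b -> L2r a b f -> acont a b P p ->
  L2r a b (fun x => P x * f x).
Proof.
move=> ab hf h; have [M HM] := AC_bounded ab h.
apply: (@L2_mulb _ _ _ _ M) => //; first exact: AC_meas h.
by move=> x /andP[ax xb]; rewrite HM // !ltW.
Qed.

Lemma L2_cat a b c f : a <= c -> c <= b -> L2r a c f -> L2r c b f -> L2r a b f.
Proof.
move=> ac cb h1 h2; have := L1_cat ac cb (L2_L1 h1) (L2_L1 h2).
move=> /L1_meas mf; split=> //; apply: (L1_cat ac cb); [by case: h1|by case: h2].
Qed.

Definition nrm2 a b f := II a b (fun x => f x ^+ 2).

Lemma nrm2_ge0 a b f : 0 <= nrm2 a b f.
Proof. by apply: II_ge0 => x _; exact: sqr_ge0. Qed.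

Lemma nrm2_HI a b f : L2r a b f -> HI a b (fun x => f x ^+ 2) (nrm2 a b f).
Proof. by move=> [_ If]; exact: L1_HI. Qed.

Lemma nrm2_eq a b f g : (forall x, a < x < b -> f x = g x) -> nrm2 a b f = nrm2 a b g.
Proof. by move=> fg; apply: II_eq => x /fg ->. Qed.

Lemma cauchy_schwarz a b f g : L2r a b f -> L2r a b g ->
  (II a b (fun x => f x * g x)) ^+ 2 <= nrm2 a b f * nrm2 a b g.
Proof.
move=> hf hg; set B := II _ _ _; set A := nrm2 _ _ f; set C := nrm2 _ _ g.
have A0 : 0 <= A by exact: nrm2_ge0.
have C0 : 0 <= C by exact: nrm2_ge0.
have key t : 0 <= A - 2 * t * B + t ^+ 2 * C.
  have h := HI_add (HI_sub (nrm2_HI hf) (HI_scale (2 * t) (L1_HI (L2_mul_L1 hf hg))))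
    (HI_scale (t ^+ 2) (nrm2_HI hg)).
  apply: (HI_ge0 h) => x _.
  rewrite (_ : _ + _ = (f x - t * g x) ^+ 2) ?sqr_ge0 //; ring.
have [C00|Cn0] := eqVneq C 0.
  rewrite C00 mulr0; have [-> //|Bn0] := eqVneq B 0; first by rewrite expr0n.
  (* With C = 0 the quadratic is affine in t, and this t gives it the value -1. *)
  have := key ((A + 1) / (2 * B)); rewrite C00 mulr0 addr0.
  have -> : 2 * ((A + 1) / (2 * B)) * B = A + 1 by field.
  by move=> h; exfalso; lra.
have Cp : 0 < C by rewrite lt_neqAle eq_sym Cn0.
have := key (B / C).
have -> : A - 2 * (B / C) * B + (B / C) ^+ 2 * C = A - B ^+ 2 / C by field.
by rewrite subr_ge0 ler_pdivrMr.
Qed.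

Lemma II_sqr_le a b f : a <= b -> L2r a b f -> (II a b f) ^+ 2 <= (b - a) * nrm2 a b f.
Proof.
move=> ab hf; have := cauchy_schwarz (L2_cst a b 1) hf.
have -> : nrm2 a b (fun=> 1) = b - a.
  have [_ h] := HI_cst 1 ab; rewrite mul1r in h; rewrite -h /nrm2.
  by apply: II_eq => x _; rewrite expr1n.
by have -> : II a b (fun x => 1 * f x) = II a b f by apply: II_eq => x _; rewrite mul1r.
Qed.

Lemma nrm2S a b c d f : a <= c -> c <= d -> d <= b -> L2r a b f -> nrm2 c d f <= nrm2 a b f.
Proof.
move=> ac cd db [_ If]; rewrite /nrm2.
rewrite (II_cat ac (le_trans cd db) If) (II_cat cd db (L1S ac (lexx b) If)).
have h1 : 0 <= II a c (fun x => f x ^+ 2) by apply: II_ge0 => x _; exact: sqr_ge0.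
have h2 : 0 <= II d b (fun x => f x ^+ 2) by apply: II_ge0 => x _; exact: sqr_ge0.
lra.
Qed.

(** By Lebesgue's theorem the primitive of [p] has derivative [p] almost everywhere, and here it is
    locally constant: near [x] it keeps its value at the midpoint of [a] and [x]. *)
Lemma II0_ae a b p : L1 a b p ->
  (forall x y, a < x -> x < y -> y < b -> II x y p = 0) ->
  {ae mu, forall x, `]a, b[%classic x -> p x = 0}.
Proof.
move=> Ip H0.
have Ip' : mu.-integrable setT (EFin \o (p \_ `]a, b[)).
  by move: Ip; rewrite /L1 integrable_mkcond ?restrict_EFin //; exact: mitv.
have FF : Filter (almost_everywhere mu) := ae_filter_ringOfSetsType _.
have h1 y : mu.-integrable [set` Interval (BLeft a) (BRight y)] (EFin \o (p \_ `]a, b[)).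
  by apply: integrableS Ip' => //; exact: mitv.
have := @FTC1 R (p \_ `]a, b[) (BLeft a) h1 (integrable_locally (mitv _) Ip).
apply: filterS => x hx; rewrite /= in_itv /= => /andP[ax xb].
case: hx => [|_]; first by rewrite [X in is_true X](_ : _ = (BLeft a < BRight x)%O) // bnd_simp ltW.
rewrite patchE mem_set /= ?in_itv /= ?ax ?xb // => <-.
rewrite derive1E.
pose k := II a ((a + x) / 2) p.
have e : {near x, (fun y => \int[mu]_(t in `[a, y]) (p \_ `]a, b[) t) =1 cst k}.
  near=> y.
  have y1 : (a + x) / 2 < y by near: y; apply: lt_nbhsr => //; lra.
  have y2 : y < b by near: y; apply: lt_nbhsl.
  rewrite -(II_closed_patch Ip); last by apply/andP; split; lra.
  have am : a < (a + x) / 2 by lra.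
  rewrite (II_cat (ltW am) (ltW y1)); last exact: (L1S (lexx a) (ltW y2)).
  by rewrite (H0 _ _ am y1 y2) addr0.
rewrite (near_eq_derive _ e) ?oner_neq0 //.
exact: derive_cst.
Unshelve. all: end_near. Qed.

(** A derivative read off a quadratic remainder. It covers affine functions, with [C = 0], and
    [half_sq], whose derivative has a kink. *)
Lemma is_derive_quad (F f : R -> R) (C : R) x :
  (forall y, `|F y - F x - f x * (y - x)| <= C * (y - x) ^+ 2) -> is_derive x 1 F (f x).
Proof.
move=> H.
have lim : h^-1 *: (F (h *: 1 + x) - F x) @[h --> 0^'] --> f x.
  apply/cvgrPdist_le => e e0.
  have Ce : 0 < e / (`|C| + 1) by rewrite divr_gt0 // ltr_pwDr.
  near=> h.
  have h0 : h != 0 by near: h; exact: nbhs_dnbhs_neq.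
  have hs : `|h| <= e / (`|C| + 1) by near: h; apply: dnbhs0_le.
  have := H (h + x); rewrite addrK.
  have -> : h *: 1 + x = h + x by rewrite /GRing.scale /= mulr1.
  rewrite -[h^-1 *: _]/(h^-1 * _) => K.
  have -> : f x - h^-1 * (F (h + x) - F x) = - (h^-1 * (F (h + x) - F x - f x * h)).
    by field.
  rewrite normrN normrM normfV ler_pdivrMl ?normr_gt0 //.
  apply: le_trans K _; rewrite -(real_normK (num_real h)).
  have h0' := normr_ge0 h; have := ler_norm C => CC.
  have C1 : 0 < `|C| + 1 by rewrite ltr_wpDl.
  rewrite (ler_pdivlMr _ _ C1) in hs.
  by rewrite expr2 mulrA [in leRHS]mulrC; apply: ler_wpM2r => //; nra.
split; last by rewrite /derive; apply/cvg_lim.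
by apply/cvg_ex; exists (f x).
Unshelve. all: end_near. Qed.

Lemma AC_small a b (m p : R -> R) (s e : R) : acont a b m p -> a <= s -> s < b -> 0 < e ->
  exists2 d, 0 < d & forall h, 0 < h -> h <= d -> s + h <= b /\ `|m (s + h) - m s| <= e.
Proof.
move=> hm as_ sb e0.
have cm := AC_continuous (ltW sb) (ACS as_ (lexx b) hm).
have /(continuous_within_itvP _ sb)[_ /cvgrPdist_le/(_ _ e0) + _] := cm.
rewrite near_withinE => /nbhs_ballP[d /= d0 hd].
have d1 : 0 < Num.min (d / 2) (b - s) by rewrite lt_min subr_gt0 sb divr_gt0.
exists (Num.min (d / 2) (b - s)) => // h h0; rewrite le_min => /andP[h1 h2].
split; first lra.
rewrite distrC; apply: hd; last by rewrite ltrDl.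
rewrite /ball /= opprD addrA subrr add0r normrN gtr0_norm //; lra.
Qed.

(** * C^1 ramps and the lemma of du Bois-Reymond *)

Definition pos_part x : R := (x + `|x|) / 2.
Definition half_sq x : R := (pos_part x) ^+ 2 / 2.

Lemma pos_part0 x : x <= 0 -> pos_part x = 0.
Proof. by move=> h; rewrite /pos_part ler0_norm // subrr mul0r. Qed.

Lemma pos_partE x : 0 <= x -> pos_part x = x.
Proof. by move=> h; rewrite /pos_part ger0_norm //; field. Qed.

Lemma half_sq_quad x y :
  `|half_sq y - half_sq x - pos_part x * (y - x)| <= 1 * (y - x) ^+ 2.
Proof.
rewrite /half_sq ler_norml; case: (lerP 0 x) => hx; case: (lerP 0 y) => hy.
- by rewrite !pos_partE //; have h := sqr_ge0 (y - x); apply/andP; split; nra.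
- rewrite (pos_partE hx) (pos_part0 (ltW hy)); apply/andP; split; nra.
- rewrite (pos_partE hy) (pos_part0 (ltW hx)); apply/andP; split; nra.
- rewrite (pos_part0 (ltW hy)) (pos_part0 (ltW hx)); have h := sqr_ge0 (y - x); apply/andP; split; nra.
Qed.

Lemma half_sq_derive c x :
  is_derive x 1 (fun x => half_sq (x - c)) (pos_part (x - c)).
Proof.
apply: (is_derive_quad (f := fun x => pos_part (x - c)) (C := 1)) => y.
have := half_sq_quad (x - c) (y - c).
by have -> : y - c - (x - c) = y - x by ring.
Qed.

Lemma pos_part_continuous c : continuous (fun x => pos_part (x - c)).
Proof.
have h : continuous (fun x : R => x - c).
  by move=> x; apply: cvgB; [exact: cvg_id|exact: cvg_cst].
move=> x; rewrite /pos_part; apply: cvgM; last exact: cvg_cst.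
by apply: cvgD; [exact: h|apply: cvg_norm; exact: h].
Qed.

(* A C^1 ramp, 0 up to s and t - s from t + e on, of slope 1 on [s + e, t]. *)
Definition ramp (s t e : R) x : R :=
  e^-1 * (half_sq (x - s) - half_sq (x - (s + e)))
  - e^-1 * (half_sq (x - t) - half_sq (x - (t + e))).
Definition ramp' (s t e : R) x : R :=
  e^-1 * (pos_part (x - s) - pos_part (x - (s + e)))
  - e^-1 * (pos_part (x - t) - pos_part (x - (t + e))).

Lemma ramp_derive s t e x : is_derive x 1 (ramp s t e) (ramp' s t e x).
Proof.
have h c := half_sq_derive c x.
exact: (is_deriveB (is_deriveZ _ (is_deriveB (h _) (h _))) (is_deriveZ _ (is_deriveB (h _) (h _)))).
Qed.

Lemma ramp'_continuous s t e : continuous (ramp' s t e).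
Proof.
have h := pos_part_continuous.
move=> x; apply: cvgB; (apply: cvgM; [exact: cvg_cst|apply: cvgB; exact: h]).
Qed.

Lemma ramp_left s t e x : 0 < e -> s <= t -> x <= s -> ramp s t e x = 0.
Proof.
by move=> e0 st xs; rewrite /ramp /half_sq !pos_part0; [ring|lra..].
Qed.

Lemma ramp_right s t e x : 0 < e -> s <= t -> t + e <= x -> ramp s t e x = t - s.
Proof.
move=> e0 st xs; rewrite /ramp /half_sq !pos_partE; [|lra..].
by field; rewrite gt_eqF.
Qed.

(** The slope is 1 on [s + e, t], lies in [0, 1] on the two transition intervals of length e, and
    vanishes elsewhere; only the transition intervals contribute to the error. *)
Lemma ramp'_int a b K s t e : L1 a b K -> a <= s -> t + e <= b -> 0 < e -> s + e <= t ->
  `|II a b (fun x => K x * ramp' s t e x) - II s t K| <=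
  II s (s + e) (fun x => `|K x|) + II t (t + e) (fun x => `|K x|).
Proof.
move=> IK as_ tb e0 set_.
have ab : a <= b by lra.
have IKr : L1 a b (fun x => K x * ramp' s t e x).
  have [M HM] := within_bounded ab (continuous_subspaceT (@ramp'_continuous s t e)).
  apply: (L1_mulr (M := M)) => //; last by move=> x /andP[ax xb]; rewrite HM // !ltW.
  apply: measurable_funTS; apply: continuous_measurable_fun; exact: ramp'_continuous.
have z u v (f : R -> R) : u <= v -> (forall x, u < x < v -> f x = 0) -> II u v f = 0.
  move=> uv f0; rewrite (II_eq (g := fun=> 0)) //.
  by have [_ ->] := HI_cst 0 uv; rewrite mul0r.
have Ir u v : a <= u -> v <= b -> L1 u v (fun x => K x * ramp' s t e x).
  by move=> au vb; exact: L1S IKr.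
have Ik u v : a <= u -> v <= b -> L1 u v K by move=> au vb; exact: L1S IK.
have ie : e * e^-1 = 1 by rewrite mulfV // gt_eqF.
have ie0 : 0 < e^-1 by rewrite invr_gt0.
rewrite (II_cat as_ _ IKr); last lra.
rewrite (@II_cat _ _ _ (s + e) _ _ _ (Ir s b _ _)); [|lra..].
rewrite (@II_cat _ _ _ t _ _ _ (Ir (s + e) b _ _)); [|lra..].
rewrite (@II_cat _ _ _ (t + e) _ _ _ (Ir t b _ _)); [|lra..].
rewrite (@II_cat _ s t (s + e) _ _ _ (Ik s t _ _)); [|lra..].
rewrite (z a s) //; last first.
  by move=> x /andP[ax xs]; rewrite /ramp' !pos_part0; [ring|lra..].
rewrite (z (t + e) b) //; last first.
  by move=> x /andP[ax xs]; rewrite /ramp' !pos_partE; [ring|lra..].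
rewrite (@II_eq _ (s + e) t (fun x => K x * ramp' s t e x) K); last first.
  move=> x /andP[ax xs]; rewrite /ramp' !(pos_part0 (x := x - t)) ?(pos_part0 (x := x - (t + e))) ?pos_partE; try lra.
  have -> : x - s - (x - (s + e)) = e by ring.
  by rewrite subrr mulr0 subr0 [e^-1 * e]mulrC ie mulr1.
set A := II s (s + e) _; set B := II _ t _; set C := II t (t + e) _.
have -> : 0 + (A + (B + (C + 0))) - (II s (s + e) K + B) = A - II s (s + e) K + C by ring.
apply: le_trans (ler_normD _ _) _; apply: lerD.
  have J := HI_sub (L1_HI (Ir s (s + e) as_ (ltac:(lra)))) (L1_HI (Ik s (s + e) as_ (ltac:(lra)))).
  rewrite /A; case: (J) => IJ <-; apply: le_trans (II_normr IJ) _.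
  apply: HI_le (HI_abs (L1_HI IJ)) (HI_abs (L1_HI (Ik s (s + e) as_ (ltac:(lra))))) _ => x /andP[sx xse].
  have -> : K x * ramp' s t e x - K x = K x * (ramp' s t e x - 1) by ring.
  rewrite normrM -[leRHS]mulr1; apply: ler_wpM2l => //.
  rewrite /ramp' !(pos_part0 (x := x - t)) ?(pos_part0 (x := x - (t + e))) ?(pos_part0 (x := x - (s + e))) ?pos_partE; [|lra..].
  rewrite ler_norml; apply/andP; split; nra.
have J := L1_HI (Ir t (t + e) (ltac:(lra)) tb).
case: (J) => IJ _; apply: le_trans (II_normr IJ) _.
apply: HI_le (HI_abs (L1_HI IJ)) (HI_abs (L1_HI (Ik t (t + e) (ltac:(lra)) tb))) _ => x /andP[sx xse].
rewrite normrM -[leRHS]mulr1; apply: ler_wpM2l => //.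
rewrite /ramp' !(pos_part0 (x := x - (t + e))) ?pos_partE; [|lra..].
rewrite ler_norml; apply/andP; split; nra.
Qed.

(** Each ramp divided by its final height ends at 1, so the difference vanishes near both ends of
    the interval. *)
Lemma C1c_ramps a b s t s' t' e : a < s -> s < t -> t + e < b ->
  a < s' -> s' < t' -> t' + e < b -> 0 < e ->
  let phi x := (t - s)^-1 * ramp s t e x - (t' - s')^-1 * ramp s' t' e x in
  C1c a b phi /\
  forall x, derive1 phi x = (t - s)^-1 * ramp' s t e x - (t' - s')^-1 * ramp' s' t' e x.
Proof.
move=> as_ st tb as' st' tb' e0 phi.
have D x : is_derive x 1 phi ((t - s)^-1 * ramp' s t e x - (t' - s')^-1 * ramp' s' t' e x).
  exact: (is_deriveB (is_deriveZ _ (ramp_derive _ _ _ _)) (is_deriveZ _ (ramp_derive _ _ _ _))).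
have E x : derive1 phi x = (t - s)^-1 * ramp' s t e x - (t' - s')^-1 * ramp' s' t' e x.
  by rewrite derive1E; apply: derive_val.
split=> //; split.
- by move=> x; have [] := D x.
- rewrite (_ : derive1 phi = fun x => (t - s)^-1 * ramp' s t e x - (t' - s')^-1 * ramp' s' t' e x); last exact/funext.
  move=> x; apply: cvgB; (apply: cvgM; [exact: cvg_cst|exact: ramp'_continuous]).
- exists (Num.min s s'), (Num.max (t + e) (t' + e)).
  split; [by rewrite lt_min as_|by rewrite gt_max tb|].
  move=> x; apply: contraNT; rewrite negb_and -!ltNge lt_min gt_max /phi => /orP[]/andP[h1 h2].
    by rewrite !ramp_left ?mulr0 ?subrr //; lra.
  by rewrite !ramp_right ?mulVf ?subrr //; try lra; rewrite subr_eq0 gt_eqF.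
Qed.

(** Testing with differences of normalized ramps of shrinking transition width shows that [K] has
    the same mean [c] over all subintervals; then all integrals of [K - c] vanish. *)
Lemma du_bois_reymond a b K : a < b -> L1 a b K ->
  (forall phi, C1c a b phi -> II a b (fun x => K x * derive1 phi x) = 0) ->
  exists c : R, {ae mu, forall x, `]a, b[%classic x -> K x = c}.
Proof.
move=> ab IK H.
have Iabs : L1 a b (fun x => `|K x|) by have [] := HI_abs (L1_HI IK).
have main s t s' t' : a < s -> s < t -> t < b -> a < s' -> s' < t' -> t' < b ->
    (t - s)^-1 * II s t K = (t' - s')^-1 * II s' t' K.
  move=> as_ st tb as' st' tb'.
  have small u v : a < u -> u < b -> 0 < v -> exists2 d, 0 < d & forall h, 0 < h -> h <= d ->
      u + h <= b /\ II u (u + h) (fun x => `|K x|) <= v.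
    move=> au ub v0; have [d d0 Hd] := AC_small (AC_prim Iabs) (ltW au) ub v0.
    exists d => // h h0 hd; have [h1 h2] := Hd h h0 hd; split=> //.
    move: h2; rewrite (AC_diff (AC_prim Iabs)) ?(ltW au) //; last by rewrite lerDl ltW.
    by apply: le_trans; rewrite ler_norm.
  apply/eqP; rewrite -subr_eq0 -normr_le0; apply/ler_addgt0Pr => eta eta0; rewrite add0r.
  set r := (t - s)^-1; set r' := (t' - s')^-1.
  have r0 : 0 < r by rewrite invr_gt0 subr_gt0.
  have r0' : 0 < r' by rewrite invr_gt0 subr_gt0.
  (* Four transition intervals contribute at most [v] each, two with weight [r] and two with weight
     [r'], which adds up to [eta]. *)
  pose v := eta / (2 * (r + r')).
  have v0 : 0 < v by rewrite divr_gt0 // mulr_gt0 // addr_gt0.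
  have [d1 d10 H1] := small s v as_ (lt_trans st tb) v0.
  have [d2 d20 H2] := small t v (lt_trans as_ st) tb v0.
  have [d3 d30 H3] := small s' v as' (lt_trans st' tb') v0.
  have [d4 d40 H4] := small t' v (lt_trans as' st') tb' v0.
  have [e [e0 [e1 e2 e3 e4] [e5 e6 e7 e8]]] : exists e, [/\ 0 < e, [/\ e <= d1, e <= d2, e <= d3 & e <= d4] &
     [/\ t + e < b, t' + e < b, s + e <= t & s' + e <= t']].
    exists (Num.min (Num.min (Num.min d1 d2) (Num.min d3 d4))
      (Num.min (Num.min ((b - t) / 2) ((b - t') / 2)) (Num.min (t - s) (t' - s')))).
    set m := Num.min _ _.
    have : m <= m by [].
    rewrite {2}/m !le_min => /andP[/andP[/andP[m1 m2] /andP[m3 m4]] /andP[/andP[m5 m6] /andP[m7 m8]]].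
    have m0 : 0 < m by rewrite /m !lt_min d10 d20 d30 d40 !subr_gt0 st st' !divr_gt0 ?subr_gt0.
    have room u : u < b -> m <= (b - u) / 2 -> u + m < b by move=> ub mu'; clear -ub mu'; lra.
    by split=> //; split; [exact: room|exact: room|rewrite addrC -lerBrDr|rewrite addrC -lerBrDr].
  have [hC hD] := C1c_ramps as_ st e5 as' st' e6 e0.
  have := H _ hC.
  have J1 := @ramp'_int a b K s t e IK (ltW as_) (ltW e5) e0 e7.
  have J2 := @ramp'_int a b K s' t' e IK (ltW as') (ltW e6) e0 e8.
  have [_ b1] := H1 e e0 e1; have [_ b2] := H2 e e0 e2.
  have [_ b3] := H3 e e0 e3; have [_ b4] := H4 e e0 e4.
  have bnd_int u w : L1 a b (fun x => K x * ramp' u w e x).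
    have [M HM] := within_bounded (ltW ab) (continuous_subspaceT (@ramp'_continuous u w e)).
    apply: (L1_mulr (M := M)) => //; last by move=> x /andP[ax xb]; rewrite HM // !ltW.
    apply: measurable_funTS; apply: continuous_measurable_fun; exact: ramp'_continuous.
  set X := II a b _ in J1 *; set Y := II a b _ in J2 *.
  have [_ ->] : HI a b (fun x => K x * derive1 (fun x => (t - s)^-1 * ramp s t e x - (t' - s')^-1 * ramp s' t' e x) x) (r * X - r' * Y).
    apply: HI_eq (HI_sub (HI_scale r (L1_HI (bnd_int s t))) (HI_scale r' (L1_HI (bnd_int s' t')))) => x _.
    by rewrite hD /r /r'; ring.
  move=> XY.
  have -> : r * II s t K - r' * II s' t' K = - r * (X - II s t K) + r' * (Y - II s' t' K).
    have -> : r * II s t K - r' * II s' t' K = (r * X - r' * Y) - r * (X - II s t K) + r' * (Y - II s' t' K) by ring.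
    by rewrite XY; ring.
  apply: le_trans (ler_normD _ _) _; rewrite !normrM normrN (gtr0_norm r0) (gtr0_norm r0').
  have -> : eta = r * (v + v) + r' * (v + v).
    by rewrite /v; field; rewrite gt_eqF // addr_gt0.
  by apply: lerD; apply: ler_wpM2l; rewrite ?(ltW r0) ?(ltW r0') //;
    [apply: le_trans J1 _|apply: le_trans J2 _]; apply: lerD.
pose s0 := (2 * a + b) / 3; pose t0 := (a + 2 * b) / 3.
pose c := (t0 - s0)^-1 * II s0 t0 K.
exists c.
have Ic : L1 a b (fun x => K x - c) := proj1 (HI_sub (L1_HI IK) (HI_cst c (ltW ab))).
have : {ae mu, forall x, `]a, b[%classic x -> K x - c = 0}.
  apply: II0_ae => // x y ax xy yb.
  have [_ ->] := HI_sub (L1_HI (L1S (ltW ax) (ltW yb) IK)) (HI_cst c (ltW xy)).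
  have h : (y - x)^-1 * II x y K = c by apply: main => //; rewrite /s0 /t0; lra.
  by rewrite -h; field; rewrite subr_eq0 gt_eqF.
have FF : Filter (almost_everywhere mu) := ae_filter_ringOfSetsType _.
by apply: filterS => x h /h /eqP; rewrite subr_eq0 => /eqP.
Qed.

End SquareIntegrableFunctions.

(** * Representatives of Sobolev functions *)

Section Classes.
Variable R : realType.
Local Notation mu := (@lebesgue_measure R).
Implicit Types (a b c x y : R) (f g : R -> R[i]).

Definition L2c a b f := L2r a b (Re \o f) /\ L2r a b (Im \o f).

Lemma sqintegrableP a b f : sqintegrable a b f <-> L2c a b f.
Proof.
split=> [[[m1 m2] I]|[[m1 I1] [m2 I2]]].
  have h (g : R -> R) : measurable_fun `]a, b[ g ->
      (forall x, g x ^+ 2 <= sqmod (f x)) -> L2r a b g.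
    move=> mg hg; split=> //; apply: le_integrable I; first exact: mitv.
      by apply/measurable_EFinP; exact: measurable_funX.
    move=> x _ /=; rewrite lee_fin !ger0_norm ?sqr_ge0 ?sqmod_ge0 //.
  by split; apply: h => // x; rewrite /sqmod /= ?lerDl ?lerDr sqr_ge0.
split=> //; have [] := HI_add (L1_HI I1) (L1_HI I2) => J _.
exact: J.
Qed.

(** The default 0 of [insubd] is reached only if [f] is not square integrable. *)
Definition cl a b f : L2 a b := \pi_(L2 a b) (insubd 0 f).

Lemma insubd_L2 a b f : L2c a b f -> (val (insubd (0 : L2fun a b) f) : R -> R[i]) = f.
Proof.
by move=> /sqintegrableP h; rewrite val_insubd /sqint_pred ifT // inE.
Qed.

Lemma L2fun_L2c a b (h : L2fun a b) : L2c a b h.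
Proof. by apply/sqintegrableP; have := valP h; rewrite inE. Qed.

Lemma pi_eqP a b (h k : L2fun a b) : (\pi_(L2 a b) h = \pi_(L2 a b) k) <->
  {ae mu, forall x, `]a, b[%classic x -> h x = k x}.
Proof.
split.
  move/eqP; rewrite -Quotient.idealrBE inE /=.
  by apply: aeS => x hx /hx e; apply/eqP; rewrite -subr_eq0; exact/eqP.
move=> hk; apply/eqP; rewrite -Quotient.idealrBE inE /=.
by apply: aeS hk => x hx /hx e; rewrite -[LHS]/(h x - k x) e subrr.
Qed.

Lemma repr_L2c a b (F : L2 a b) : L2c a b (repr F).
Proof. exact: L2fun_L2c. Qed.

Lemma cl_repr a b (F : L2 a b) : cl a b (repr F) = F.
Proof.
rewrite -[RHS]reprK; apply/pi_eqP; apply: aeW => x _.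
by rewrite (insubd_L2 (repr_L2c F)).
Qed.

Lemma cl_eqP a b f g : L2c a b f -> L2c a b g ->
  cl a b f = cl a b g <-> {ae mu, forall x, `]a, b[%classic x -> f x = g x}.
Proof.
move=> hf hg; rewrite /cl pi_eqP.
by split; apply: aeS => x; rewrite (insubd_L2 hf) (insubd_L2 hg).
Qed.

Lemma repr_cl a b f : L2c a b f ->
  {ae mu, forall x, `]a, b[%classic x -> repr (cl a b f) x = f x}.
Proof.
move=> hf; apply/cl_eqP => //; first exact: repr_L2c.
by rewrite cl_repr.
Qed.

Lemma cl_comb a b k f g : L2c a b f -> L2c a b g ->
  cl a b (fun x => k * f x + g x) = k *: cl a b f + cl a b g.
Proof.
move=> hf hg.
have -> : k *: cl a b f = \pi_(L2 a b) (k *: insubd 0 f) by exact: pi_scaleL2.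
rewrite pi_addL2; apply/pi_eqP; apply: aeW => x _.
rewrite insubd_L2; last first.
  apply/sqintegrableP; apply: (@sqintegrable_comb _ _ _ k f g); exact/sqintegrableP.
by change (k * f x + g x = k * (val (insubd (0 : L2fun a b) f)) x + (val (insubd (0 : L2fun a b) g)) x); rewrite !insubd_L2.
Qed.

Lemma L2c_comb a b k f g : L2c a b f -> L2c a b g -> L2c a b (fun x => k * f x + g x).
Proof.
move=> hf hg.
apply/sqintegrableP; apply: (@sqintegrable_comb _ _ _ k f g); exact/sqintegrableP.
Qed.

Lemma L2c_ext a b f g : (forall x, a < x < b -> f x = g x) -> L2c a b f -> L2c a b g.
Proof.
by move=> fg [h1 h2]; split; [apply: L2_ext h1|apply: L2_ext h2] => x /fg /= ->.
Qed.

Lemma cl_ext a b f g : (forall x, a < x < b -> f x = g x) -> L2c a b f -> cl a b f = cl a b g.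
Proof.
move=> fg hf; apply/cl_eqP => //; first exact: L2c_ext hf.
by apply: aeW => x /=; rewrite in_itv /=; exact: fg.
Qed.

Lemma L2cS a b c d f : a <= c -> d <= b -> L2c a b f -> L2c c d f.
Proof. by move=> ac db [h1 h2]; split; [exact: L2S h1|exact: L2S h2]. Qed.

Lemma ess_bounded_mul a b (q h : R -> R) : ess_bounded a b q -> L2r a b h ->
  L2r a b (fun x => q x * h x).
Proof.
move=> [mq [M HM]] [mh Ih].
split; first exact: measurable_funM.
(* Clipping to [-|M|, |M|] makes the bound hold everywhere and changes [q] only on a null set of the
   interval. *)
pose q' x := Num.max (- `|M|) (Num.min `|M| (q x)).
have mq' : measurable_fun `]a, b[ q'.
  apply: measurable_maxr; first exact: measurable_cst.
  by apply: measurable_minr; first exact: measurable_cst.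
have qM x : `|q' x| <= `|M|.
  rewrite /q' ler_norml le_max lexx /= ge_max ge_min lexx /= andbT.
  by rewrite (le_trans _ (normr_ge0 M)) // oppr_le0.
have [_ J] := @L2_mulb R a b h q' `|M| (conj mh Ih) mq' (fun x _ => qM x).
apply: L1_ae J; first by apply: measurable_funX; exact: measurable_funM.
apply: aeS HM => x hx /hx h'; rewrite /q'.
have : `|q x| <= `|M| by rewrite (le_trans h') // ler_norm.
by rewrite ler_norml => /andP[h1 h2]; rewrite min_r // max_r.
Qed.

Lemma L2c_mulr a b (q : R -> R) f : ess_bounded a b q -> L2c a b f ->
  L2c a b (fun x => (q x)%:C * f x).
Proof.
move=> hq [h1 h2]; split.
  apply: L2_ext (ess_bounded_mul hq h1) => x _ /=.
  by case: (f x) => u v /=; rewrite mul0r subr0.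
apply: L2_ext (ess_bounded_mul hq h2) => x _ /=.
by case: (f x) => u v /=; rewrite mul0r addr0.
Qed.

Lemma mulL2_cl a b (q : R -> R) f : ess_bounded a b q -> L2c a b f ->
  mulL2 q (cl a b f) = cl a b (fun x => (q x)%:C * f x).
Proof.
move=> hq hf; apply/cl_eqP.
- exact: L2c_mulr (repr_L2c _).
- exact: L2c_mulr.
- by apply: aeS (repr_cl hf) => x h /h ->.
Qed.

Lemma sqmod_L1 a b (q : R -> R) f : ess_bounded a b q -> L2c a b f ->
  L1 a b (fun x => q x * sqmod (f x)).
Proof.
move=> hq [h1 h2].
apply: L1_eq (proj1 (HI_add (L1_HI (L2_mul_L1 (ess_bounded_mul hq h1) h1))
  (L1_HI (L2_mul_L1 (ess_bounded_mul hq h2) h2)))) => x _.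
by rewrite /sqmod /=; ring.
Qed.

Definition cac a b (P p : R -> R[i]) :=
  acont a b (Re \o P) (Re \o p) /\ acont a b (Im \o P) (Im \o p).

Lemma cac_ext a b P p P' p' : (forall x, a <= x <= b -> P x = P' x) ->
  (forall x, a < x < b -> p x = p' x) -> cac a b P p -> cac a b P' p'.
Proof.
move=> e1 e2 [h1 h2]; split; [apply: AC_ext h1|apply: AC_ext h2] => x hx /=;
 by rewrite ?e1 ?e2.
Qed.

Lemma cacS a b c d P p : a <= c -> d <= b -> cac a b P p -> cac c d P p.
Proof. by move=> ac db [h1 h2]; split; [exact: ACS h1|exact: ACS h2]. Qed.

Lemma AC_cat a b c (P p : R -> R) : a <= c -> c <= b -> acont a c P p -> acont c b P p ->
  acont a b P p.
Proof.
move=> ac cb [I1 H1] [I2 H2]; have I0 := L1_cat ac cb I1 I2; split=> // x /andP[ax xb].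
have [xc|cx] := lerP x c; first by apply: H1; rewrite ax.
rewrite (H2 x) ?(ltW cx) // (H1 c) ?lexx ?ac // -addrA; congr (_ + _).
by rewrite (II_cat ac (ltW cx)) //; exact: L1S I0.
Qed.

Lemma cac_cat a b c P p : a <= c -> c <= b -> cac a c P p -> cac c b P p ->
  cac a b P p.
Proof. by move=> ac cb [h1 h2] [h3 h4]; split; apply: AC_cat h1 _ || apply: AC_cat h2 _. Qed.

Lemma L2c_cac a b P p : a <= b -> cac a b P p -> L2c a b P.
Proof. by move=> ab [h1 h2]; split; [exact: L2_AC h1|exact: L2_AC h2]. Qed.

(** A null set contains no interval, so the points of equality are dense; continuity does the rest,
    with approach from inside at the two ends. *)
Lemma ae_continuous_eq a b (f g : R -> R) : a < b ->
  {within `[a, b], continuous f} -> {within `[a, b], continuous g} ->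
  {ae mu, forall x, `]a, b[%classic x -> f x = g x} ->
  forall x, a <= x <= b -> f x = g x.
Proof.
move=> ab cf cg fg.
have inner c d : a <= c -> c < d -> d <= b -> exists2 y, c < y < d & f y = g y.
  move=> ac cd db; apply: contrapT => H.
  have [N [mN N0 sN]] := fg.
  have sub : `]c, d[%classic `<=` N.
    move=> y /=; rewrite in_itv /= => /andP[cy yd]; apply: sN => /= K.
    apply: H; exists y; first by rewrite cy.
    by apply: K; rewrite in_itv /= (le_lt_trans ac cy) (lt_le_trans yd db).
  have : (mu `]c, d[%classic <= 0)%E.
    by rewrite -N0; apply: le_measure; rewrite ?inE //; exact: mitv.
  rewrite (mu_oo (ltW cd)) lee_fin subr_le0.
  by rewrite leNgt cd.
move=> x /andP[ax xb]; apply/eqP; rewrite -subr_eq0 -normr_le0.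
apply/ler_addgt0Pr => e e0; rewrite add0r.
have ch : {within `[a, b], continuous (fun x => f x - g x)}.
  by move=> y; apply: cvgB; [exact: cf|exact: cg].
have xab : `[a, b]%classic x by rewrite /= in_itv /= ax.
have /subspace_continuousP/(_ x xab) := ch.
move=> /cvgrPdist_le/(_ _ e0); rewrite near_withinE => /nbhs_ballP[d /= d0 hd].
have [y [h1 h2] h3] : exists2 y, (a <= y <= b) /\ ball x d y & f y = g y.
  have [xb'|bx] := ltP x b.
    have m0 : x < Num.min (x + d) b by rewrite lt_min ltrDl d0.
    have [|y /andP[xy]] := inner _ _ ax m0; first by rewrite ge_min lexx orbT.
    rewrite lt_min => /andP[y1 y2] e1; exists y => //; split.
      by rewrite (le_trans ax (ltW xy)) (ltW y2).
    by rewrite /ball /= distrC gtr0_norm ?subr_gt0 //; lra.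
  have xeb : x = b by apply/eqP; rewrite eq_le xb.
  have m0 : Num.max (x - d) a < x by rewrite gt_max xeb ab andbT; lra.
  have [|y /andP[]] := inner _ _ _ m0 xb; first by rewrite le_max lexx orbT.
  rewrite gt_max => /andP[y1 y2] yx e1; exists y => //; split.
    by rewrite (ltW y2) (le_trans (ltW yx)).
  by rewrite /ball /= gtr0_norm ?subr_gt0 //; lra.
have := hd y h2; rewrite /= in_itv /= => /(_ h1).
by rewrite /from_subspace h3 subrr subr0.
Qed.

(** Two continuous representatives agree everywhere on [a, b], so the set of values from which
    [trace] chooses is a singleton. *)
Lemma trace_cl a b f g x : a < b -> cac a b f g -> a <= x <= b -> trace (cl a b f) x = f x.
Proof.
move=> ab [h1 h2] xab.
have hf := L2c_cac (ltW ab) (conj h1 h2).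
have c1 := AC_continuous (ltW ab) h1; have c2 := AC_continuous (ltW ab) h2.
rewrite /trace; apply: xget_unique; first by exists f; split=> //; apply: aeS (repr_cl hf) => y h /h ->.
move=> z [k [k1 k2 k3 <-]].
have e1 : Re (k x) = Re (f x).
  apply: (ae_continuous_eq ab k1 c1) => //.
  by apply: aeS2 k3 (repr_cl hf) => y A B yab /=; rewrite A // B.
have e2 : Im (k x) = Im (f x).
  apply: (ae_continuous_eq ab k2 c2) => //.
  by apply: aeS2 k3 (repr_cl hf) => y A B yab /=; rewrite A // B.
by apply/eqP; rewrite eq_complex e1 e2 !eqxx.
Qed.

(** * Weak derivatives and their primitives *)

Lemma C1c_acont a b phi : a < b -> C1c a b phi ->
  [/\ acont a b phi (derive1 phi), phi a = 0 & phi b = 0].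
Proof.
move=> ab [d1 c1 [c [d [ac db H]]]]; split.
- apply: AC_C1; [exact: ltW| |exact: c1].
  by move=> x; split; [exact: d1|rewrite derive1E].
- by apply: contrapT => /eqP/H /andP[ca _]; have := lt_le_trans ac ca; rewrite ltxx.
- by apply: contrapT => /eqP/H /andP[_ bd]; have := le_lt_trans bd db; rewrite ltxx.
Qed.

(** Subtracting a primitive of [G] from [F] leaves a function with zero weak derivative, which is
    constant by [du_bois_reymond]. *)
Lemma weak_primitive a b (F G : R -> R) : a < b -> L2r a b F -> L2r a b G ->
  (forall phi, C1c a b phi ->
     II a b (fun x => F x * derive1 phi x) = - II a b (fun x => G x * phi x)) ->
  exists f : R -> R, acont a b f G /\ {ae mu, forall x, `]a, b[%classic x -> f x = F x}.
Proof.
move=> ab hF hG H.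
have hk := AC_prim (L2_L1 hG); set k := (fun x => II a x G) in hk.
have IK : L1 a b (fun x => F x - k x).
  exact: proj1 (HI_sub (L1_HI (L2_L1 hF)) (L1_HI (L2_L1 (L2_AC (ltW ab) hk)))).
have [|c hc] := du_bois_reymond ab IK.
  move=> phi hphi; have [aphi pa pb] := C1c_acont ab hphi.
  have [_ e1] := AC_HI (ltW ab) (AC_mul (ltW ab) hk aphi).
  rewrite pa pb !mulr0 subrr in e1.
  have bphi : exists M : R, forall x, a <= x <= b -> `|derive1 phi x| <= M.
    by apply: within_bounded (ltW ab) _; apply: continuous_subspaceT; case: hphi.
  have [M HM] := bphi.
  have mphi : measurable_fun `]a, b[ (derive1 phi) by apply: L1_meas; case: aphi.
  have prod (u : R -> R) : L1 a b u -> L1 a b (fun x => u x * derive1 phi x).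
    by move=> Iu; apply: (L1_mulr (M := M)) => // x /andP[ax xb]; rewrite HM // !ltW.
  have J1 := L1_HI (prod _ (L2_L1 hF)).
  have J2 := L1_HI (prod _ (L2_L1 (L2_AC (ltW ab) hk))).
  have J3 : HI a b (fun x => G x * phi x) (II a b (fun x => G x * phi x)).
    exact/L1_HI/L2_mul_L1/(L2_AC (ltW ab) aphi).
  have [_ e2] := HI_eq (g := fun x => G x * phi x + k x * derive1 phi x) (fun x _ => erefl) (HI_add J3 J2).
  have [_ e3] := HI_eq (g := fun x => (F x - k x) * derive1 phi x) (fun x _ => esym (mulrBl _ _ _)) (HI_sub J1 J2).
  rewrite e3 H //; rewrite e1 in e2; lra.
exists (fun x => c + k x); split.
  apply: AC_ext (AC_add (AC_cst c (ltW ab)) hk) => x _ //; by rewrite add0r.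
by apply: aeS hc => x h /h <-; rewrite subrK.
Qed.

Lemma cintegral_mulr a b f (phi : R -> R) :
  cintegral a b (fun x => f x * (phi x)%:C) =
  (II a b (fun x => Re (f x) * phi x)) +i* (II a b (fun x => Im (f x) * phi x)).
Proof.
rewrite /cintegral -!/(II _ _ _); congr (_ +i* _); apply: II_eq => x _;
  by case: (f x) => u v /=; rewrite !mulr0 ?subr0 ?add0r.
Qed.

Lemma wderiv_primitive a b (F G : L2 a b) : a < b -> is_wderiv F G ->
  exists f, cac a b f (repr G) /\ {ae mu, forall x, `]a, b[%classic x -> f x = repr F x}.
Proof.
move=> ab H.
have [f1 f2] := repr_L2c F; have [g1 g2] := repr_L2c G.
have H' phi : C1c a b phi ->
  II a b (fun x => Re (repr F x) * derive1 phi x) = - II a b (fun x => Re (repr G x) * phi x) /\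
  II a b (fun x => Im (repr F x) * derive1 phi x) = - II a b (fun x => Im (repr G x) * phi x).
  by move=> /H; rewrite !cintegral_mulr => -[-> ->].
have [u [u1 u2]] := weak_primitive ab f1 g1 (fun phi h => proj1 (H' phi h)).
have [v [v1 v2]] := weak_primitive ab f2 g2 (fun phi h => proj2 (H' phi h)).
exists (fun x => u x +i* v x); split; first by split.
apply: aeS2 u2 v2 => x h1 h2 hx; apply/eqP; rewrite eq_complex /=.
by rewrite h1 // h2 // !eqxx.
Qed.

(** The primitives of both candidates are continuous representatives of [F], hence equal everywhere,
    so the candidates have equal integrals over all subintervals. *)
Lemma wderiv_unique a b (F G G' : L2 a b) : a < b -> is_wderiv F G -> is_wderiv F G' -> G = G'.
Proof.
move=> ab H H'.
have [f [[f1 f2] f3]] := wderiv_primitive ab H.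
have [g [[g1 g2] g3]] := wderiv_primitive ab H'.
rewrite -(cl_repr G) -(cl_repr G'); apply/cl_eqP; [exact: repr_L2c|exact: repr_L2c|].
have key (u v u' v' : R -> R) : acont a b u u' -> acont a b v v' ->
    {ae mu, forall x, `]a, b[%classic x -> u x = v x} ->
    {ae mu, forall x, `]a, b[%classic x -> u' x = v' x}.
  move=> hu hv uv.
  have E := ae_continuous_eq ab (AC_continuous (ltW ab) hu) (AC_continuous (ltW ab) hv) uv.
  have hd := AC_sub hu hv.
  have : {ae mu, forall x, `]a, b[%classic x -> u' x - v' x = 0}.
    apply: II0_ae; first by case: hd.
    move=> x y ax xy yb.
    rewrite -(AC_diff hd (ltW ax) (ltW xy) (ltW yb)) !E ?subrr //; apply/andP; split; lra.
  by apply: aeS => x h /h /eqP; rewrite subr_eq0 => /eqP.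
have e1 := key _ _ _ _ f1 g1; have e2 := key _ _ _ _ f2 g2.
have fg : {ae mu, forall x, `]a, b[%classic x -> f x = g x}.
  by apply: aeS2 f3 g3 => x h1 h2 hx; rewrite h1 // h2.
have e1' := e1 (aeS (fun x (h : _ -> f x = g x) hx => congr1 Re (h hx)) fg).
have e2' := e2 (aeS (fun x (h : _ -> f x = g x) hx => congr1 Im (h hx)) fg).
apply: aeS2 e1' e2' => x h1 h2 hx; apply/eqP; rewrite eq_complex.
by move: (h1 hx) (h2 hx) => /= -> ->; rewrite !eqxx.
Qed.

Lemma is_wderiv_cl a b f g : a < b -> cac a b f g -> L2c a b g ->
  is_wderiv (cl a b f) (cl a b g).
Proof.
move=> ab [h1 h2] hg phi hphi; have [aphi pa pb] := C1c_acont ab hphi.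
have hf := L2c_cac (ltW ab) (conj h1 h2).
rewrite !cintegral_mulr.
have key (u v p q : R -> R) : acont a b u v -> L2r a b p -> L2r a b q ->
    {ae mu, forall x, `]a, b[%classic x -> p x = u x} ->
    {ae mu, forall x, `]a, b[%classic x -> q x = v x} ->
    II a b (fun x => p x * derive1 phi x) = - II a b (fun x => q x * phi x).
  move=> huv hp hq pu qv.
  have [I1 e1] := AC_HI (ltW ab) (AC_mul (ltW ab) huv aphi).
  rewrite pa pb !mulr0 subrr in e1.
  have [M HM] : exists M : R, forall x, a <= x <= b -> `|derive1 phi x| <= M.
    by apply: within_bounded (ltW ab) _; apply: continuous_subspaceT; case: hphi.
  have mphi : measurable_fun `]a, b[ (derive1 phi) by apply: L1_meas; case: aphi.
  have J1 : L1 a b (fun x => p x * derive1 phi x).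
    by apply: (L1_mulr (M := M)) => //; [exact: L2_L1|move=> x /andP[ax xb]; rewrite HM // !ltW].
  have J2 : L1 a b (fun x => q x * phi x) by exact: L2_mul_L1 hq (L2_AC (ltW ab) aphi).
  have [_] := HI_add (L1_HI J1) (L1_HI J2).
  have -> : II a b (fun x => p x * derive1 phi x + q x * phi x) = 0.
    rewrite -e1; apply: II_ae; first exact: L1_meas.
      by apply: aeS2 pu qv => x A B hx; rewrite A // B // addrC.
    exact: (proj1 (HI_add (L1_HI J1) (L1_HI J2))).
  by move=> e; lra.
have [f1 f2] := repr_L2c (cl a b f); have [g1 g2] := repr_L2c (cl a b g).
rewrite (key _ _ _ _ h1 f1 g1).
- rewrite (key _ _ _ _ h2 f2 g2) //.
  + by apply: aeS (repr_cl hf) => x h hx /=; rewrite h.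
  + by apply: aeS (repr_cl hg) => x h hx /=; rewrite h.
- by apply: aeS (repr_cl hf) => x h hx /=; rewrite h.
- by apply: aeS (repr_cl hg) => x h hx /=; rewrite h.
Qed.

Lemma wderiv_cl a b f g : a < b -> cac a b f g -> L2c a b g ->
  wderiv (cl a b f) = cl a b g.
Proof.
move=> ab hfg hg; rewrite /wderiv; have H := is_wderiv_cl ab hfg hg.
by apply: xget_unique => // G HG; exact: wderiv_unique HG H.
Qed.

Lemma sobolev1_cl a b f g : a < b -> cac a b f g -> L2c a b g -> sobolev1 (cl a b f).
Proof. by move=> ab hfg hg; exists (cl a b g); exact: is_wderiv_cl. Qed.

Lemma sobolev1_primitive a b (F : L2 a b) : a < b -> sobolev1 F ->
  exists f, cac a b f (repr (wderiv F)) /\ F = cl a b f.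
Proof.
move=> ab [G HG].
have [f [f1 f2]] := wderiv_primitive ab HG.
have -> : wderiv F = G.
  by rewrite /wderiv; apply: xget_unique => // G' HG'; exact: wderiv_unique HG' HG.
exists f; split=> //; rewrite -(cl_repr F); apply/esym/cl_eqP => //.
- exact: L2c_cac (ltW ab) f1.
- exact: repr_L2c.
Qed.

Lemma sobolev2_cl a b f f1 f2 : a < b -> cac a b f f1 -> cac a b f1 f2 -> L2c a b f2 ->
  sobolev2 (cl a b f) /\ wderiv (wderiv (cl a b f)) = cl a b f2.
Proof.
move=> ab h1 h2 h3; have h4 := L2c_cac (ltW ab) h2.
split; last by rewrite (wderiv_cl ab h1 h4) (wderiv_cl ab h2 h3).
split; first exact: sobolev1_cl h1 h4.
by rewrite (wderiv_cl ab h1 h4); exact: sobolev1_cl h2 h3.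
Qed.

(** The derivative of [f] is at first an arbitrary representative of [wderiv F]; it is changed on a
    null set into the continuous [f1]. *)
Lemma sobolev2_primitive a b (F : L2 a b) : a < b -> sobolev2 F ->
  exists f f1 f2, [/\ cac a b f f1, cac a b f1 f2, L2c a b f2, F = cl a b f &
    wderiv F = cl a b f1 /\ wderiv (wderiv F) = cl a b f2].
Proof.
move=> ab [s1 s2].
have [f [hf Ff]] := sobolev1_primitive ab s1.
have [f1 [hf1 Ff1]] := sobolev1_primitive ab s2.
exists f, f1, (repr (wderiv (wderiv F))); split=> //; last by rewrite cl_repr.
  have e : {ae mu, forall x, `]a, b[%classic x -> repr (wderiv F) x = f1 x}.
    by rewrite Ff1; exact: repr_cl (L2c_cac (ltW ab) hf1).
  have [m1 m2] := L2c_cac (ltW ab) hf1.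
  case: hf => k1 k2; split.
    apply: AC_ae k1; first by case: m1.
    by apply: aeS e => x h hx /=; rewrite h.
  apply: AC_ae k2; first by case: m2.
  by apply: aeS e => x h hx /=; rewrite h.
exact: repr_L2c.
Qed.

End Classes.

(** * Gluing the two pieces *)

Lemma measurable_invr (R : realType) (A : set R) (h : R -> R) : measurable_fun A h ->
  (forall t, h t != 0) -> measurable_fun A (fun t => (h t)^-1).
Proof.
move=> mh h0.
rewrite -[X in measurable_fun _ X]/((fun x : R => x^-1) \o h).
apply: (@measurable_comp _ _ _ _ _ _ [set~ (0 : R)]) => //.
- by apply: measurableC; exact: measurable_set1.
- by move=> u [t _ <-] /=; apply/eqP; exact: h0.
- apply: open_continuous_measurable_fun; first exact/closed_openC/accessible_closed_set1/hausdorff_accessible/Rhausdorff.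
  by move=> t; rewrite inE => /eqP t0; exact: inv_continuous.
Qed.

Section Gluing.
Variables (R : realType) (l L : R).
Hypotheses (l0 : 0 < l) (lL : l < L).
Local Notation mu := (@lebesgue_measure R).
Local Notation Hsp := (Hsp l L).
Implicit Types (f g W V S : R -> R[i]) (w v : Hsp) (x y : Hsp * Hsp).

Definition clH f : Hsp := (cl 0 l f, cl l L f).
Definition glue f g (x : R) := if x < l then f x else g x.

Let L0 : 0 < L := lt_trans l0 lL.

Lemma L2c_left f : L2c 0 L f -> L2c 0 l f.
Proof. by apply: L2cS => //; exact: ltW. Qed.

Lemma L2c_right f : L2c 0 L f -> L2c l L f.
Proof. by apply: L2cS => //; exact: ltW. Qed.

Lemma L2c_cat f : L2c 0 l f -> L2c l L f -> L2c 0 L f.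
Proof.
by move=> [h1 h2] [h3 h4]; split; [apply: L2_cat h1 h3|apply: L2_cat h2 h4]; exact: ltW.
Qed.

Lemma glue_left f g t : t < l -> glue f g t = f t.
Proof. by rewrite /glue => ->. Qed.

Lemma glue_right f g t : l <= t -> glue f g t = g t.
Proof. by rewrite /glue ltNge => ->. Qed.

Lemma L2c_glue f g : L2c 0 l f -> L2c l L g -> L2c 0 L (glue f g).
Proof.
move=> hf hg; apply: L2c_cat.
  by apply: L2c_ext hf => t /andP[_ tl]; rewrite glue_left.
by apply: L2c_ext hg => t /andP[tl _]; rewrite glue_right // ltW.
Qed.

Lemma clH_glue f g : L2c 0 l f -> L2c l L g -> clH (glue f g) = (cl 0 l f, cl l L g).
Proof.
move=> hf hg; congr (_, _); apply/esym/cl_ext => // t /andP[t1 t2].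
  by rewrite glue_left.
by rewrite glue_right // ltW.
Qed.

Lemma clH_surj v : exists2 f, L2c 0 L f & v = clH f.
Proof.
exists (glue (repr v.1) (repr v.2)); first by apply: L2c_glue; exact: repr_L2c.
by rewrite clH_glue ?cl_repr; [case: v|exact: repr_L2c|exact: repr_L2c].
Qed.

Lemma clH_comb k f g : L2c 0 L f -> L2c 0 L g ->
  clH (fun t => k * f t + g t) = k *: clH f + clH g.
Proof.
move=> hf hg; rewrite /clH.
rewrite (cl_comb k (L2c_left hf) (L2c_left hg)).
by rewrite (cl_comb k (L2c_right hf) (L2c_right hg)).
Qed.

Lemma clH_opp f : L2c 0 L f -> clH (fun t => - f t) = - clH f.
Proof.
move=> hf; have h0 : L2c 0 L (fun=> 0 : R[i]) by split; exact: L2_cst.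
have e0 : clH (fun=> 0) = 0.
  have := clH_comb 1 h0 h0; rewrite scale1r.
  have -> : (fun t : R => 1 * 0 + 0) = (fun=> 0 : R[i]) by apply/funext => t; rewrite mulr0 addr0.
  by move=> e; apply: (@addrI _ (clH (fun=> 0))); rewrite -e addr0.
have := clH_comb (-1) hf h0; rewrite e0 addr0 scaleN1r => <-.
by congr clH; apply/funext => t; rewrite mulN1r addr0.
Qed.

Lemma clH_eq_ae f g : L2c 0 L f -> L2c 0 L g -> clH f = clH g ->
  {ae mu, forall t, `]0, L[%classic t -> f t = g t}.
Proof.
move=> hf hg [e1 e2].
have /(cl_eqP (L2c_left hf) (L2c_left hg)) a1 := e1.
have /(cl_eqP (L2c_right hf) (L2c_right hg)) a2 := e2.
have a3 : {ae mu, forall t, t != l}.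
  exists [set l]; split; [exact: measurable_set1|exact: lebesgue_measure_set1|].
  by move=> t /= /negP; rewrite negbK => /eqP.
have a4 := aeS2 (fun t A B => conj A B) a1 a2.
apply: aeS2 a4 a3 => t [A B] tl /=; rewrite in_itv /= => /andP[t0 tL].
have [tl'|lt'|e] := ltgtP t l.
- by apply: A; rewrite /= in_itv /= t0.
- by apply: B; rewrite /= in_itv /= lt'.
- by rewrite e eqxx in tl.
Qed.

(** H^2(0, L), and below it H^2_0(0, L), with both derivatives kept as functions so that pointwise
    identities can be used. *)
Definition H2c f f1 f2 := [/\ cac 0 L f f1, cac 0 L f1 f2 & L2c 0 L f2].
Definition H20 f f1 f2 := H2c f f1 f2 /\ [/\ f 0 = 0, f1 0 = 0, f L = 0 & f1 L = 0].
Definition D2 w : Hsp := (wderiv (wderiv w.1), wderiv (wderiv w.2)).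
(** The transmission conditions, common to the displacements in [V1] and to the pair of [S1] and
    [S2] in [domA1]. *)
Definition matched w := [/\ sobolev2 w.1, sobolev2 w.2, trace w.1 l = trace w.2 l &
  trace (wderiv w.1) l = trace (wderiv w.2) l].

Lemma H2c_matched f f1 f2 : H2c f f1 f2 ->
  [/\ matched (clH f), D2 (clH f) = clH f2,
    trace (clH f).1 0 = f 0 /\ trace (wderiv (clH f).1) 0 = f1 0 &
    trace (clH f).2 L = f L /\ trace (wderiv (clH f).2) L = f1 L].
Proof.
move=> [h1 h2 h3].
have ll := ltW l0; have lL' := ltW lL.
have a1 := cacS (lexx 0) lL' h1; have a2 := cacS (lexx 0) lL' h2; have a3 := L2c_left h3.
have b1 := cacS ll (lexx L) h1; have b2 := cacS ll (lexx L) h2; have b3 := L2c_right h3.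
have [s1 d1] := sobolev2_cl l0 a1 a2 a3; have [s2 d2] := sobolev2_cl lL b1 b2 b3.
have e1 : wderiv (cl 0 l f) = cl 0 l f1 := wderiv_cl l0 a1 (L2c_cac ll a2).
have e2 : wderiv (cl l L f) = cl l L f1 := wderiv_cl lL b1 (L2c_cac lL' b2).
rewrite /matched /D2 /= d1 d2 e1 e2; split=> //.
- have bl : 0 <= l <= l by rewrite ll lexx.
  have bL : l <= l <= L by rewrite lexx lL'.
  split=> //.
    by rewrite (trace_cl l0 a1 bl) (trace_cl lL b1 bL).
  by rewrite (trace_cl l0 a2 bl) (trace_cl lL b2 bL).
- have bl : (0 : R) <= 0 <= l by rewrite ll andbT.
  by rewrite (trace_cl l0 a1 bl) (trace_cl l0 a2 bl).
- have bL : l <= L <= L by rewrite lL' lexx.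
  by rewrite (trace_cl lL b1 bL) (trace_cl lL b2 bL).
Qed.

Lemma cac_glue f f1 g g1 : cac 0 l f f1 -> cac l L g g1 -> f l = g l ->
  cac 0 L (glue f g) (glue f1 g1).
Proof.
move=> h1 h2 e; apply: (@cac_cat _ 0 L l); [exact: ltW|exact: ltW| |].
  apply: cac_ext h1 => t /andP[t0]; last by move=> tl; rewrite glue_left.
  by rewrite le_eqVlt => /predU1P[->|tl]; [rewrite glue_right|rewrite glue_left].
by apply: cac_ext h2 => t /andP[t0 _]; rewrite glue_right // ltW.
Qed.

(** Equality of the two traces is what makes the glued function and its glued derivative absolutely
    continuous across [l]. *)
Lemma matched_H2c w : matched w -> exists f f1 f2, [/\ H2c f f1 f2, w = clH f & D2 w = clH f2].
Proof.
move=> [s1 s2 t1 t2].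
have [f [f1 [f2 [a1 a2 a3 a4 [a5 a6]]]]] := sobolev2_primitive l0 s1.
have [g [g1 [g2 [b1 b2 b3 b4 [b5 b6]]]]] := sobolev2_primitive lL s2.
have ll : 0 <= l <= l by rewrite lexx (ltW l0).
have lL' : l <= l <= L by rewrite lexx (ltW lL).
have e1 : f l = g l.
  by move: t1; rewrite a4 b4 (trace_cl l0 a1) ?(trace_cl lL b1).
have e2 : f1 l = g1 l.
  by move: t2; rewrite a5 b5 (trace_cl l0 a2) ?(trace_cl lL b2).
exists (glue f g), (glue f1 g1), (glue f2 g2); split.
- by split; [exact: cac_glue|exact: cac_glue|exact: L2c_glue].
- rewrite clH_glue; last exact: L2c_cac (ltW lL) b1.
    by case: w a4 b4 {s1 s2 t1 t2 a5 a6 b5 b6} => w1 w2 /= -> ->.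
  exact: L2c_cac (ltW l0) a1.
- by rewrite clH_glue // /D2 a6 b6.
Qed.

Lemma V1P w : V1 w <-> exists f f1 f2, [/\ H20 f f1 f2, w = clH f & D2 w = clH f2].
Proof.
split.
  move=> [s1 s2 [t1 t2] [t3 t4] [t5 t6]].
  have [|f [f1 [f2 [h e1 e2]]]] := @matched_H2c w; first by split.
  have [_ _ [u1 u2] [u3 u4]] := H2c_matched h; rewrite -e1 in u1 u2 u3 u4.
  exists f, f1, f2; split=> //; split=> //.
  by rewrite -u1 -u2 -u3 -u4; split.
move=> [f [f1 [f2 [[h [z1 z2 z3 z4]] -> _]]]].
have [[m1 m2 m3 m4] _ [u1 u2] [u3 u4]] := H2c_matched h.
by split=> //; rewrite ?u1 ?u2 ?u3 ?u4.
Qed.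

Lemma cac_comb k f g f1 g1 : cac 0 L f f1 -> cac 0 L g g1 ->
  cac 0 L (fun t => k * f t + g t) (fun t => k * f1 t + g1 t).
Proof.
case: k => k1 k2 [h1 h2] [h3 h4]; split.
  apply: AC_ext (AC_add (AC_sub (AC_scale k1 h1) (AC_scale k2 h2)) h3) => t _ /=.
    by case: (f t) (g t) => ? ? [? ?].
  by case: (f1 t) (g1 t) => ? ? [? ?].
apply: AC_ext (AC_add (AC_add (AC_scale k1 h2) (AC_scale k2 h1)) h4) => t _ /=.
  by case: (f t) (g t) => ? ? [? ?].
by case: (f1 t) (g1 t) => ? ? [? ?].
Qed.

Lemma H2c_comb k f f1 f2 g g1 g2 : H2c f f1 f2 -> H2c g g1 g2 ->
  H2c (fun t => k * f t + g t) (fun t => k * f1 t + g1 t) (fun t => k * f2 t + g2 t).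
Proof.
by move=> [? ? ?] [? ? ?]; split; [exact: cac_comb|exact: cac_comb|exact: L2c_comb].
Qed.

Lemma H20_comb k f f1 f2 g g1 g2 : H20 f f1 f2 -> H20 g g1 g2 ->
  H20 (fun t => k * f t + g t) (fun t => k * f1 t + g1 t) (fun t => k * f2 t + g2 t).
Proof.
move=> [h1 [a1 a2 a3 a4]] [h2 [b1 b2 b3 b4]]; split; first exact: H2c_comb.
by rewrite a1 a2 a3 a4 b1 b2 b3 b4 mulr0 addr0; split.
Qed.

(** * Energy inner product and representatives of domain elements *)

Definition dot (z z' : R[i]) : R := Re z * Re z' + Im z * Im z'.

Lemma dotzz z : dot z z = sqmod z.
Proof. by rewrite /dot /sqmod !expr2. Qed.

(** [qq] and [DD] are coefficients on all of (0, L) whose bounds hold at every point, whereas the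
    given [q1], [q2] and [D] agree with them only almost everywhere. *)
Variables (q1 q2 D qq DD : R -> R) (c0 Q : R).
Hypotheses (c00 : 0 < c0) (q1_b : ess_bounded 0 l q1) (q2_b : ess_bounded l L q2)
  (D_b : ess_bounded 0 l D).
Hypotheses (mqq : measurable_fun `]0, L[ qq) (qq_b : forall t, c0 <= qq t <= Q).
Hypotheses (mDD : measurable_fun `]0, L[ DD) (DD_b : forall t, 0 <= DD t <= Q).
Hypotheses (qq1 : {ae mu, forall t, `]0, l[%classic t -> q1 t = qq t})
  (qq2 : {ae mu, forall t, `]l, L[%classic t -> q2 t = qq t})
  (DD1 : {ae mu, forall t, `]0, l[%classic t -> D t = DD t})
  (DD2 : forall t, l < t -> DD t = 0).

Lemma L2c_bmul (h : R -> R) (M : R) f : measurable_fun `]0, L[ h -> (forall t, `|h t| <= M) ->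
  L2c 0 L f -> L2c 0 L (fun t => (h t)%:C * f t).
Proof.
move=> mh hM hf; apply: L2c_mulr hf; split=> //.
by exists M; apply: aeW => t _; exact: hM.
Qed.

Lemma qq_pos t : 0 < qq t.
Proof. by have /andP[h _] := qq_b t; exact: lt_le_trans h. Qed.

Lemma qq_abs t : `|qq t| <= Q.
Proof. by rewrite gtr0_norm ?qq_pos //; case/andP: (qq_b t). Qed.

Lemma DD_abs t : `|DD t| <= Q.
Proof. by case/andP: (DD_b t) => h1 h2; rewrite ger0_norm. Qed.

(** Energy and inner product see only the second derivative [f2] of the displacement and the
    velocity [V]; the displacement itself stays hidden. *)
Definition rep x f2 V := exists f f1, [/\ H20 f f1 f2, L2c 0 L V, x = (clH f, clH V) & D2 (clH f) = clH f2].

Lemma rep_intro f f1 f2 V : H20 f f1 f2 -> L2c 0 L V -> rep (clH f, clH V) f2 V.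
Proof. by move=> h hV; exists f, f1; split=> //; case: h => /H2c_matched[]. Qed.

Lemma rep_E x f2 V : rep x f2 V -> energy_space l L x.
Proof.
move=> [f [f1 [h hV -> e]]]; apply/V1P; exists f, f1, f2; split=> //.
Qed.

Lemma E_rep x : energy_space l L x -> exists f2 V, rep x f2 V.
Proof.
move=> /V1P[f [f1 [f2 [h e1 e2]]]]; have [V hV eV] := clH_surj x.2.
exists f2, V, f, f1; split; [exact: h|exact: hV| |by rewrite -e1].
by rewrite -e1 -eV; case: (x).
Qed.

Lemma rep_L2 x f2 V : rep x f2 V -> L2c 0 L f2 /\ L2c 0 L V.
Proof. by move=> [f [f1 [[[_ _ h] _] hV _ _]]]. Qed.

Lemma rep_comb k x y f2 V g2 U : rep x f2 V -> rep y g2 U ->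
  rep (k *: x + y) (fun t => k * f2 t + g2 t) (fun t => k * V t + U t).
Proof.
move=> [f [f1 [h1 h2 -> e1]]] [g [g1 [h3 h4 -> e2]]].
have h5 := H20_comb k h1 h3.
exists (fun t => k * f t + g t), (fun t => k * f1 t + g1 t); split.
- exact: h5.
- exact: L2c_comb.
- have hf : L2c 0 L f by case: h1 => -[a b c] _; exact: L2c_cac (ltW L0) a.
  have hg : L2c 0 L g by case: h3 => -[a b c] _; exact: L2c_cac (ltW L0) a.
  by rewrite (clH_comb k hf hg) (clH_comb k h2 h4).
- by case: h5 => /H2c_matched[].
Qed.

Definition ipL2 (a b : R) (q : R -> R) (F G : L2 a b) : R :=
  II a b (fun t => q t * dot (repr F t) (repr G t)).

(** Real part of the Hermitian inner product of the energy space. The complex structure enters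
    through [ipE_scale]: multiplication by [k] is adjoint to multiplication by its conjugate. *)
Definition ipE x y : R :=
  ipL2 qq (D2 x.1).1 (D2 y.1).1 + ipL2 qq (D2 x.1).2 (D2 y.1).2 +
  (ipL2 (fun=> 1) x.2.1 y.2.1 + ipL2 (fun=> 1) x.2.2 y.2.2).

Lemma dot_L1 a b (q : R -> R) f g : ess_bounded a b q -> L2c a b f -> L2c a b g ->
  L1 a b (fun t => q t * dot (f t) (g t)).
Proof.
move=> hq [h1 h2] [h3 h4].
apply: L1_eq (proj1 (HI_add (L1_HI (L2_mul_L1 (ess_bounded_mul hq h1) h3))
  (L1_HI (L2_mul_L1 (ess_bounded_mul hq h2) h4)))) => t _.
by rewrite /dot /=; ring.
Qed.

Lemma ipL2_cl a b (q : R -> R) f g : ess_bounded a b q -> L2c a b f -> L2c a b g ->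
  ipL2 q (cl a b f) (cl a b g) = II a b (fun t => q t * dot (f t) (g t)).
Proof.
move=> hq hf hg; have I0 := dot_L1 hq (repr_L2c (cl a b f)) (repr_L2c (cl a b g)).
apply: II_ae I0; first by apply: L1_meas; exact: dot_L1.
by apply: aeS2 (repr_cl hf) (repr_cl hg) => t A B ht; rewrite A // B.
Qed.

Lemma qq_ess a b : 0 <= a -> b <= L -> ess_bounded a b qq.
Proof.
move=> a0 bL; split; last by exists Q; apply: aeW => t _; exact: qq_abs.
apply: measurable_funS mqq; first exact: mitv.
by move=> t /=; rewrite !in_itv /= => /andP[h1 h2]; rewrite (le_lt_trans a0 h1) (lt_le_trans h2).
Qed.

Lemma DD_ess a b : 0 <= a -> b <= L -> ess_bounded a b DD.
Proof.
move=> a0 bL; split; last by exists Q; apply: aeW => t _; exact: DD_abs.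
apply: measurable_funS mDD; first exact: mitv.
by move=> t /=; rewrite !in_itv /= => /andP[h1 h2]; rewrite (le_lt_trans a0 h1) (lt_le_trans h2).
Qed.

Lemma one_ess a b : ess_bounded a b (fun=> 1 : R).
Proof. by split; [exact: measurable_cst|exists 1; apply: aeW => t _; rewrite normr1]. Qed.

Lemma ipE_rep x y f2 V g2 U : rep x f2 V -> rep y g2 U ->
  ipE x y = II 0 L (fun t => qq t * dot (f2 t) (g2 t)) + II 0 L (fun t => 1 * dot (V t) (U t)).
Proof.
move=> hx hy; have [hf hV] := rep_L2 hx; have [hg hU] := rep_L2 hy.
case: hx => f [f1 [h1 h2 -> e1]]; case: hy => g [g1 [h3 h4 -> e2]].
have E w v w' v' : ipE (w, v) (w', v') = ipL2 qq (D2 w).1 (D2 w').1 + ipL2 qq (D2 w).2 (D2 w').2 +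
  (ipL2 (fun=> 1) v.1 v'.1 + ipL2 (fun=> 1) v.2 v'.2) by [].
rewrite E e1 e2 /clH /=.
have ll := ltW l0; have lL' := ltW lL.
rewrite !ipL2_cl; try exact: one_ess; try exact: qq_ess; try exact: L2c_left; try exact: L2c_right.
rewrite (II_cat ll lL' (dot_L1 (qq_ess (lexx 0) (lexx L)) hf hg)).
by rewrite (II_cat ll lL' (dot_L1 (one_ess 0 L) hV hU)).
Qed.

Lemma sqnormL2_ae a b (q q' : R -> R) (F : L2 a b) : ess_bounded a b q -> ess_bounded a b q' ->
  {ae mu, forall t, `]a, b[%classic t -> q t = q' t} -> sqnormL2 q F = sqnormL2 q' F.
Proof.
move=> hq hq' qq'; apply: II_ae (sqmod_L1 hq (repr_L2c F)).
  by apply: L1_meas; exact: sqmod_L1 hq' (repr_L2c F).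
by apply: aeS qq' => t h ht; rewrite h.
Qed.

Lemma sqnormL2_ip a b (q : R -> R) (F : L2 a b) : sqnormL2 q F = ipL2 q F F.
Proof. by apply: II_eq => t _; rewrite dotzz. Qed.

Lemma sqnormL2_ge0 a b (q : R -> R) (F : L2 a b) : (forall t, 0 <= q t) -> 0 <= sqnormL2 q F.
Proof. by move=> q0; apply: II_ge0 => t _; rewrite mulr_ge0 // sqmod_ge0. Qed.

Lemma energy_norm_sq x : energy_norm q1 q2 x ^+ 2 = ipE x x.
Proof.
have ll := ltW l0; have lL' := ltW lL.
have e1 : sqnormL2 q1 (D2 x.1).1 = sqnormL2 qq (D2 x.1).1 by apply: sqnormL2_ae => //; exact: qq_ess.
have e2 : sqnormL2 q2 (D2 x.1).2 = sqnormL2 qq (D2 x.1).2 by apply: sqnormL2_ae => //; exact: qq_ess.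
have q0 t : 0 <= qq t := ltW (qq_pos t).
have ev : normV1 q1 q2 x.1 ^+ 2 = sqnormL2 qq (D2 x.1).1 + sqnormL2 qq (D2 x.1).2.
  by rewrite -e1 -e2 sqr_sqrtr // e1 e2 addr_ge0 // sqnormL2_ge0.
have eh : normH x.2 ^+ 2 = sqnormL2 (fun=> 1) x.2.1 + sqnormL2 (fun=> 1) x.2.2.
  by rewrite sqr_sqrtr // addr_ge0 // sqnormL2_ge0.
by rewrite sqr_sqrtr ?addr_ge0 ?sqr_ge0 // ev eh !sqnormL2_ip.
Qed.

Lemma energy_norm_ge0 x : 0 <= energy_norm q1 q2 x.
Proof. exact: sqrtr_ge0. Qed.

Lemma II_comb (a b : R) (h h1 h2 : R -> R) (k : R) : L1 a b h1 -> L1 a b h2 ->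
  (forall t, a < t < b -> h t = k * h1 t + h2 t) -> II a b h = k * II a b h1 + II a b h2.
Proof.
move=> I1 I2 e; rewrite (II_eq e).
by have [_ ->] := HI_add (HI_scale k (L1_HI I1)) (L1_HI I2).
Qed.

Lemma ipE_sym x y : energy_space l L x -> energy_space l L y -> ipE x y = ipE y x.
Proof.
move=> /E_rep[f [V hx]] /E_rep[g [U hy]].
rewrite (ipE_rep hx hy) (ipE_rep hy hx).
by congr (_ + _); apply: II_eq => t _; rewrite /dot; ring.
Qed.

Lemma dot_comb (r : R) (z1 z2 z : R[i]) : dot (r%:C * z1 + z2) z = r * dot z1 z + dot z2 z.
Proof. by case: z1 z2 z => ? ? [? ?] [? ?]; rewrite /dot /=; ring. Qed.

Lemma dot_conj (k z1 z2 : R[i]) : dot (k * z1) z2 = dot z1 (k^* * z2).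
Proof. by case: k z1 z2 => ? ? [? ?] [? ?]; rewrite /dot /=; ring. Qed.

Lemma ipE_comb (r : R) x y z : energy_space l L x -> energy_space l L y -> energy_space l L z ->
  ipE (r%:C *: x + y) z = r * ipE x z + ipE y z.
Proof.
move=> /E_rep[f [V hx]] /E_rep[g [U hy]] /E_rep[h [Z hz]].
rewrite (ipE_rep (rep_comb r%:C hx hy) hz) (ipE_rep hx hz) (ipE_rep hy hz).
have [hf hV] := rep_L2 hx; have [hg hU] := rep_L2 hy; have [hh hZ] := rep_L2 hz.
have qe := qq_ess (lexx 0) (lexx L); have oe := one_ess 0 L.
have key (q : R -> R) (u v w : R -> R[i]) : ess_bounded 0 L q -> L2c 0 L u -> L2c 0 L v -> L2c 0 L w ->
    II 0 L (fun t => q t * dot (r%:C * u t + v t) (w t)) =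
    r * II 0 L (fun t => q t * dot (u t) (w t)) + II 0 L (fun t => q t * dot (v t) (w t)).
  move=> hq hu hv hw; apply: II_comb; [exact: dot_L1|exact: dot_L1|].
  by move=> t _; rewrite dot_comb; ring.
rewrite (key qq) // (key (fun=> 1)) //; ring.
Qed.

Lemma rep0 : rep 0 (fun=> 0) (fun=> 0).
Proof.
have c0' : cac 0 L (fun=> 0 : R[i]) (fun=> 0) by split; exact: AC_cst (ltW L0).
have l0' : L2c 0 L (fun=> 0 : R[i]) by split; exact: L2_cst.
have h : H20 (fun=> 0) (fun=> 0) (fun=> 0) by split.
have := rep_intro h l0'; congr rep.
have e := clH_opp l0'.
have e2 : clH (fun=> 0) = 0.
  have := clH_comb 1 l0' l0'; rewrite scale1r.
  have -> : (fun t : R => 1 * 0 + 0) = (fun=> 0 : R[i]) by apply/funext => t; rewrite mulr0 addr0.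
  by move=> e3; apply: (@addrI _ (clH (fun=> 0))); rewrite -e3 addr0.
by rewrite e2.
Qed.

Lemma rep_scale k x f2 V : rep x f2 V -> rep (k *: x) (fun t => k * f2 t) (fun t => k * V t).
Proof.
move=> /(rep_comb k)/(_ rep0); rewrite addr0.
by under eq_fun do rewrite addr0; under [in X in rep _ _ X]eq_fun do rewrite addr0.
Qed.

Lemma ipE_scale k x y : energy_space l L x -> energy_space l L y ->
  ipE (k *: x) y = ipE x (k^* *: y).
Proof.
move=> /E_rep[f [V hx]] /E_rep[g [U hy]].
rewrite (ipE_rep (rep_scale k hx) hy) (ipE_rep hx (rep_scale _ hy)).
by congr (_ + _); apply: II_eq => t _; rewrite dot_conj.
Qed.

Lemma E_comb k x y : energy_space l L x -> energy_space l L y -> energy_space l L (k *: x + y).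
Proof.
by move=> /E_rep[f [V hx]] /E_rep[g [U hy]]; exact: rep_E (rep_comb k hx hy).
Qed.

(* In the domain, w'' is normalized so that S = q w'' + D v'' holds everywhere. *)
Definition drep x W W1 W2 V V1 V2 S S1 S2 :=
  [/\ H20 W W1 W2, H20 V V1 V2, H2c S S1 S2,
      (forall t, 0 < t < L -> S t = (qq t)%:C * W2 t + (DD t)%:C * V2 t) &
      x = (clH W, clH V)].

Lemma cac_ae f f1 g : L2c 0 L g -> {ae mu, forall t, `]0, L[%classic t -> f1 t = g t} ->
  cac 0 L f f1 -> cac 0 L f g.
Proof.
move=> [m1 m2] e [h1 h2]; split.
  apply: AC_ae h1; first by case: m1.
  by apply: aeS e => t h ht /=; rewrite h.
apply: AC_ae h2; first by case: m2.
by apply: aeS e => t h ht /=; rewrite h.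
Qed.

Lemma S1_cl W2 V2 : L2c 0 L W2 -> L2c 0 L V2 ->
  mulL2 q1 (cl 0 l W2) + mulL2 D (cl 0 l V2) =
  cl 0 l (fun t => (qq t)%:C * W2 t + (DD t)%:C * V2 t).
Proof.
move=> hW hV; have qe := qq_ess (lexx 0) (ltW lL); have de := DD_ess (lexx 0) (ltW lL).
have hW' := L2c_left hW; have hV' := L2c_left hV.
have e1 : mulL2 q1 (cl 0 l W2) = cl 0 l (fun t => (qq t)%:C * W2 t).
  rewrite mulL2_cl //; apply/cl_eqP; [exact: L2c_mulr|exact: L2c_mulr|].
  by apply: aeS qq1 => t h ht; rewrite h.
have e2 : mulL2 D (cl 0 l V2) = cl 0 l (fun t => (DD t)%:C * V2 t).
  rewrite mulL2_cl //; apply/cl_eqP; [exact: L2c_mulr|exact: L2c_mulr|].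
  by apply: aeS DD1 => t h ht; rewrite h.
have := @cl_comb _ 0 l 1 (fun t => (qq t)%:C * W2 t) (fun t => (DD t)%:C * V2 t) (L2c_mulr qe hW') (L2c_mulr de hV').
rewrite scale1r e1 e2 => <-; congr cl; apply/funext => t; by rewrite mul1r.
Qed.

Lemma S2_cl W2 V2 : L2c 0 L W2 -> L2c 0 L V2 ->
  mulL2 q2 (cl l L W2) = cl l L (fun t => (qq t)%:C * W2 t + (DD t)%:C * V2 t).
Proof.
move=> hW hV; have qe := qq_ess (ltW l0) (lexx L); have de := DD_ess (ltW l0) (lexx L).
have hW' := L2c_right hW; have hV' := L2c_right hV.
have := @cl_comb _ l L 1 (fun t => (qq t)%:C * W2 t) (fun t => (DD t)%:C * V2 t) (L2c_mulr qe hW') (L2c_mulr de hV').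
move=> E; rewrite mulL2_cl //; apply/cl_eqP.
- exact: L2c_mulr.
- apply: L2c_ext (@L2c_comb _ l L 1 _ _ (L2c_mulr qe hW') (L2c_mulr de hV')) => t _.
  by rewrite mul1r.
- apply: aeS qq2 => t h ht; rewrite h //; move: ht; rewrite /= in_itv /= => /andP[lt _].
  by rewrite DD2 // mul0r addr0.
Qed.

Lemma dom_drep x : domA1 q1 q2 D x -> exists W W1 W2 V V1 V2 S S1 S2,
  drep x W W1 W2 V V1 V2 S S1 S2 /\ A1 q1 q2 D x = (clH V, clH (fun t => - S2 t)).
Proof.
move=> [/V1P[W [W1 [W2 [hW ew eW]]]] /V1P[V [V1' [V2 [hV ev eV]]]] s1 s2 [t1 t2]].
have hW2 : L2c 0 L W2 by case: hW => -[].
have hV2 : L2c 0 L V2 by case: hV => -[].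
(* The pair of [S1] and [S2] satisfies the same transmission conditions as a displacement, so it is
   glued into one [S] in H^2(0, L). *)
have [|S [S1' [S2' [hS eS eS2]]]] := @matched_H2c (S1 q1 D x, S2 q2 x); first by split.
have E1 : S1 q1 D x = cl 0 l (fun t => (qq t)%:C * W2 t + (DD t)%:C * V2 t).
  rewrite -(S1_cl hW2 hV2) /S1; case: eW => -> _; by case: eV => -> _.
have E2 : S2 q2 x = cl l L (fun t => (qq t)%:C * W2 t + (DD t)%:C * V2 t).
  by rewrite -(S2_cl hW2 hV2) /S2; case: eW => _ ->.
pose T t := (qq t)%:C * W2 t + (DD t)%:C * V2 t.
have hT : L2c 0 L T.
  have qe := qq_ess (lexx 0) (lexx L); have de := DD_ess (lexx 0) (lexx L).
  apply: L2c_ext (@L2c_comb _ 0 L 1 _ _ (L2c_mulr qe hW2) (L2c_mulr de hV2)) => t _.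
  by rewrite mul1r.
have hS0 : L2c 0 L S by case: hS => a _ _; exact: L2c_cac (ltW L0) a.
have ST : {ae mu, forall t, `]0, L[%classic t -> S t = T t}.
  apply: clH_eq_ae => //; rewrite -eS E1 E2 //.
pose W2' t := ((qq t)^-1)%:C * (S t - (DD t)%:C * V2 t).
have qi b : `|(qq b)^-1| <= c0^-1.
  rewrite gtr0_norm ?invr_gt0 ?qq_pos // lef_pV2 ?posrE ?qq_pos //.
  by case/andP: (qq_b b).
have mqi : measurable_fun `]0, L[ (fun t => (qq t)^-1).
  by apply: measurable_invr => // t; rewrite gt_eqF // qq_pos.
have hW2' : L2c 0 L W2'.
  apply: (L2c_bmul mqi qi).
  have de := DD_ess (lexx 0) (lexx L).
  apply: L2c_ext (@L2c_comb _ 0 L (-1) _ _ (L2c_mulr de hV2) hS0) => t _.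
  by rewrite mulN1r addrC.
have WW : {ae mu, forall t, `]0, L[%classic t -> W2 t = W2' t}.
  apply: aeS ST => t h ht; rewrite /W2' h // /T addrK mulrA -rmorphM /=.
  by rewrite mulVf ?mul1r // gt_eqF // qq_pos.
exists W, W1, W2', V, V1', V2, S, S1', S2'; split.
  split=> //.
  - by case: hW => -[a1 a2 a3] a4; split=> //; split=> //; exact: cac_ae WW a2.
  - move=> t _; rewrite /W2' mulrA -rmorphM /= mulfV ?mul1r ?subrK //.
    by rewrite gt_eqF // qq_pos.
  - by rewrite -ew -ev; case: (x).
rewrite /A1 ev; congr (_, _).
have hS2 : L2c 0 L S2' by case: hS.
rewrite clH_opp // -eS2 /D2 /=.
by [].
Qed.

Lemma drep_dom x W W1 W2 V V1 V2 S S1 S2 : drep x W W1 W2 V V1 V2 S S1 S2 -> domA1 q1 q2 D x.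
Proof.
move=> [hW hV hS e ->].
have hW2 : L2c 0 L W2 by case: hW => -[].
have hV2 : L2c 0 L V2 by case: hV => -[].
have hS0 : L2c 0 L S by case: hS => a _ _; exact: L2c_cac (ltW L0) a.
have [mm eS _ _] := H2c_matched hS.
have [_ eW _ _] := H2c_matched (proj1 hW).
have [_ eV _ _] := H2c_matched (proj1 hV).
have E1 : Defs.S1 q1 D (clH W, clH V) = cl 0 l S.
  rewrite /Defs.S1 /=; case: eW => -> _; case: eV => -> _; rewrite S1_cl //.
  apply/esym/cl_ext; last exact: L2c_left.
  by move=> t /andP[t0 tl]; apply: e; rewrite t0 (lt_trans tl).
have E2 : Defs.S2 q2 (clH W, clH V) = cl l L S.
  rewrite /Defs.S2 /=; case: eW => _ ->; rewrite (S2_cl hW2 hV2).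
  apply/esym/cl_ext; last exact: L2c_right.
  by move=> t /andP[tl tL]; apply: e; rewrite tL (lt_trans l0).
case: mm => m1 m2 m3 m4.
have v1 : Defs.V1 (clH W) by apply/V1P; exists W, W1, W2.
have v2 : Defs.V1 (clH V) by apply/V1P; exists V, V1, V2.
split; [exact: v1|exact: v2|by rewrite E1; exact: m1|by rewrite E2; exact: m2|].
by rewrite E1 E2; split; [exact: m3|exact: m4].
Qed.

End Gluing.

Lemma cvg0_right (R : realType) (f : R -> R) : f h @[h --> 0^'+] --> 0 ->
  forall e, 0 < e -> exists2 d, 0 < d & forall h, 0 < h -> h <= d -> `|f h| <= e.
Proof.
move=> /cvgrPdist_le H e e0; have := H _ e0; rewrite near_withinE => /nbhs_ballP[d /= d0 hd].
exists (d / 2); first by rewrite divr_gt0.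
move=> h h0 hdd; rewrite -normrN -sub0r; apply: hd => //.
by rewrite /ball /= sub0r normrN gtr0_norm //; lra.
Qed.

(** The cutoff in time is the discrete parabola j (n - j): it vanishes at both ends, its increments
    are at most n and its values at most n^2. For n = 4 m it is at least 3 m^2 on the middle half,
    by [parabola_ge]. *)
Lemma parabola_step (R : realType) (j n : R) : 0 <= j -> j + 2 <= n ->
  [/\ `|(j + 2) * (n - (j + 2)) - (j + 1) * (n - (j + 1))| <= n,
      `|(j + 1) * (n - (j + 1)) - j * (n - j)| <= n & (j + 1) * (n - (j + 1)) <= n * n].
Proof.
move=> j0 jn; split; last by apply: ler_pM; lra.
  by rewrite ler_norml; apply/andP; split; lra.
by rewrite ler_norml; apply/andP; split; lra.
Qed.

Lemma parabola_ge (R : realType) (j m : R) : m <= j -> j <= 3 * m ->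
  3 * m ^+ 2 <= j * (4 * m - j).
Proof. by move=> mj jm; nra. Qed.

(** * The resolvent criterion *)

Section HilbertSemigroup.
Variables (R : realType) (X : lmodType R[i]) (E : set X) (N : X -> R) (B : X -> X -> R).
Implicit Types (x y z : X) (s t h : R) (k : R[i]).
Hypotheses (E_comb : forall k x y, E x -> E y -> E (k *: x + y))
  (N_ge0 : forall x, 0 <= N x)
  (N_sq : forall x, E x -> N x ^+ 2 = B x x)
  (B_sym : forall x y, E x -> E y -> B x y = B y x)
  (B_comb : forall (r : R) x y z, E x -> E y -> E z -> B (r%:C *: x + y) z = r * B x z + B y z)
  (B_scale : forall k x y, E x -> E y -> B (k *: x) y = B x (k^* *: y)).

Lemma E_zero x : E x -> E 0.
Proof. by move=> Ex; have := E_comb (-1) Ex Ex; rewrite scaleN1r addNr. Qed.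

Lemma E_scale k x : E x -> E (k *: x).
Proof. by move=> Ex; have := E_comb k Ex (E_zero Ex); rewrite addr0. Qed.

Lemma E_add x y : E x -> E y -> E (x + y).
Proof. by move=> Ex Ey; have := E_comb 1 Ex Ey; rewrite scale1r. Qed.

Lemma E_sub x y : E x -> E y -> E (x - y).
Proof. by move=> Ex Ey; have := E_comb (-1) Ey Ex; rewrite scaleN1r addrC. Qed.

Lemma B_add x y z : E x -> E y -> E z -> B (x + y) z = B x z + B y z.
Proof. by move=> Ex Ey Ez; have := B_comb 1 Ex Ey Ez; rewrite scale1r mul1r. Qed.

Lemma B_add' x y z : E x -> E y -> E z -> B z (x + y) = B z x + B z y.
Proof.
move=> Ex Ey Ez; rewrite B_sym // ?B_add // ?(B_sym Ex) ?(B_sym Ey) //.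
exact: E_add.
Qed.

Lemma B0 y : E y -> B 0 y = 0.
Proof.
move=> Ey; have E0 := E_zero Ey; have := B_add E0 E0 Ey; rewrite addr0 => e; lra.
Qed.

Lemma B_real (r : R) x y : E x -> E y -> B (r%:C *: x) y = r * B x y.
Proof.
by move=> Ex Ey; have := B_comb r Ex (E_zero Ex) Ey; rewrite addr0 B0 // addr0.
Qed.

Lemma B_real' (r : R) x y : E x -> E y -> B x (r%:C *: y) = r * B x y.
Proof.
by move=> Ex Ey; rewrite B_sym ?B_real ?(B_sym Ey) //; exact: E_scale.
Qed.

Lemma N_comb (r : R) x y : E x -> E y ->
  N (r%:C *: x + y) ^+ 2 = r ^+ 2 * N x ^+ 2 + 2 * r * B x y + N y ^+ 2.
Proof.
move=> Ex Ey; have Erx := E_scale r%:C Ex.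
rewrite !N_sq //; last exact: E_add.
rewrite B_comb //; last exact: E_add.
rewrite !B_add' // !B_real' // (B_sym Ey Ex); ring.
Qed.

(** The discriminant argument. [N x = 0] and [N y = 0] are treated apart, since [N] need not be
    definite; a suitable real multiple of [x] then makes the quadratic negative. *)
Lemma B_le x y : E x -> E y -> B x y <= N x * N y.
Proof.
move=> Ex Ey; have Nx := N_ge0 x; have Ny := N_ge0 y.
have key (r : R) : 0 <= r ^+ 2 * N x ^+ 2 + 2 * r * B x y + N y ^+ 2.
  by rewrite -N_comb // sqr_ge0.
have [Nx0|Nxn] := eqVneq (N x) 0.
  rewrite Nx0 mul0r leNgt; apply/negP => Bp.
  have := key (- (N y ^+ 2 + 1) / (2 * B x y)).
  rewrite Nx0 expr0n mulr0 add0r.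
  have -> : 2 * (- (N y ^+ 2 + 1) / (2 * B x y)) * B x y = - (N y ^+ 2 + 1).
    by field; rewrite gt_eqF.
  by move=> h; lra.
have Nxp : 0 < N x by rewrite lt_neqAle eq_sym Nxn.
rewrite leNgt; apply/negP => Bp.
have := key (- (N y / N x)).
have -> : (- (N y / N x)) ^+ 2 * N x ^+ 2 + 2 * - (N y / N x) * B x y + N y ^+ 2 =
  2 * (N y / N x) * (N x * N y - B x y).
  by field.
have [Ny0|Nyn] := eqVneq (N y) 0.
  move=> _; have := key (- (B x y / N x ^+ 2)); rewrite Ny0.
  have -> : (- (B x y / N x ^+ 2)) ^+ 2 * N x ^+ 2 + 2 * - (B x y / N x ^+ 2) * B x y + 0 ^+ 2 =
     - (B x y ^+ 2 / N x ^+ 2) by field.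
  rewrite Ny0 mulr0 in Bp.
  by rewrite oppr_ge0 leNgt divr_gt0 // exprn_gt0.
have Nyp : 0 < N y by rewrite lt_neqAle eq_sym Nyn.
rewrite leNgt => /negP; apply.
by rewrite pmulr_rlt0 ?subr_lt0 // mulr_gt0 // divr_gt0.
Qed.

Lemma N_add x y : E x -> E y -> N (x + y) <= N x + N y.
Proof.
move=> Ex Ey; rewrite -(@ler_pXn2r _ 2) ?nnegrE ?addr_ge0 //.
have := N_comb 1 Ex Ey; rewrite scale1r => ->.
by have := B_le Ex Ey; nra.
Qed.

Lemma N_scale2 k x : E x -> N (k *: x) ^+ 2 = sqmod k * N x ^+ 2.
Proof.
move=> Ex; rewrite !N_sq //; last exact: E_scale.
rewrite B_scale //; last exact: E_scale.
rewrite scalerA.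
have -> : k^* * k = (sqmod k)%:C.
  by case: k => a b; apply/eqP; rewrite eq_complex /sqmod /=; apply/andP; split; apply/eqP; ring.
by rewrite B_real'.
Qed.

Lemma N_real (r : R) x : E x -> N (r%:C *: x) = `|r| * N x.
Proof.
move=> Ex; apply/eqP; rewrite -(@eqrXn2 _ 2) ?mulr_ge0 // N_scale2 // exprMn real_normK ?num_real //.
by rewrite /sqmod /= expr0n addr0.
Qed.

Lemma N_unit k x : E x -> sqmod k = 1 -> N (k *: x) = N x.
Proof.
by move=> Ex k1; apply/eqP; rewrite -(@eqrXn2 _ 2) // N_scale2 // k1 mul1r.
Qed.

Lemma N_opp x : E x -> N (- x) = N x.
Proof. by move=> Ex; rewrite -scaleN1r N_unit // /sqmod /= oppr0 expr0n addr0 sqrrN expr1n. Qed.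

Lemma N_sub x y : E x -> E y -> N (x - y) <= N x + N y.
Proof.
by move=> Ex Ey; rewrite -(N_opp Ey) N_add // -scaleN1r; exact: E_scale.
Qed.

Lemma N_dist x y : E x -> E y -> N x <= N y + N (x - y).
Proof.
by move=> Ex Ey; have := N_add Ey (E_sub Ex Ey); rewrite addrC subrK.
Qed.

Lemma E_sum n (F : nat -> X) x : E x -> (forall j, E (F j)) -> E (\sum_(j < n) F j).
Proof.
move=> Ex EF; elim: n => [|n IH]; first by rewrite big_ord0; exact: E_zero Ex.
by rewrite big_ord_recr; exact: E_add.
Qed.

Lemma B_suml n (F : nat -> X) y : E y -> (forall j, E (F j)) ->
  B (\sum_(j < n) F j) y = \sum_(j < n) B (F j) y.
Proof.
move=> Ey EF; elim: n => [|n IH]; first by rewrite !big_ord0 B0.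
by rewrite !big_ord_recr /= B_add ?IH //; exact: E_sum Ey EF.
Qed.

Lemma B_sumr n (F : nat -> X) y : E y -> (forall j, E (F j)) ->
  B y (\sum_(j < n) F j) = \sum_(j < n) B y (F j).
Proof.
move=> Ey EF; rewrite B_sym //; last exact: E_sum Ey EF.
by rewrite B_suml //; apply: eq_bigr => j _; rewrite B_sym.
Qed.

Lemma B_suml_scalar n (c : nat -> R[i]) x y : E x -> E y ->
  \sum_(j < n) B x (c j *: y) = B x ((\sum_(j < n) c j) *: y).
Proof.
by move=> Ex Ey; rewrite scaler_suml (@B_sumr n (fun j => c j *: y)) // => j; exact: E_scale.
Qed.

(** * Discrete Fourier transform and Parseval's identity *)

Definition root1 (n : nat) : R[i] := cos (2 * pi / n%:R) +i* sin (2 * pi / n%:R).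

Lemma root1X n m : root1 n ^+ m = cos (m%:R * (2 * pi / n%:R)) +i* sin (m%:R * (2 * pi / n%:R)).
Proof.
elim: m => [|m IH]; first by rewrite expr0 mul0r cos0 sin0.
have -> : m.+1%:R = m%:R + 1 :> R by rewrite natr1.
rewrite exprSr IH /root1; set th := 2 * pi / n%:R.
have -> : (m%:R + 1) * th = m%:R * th + th by ring.
rewrite cosD sinD.
by apply/eqP; rewrite eq_complex /=; apply/andP; split; apply/eqP; ring.
Qed.

Lemma root1_order n : (0 < n)%N -> root1 n ^+ n = 1.
Proof.
move=> n0; rewrite root1X mulrC divfK ?pnatr_eq0 -?lt0n //.
by rewrite mulr_natl cos2pi sin2pi.
Qed.

Lemma sqmod_root1 n m : sqmod (root1 n ^+ m) = 1.
Proof. by rewrite root1X /sqmod /= cos2Dsin2. Qed.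

(** The real part is cos (2 y) = 1 - 2 (sin y)^2 with 0 < y < pi, hence below 1. *)
Lemma root1_neq1 n m : (0 < m < n)%N -> root1 n ^+ m != 1.
Proof.
move=> /andP[m0 mn]; rewrite root1X eq_complex /= negb_and; apply/orP; left.
set y := m%:R * (pi / n%:R) : R.
have n0 : 0 < n%:R :> R by rewrite ltr0n (leq_trans _ mn).
have -> : m%:R * (2 * pi / n%:R) = y *+ 2 :> R by rewrite /y mulr2n; ring.
have sy : 0 < sin y.
  apply: sin_gt0_pi; apply/andP; split.
    by rewrite mulr_gt0 ?ltr0n // divr_gt0 // pi_gt0.
  rewrite /y mulrCA -[ltRHS]mulr1 ltr_pM2l ?pi_gt0 // ltr_pdivrMr // mul1r ltr_nat //.
rewrite cos_mulr2n; have := cos2Dsin2 y => e.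
by apply/eqP => e2; nra.
Qed.

Lemma mul_conj_unit k : sqmod k = 1 -> k * k^* = 1.
Proof.
case: k => a b /= e; apply/eqP; rewrite eq_complex /=; apply/andP; split; apply/eqP.
  by rewrite -e /sqmod /=; ring.
by ring.
Qed.

(** A geometric sum of a ratio [r] with [r ^+ n = 1], where [r != 1] unless the indices agree. *)
Lemma root1_orth n j j' : (j < n)%N -> (j' < n)%N ->
  \sum_(k < n) ((root1 n ^+ k) ^+ j)^* * (root1 n ^+ k) ^+ j' = if j == j' then n%:R else 0.
Proof.
move=> jn j'n; have n0 : (0 < n)%N by rewrite (leq_trans _ jn).
have cz : root1 n * (root1 n)^* = 1 by apply: mul_conj_unit; rewrite -(expr1 (root1 n)) sqmod_root1.
have czX m : (root1 n ^+ m) * ((root1 n ^+ m)^*) = 1 by apply: mul_conj_unit; exact: sqmod_root1.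
case: eqP => [<-|/eqP jj].
  rewrite (eq_bigr (fun=> 1)); last by move=> k _; rewrite -exprM mulrC czX.
  by rewrite sumr_const card_ord.
pose r := (root1 n ^+ j)^* * root1 n ^+ j'.
have e (k : nat) : ((root1 n ^+ k) ^+ j)^* * (root1 n ^+ k) ^+ j' = r ^+ k.
  by rewrite /r exprMn -rmorphXn -!exprM ![(k * _)%N]mulnC.
have r1 : r != 1.
  apply/eqP => e1.
  have e2 : root1 n ^+ j' = root1 n ^+ j.
    by rewrite -[LHS]mul1r -(czX j) -mulrA -/r e1 mulr1.
  have nz m : root1 n ^+ m != 0.
    by apply/eqP => e3; have := czX m; rewrite e3 mul0r => /esym/eqP; rewrite oner_eq0.
  have [lt|lt|e3] := ltngtP j j'; last by rewrite e3 eqxx in jj.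
    have := @root1_neq1 n (j' - j); rewrite subn_gt0 lt (leq_ltn_trans (leq_subr _ _)) //.
    by move=> /(_ isT)/eqP; apply; apply: (mulfI (nz j)); rewrite -exprD subnKC ?mulr1 // ltnW.
  have := @root1_neq1 n (j - j'); rewrite subn_gt0 lt (leq_ltn_trans (leq_subr _ _)) //.
  by move=> /(_ isT)/eqP; apply; apply: (mulfI (nz j')); rewrite -exprD subnKC ?mulr1 ?e2 // ltnW.
rewrite (eq_bigr (fun k : 'I_n => r ^+ k)); last by move=> k _; exact: e.
have := subrX1 r n.
have -> : r ^+ n = 1.
  rewrite /r exprMn -rmorphXn -!exprM ![(_ * n)%N]mulnC !exprM root1_order //.
  by rewrite !expr1n rmorph1 mulr1.
by rewrite subrr => /esym/eqP; rewrite mulf_eq0 subr_eq0 (negbTE r1) /= => /eqP.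
Qed.

Lemma parseval n (a : nat -> X) : (forall j, E (a j)) ->
  \sum_(k < n) N (\sum_(j < n) (root1 n ^+ k) ^+ j *: a j) ^+ 2 =
  n%:R * \sum_(j < n) N (a j) ^+ 2.
Proof.
move=> Ea; pose w (k j : nat) := (root1 n ^+ k) ^+ j.
have Ewa (k j : nat) : E (w k j *: a j) by exact: E_scale.
have step (k : 'I_n) : N (\sum_(j < n) w k j *: a j) ^+ 2 =
    \sum_(j < n) \sum_(j' < n) B (a j) (((w k j)^* * w k j') *: a j').
  rewrite N_sq; last exact: (@E_sum n (fun j => w k j *: a j) _ (Ea 0%N)).
  rewrite (@B_suml n (fun j => w k j *: a j)) //; last first.
    exact: (@E_sum n (fun j => w k j *: a j) _ (Ea 0%N)).
  apply: eq_bigr => j _.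
  rewrite (@B_sumr n (fun j => w k j *: a j)) //.
  by apply: eq_bigr => j' _; rewrite B_scale ?scalerA.
rewrite (eq_bigr _ (fun (i : 'I_n) _ => step i)) exchange_big mulr_sumr /=.
apply: eq_bigr => j _; rewrite exchange_big /=.
rewrite (bigD1 j) //= [X in _ + X]big1 ?addr0.
  rewrite (@B_suml_scalar n (fun k : nat => (w k j)^* * w k j)) // root1_orth // eqxx.
  have -> : n%:R = (n%:R : R)%:C :> R[i] by rewrite rmorph_nat.
  by rewrite B_real' // N_sq.
move=> j' jj'; rewrite (@B_suml_scalar n (fun k : nat => (w k j)^* * w k j')) // root1_orth //.
by move: jj'; rewrite -(inj_eq val_inj) /= eq_sym => /negbTE ->; rewrite scale0r B_sym ?B0 //; exact: E_zero (Ea j).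
Qed.

(** * The semigroup is a contraction *)

Section Generator.
Variables (D : set X) (A : X -> X) (T : R -> X -> X).
Hypotheses (D_E : forall x, D x -> E x) (A_E : forall x, D x -> E (A x))
  (dissipative : forall x, D x -> B (A x) x <= 0)
  (dense : forall x (e : R), E x -> 0 < e -> exists2 y, D y & N (x - y) <= e)
  (T_sg : C0_semigroup E N T) (T_gen : generates E N D A T).

Lemma T_E t x : 0 <= t -> E x -> E (T t x).
Proof. by move=> t0; case: T_sg => H _ _ _; have [h _ _] := H t t0; exact: h. Qed.

Lemma T_lin t k x y : 0 <= t -> E x -> E y -> T t (k *: x + y) = k *: T t x + T t y.
Proof. by move=> t0; case: T_sg => H _ _ _; have [_ h _] := H t t0; exact: h. Qed.

Lemma T_add s t x : 0 <= s -> 0 <= t -> E x -> T (s + t) x = T s (T t x).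
Proof. by case: T_sg => _ _ H _; exact: H. Qed.

Lemma T_zero x : E x -> T 0 x = x.
Proof. by case: T_sg => _ H _ _; exact: H. Qed.

Lemma T_cont x : E x -> N (T t x - x) @[t --> 0^'+] --> 0.
Proof. by case: T_sg => _ _ _ H; exact: H. Qed.

Lemma T_sub t x y : 0 <= t -> E x -> E y -> T t (x - y) = T t x - T t y.
Proof.
by move=> t0 Ex Ey; rewrite addrC -scaleN1r T_lin // scaleN1r addrC.
Qed.

Lemma T_scale t k x : 0 <= t -> E x -> T t (k *: x) = k *: T t x.
Proof.
move=> t0 Ex; have E0 := E_zero Ex.
have T0 : T t 0 = 0 by have := T_sub t0 Ex Ex; rewrite !subrr.
by have := T_lin k t0 Ex E0; rewrite !addr0 T0 addr0.
Qed.

Lemma T_bounded t : 0 <= t -> exists2 K, 0 <= K & forall x, E x -> N (T t x) <= K * N x.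
Proof.
move=> t0; case: (T_sg) => H _ _ _; have [_ _ op] := H t t0.
have [K K0 HK] : exists2 K : R, 0 <= K & forall x, E x -> N x <= 1 -> N (T t x) <= K.
  have ub x : E x -> N x <= 1 -> ((N (T t x))%:E <= opnorm E N (T t))%E.
    by move=> Ex Nx; apply: ereal_sup_ubound; exists x.
  move: op ub; case: (opnorm E N (T t)) => [r|//|] _ ub.
    by exists `|r| => // x Ex Nx; have := ub x Ex Nx; rewrite lee_fin => h; rewrite (le_trans h) // ler_norm.
  by exists 0 => // x Ex Nx; have := ub x Ex Nx.
exists K => // x Ex; apply/ler_addgt0Pr => e e0.
(* Slightly larger than [N x], so that normalizing is possible even if [N x = 0]. *)
pose s := N x + e / (K + 1).
have K1 : 0 < K + 1 by rewrite ltr_wpDl.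
have s0 : 0 < s by rewrite ltr_wpDl // divr_gt0.
have Es := E_scale (s^-1)%:C Ex.
have := HK _ Es; rewrite N_real // T_scale // N_real //; last exact: T_E.
rewrite gtr0_norm ?invr_gt0 // ler_pdivrMl // mulr1 => /(_ _)/wrap[].
  by rewrite /s lerDl ltW // divr_gt0.
rewrite ler_pdivrMl // => h; apply: le_trans h _.
rewrite /s mulrC mulrDr lerD2l mulrA ler_pdivrMr //.
by rewrite mulrC ler_wpM2l ?(ltW e0) // lerDl.
Qed.

Lemma T_right_cont x s : E x -> 0 <= s -> N (T (s + t) x - T s x) @[t --> 0^'+] --> 0.
Proof.
move=> Ex s0; have [K K0 HK] := T_bounded s0.
have h0 : K * N (T t x - x) @[t --> 0^'+] --> 0.
  by rewrite -[X in _ --> X](mulr0 K); apply: cvgMr; exact: T_cont.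
apply: (squeeze_cvgr _ (@cvg_cst _ 0 _ _ _) h0).
near=> t; have t0 : 0 < t by near: t; exact: nbhs_right_gt.
rewrite N_ge0 /= T_add ?(ltW t0) // -T_sub //; last exact: T_E (ltW t0) Ex.
by apply: HK; apply: E_sub => //; exact: T_E (ltW t0) Ex.
Unshelve. all: end_near. Qed.

(* Baire's argument with nested intervals: the orbit of each vector is right continuous, so
   unboundedness on every interval would produce an orbit unbounded near a point. *)
Lemma T_bounded_somewhere (eps : R) : 0 < eps -> exists a b K : R,
  [/\ 0 <= a, a < b, b <= eps & 0 <= K] /\
  forall s x, a <= s <= b -> E x -> N (T s x) <= K * N x.
Proof.
move=> eps0; apply: contrapT => H.
have step (n : nat) (p : R * R) : 0 <= p.1 -> p.1 < p.2 -> p.2 <= eps ->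
    exists q : R * R, [/\ p.1 <= q.1, q.1 < q.2 & q.2 <= p.2] /\
    exists2 x, E x & forall s, q.1 <= s <= q.2 -> n%:R * N x < N (T s x).
  case: p => a b /= a0 ab be.
  have [s [x [/andP[as_ sb] Ex hx]]] : exists s x, [/\ a <= s <= (a + b) / 2, E x & n%:R * N x < N (T s x)].
    apply: contrapT => H2; apply: H; exists a, ((a + b) / 2), n%:R; split.
      by split=> //; lra.
    move=> s x hs Ex; rewrite leNgt; apply/negP => h; apply: H2; by exists s, x.
  have s0 : 0 <= s by exact: le_trans as_.
  have g0 : 0 < (N (T s x) - n%:R * N x) / 2 by rewrite divr_gt0 // subr_gt0.
  have [d d0 hd] := cvg0_right (T_right_cont Ex s0) g0.
  exists (s, Num.min b (s + d)); split=> /=.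
    split=> //; last by rewrite ge_min lexx.
    by rewrite lt_min ltrDl d0 andbT; lra.
  exists x => // t /andP[]; rewrite le_eqVlt => /predU1P[<- //|st].
  rewrite le_min => /andP[tb td].
  have := hd (t - s); rewrite subr_gt0 subrKC ger0_norm //.
  move=> /(_ st)/(_ _)/wrap[|h]; first lra.
  have := N_dist (T_E s0 Ex) (T_E (le_trans s0 (ltW st)) Ex).
  have -> : N (T s x - T t x) = N (T t x - T s x).
    by rewrite -N_opp ?opprB //; apply: E_sub; apply: T_E => //; lra.
  by move=> h2; lra.
pose P (p : R * R) := [/\ 0 <= p.1, p.1 < p.2 & p.2 <= eps].
have Pstep (np : nat * {p | P p}) : exists q : {p | P p},
    ((sval np.2).1 <= (sval q).1 /\ (sval q).2 <= (sval np.2).2) /\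
    exists2 x, E x & forall s, (sval q).1 <= s <= (sval q).2 -> np.1%:R * N x < N (T s x).
  case: np => n [p [p1 p2 p3]] /=.
  have [q [[q1 q2 q3] hq]] := step n p p1 p2 p3.
  have Pq : P q by split=> //; [exact: le_trans q1|exact: le_trans p3].
  by exists (exist _ q Pq).
have [F HF] := choice Pstep.
have P0 : P (0, eps) by split.
pose u := fix u (n : nat) : {p | P p} := if n is m.+1 then F (m, u m) else exist _ (0, eps) P0.
pose a n := (sval (u n)).1; pose b n := (sval (u n)).2.
have mono n m : a n <= a (n + m)%N /\ b (n + m)%N <= b n.
  elim: m => [|m [IH1 IH2]]; first by rewrite addn0.
  rewrite addnS; have [[h1 h2] _] := HF ((n + m)%N, u (n + m)%N).
  by split; [exact: le_trans h1|exact: le_trans IH2].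
have ab n : a n < b n by case: (svalP (u n)).
have amb m n : a m <= b n.
  have [h1 _] := mono m n; have [_ h2] := mono n m; rewrite addnC in h2.
  by rewrite (le_trans h1) // (le_trans (ltW (ab _))).
pose c := sup (range a).
have hs : has_sup (range a).
  by split; [exists (a 0%N), 0%N|exists (b 0%N) => _ [n _ <-]].
have ca n : a n <= c by apply: ub_le_sup; [exact: hs.2|exists n].
have cb n : c <= b n by apply: ge_sup; [exact: hs.1|move=> _ [m _ <-]].
have c0 : 0 <= c by rewrite (le_trans _ (ca 0%N)).
have [K K0 HK] := T_bounded c0.
pose n := Num.bound K.
have Kn : K < n%:R by have := archi_boundP K0.
have [_ [x Ex hx]] := HF (n, u n).
have := hx c; rewrite -/(u n.+1) -/(a n.+1) -/(b n.+1) ca cb => /(_ isT).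
rewrite ltNge => /negP; apply; apply: le_trans (HK x Ex) _.
by apply: ler_wpM2r => //; exact: ltW.
Qed.

(** [T t] commutes with the difference quotients and is bounded, so the quotients at [T t x]
    converge; [generates] reads membership in the domain off this limit. *)
Lemma T_dom t x : 0 <= t -> D x -> D (T t x) /\ A (T t x) = T t (A x).
Proof.
move=> t0 Dx; have Ex := D_E Dx; have EA := A_E Dx.
have [K K0 HK] := T_bounded t0.
apply/(T_gen (T_E t0 Ex) (T_E t0 EA)).
have h0 : K * N ((h^-1)%:C *: (T h x - x) - A x) @[h --> 0^'+] --> 0.
  rewrite -[X in _ --> X](mulr0 K); apply: cvgMr.
  by apply/(T_gen Ex EA).
apply: (squeeze_cvgr _ (@cvg_cst _ 0 _ _ _) h0).
near=> h; have hp : 0 < h by near: h; exact: nbhs_right_gt.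
have Eh := T_E (ltW hp) Ex.
rewrite N_ge0 /= -T_add ?(ltW hp) // [h + t]addrC T_add ?(ltW hp) // -T_sub // -T_scale //; last exact: E_sub.
rewrite -T_sub //; last exact/E_scale/E_sub.
by apply: HK; apply: E_sub => //; exact/E_scale/E_sub.
Unshelve. all: end_near. Qed.

Lemma implicit_euler h z : 0 <= h -> D z -> N z <= N (z - h%:C *: A z).
Proof.
move=> h0 Dz; have Ez := D_E Dz; have EA := A_E Dz.
rewrite -(@ler_pXn2r _ 2) ?nnegrE //.
have -> : z - h%:C *: A z = (- h)%:C *: A z + z by rewrite rmorphN scaleNr addrC.
rewrite N_comb //; have := dissipative Dz; have := sqr_ge0 (h * N (A z)); nra.
Qed.

(* The norm does not increase along implicit Euler steps, which follow the orbit up to o(h). *)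
Lemma T_euler_monotone x s t (K : R) : D x -> 0 <= s -> 0 <= t -> 0 <= K ->
  (forall r y, s <= r <= s + t -> E y -> N (T r y) <= K * N y) ->
  N (T (s + t) x) <= N (T s x).
Proof.
move=> Dx s0 t0 K0 HK; have Ex := D_E Dx; have EA := A_E Dx.
apply/ler_addgt0Pr => e e0.
(* The [n] steps have local errors [h * (K * (2 * e'))], which add up to at most [e] because n h =
   t. *)
pose e' := e / (2 * (t * K + 1)).
have tK : 0 < t * K + 1 by rewrite ltr_wpDl // mulr_ge0.
have e'0 : 0 < e' by rewrite divr_gt0 // mulr_gt0.
have g1 : N ((h^-1)%:C *: (T h x - x) - A x) @[h --> 0^'+] --> 0 by apply/(T_gen Ex EA).
have [d1 d10 h1] := cvg0_right g1 e'0.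
have [d2 d20 h2] := cvg0_right (T_cont EA) e'0.
pose d := Num.min d1 d2; have d0 : 0 < d by rewrite lt_min d10.
pose n := (Num.bound (t / d)).+1.
have n0 : 0 < n%:R :> R by rewrite ltr0n.
have td : t / n%:R <= d.
  rewrite ler_pdivrMr // mulrC -ler_pdivrMr //.
  have := archi_boundP (divr_ge0 t0 (ltW d0)) => h; apply/ltW/(lt_trans h).
  by rewrite ltr_nat.
pose h := t / n%:R; have hge : 0 <= h by rewrite divr_ge0 // ltW.
have [h00|hpos] : h = 0 \/ 0 < h by move: hge; rewrite le_eqVlt => /predU1P[<-|]; [left|right].
  have -> : t = 0 by move/eqP: h00; rewrite mulf_eq0 invr_eq0 (gt_eqF n0) orbF => /eqP.
  by rewrite addr0 lerDl ltW.
move: td; rewrite -/h le_min => /andP[hd1 hd2].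
have r1 := h1 h hpos hd1; have r2 := h2 h hpos hd2.
rewrite !ger0_norm // in r1 r2.
have Eh := T_E hge Ex; have EhA := T_E hge EA.
have claim (j : nat) : (j <= n)%N -> N (T (s + j%:R * h) x) <= N (T s x) + j%:R * (h * (K * (2 * e'))).
  elim: j => [_|j IH jn]; first by rewrite !mul0r !addr0.
  have jh : 0 <= j%:R * h by rewrite mulr_ge0.
  set r := s + j%:R * h; have r0 : 0 <= r by rewrite addr_ge0.
  have rt : s <= r <= s + t.
    rewrite lerDl jh /= lerD2l /h mulrC mulrAC -mulrA ler_piMr // ler_pdivrMr // mul1r ler_nat.
    exact: ltnW.
  have -> : s + j.+1%:R * h = r + h by rewrite -natr1 /r; ring.
  have Dr := T_dom (addr_ge0 r0 hge) Dx; case: (Dr) => Dr1 Dr2.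
  have := implicit_euler hge Dr1; rewrite Dr2.
  (* The local defect of the implicit Euler step: x = T(h) x - h T(h) A x - h y, where the
     difference quotient and T(h) A x are both within e' of A x. *)
  pose y := (h^-1)%:C *: (T h x - x) - A x + (A x - T h (A x)).
  have Ey : E y by apply: E_add; apply: E_sub => //; exact/E_scale/E_sub.
  have -> : T (r + h) x - h%:C *: T (r + h) (A x) = T r x + h%:C *: T r y.
    have e1 : T (r + h) x = T r (T h x) by rewrite T_add.
    have e2 : T (r + h) (A x) = T r (T h (A x)) by rewrite T_add.
    have e3 := T_lin (- h%:C) r0 EhA Eh; have e4 := T_lin h%:C r0 Ey Ex.
    transitivity (T r (- h%:C *: T h (A x) + T h x)); first by rewrite e3 scaleNr addrC e1 e2.
    transitivity (T r (h%:C *: y + x)); last by rewrite e4 addrC.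
    congr (T r _); rewrite /y addrA subrK scalerBr scalerA -rmorphM mulfV ?gt_eqF // scale1r.
    by rewrite [RHS](ACl (1 * 2 * 4 * 3)) /= subrK scaleNr addrC.
  move=> h3; apply: le_trans h3 _.
  apply: le_trans (N_add _ _) _; [exact: T_E|exact/E_scale/T_E|].
  rewrite N_real ?(gtr0_norm hpos); last exact: T_E.
  have y1 : N y <= 2 * e'.
    apply: le_trans (N_add _ _) _; [by apply: E_sub => //; exact/E_scale/E_sub|exact: E_sub|].
    rewrite -[N (A x - _)]N_opp ?opprB; last exact: E_sub.
    lra.
  have y2 : h * N (T r y) <= h * (K * (2 * e')).
    apply: ler_wpM2l => //; apply: le_trans (HK r y rt Ey) _; exact: ler_wpM2l.
  have := IH (ltnW jn); rewrite -/r -natr1; lra.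
have := claim n (leqnn n).
have -> : s + n%:R * h = s + t by rewrite /h mulrC divfK // gt_eqF.
move=> h3; apply: le_trans h3 _; rewrite lerD2l.
have -> : n%:R * (h * (K * (2 * e'))) = e * (t * K / (t * K + 1)).
  rewrite /h /e'; field; rewrite gt_eqF //=; by rewrite gt_eqF.
by rewrite ler_piMr ?(ltW e0) // ler_pdivrMr // mul1r lerDl.
Qed.

(** Composition with [T (b - a)] extends the uniform bound to the right by one length at a time. It
    starts at [a] because uniform boundedness down to time 0 is not known at this point. *)
Lemma T_bounded_from a b (K : R) : 0 <= a -> a < b -> 0 <= K ->
  (forall s x, a <= s <= b -> E x -> N (T s x) <= K * N x) ->
  forall m : nat, exists2 K' : R, 0 <= K' &
    forall s x, a <= s <= a + m.+1%:R * (b - a) -> E x -> N (T s x) <= K' * N x.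
Proof.
move=> a0 ab K0 HK; elim=> [|m [K' K'0 IH]].
  by exists K => // s x hs Ex; apply: HK => //; move: hs; rewrite mul1r subrKC.
have d0 : 0 <= b - a by rewrite subr_ge0 ltW.
have [Kd Kd0 HKd] := T_bounded d0.
exists (K' + Kd * K'); first by rewrite addr_ge0 // mulr_ge0.
move=> s x /andP[as_ sb] Ex; rewrite mulrDl.
have [h|h] := lerP s (a + m.+1%:R * (b - a)).
  by apply: le_trans (IH s x _ Ex) _; rewrite ?as_ // lerDl mulr_ge0 // mulr_ge0.
have m0 : (b - a) <= m.+1%:R * (b - a) by rewrite ler_peMl // ler1n.
have sd : a <= s - (b - a) by lra.
have sd2 : s - (b - a) <= a + m.+1%:R * (b - a).
  have sb' : s <= a + (m.+1%:R + 1) * (b - a) by rewrite natr1.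
  by lra.
have -> : s = (b - a) + (s - (b - a)) by ring.
have sd0 := le_trans a0 sd.
rewrite T_add //; apply: le_trans (HKd _ (T_E sd0 Ex)) _.
rewrite -[leLHS]add0r; apply: lerD; first by rewrite mulr_ge0.
by rewrite -mulrA; apply: ler_wpM2l => //; apply: IH => //; rewrite sd.
Qed.

(** The norm does not increase from some time [a] on, after which the semigroup is uniformly bounded
    on bounded time intervals; [a] is so small that [T a x] is close to [x]. *)
Lemma T_contraction_dom t x : 0 <= t -> D x -> N (T t x) <= N x.
Proof.
rewrite le_eqVlt => /predU1P[<-|t0] Dx; first by rewrite T_zero //; exact: D_E.
have Ex := D_E Dx; apply/ler_addgt0Pr => e e0.
have [d d0 hd] := cvg0_right (T_cont Ex) e0.
have td : 0 < Num.min d t by rewrite lt_min d0.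
have [a [b [K [[a0 ab bd K0] HK]]]] := T_bounded_somewhere td.
move: bd; rewrite le_min => /andP[bd bt].
have Na : N (T a x) <= N x + e.
  move: a0; rewrite le_eqVlt => /predU1P[<-|a0]; first by rewrite T_zero // lerDl ltW.
  have := hd a a0 (le_trans (ltW ab) bd); rewrite ger0_norm // => h.
  by apply: le_trans (N_dist (T_E (ltW a0) Ex) Ex) _; rewrite lerD2l.
pose m := Num.bound (t / (b - a)).
have [K' K'0 HK'] := T_bounded_from a0 ab K0 HK m.
have ba0 : 0 < b - a by rewrite subr_gt0.
have tm : t <= m.+1%:R * (b - a).
  rewrite -ler_pdivrMr //; have := archi_boundP (divr_ge0 (ltW t0) (ltW ba0)) => h.
  by apply/ltW/(lt_trans h); rewrite ltr_nat.
have ta : 0 <= t - a by lra.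
have := T_euler_monotone Dx a0 ta K'0; rewrite subrKC => h.
apply: le_trans (h _) Na => r y /andP[ar rt] Ey; apply: HK' => //.
by rewrite ar (le_trans rt) // (le_trans tm) // lerDr.
Qed.

Lemma T_contraction t x : 0 <= t -> E x -> N (T t x) <= N x.
Proof.
move=> t0 Ex; have [K K0 HK] := T_bounded t0.
apply/ler_addgt0Pr => e e0.
have K2 : 0 < K + 1 + 1 by lra.
have [y Dy hy] := dense Ex (divr_gt0 e0 K2).
have Ey := D_E Dy; have Exy := E_sub Ex Ey.
have h1 := N_dist (T_E t0 Ex) (T_E t0 Ey); rewrite -T_sub // in h1.
have h2 := HK _ Exy; have h3 := T_contraction_dom t0 Dy.
have h4 : N y <= N x + N (x - y).
  by have := N_dist Ey Ex; rewrite -[N (y - x)]N_opp ?opprB //; exact: E_sub.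
have h5 : (K + 1) * N (x - y) <= e.
  rewrite ler_pdivlMr // in hy; rewrite mulrC (le_trans _ hy) // ler_wpM2l //; lra.
nra.
Qed.

(** [D] and [A] are only a set and a function; their linearity is read off the limit that
    characterizes the generator. *)
Lemma D_comb k x y : D x -> D y -> D (k *: x + y) /\ A (k *: x + y) = k *: A x + A y.
Proof.
move=> Dx Dy; have Ex := D_E Dx; have Ey := D_E Dy.
have EAx := A_E Dx; have EAy := A_E Dy.
apply/(T_gen (E_comb k Ex Ey) (E_comb k EAx EAy)).
have g1 : N ((h^-1)%:C *: (T h x - x) - A x) @[h --> 0^'+] --> 0 by apply/(T_gen Ex EAx).
have g2 : N ((h^-1)%:C *: (T h y - y) - A y) @[h --> 0^'+] --> 0 by apply/(T_gen Ey EAy).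
have h0 : Num.sqrt (sqmod k) * N ((h^-1)%:C *: (T h x - x) - A x) + N ((h^-1)%:C *: (T h y - y) - A y) @[h --> 0^'+] --> 0.
  rewrite -[X in _ --> X](addr0 0) -[X in _ --> X + _](mulr0 (Num.sqrt (sqmod k))).
  by apply: cvgD => //; exact: cvgMr.
apply: (squeeze_cvgr _ (@cvg_cst _ 0 _ _ _) h0).
near=> h; have hp : 0 < h by near: h; exact: nbhs_right_gt.
have Eh1 := T_E (ltW hp) Ex; have Eh2 := T_E (ltW hp) Ey.
rewrite N_ge0 /=.
set u := _ - A x; set v := _ - A y.
have Eu : E u by apply: E_sub => //; exact/E_scale/E_sub.
have Ev : E v by apply: E_sub => //; exact/E_scale/E_sub.
have -> : (h^-1)%:C *: (T h (k *: x + y) - (k *: x + y)) - (k *: A x + A y) = k *: u + v.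
  rewrite T_lin ?(ltW hp) // /u /v !scalerBr !scalerDr !scalerA [k * _]mulrC.
  by rewrite !opprD !addrA [LHS](ACl (1 * 3 * 5 * 2 * 4 * 6)).
apply: le_trans (N_add (E_scale k Eu) Ev) _; rewrite lerD2r.
rewrite -(@ler_pXn2r _ 2) ?nnegrE ?mulr_ge0 ?sqrtr_ge0 // N_scale2 // exprMn sqr_sqrtr //.
exact: sqmod_ge0.
Unshelve. all: end_near. Qed.

(** * Decay of orbits from the a priori resolvent bound *)

Section Decay.
Variable M : R.
Hypotheses (M0 : 0 < M)
  (apriori : forall (om : R) x, D x -> N x <= M * N ((0 +i* om) *: x - A x)).

Lemma D_sum n (F : nat -> X) x : D x -> (forall j, D (F j)) ->
  D (\sum_(j < n) F j) /\ A (\sum_(j < n) F j) = \sum_(j < n) A (F j).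
Proof.
move=> Dx DF; elim: n => [|n [IH1 IH2]].
  rewrite !big_ord0; have := D_comb (-1) Dx Dx.
  by rewrite scaleN1r addNr scaleN1r addNr.
rewrite !big_ord_recr /=; have := D_comb 1 IH1 (DF n); rewrite !scale1r IH2.
by [].
Qed.

Lemma D_scale k x : D x -> D (k *: x) /\ A (k *: x) = k *: A x.
Proof.
move=> Dx; have [D0 A0] := D_comb (-1) Dx Dx; rewrite scaleN1r addNr scaleN1r addNr in D0 A0.
by have := D_comb k Dx D0; rewrite !addr0 A0 addr0.
Qed.

(* The discrete Fourier transform turns the central difference equation into
   resolvent equations on the imaginary axis. *)
Lemma periodic_difference_bound n (a g : nat -> X) h : (0 < n)%N -> 0 < h ->
  (forall j, D (a j)) -> a n = a 0%N -> a n.+1 = a 1%N ->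
  (forall j, g j = ((2 * h)^-1)%:C *: (a j.+2 - a j) - A (a j.+1)) ->
  \sum_(j < n) N (a j) ^+ 2 <= M ^+ 2 * \sum_(j < n) N (g j) ^+ 2.
Proof.
move=> n0 h0 Da an0 an1 ag.
have Ea j := D_E (Da j); have EA j := A_E (Da j).
have Eg j : E (g j) by rewrite ag; apply: E_sub => //; exact/E_scale/E_sub.
have nr : 0 < n%:R :> R by rewrite ltr0n.
rewrite -(ler_pM2l nr) mulrCA -!parseval // mulr_sumr; apply: ler_sum => k _.
pose w := root1 n ^+ k.
have w1 : sqmod w = 1 by exact: sqmod_root1.
have wn : w ^+ n = 1 by rewrite /w -exprM mulnC exprM root1_order // expr1n.
have wc : w * w^* = 1 by exact: mul_conj_unit.
pose ah := \sum_(j < n) w ^+ j *: a j.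
have [Dah Aah] : D ah /\ A ah = \sum_(j < n) w ^+ j *: A (a j).
  have [d1 d2] := @D_sum n (fun j => w ^+ j *: a j) _ (Da 0%N) (fun j => proj1 (D_scale _ (Da j))).
  split; first exact: d1.
  by rewrite d2; apply: eq_bigr => j _; exact: (proj2 (D_scale _ (Da j))).
have shift (c : nat -> X) : c n = c 0%N -> w *: \sum_(j < n) w ^+ j *: c j.+1 = \sum_(j < n) w ^+ j *: c j.
  move=> cn; rewrite scaler_sumr.
  have -> : \sum_(j < n) w *: (w ^+ j *: c j.+1) = \sum_(j < n) w ^+ j.+1 *: c j.+1.
    by apply: eq_bigr => j _; rewrite scalerA -exprS.
  have e1 : \sum_(j < n.+1) w ^+ j *: c j = c 0%N + \sum_(j < n) w ^+ j.+1 *: c j.+1.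
    by rewrite big_ord_recl /= expr0 scale1r; congr (_ + _); apply: eq_bigr => j _.
  have e2 : \sum_(j < n.+1) w ^+ j *: c j = c 0%N + \sum_(j < n) w ^+ j *: c j.
    by rewrite big_ord_recr /= wn scale1r cn addrC.
  by apply: (addrI (c 0%N)); rewrite -e1 -e2.
pose Z := \sum_(j < n) w ^+ j *: a j.+1.
have s1 : w *: Z = ah by exact: shift.
have s2 : w *: \sum_(j < n) w ^+ j *: a j.+2 = Z by exact: (shift (fun j => a j.+1)).
have s3 : Z = w^* *: ah by rewrite -s1 scalerA mulrC wc scale1r.
have s4 : w *: \sum_(j < n) w ^+ j *: A (a j.+1) = A ah.
  by rewrite Aah; apply: (shift (fun j => A (a j))); rewrite an0.
pose G := \sum_(j < n) w ^+ j *: g j.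
have EG : E G by exact: (@E_sum n (fun j => w ^+ j *: g j) _ (Ea 0%N) (fun j => E_scale _ (Eg j))).
(* Multiplication by [w] shifts the index, so the central difference acts as (conj w - w) / (2 h) =
   - i Im w / h, a point of the imaginary axis. A one-sided difference would leave that axis. *)
have wG : w *: G = (0 +i* (- complex.Im w / h)) *: ah - A ah.
  have -> : G = ((2 * h)^-1)%:C *: (\sum_(j < n) w ^+ j *: a j.+2 - ah) - \sum_(j < n) w ^+ j *: A (a j.+1).
    rewrite /ah -sumrB scaler_sumr -sumrB; apply: eq_bigr => j _.
    by rewrite ag scalerBr scalerA [w ^+ j * _]mulrC -scalerA scalerBr.
  rewrite scalerBr s4; congr (_ - _).
  rewrite scalerA mulrC -scalerA scalerBr s2 s3 -scalerBl scalerA; congr (_ *: _).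
  case: (w) => p q; apply/eqP; rewrite eq_complex /=; apply/andP; split; apply/eqP.
    by ring.
  by field; rewrite gt_eqF.
have hN := apriori (- complex.Im w / h) Dah; rewrite -wG N_unit // in hN.
by rewrite -exprMn ler_pXn2r ?nnegrE ?mulr_ge0 // ltW.
Qed.

(** The samples of the orbit times the parabola satisfy a periodic difference equation; its
    right-hand side stems from the slope of the parabola, up to consistency errors. The middle half
    of the samples contributes at least 2 m (3 m^2 Y)^2 with Y = N (T tau x), since earlier norms
    are at least Y. The right-hand side is at most n (n^2 W)^2 with n = 4 m, and the powers m^5
    cancel. *)
Lemma decay_dom (tau : R) x : 0 < tau -> D x -> N (T tau x) <= 8 * M / tau * N x.
Proof.
move=> tau0 Dx; have Ex := D_E Dx; have EA := A_E Dx.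
apply/ler_addgt0Pr => e e0.
(* The consistency error enters the final bound as 8 M (2 e') = e. *)
pose e' := e / (16 * M).
have e'0 : 0 < e' by rewrite divr_gt0 // mulr_gt0.
have g1 : N ((h^-1)%:C *: (T h x - x) - A x) @[h --> 0^'+] --> 0 by apply/(T_gen Ex EA).
have [d1 d10 h1] := cvg0_right g1 e'0.
have [d2 d20 h2] := cvg0_right (T_cont EA) e'0.
(* The central difference spans 2 h, hence half of [d1]. *)
pose d := Num.min (d1 / 2) d2; have d0 : 0 < d by rewrite lt_min divr_gt0.
have [m m1 hd] : exists2 m : nat, (0 < m)%N & tau / (4 * m)%:R <= d.
  exists (Num.bound (tau / d)).+1 => //.
  rewrite ler_pdivrMr ?ltr0n // mulrC -ler_pdivrMr //.
  have := archi_boundP (divr_ge0 (ltW tau0) (ltW d0)) => hb; apply/ltW/(lt_trans hb).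
  by rewrite ltr_nat mulSn; exact: (leq_trans (ltnSn _) (leq_addr _ _)).
pose n := (4 * m)%N.
have m0 : 0 < m%:R :> R by rewrite ltr0n.
have nm : n%:R = 4 * m%:R :> R by rewrite natrM.
have n0 : 0 < n%:R :> R by rewrite nm mulr_gt0.
pose h := tau / n%:R; have h0 : 0 < h by rewrite divr_gt0.
have hn : n%:R * h = tau by rewrite /h mulrC divfK // gt_eqF.
move: hd; rewrite le_min => /andP[hd1 hd2].
have r1 := h1 (2 * h) (mulr_gt0 (ltr0Sn _ 1) h0); have r2 := h2 h h0 hd2.
have {r1} r1 : `|N (((2 * h)^-1)%:C *: (T (2 * h) x - x) - A x)| <= e'.
  by apply: r1; rewrite mulrC -ler_pdivlMr.
rewrite !ger0_norm // in r1 r2.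
pose u (j : nat) := T (j%:R * h) x.
pose phi (j : nat) := (j * (n - j))%:R : R.
have jh j : 0 <= j%:R * h by rewrite mulr_ge0 // ltW.
have Du j : D (u j) by exact: (proj1 (T_dom (jh j) Dx)).
have Eu j : E (u j) by exact: D_E (Du j).
have Nu j : N (u j) <= N x by exact: T_contraction.
have Au j : A (u j) = T (j%:R * h) (A x) by exact: (proj2 (T_dom (jh j) Dx)).
pose f j := (phi j)%:C *: u j.
(* Periodic continuation; only indices up to n + 1 enter the sums. *)
pose a j := if (j <= n)%N then f j else f (j - n)%N.
pose g j := ((2 * h)^-1)%:C *: (a j.+2 - a j) - A (a j.+1).
have Df j : D (f j) := proj1 (D_scale _ (Du j)).
have Da j : D (a j) by rewrite /a; case: ifP.
have Ea j := D_E (Da j).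
have fn : f n = 0 by rewrite /f /phi subnn muln0 scale0r.
have f0 : f 0%N = 0 by rewrite /f /phi mul0n scale0r.
have A0 : A 0 = 0 by have [_] := D_comb (-1) Dx Dx; rewrite !scaleN1r !addNr.
have phiE j : (j <= n)%N -> phi j = j%:R * (n%:R - j%:R) by move=> jn; rewrite /phi natrM natrB.
have h2i : 0 < (2 * h)^-1 by rewrite invr_gt0 mulr_gt0.
have gb j : (j < n)%N -> N (g j) <= n%:R ^+ 2 * (2 * e' + N x / tau).
  move=> jn.
  have jnR : j%:R + 1 <= n%:R :> R by rewrite natr1 ler_nat.
  have j0R : 0 <= j%:R :> R by [].
  have -> : n%:R ^+ 2 * (2 * e' + N x / tau) = n%:R ^+ 2 * (2 * e') + ((2 * h)^-1 * (n%:R * N x) + (2 * h)^-1 * (n%:R * N x)).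
    by rewrite /h; field; rewrite !gt_eqF.
  (* For j = n - 1 the difference wraps around: a (n + 1) = f 1 and a n = 0, and both remaining
     samples have weight n - 1. *)
  move: (jn); rewrite leq_eqVlt => /predU1P[jn1|jn2].
    have -> : g j = ((2 * h)^-1)%:C *: (f 1%N - f j).
      have jf : (j.+2 <= n)%N = false by rewrite jn1 ltnn.
      have j1 : (j.+2 - n)%N = 1%N by rewrite -[X in (_ - X)%N]jn1 subSnn.
      by rewrite /g /a jf j1 jn1 leqnn (ltnW jn) fn A0 subr0.
    have b1 (k : nat) : (k <= n)%N -> k%:R * (n%:R - k%:R) = n%:R - 1 :> R -> N (f k) <= n%:R * N x.
      move=> kn e1; rewrite /f N_real // phiE // e1 ger0_norm; last by lra.
      apply: le_trans (ler_wpM2l _ (Nu k)) _; first by lra.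
      by apply: ler_wpM2r => //; lra.
    have B1 : N (f 1%N) <= n%:R * N x by apply: b1; rewrite ?mul1r // -jn1.
    have B2 : N (f j) <= n%:R * N x.
      by apply: b1; [exact: ltnW|rewrite -jn1 -natr1; ring].
    rewrite N_real; last by apply: E_sub; apply: D_E.
    rewrite gtr0_norm //; apply: le_trans (ler_wpM2l (ltW h2i) (N_sub (D_E (Df _)) (D_E (Df _)))) _.
    apply: le_trans (ler_wpM2l (ltW h2i) (lerD B1 B2)) _.
    by rewrite mulrDr lerDr mulr_ge0 ?sqr_ge0 // mulr_ge0 // ltW.
  have jn3R : j%:R + 2 <= n%:R :> R by rewrite -natrD ler_nat addn2.
  pose y := ((2 * h)^-1)%:C *: (u j.+2 - u j) - A (u j.+1).
  have yE : y = T (j%:R * h) ((((2 * h)^-1)%:C *: (T (2 * h) x - x) - A x) + (A x - T h (A x))).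
    have Eh := T_E (ltW h0) EA; have E2 := T_E (ltW (mulr_gt0 (ltr0Sn _ 1) h0)) Ex.
    rewrite addrA subrK /y Au T_sub //; last exact/E_scale/E_sub.
    rewrite T_scale ?T_sub //; last exact: E_sub.
    rewrite -T_add // ?mulr_ge0 ?(ltW h0) // -T_add // ?(ltW h0) // /u.
    by congr (_ *: (T _ _ - _) - T _ _); rewrite -!natr1; ring.
  have Ny : N y <= 2 * e'.
    have Eh := T_E (ltW h0) EA; have E2 := T_E (ltW (mulr_gt0 (ltr0Sn _ 1) h0)) Ex.
    have Ey1 : E (((2 * h)^-1)%:C *: (T (2 * h) x - x) - A x) by apply: E_sub => //; exact/E_scale/E_sub.
    have Ey2 : E (A x - T h (A x)) by exact: E_sub.
    rewrite yE; apply: le_trans (T_contraction (jh j) (E_add Ey1 Ey2)) _.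
    apply: le_trans (N_add Ey1 Ey2) _.
    by rewrite -[N (A x - _)]N_opp // opprB; lra.
  have Ey : E y by apply: E_sub; [apply/E_scale/E_sub|exact: A_E].
  have gE : g j = (phi j.+1)%:C *: y + (((2 * h)^-1 * (phi j.+2 - phi j.+1))%:C *: u j.+2 +
      ((2 * h)^-1 * (phi j.+1 - phi j))%:C *: u j).
    rewrite /g /a jn2 (ltnW jn2) (ltnW (ltnW jn2)) /f (proj2 (D_scale _ (Du j.+1))) /y.
    rewrite !scalerBr !scalerA -!rmorphM /=.
    transitivity ((phi j.+1 / (2 * h) + (2 * h)^-1 * (phi j.+2 - phi j.+1))%:C *: u j.+2 +
        (- (phi j.+1 / (2 * h)) + (2 * h)^-1 * (phi j.+1 - phi j))%:C *: u j - (phi j.+1)%:C *: A (u j.+1)).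
      rewrite -scaleNr -rmorphN; congr (_%:C *: _ + _%:C *: _ - _); by ring.
    rewrite (rmorphD _ (phi j.+1 / (2 * h))) (rmorphD _ (- _)) !scalerDl rmorphN scaleNr !addrA.
    by rewrite [LHS](ACl (1 * 3 * 5 * 2 * 4)).
  have ej1 : j.+1%:R = j%:R + 1 :> R by rewrite natr1.
  have ej2 : j.+2%:R = j%:R + 2 :> R by rewrite -natrD addn2.
  have p0 : 0 <= phi j.+1 by [].
  have pn : phi j.+1 <= n%:R ^+ 2.
    rewrite phiE //; apply: (@le_trans _ _ (n%:R * n%:R)); last by rewrite expr2.
    by rewrite ej1; have [] := parabola_step j0R jn3R.
  rewrite gE; apply: le_trans (N_add (E_scale _ Ey) (E_add (E_scale _ (Eu _)) (E_scale _ (Eu _)))) _.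
  apply: lerD.
    rewrite N_real // ger0_norm //; apply: le_trans (ler_wpM2l p0 Ny) _.
    by apply: ler_wpM2r => //; rewrite mulr_ge0 // ltW.
  apply: le_trans (N_add (E_scale _ (Eu _)) (E_scale _ (Eu _))) _.
  have term (c : R) (k : nat) : `|c| <= n%:R -> N (((2 * h)^-1 * c)%:C *: u k) <= (2 * h)^-1 * (n%:R * N x).
    move=> cn; rewrite N_real // normrM (gtr0_norm h2i) -mulrA; apply: ler_wpM2l; first exact: ltW.
    by apply: ler_pM.
  apply: lerD; apply: term; rewrite !phiE // ?(ltnW jn2) ?(ltnW (ltnW jn2)) // ?ej2 ej1.
    by have [] := parabola_step j0R jn3R.
  by have [] := parabola_step j0R jn3R.
have an0 : a n = a 0%N by rewrite /a leqnn fn f0.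
have an1 : a n.+1 = a 1%N.
  by rewrite /a ltnn subSnn (_ : (1 <= n)%N) // -(ltr_nat R).
have n0' : (0 < n)%N by rewrite -(ltr_nat R).
have key := periodic_difference_bound n0' h0 Da an0 an1 (fun j => erefl (g j)).
set Y := N (T tau x).
have Y0 : 0 <= Y by exact: N_ge0.
set W := 2 * e' + N x / tau in gb.
have W0 : 0 <= W by apply: addr_ge0; [exact: mulr_ge0 (ler0n _ 2) (ltW e'0)|exact: divr_ge0 (N_ge0 x) (ltW tau0)].
have up : \sum_(j < n) N (g j) ^+ 2 <= n%:R * (n%:R ^+ 2 * W) ^+ 2.
  rewrite mulr_natl -[X in _ *+ X](card_ord n) -sumr_const; apply: ler_sum => j _.
  by rewrite ler_pXn2r ?nnegrE ?mulr_ge0 ?sqr_ge0 //; exact: gb.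
have lo : 2 * m%:R * (3 * m%:R ^+ 2 * Y) ^+ 2 <= \sum_(j < n) N (a j) ^+ 2.
  rewrite -(big_mkord xpredT (fun j => N (a j) ^+ 2)).
  rewrite (@big_cat_nat _ _ _ m) //=; last by rewrite /n leq_pmull.
  have m3 : (m <= 3 * m)%N by rewrite leq_pmull.
  have m34 : (3 * m <= n)%N by rewrite leq_mul2r orbT.
  rewrite [X in _ + X](@big_cat_nat _ _ _ (3 * m)) //=.
  have s0 b c : 0 <= \sum_(b <= i < c) N (a i) ^+ 2 by apply: sumr_ge0 => i _; exact: sqr_ge0.
  apply: le_trans (_ : \sum_(m <= i < 3 * m) N (a i) ^+ 2 <= _); last first.
    by rewrite addrCA lerDl addr_ge0.
  have -> : 2 * m%:R * (3 * m%:R ^+ 2 * Y) ^+ 2 = \sum_(m <= i < 3 * m) (3 * m%:R ^+ 2 * Y) ^+ 2.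
    have e3m : (3 * m - m)%N = (2 * m)%N by rewrite -[X in (_ - X)%N]mul1n -mulnBl.
    by rewrite sumr_const_nat e3m -natrM mulr_natl.
  apply: ler_sum_nat => j /andP[mj j3].
  have jn : (j <= n)%N by rewrite (leq_trans (ltnW j3)) // leq_mul2r orbT.
  have mjR : m%:R <= j%:R :> R by rewrite ler_nat.
  have j3R : j%:R <= 3 * m%:R :> R by rewrite -natrM ler_nat ltnW.
  rewrite ler_pXn2r ?nnegrE ?mulr_ge0 ?sqr_ge0 //.
  rewrite /a jn /f N_real // ger0_norm //; apply: ler_pM; rewrite ?mulr_ge0 ?sqr_ge0 //.
    by rewrite phiE // nm; exact: parabola_ge.
  rewrite /Y /u; have jt : j%:R * h <= tau by rewrite -hn ler_wpM2r ?ler_nat // ltW.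
  have -> : tau = (tau - j%:R * h) + j%:R * h by ring.
  have tj : 0 <= tau - j%:R * h by rewrite subr_ge0.
  by rewrite (T_add tj (jh j) Ex); exact: T_contraction tj (Eu j).
have M2 : 0 <= M ^+ 2 by exact: sqr_ge0.
have fin1 := le_trans lo (le_trans key (ler_wpM2l M2 up)).
have fin2 : Y ^+ 2 <= (8 * M * W) ^+ 2.
  have m5 : 0 < m%:R ^+ 5 :> R by rewrite exprn_gt0.
  rewrite nm in fin1.
  have e1 : 2 * m%:R * (3 * m%:R ^+ 2 * Y) ^+ 2 = m%:R ^+ 5 * (18 * Y ^+ 2) by ring.
  have e2 : M ^+ 2 * (4 * m%:R * ((4 * m%:R) ^+ 2 * W) ^+ 2) = m%:R ^+ 5 * (16 * (8 * M * W) ^+ 2) by ring.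
  rewrite e1 e2 ler_pM2l // in fin1.
  have h18 (p q : R) : 0 <= p -> 18 * p <= 16 * q -> p <= q by move=> *; lra.
  by apply: h18 fin1; exact: sqr_ge0.
have MW0 : 0 <= 8 * M * W by apply: mulr_ge0 => //; apply: mulr_ge0 => //; exact: ltW.
rewrite ler_pXn2r ?nnegrE // in fin2.
apply: le_trans fin2 _; rewrite le_eqVlt; apply/orP; left; apply/eqP.
by rewrite /W /e'; field; rewrite !gt_eqF.
Qed.

Lemma decay (tau : R) x : 0 < tau -> E x -> N (T tau x) <= 8 * M / tau * N x.
Proof.
move=> tau0 Ex; set c := 8 * M / tau.
have c0 : 0 <= c by rewrite divr_ge0 ?mulr_ge0 // ltW.
apply/ler_addgt0Pr => e e0.
have e1 : 0 < e / (1 + c) by rewrite divr_gt0 // ltr_pwDl.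
have [y Dy hy] := dense Ex e1.
have Ey := D_E Dy; have Exy := E_sub Ex Ey.
have h1 := N_dist (T_E (ltW tau0) Ex) (T_E (ltW tau0) Ey).
rewrite -T_sub ?(ltW tau0) // in h1.
have h2 := T_contraction (ltW tau0) Exy; have h3 := decay_dom tau0 Dy.
have h4 : N y <= N x + N (x - y).
  by have := N_dist Ey Ex; rewrite -[N (y - x)]N_opp ?opprB //; exact: E_sub.
rewrite ler_pdivlMr in hy; last by rewrite ltr_pwDl.
have h5 := ler_wpM2l c0 h4; rewrite -/c in h3; lra.
Qed.

Lemma decay_iter (tau : R) m x : 0 < tau -> E x ->
  (forall x, E x -> N (T tau x) <= 2^-1 * N x) -> N (T (m%:R * tau) x) <= 2^-1 ^+ m * N x.
Proof.
move=> tau0 Ex H; elim: m => [|m IH]; first by rewrite mul0r T_zero // expr0 mul1r.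
have m0 : 0 <= m%:R * tau by rewrite mulr_ge0 // ltW.
rewrite -natr1 mulrDl mul1r addrC T_add ?(ltW tau0) //.
apply: le_trans (H _ (T_E m0 Ex)) _; rewrite exprS -mulrA.
by apply: ler_wpM2l => //; rewrite invr_ge0.
Qed.

(** At time tau = 16 M the decay estimate halves the norm. Iteration gives the exponential;
    contraction covers the time left over, and the factor 2 pays for it. *)
Theorem gearhart_pruss : exponentially_stable E N T.
Proof.
pose tau := 16 * M; have tau0 : 0 < tau by rewrite mulr_gt0.
have H x : E x -> N (T tau x) <= 2^-1 * N x.
  move=> Ex; apply: le_trans (decay tau0 Ex) _.
  by rewrite le_eqVlt; apply/orP; left; apply/eqP; rewrite /tau; field; rewrite gt_eqF.
have ln20 : 0 < ln (2 : R) by rewrite ln_gt0 // ltr1n.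
exists (ln 2 / tau), 2; split => //; first by rewrite divr_gt0.
move=> t t0; apply: ge_ereal_sup => _ [x [Ex Nx] <-]; rewrite lee_fin.
pose m := Num.truncn (t / tau).
have tt : 0 <= t / tau by rewrite divr_ge0 // ltW.
have /andP[mt tm] := truncn_itv tt.
have r0 : 0 <= t - m%:R * tau by rewrite subr_ge0 -ler_pdivlMr.
have m0 : 0 <= m%:R * tau by rewrite mulr_ge0 // ltW.
have -> : t = m%:R * tau + (t - m%:R * tau) by ring.
rewrite T_add //; have Er := T_E r0 Ex.
apply: le_trans (decay_iter m tau0 Er H) _.
have N1 : N (T (t - m%:R * tau) x) <= 1 by exact: le_trans (T_contraction r0 Ex) Nx.
have e0 : 0 <= 2^-1 ^+ m :> R by rewrite exprn_ge0 // invr_ge0.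
apply: le_trans (ler_wpM2l e0 N1) _; rewrite mulr1 subrKC.
have -> : (2 : R)^-1 ^+ m = expR (- (m%:R * ln 2)).
  by rewrite expRN mulrC expRM_natr lnK ?posrE // exprVn.
have -> : 2 * expR (- (ln 2 / tau) * t) = expR (ln 2 + - (ln 2 / tau) * t).
  by rewrite expRD lnK // posrE.
rewrite ler_expR.
have := ler_wpM2l (ltW ln20) (ltW tm); rewrite -natr1 -/m.
have -> : - (ln 2 / tau) * t = - (ln 2 * (t / tau)) by ring.
lra.
Qed.

End Decay.

End Generator.
End HilbertSemigroup.

(** * Boundary values of solutions *)

Section TestFunctions.
Variable R : realType.
Implicit Types (a b c d e x y : R) (f g P Q : R -> R[i]).

(** The imaginary part of z times the conjugate of z', as [dot] is the real part. *)
Definition crs (z z' : R[i]) : R := Im z * Re z' - Re z * Im z'.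

Lemma AC_dot a b P p Q q : a <= b -> cac a b P p -> cac a b Q q ->
  acont a b (fun x => dot (P x) (Q x)) (fun x => dot (p x) (Q x) + dot (P x) (q x)).
Proof.
move=> ab [h1 h2] [h3 h4].
apply: AC_ext (AC_add (AC_mul ab h1 h3) (AC_mul ab h2 h4)) => x _; rewrite /dot /=; ring.
Qed.

Lemma AC_crs a b P p Q q : a <= b -> cac a b P p -> cac a b Q q ->
  acont a b (fun x => crs (P x) (Q x)) (fun x => crs (p x) (Q x) + crs (P x) (q x)).
Proof.
move=> ab [h1 h2] [h3 h4].
apply: AC_ext (AC_sub (AC_mul ab h2 h3) (AC_mul ab h1 h4)) => x _; rewrite /crs /=; ring.
Qed.

Definition n2 a b f : R := II a b (fun x => sqmod (f x)).

Lemma L2c_sqmod_L1 a b f : L2c a b f -> L1 a b (fun x => sqmod (f x)).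
Proof.
move=> [h1 h2]; apply: L1_eq (proj1 (HI_add (nrm2_HI h1) (nrm2_HI h2))) => x _.
by [].
Qed.

Lemma n2_HI a b f : L2c a b f -> HI a b (fun x => sqmod (f x)) (n2 a b f).
Proof. by move=> /L2c_sqmod_L1 h; exact: L1_HI. Qed.

Lemma n2_ge0 a b f : 0 <= n2 a b f.
Proof. by apply: II_ge0 => x _; exact: sqmod_ge0. Qed.

Lemma n2E a b f : L2c a b f -> n2 a b f = nrm2 a b (Re \o f) + nrm2 a b (Im \o f).
Proof. by move=> [h1 h2]; have [_ <-] := HI_add (nrm2_HI h1) (nrm2_HI h2). Qed.

Lemma n2S a b c d f : a <= c -> c <= d -> d <= b -> L2c a b f -> n2 c d f <= n2 a b f.
Proof.
move=> ac cd db h; rewrite (n2E h) (n2E (L2cS ac db h)); case: h => h1 h2.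
by apply: lerD; exact: nrm2S.
Qed.

Lemma n2_le2 a b f g h (k k' : R) : L2c a b f -> L2c a b g -> L2c a b h ->
  (forall x, a < x < b -> sqmod (f x) <= k * sqmod (g x) + k' * sqmod (h x)) ->
  n2 a b f <= k * n2 a b g + k' * n2 a b h.
Proof.
move=> hf hg hh; exact: HI_le (n2_HI hf) (HI_add (HI_scale k (n2_HI hg)) (HI_scale k' (n2_HI hh))).
Qed.

Lemma n2_bnd a b f (k : R) : a <= b -> L2c a b f -> (forall x, a < x < b -> sqmod (f x) <= k) ->
  n2 a b f <= k * (b - a).
Proof. by move=> ab hf; exact: HI_le (n2_HI hf) (HI_cst k ab). Qed.

Lemma dot_HI a b f g : L2c a b f -> L2c a b g ->
  HI a b (fun x => dot (f x) (g x)) (II a b (fun x => dot (f x) (g x))).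
Proof.
move=> [h1 h2] [h3 h4]; apply: L1_HI.
by apply: L1_eq (proj1 (HI_add (L1_HI (L2_mul_L1 h1 h3)) (L1_HI (L2_mul_L1 h2 h4)))).
Qed.

Lemma crs_HI a b f g : L2c a b f -> L2c a b g ->
  HI a b (fun x => crs (f x) (g x)) (II a b (fun x => crs (f x) (g x))).
Proof.
move=> [h1 h2] [h3 h4]; apply: L1_HI.
by apply: L1_eq (proj1 (HI_sub (L1_HI (L2_mul_L1 h2 h3)) (L1_HI (L2_mul_L1 h1 h4)))).
Qed.

Lemma dot_le (t : R) (z z' : R[i]) : 0 < t -> 2 * `|dot z z'| <= t * sqmod z + t^-1 * sqmod z'.
Proof.
move=> t0; case: z z' => [p q] [r s]; rewrite /dot /sqmod /=.
have ti : 0 < t^-1 by rewrite invr_gt0.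
have tt : t * t^-1 = 1 by rewrite mulfV // gt_eqF.
have e1 : t * (p ^+ 2 + q ^+ 2) + t^-1 * (r ^+ 2 + s ^+ 2) - 2 * (p * r + q * s) =
  t * ((p - t^-1 * r) ^+ 2 + (q - t^-1 * s) ^+ 2) by field; rewrite gt_eqF.
have e2 : t * (p ^+ 2 + q ^+ 2) + t^-1 * (r ^+ 2 + s ^+ 2) + 2 * (p * r + q * s) =
  t * ((p + t^-1 * r) ^+ 2 + (q + t^-1 * s) ^+ 2) by field; rewrite gt_eqF.
have g1 : 0 <= t * ((p - t^-1 * r) ^+ 2 + (q - t^-1 * s) ^+ 2) by rewrite mulr_ge0 ?addr_ge0 ?sqr_ge0 // ltW.
have g2 : 0 <= t * ((p + t^-1 * r) ^+ 2 + (q + t^-1 * s) ^+ 2) by rewrite mulr_ge0 ?addr_ge0 ?sqr_ge0 // ltW.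
have [h|h] := ger0P (p * r + q * s); lra.
Qed.

Lemma crsE (z z' : R[i]) : crs z z' = dot z ((0 +i* 1) * z').
Proof. by case: z z' => [p q] [r s]; rewrite /crs /dot /=; ring. Qed.

Lemma sqmod_i (z : R[i]) : sqmod ((0 +i* 1) * z) = sqmod z.
Proof. by case: z => [p q]; rewrite /sqmod /=; ring. Qed.

Lemma crs_le (t : R) (z z' : R[i]) : 0 < t -> 2 * `|crs z z'| <= t * sqmod z + t^-1 * sqmod z'.
Proof. by move=> t0; rewrite crsE -(sqmod_i z'); exact: dot_le. Qed.

Lemma II_dot_le a b f g (h : R -> R) (M t : R) : a <= b -> 0 < t -> 0 <= M ->
  L2c a b f -> L2c a b g -> L1 a b (fun x => h x * dot (f x) (g x)) -> (forall x, a < x < b -> `|h x| <= M) ->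
  2 * `|II a b (fun x => h x * dot (f x) (g x))| <= M * (t * n2 a b f + t^-1 * n2 a b g).
Proof.
move=> ab t0 M0 hf hg I hM.
apply: le_trans (ler_wpM2l (ler0n _ 2) (II_normr I)) _.
apply: HI_le (HI_scale 2 (HI_abs (L1_HI I))) (HI_scale M (HI_add (HI_scale t (n2_HI hf)) (HI_scale t^-1 (n2_HI hg)))) _ => x xab /=.
rewrite normrM mulrCA; apply: ler_pM; [by []|by rewrite mulr_ge0|exact: hM|exact: dot_le].
Qed.

(* [e] is the end of [a, b] to be estimated and [p] the other one; [ptime] runs affinely
   from 0 at [p] to 1 at [e], with slope [s]. *)
Definition endpoints a b (p e s : R) := (p = a /\ e = b /\ s = (b - a)^-1) \/
  (p = b /\ e = a /\ s = - (b - a)^-1).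

Definition ptime (p s x : R) : R := s * (x - p).

Section Endpoint.
Variables (a b p e s : R).
Hypotheses (ab : a < b) (pe : endpoints a b p e s).
Local Notation t := (ptime p s).
Local Notation eta := (b - a).

Let eta0 : 0 < eta. Proof. by rewrite subr_gt0. Qed.

Lemma t_p : t p = 0. Proof. by rewrite /ptime subrr mulr0. Qed.

Lemma t_e : t e = 1.
Proof.
rewrite /ptime; case: pe => -[-> [-> ->]]; first by rewrite mulVf // gt_eqF.
by rewrite mulNr -mulrN opprB mulVf // gt_eqF.
Qed.

Lemma t01 x : a < x < b -> 0 <= t x <= 1.
Proof.
move=> /andP[ax xb]; rewrite /ptime; case: pe => -[-> [_ ->]].
  rewrite mulrC ler_pdivrMr // mul1r divr_ge0 //=; lra.
have -> : - eta^-1 * (x - b) = (b - x) / eta by ring.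
rewrite ler_pdivrMr // mul1r divr_ge0 //=; lra.
Qed.

Lemma s2 : s ^+ 2 = (eta ^+ 2)^-1.
Proof. by case: pe => -[_ [_ ->]]; rewrite ?sqrrN exprVn. Qed.

Lemma s_eta : `|s| * eta = 1.
Proof.
case: pe => -[_ [_ ->]]; rewrite ?normrN gtr0_norm ?invr_gt0 // mulVf // gt_eqF //.
Qed.

Lemma AC_t : acont a b t (fun=> s).
Proof.
split; first by have [] := HI_cst s (ltW ab).
move=> x /andP[ax xb]; have [_ ->] := HI_cst s ax; rewrite /ptime; ring.
Qed.

Lemma AC_t2 : acont a b (fun x => t x ^+ 2) (fun x => s * (2 * t x)).
Proof.
by apply: AC_ext (AC_mul (ltW ab) AC_t AC_t) => x _; ring.
Qed.

Lemma AC_t3 : acont a b (fun x => t x ^+ 3) (fun x => s * (3 * t x ^+ 2)).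
Proof.
by apply: AC_ext (AC_mul (ltW ab) AC_t AC_t2) => x _; ring.
Qed.

Lemma boundary_sqr (h : R -> R) : h p = 0 -> (h b - h a) ^+ 2 = h e ^+ 2.
Proof.
case: pe => -[-> [-> _]] ->; first by rewrite subr0.
by rewrite sub0r sqrrN.
Qed.

Lemma test_identity (u u1 u2' psi psi1 psi2 : R -> R) : acont a b u u1 -> acont a b u1 u2' ->
  acont a b psi psi1 -> acont a b psi1 psi2 ->
  HI a b (fun x => u2' x * psi x - u x * psi2 x)
    ((u1 b * psi b - u b * psi1 b) - (u1 a * psi a - u a * psi1 a)).
Proof.
move=> h1 h2 h3 h4; have ab' := ltW ab.
apply: HI_eq (AC_HI ab' (AC_sub (AC_mul ab' h2 h3) (AC_mul ab' h1 h4))) => x _; ring.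
Qed.

Lemma nrm2_bnd (f : R -> R) (k : R) : L2r a b f -> (forall x, a < x < b -> f x ^+ 2 <= k) ->
  nrm2 a b f <= k * eta.
Proof. by move=> hf; exact: HI_le (nrm2_HI hf) (HI_cst k (ltW ab)). Qed.

(** [psi] vanishes at [p] together with its derivative, so Green's second identity leaves only the
    flux at [e]; Cauchy-Schwarz bounds the two integrals. *)
Lemma test_bound (u u1 u2' psi psi1 psi2 : R -> R) (k k2 : R) : acont a b u u1 -> acont a b u1 u2' ->
  L2r a b u2' -> acont a b psi psi1 -> acont a b psi1 psi2 -> L2r a b psi2 -> psi p = 0 -> psi1 p = 0 ->
  (forall x, a < x < b -> psi x ^+ 2 <= k) -> (forall x, a < x < b -> psi2 x ^+ 2 <= k2) ->
  (u1 e * psi e - u e * psi1 e) ^+ 2 <= 2 * (k * eta) * nrm2 a b u2' + 2 * (k2 * eta) * nrm2 a b u.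
Proof.
move=> h1 h2 l2 h3 h4 l4 p0 p1 hk hk2; have ab' := ltW ab.
have lu := L2_AC ab' h1; have lp := L2_AC ab' h3.
rewrite -(boundary_sqr (h := fun x => u1 x * psi x - u x * psi1 x)); last by rewrite p0 p1 !mulr0 subr0.
have [_ <-] := test_identity h1 h2 h3 h4.
have [_ ->] := HI_sub (L1_HI (L2_mul_L1 l2 lp)) (L1_HI (L2_mul_L1 lu l4)).
have c1 := cauchy_schwarz l2 lp; have c2 := cauchy_schwarz lu l4.
have b1 := ler_wpM2l (nrm2_ge0 a b u2') (nrm2_bnd lp hk).
have b2 := ler_wpM2l (nrm2_ge0 a b u) (nrm2_bnd l4 hk2).
set A := II _ _ _ in c1 *; set B := II _ _ _ in c2 *.
have := sqr_ge0 (A + B); lra.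
Qed.

(* Test with a cubic vanishing to second order at [p] and taking the values (1, 0), resp.
   (0, 1), to first order at [e]. *)
Lemma endpoint_interpolation (u u1 u2' : R -> R) : acont a b u u1 -> acont a b u1 u2' -> L2r a b u2' ->
  u1 e ^+ 2 <= 2 * eta * nrm2 a b u2' + 72 * (eta ^+ 3)^-1 * nrm2 a b u /\
  u e ^+ 2 <= 2 * eta ^+ 3 * nrm2 a b u2' + 32 * eta^-1 * nrm2 a b u.
Proof.
move=> h1 h2 l2; have ab' := ltW ab; have en : eta != 0 by rewrite gt_eqF.
have s4 : (s ^+ 2) ^+ 2 = (eta ^+ 4)^-1 by rewrite s2 exprVn -exprM.
split.
  pose psi x := 3 * t x ^+ 2 - 2 * t x ^+ 3.
  pose psi1 x := s * (6 * t x) - s * (6 * t x ^+ 2).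
  pose psi2 x := s ^+ 2 * (6 - 12 * t x).
  have a1 : acont a b psi psi1.
    by apply: AC_ext (AC_sub (AC_scale 3 AC_t2) (AC_scale 2 AC_t3)) => x _; rewrite /psi /psi1; ring.
  have a2 : acont a b psi1 psi2.
    apply: AC_ext (AC_sub (AC_scale s (AC_scale 6 AC_t)) (AC_scale s (AC_scale 6 AC_t2))) => x _; rewrite /psi1 /psi2; ring.
  have l4 : L2r a b psi2.
    apply: (L2_AC ab' (p := fun x => s ^+ 2 * (0 - 12 * s))).
    by apply: AC_scale; apply: AC_sub; [exact: AC_cst|exact: AC_scale AC_t].
  have := @test_bound u u1 u2' psi psi1 psi2 1 (36 * (eta ^+ 4)^-1) h1 h2 l2 a1 a2 l4.
  rewrite /psi /psi1 t_p t_e.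
  have -> : u1 e * (3 * 1 ^+ 2 - 2 * 1 ^+ 3) - u e * (s * (6 * 1) - s * (6 * 1 ^+ 2)) = u1 e by ring.
  have -> : 2 * (36 / eta ^+ 4 * eta) = 72 / eta ^+ 3 by field.
  rewrite mul1r; apply.
  - ring. - ring.
  - move=> x /t01/andP[t0 t1]; set T := t x in t0 t1 *.
    have e1 : 0 <= T ^+ 2 * (3 - 2 * T) by apply: mulr_ge0; [exact: sqr_ge0|lra].
    have e2 : 0 <= (1 - T) ^+ 2 * (1 + 2 * T) by apply: mulr_ge0; [exact: sqr_ge0|lra].
    by apply: exprn_ile1; lra.
  - move=> x /t01/andP[t0 t1]; rewrite exprMn s4 mulrC; apply: ler_wpM2r.
      by rewrite invr_ge0 exprn_ge0 // ltW.
    by set T := t x in t0 t1 *; nra.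
pose psi x := eta * (t x ^+ 3 - t x ^+ 2).
pose psi1 x := eta * (s * (3 * t x ^+ 2) - s * (2 * t x)).
pose psi2 x := eta * (s ^+ 2 * (6 * t x - 2)).
have a1 : acont a b psi psi1 by exact: AC_scale (AC_sub AC_t3 AC_t2).
have a2 : acont a b psi1 psi2.
  apply: AC_ext (AC_scale eta (AC_sub (AC_scale s (AC_scale 3 AC_t2)) (AC_scale s (AC_scale 2 AC_t)))) => x _; rewrite /psi1 /psi2; ring.
have l4 : L2r a b psi2.
  apply: (L2_AC ab' (p := fun x => eta * (s ^+ 2 * (6 * s - 0)))).
  by do 2 apply: AC_scale; apply: AC_sub; [exact: AC_scale AC_t|exact: AC_cst].
have := @test_bound u u1 u2' psi psi1 psi2 (eta ^+ 2) (16 * (eta ^+ 2)^-1) h1 h2 l2 a1 a2 l4.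
rewrite /psi /psi1 t_p t_e.
have -> : (u1 e * (eta * (1 ^+ 3 - 1 ^+ 2)) - u e * (eta * (s * (3 * 1 ^+ 2) - s * (2 * 1)))) ^+ 2 = u e ^+ 2 * (s ^+ 2 * eta ^+ 2) by ring.
rewrite s2 mulVf ?expf_neq0 // mulr1.
have -> : 2 * (16 / eta ^+ 2 * eta) = 32 / eta by field.
have -> : 2 * (eta ^+ 2 * eta) = 2 * eta ^+ 3 by ring.
apply.
- ring. - ring.
- move=> x /t01/andP[t0 t1]; rewrite exprMn -[leRHS]mulr1; apply: ler_wpM2l; first exact: sqr_ge0.
  set T := t x in t0 t1 *.
  have -> : (T ^+ 3 - T ^+ 2) ^+ 2 = (T ^+ 2 * (1 - T)) ^+ 2 by ring.
  have T2 : T ^+ 2 <= 1 by exact: exprn_ile1.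
  apply: exprn_ile1; first by apply: mulr_ge0; [exact: sqr_ge0|lra].
  by apply: mulr_ile1; rewrite ?sqr_ge0 //; lra.
- move=> x /t01/andP[t0 t1];
  have -> : psi2 x ^+ 2 = eta ^+ 2 * ((s ^+ 2) ^+ 2 * (6 * t x - 2) ^+ 2) by rewrite /psi2; ring.
  rewrite s4.
  have -> : eta ^+ 2 * ((eta ^+ 4)^-1 * (6 * t x - 2) ^+ 2) = (6 * t x - 2) ^+ 2 / eta ^+ 2 by field.
  apply: ler_wpM2r; first by rewrite invr_ge0 exprn_ge0 // ltW.
  by set T := t x in t0 t1 *; nra.
Qed.

Section Exponential.
Variables (kap : R).
Hypothesis kap0 : 0 < kap.

(** This is exp (- kap |x - e|) on [a, b], since [ptime] minus 1 equals - |x - e| / (b - a)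
    there. *)
Definition decexp x : R := expR (kap * eta * (t x - 1)).

Lemma decexp_le1 x : a < x < b -> 0 <= decexp x <= 1.
Proof.
move=> /t01/andP[t0 t1]; rewrite expR_ge0 /= -expR0 ler_expR.
by rewrite pmulr_rle0 ?subr_le0 // mulr_gt0.
Qed.

Lemma AC_decexp : acont a b decexp (fun x => s * (kap * eta * decexp x)).
Proof.
apply: AC_C1; first exact: ltW.
  move=> x; rewrite /decexp.
  have h1 : is_derive x 1 (fun y => kap * eta * (t y - 1)) (kap * eta * s).
    apply: (is_derive_quad (f := fun=> kap * eta * s) (C := 0)) => y.
    have -> : kap * eta * (t y - 1) - kap * eta * (t x - 1) - kap * eta * s * (y - x) = 0 by rewrite /ptime; ring.
    by rewrite normr0 mul0r.
  have := is_derive1_comp (is_derive_expR _) h1.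
  by rewrite [X in is_derive _ _ _ X -> _](_ : _ = s * (kap * eta * expR (kap * eta * (t x - 1)))) //; ring.
move=> x; apply: cvgMr; apply: cvgMr; rewrite /decexp.
apply: (@continuous_comp _ _ _ (fun y => kap * eta * (t y - 1)) expR); last exact: continuous_expR.
apply: cvgMr; apply: cvgB; last exact: cvg_cst.
by apply: cvgMr; apply: cvgB; [exact: cvg_id|exact: cvg_cst].
Qed.

(** The integral equals (1 - decexp(p)^2) / (2 kap); the gain 1 / kap is the purpose of the
    exponential. *)
Lemma nrm2_decexp : nrm2 a b decexp <= (2 * kap)^-1.
Proof.
have ab' := ltW ab.
have := AC_HI ab' (AC_mul ab' AC_decexp AC_decexp).
set v := decexp b * _ - _ => h.
have hv : HI a b (fun x => decexp x ^+ 2) (v * (2 * s * kap * eta)^-1).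
  rewrite mulrC; apply: HI_eq (HI_scale (2 * s * kap * eta)^-1 h) => x _.
  have sn : s != 0.
    by apply/eqP => s0; have := s_eta; rewrite s0 normr0 mul0r => /esym/eqP; rewrite oner_eq0.
  by field; rewrite sn !gt_eqF.
rewrite /nrm2; case: hv => _ ->.
have e1 : decexp e = 1 by rewrite /decexp t_e subrr mulr0 expR0.
have e2 : 0 <= decexp p <= 1.
  rewrite expR_ge0 /= -expR0 ler_expR t_p sub0r mulrN1 oppr_le0; by rewrite mulr_ge0 // ltW.
have se : s * eta * v = 1 - decexp p ^+ 2.
  move: e1 e2; rewrite /v; case: pe => -[-> [-> ->]] -> _.
    by rewrite mulVf ?gt_eqF //; ring.
  by rewrite mulNr mulVf ?gt_eqF //; ring.
have ses : (s * eta) ^+ 2 = 1.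
  by rewrite exprMn s2 mulVf // expf_neq0 // gt_eqF.
have sne : s * eta != 0 by apply/eqP => e0; move/eqP: ses; rewrite e0 expr0n /= eq_sym oner_eq0.
have -> : v / (2 * s * kap * eta) = (1 - decexp p ^+ 2) * (2 * kap)^-1.
  rewrite -se -[LHS]mul1r -ses; field.
  by rewrite (gt_eqF kap0) -negb_or orbC -mulf_eq0 sne.
rewrite ler_piMl ?invr_ge0 ?mulr_ge0 ?(ltW kap0) //.
by rewrite gerBl ?sqr_ge0.
Qed.

(* Test with [t^2 decexp], so that only the cutoff [t^2] contributes to the integral of [u]. *)
Lemma endpoint_decay (u u1 u2' F : R -> R) : acont a b u u1 -> acont a b u1 u2' -> L2r a b F ->
  (forall x, a < x < b -> u2' x = kap ^+ 2 * u x + F x) ->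
  kap ^+ 2 * u e ^+ 2 <= 3 * u1 e ^+ 2 + 3 * ((2 * kap)^-1 * nrm2 a b F) +
    3 * ((2 * (eta ^+ 2)^-1 + 4 * kap * eta^-1) ^+ 2 * (2 * kap)^-1 * nrm2 a b u).
Proof.
move=> h1 h2 lF eF; have ab' := ltW ab; have en : eta != 0 by rewrite gt_eqF.
pose psi x := t x ^+ 2 * decexp x.
pose psi1 x := s * (2 * t x + kap * eta * t x ^+ 2) * decexp x.
(* The part of [psi2] produced by the cutoff; the rest is kap^2 psi and cancels against the equation
   for [u]. *)
pose c x := s ^+ 2 * (2 + 4 * kap * eta * t x).
pose psi2 x := c x * decexp x + kap ^+ 2 * psi x.
have s2e : s ^+ 2 * eta ^+ 2 = 1 by rewrite s2 mulVf // expf_neq0.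
have a1 : acont a b psi psi1.
  by apply: AC_ext (AC_mul ab' AC_t2 AC_decexp) => x _; rewrite /psi /psi1; ring.
have a2 : acont a b psi1 psi2.
  have := AC_mul ab' (AC_scale s (AC_add (AC_scale 2 AC_t) (AC_scale (kap * eta) AC_t2))) AC_decexp.
  apply: AC_ext => x _ //; rewrite /psi2 /psi /c.
  have -> : kap ^+ 2 * (t x ^+ 2 * decexp x) = s ^+ 2 * eta ^+ 2 * kap ^+ 2 * (t x ^+ 2 * decexp x) by rewrite s2e mul1r.
  ring.
have lE := L2_AC ab' AC_decexp; have lpsi := L2_AC ab' a1.
have lc : L2r a b (fun x => c x * decexp x).
  apply: (L2_mulAC ab' lE (P := c) (p := fun x => s ^+ 2 * (0 + 4 * kap * eta * s))).
  by apply: AC_scale; apply: AC_add; [exact: AC_cst|exact: AC_scale AC_t].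
have lu := L2_AC ab' h1.
have J : HI a b (fun x => F x * psi x - u x * (c x * decexp x))
    ((u1 b * psi b - u b * psi1 b) - (u1 a * psi a - u a * psi1 a)).
  apply: HI_eq (test_identity h1 h2 a1 a2) => x /eF ->; rewrite /psi2; ring.
have [_ E1] := J.
have [_ E2] := HI_sub (L1_HI (L2_mul_L1 lF lpsi)) (L1_HI (L2_mul_L1 lu lc)).
have c1 := cauchy_schwarz lF lpsi; have c2 := cauchy_schwarz lu lc.
have bd := boundary_sqr (h := fun x => u1 x * psi x - u x * psi1 x).
rewrite -E1 E2 /psi /psi1 t_p t_e in bd.
have e1 : decexp e = 1 by rewrite /decexp t_e subrr mulr0 expR0.
rewrite e1 in bd.
set A := II _ _ _ in c1 bd *; set B := II _ _ _ in c2 bd *.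
have {}bd : (A - B) ^+ 2 = (u1 e - u e * (s * (2 + kap * eta))) ^+ 2.
  by rewrite bd; [congr (_ ^+ 2); ring|ring].
have n1 : nrm2 a b psi <= nrm2 a b decexp.
  apply: HI_le (nrm2_HI lpsi) (nrm2_HI lE) _ => x xab.
  have /andP[t0 t1] := t01 xab; have /andP[d0 d1] := decexp_le1 xab.
  by rewrite /psi exprMn ler_piMl ?sqr_ge0 // -exprM exprn_ile1.
pose Cc := (2 * (eta ^+ 2)^-1 + 4 * kap * eta^-1) ^+ 2.
have n2' : nrm2 a b (fun x => c x * decexp x) <= Cc * nrm2 a b decexp.
  apply: HI_le (nrm2_HI lc) (HI_scale Cc (nrm2_HI lE)) _ => x xab.
  have /andP[t0 t1] := t01 xab.
  rewrite exprMn; apply: ler_wpM2r; first exact: sqr_ge0.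
  rewrite /Cc /c s2; have ei : 0 < (eta ^+ 2)^-1 by rewrite invr_gt0 exprn_gt0.
  have -> : (eta ^+ 2)^-1 * (2 + 4 * kap * eta * t x) = 2 / eta ^+ 2 + 4 * kap / eta * t x by field.
  have k0 : 0 <= 4 * kap / eta by rewrite divr_ge0 // ?mulr_ge0 // ltW.
  have kt : 4 * kap / eta * t x <= 4 * kap / eta by rewrite ler_piMr.
  have e2 : 0 <= 2 / eta ^+ 2 by rewrite divr_ge0 // ltW // -invr_gt0.
  by rewrite ler_sqr ?nnegrE ?lerD2l //; apply: addr_ge0 => //; exact: mulr_ge0.
have nE := nrm2_decexp.
have Cc0 : 0 <= Cc by exact: sqr_ge0.
have F0 := nrm2_ge0 a b F; have U0 := nrm2_ge0 a b u.
have c1' : A ^+ 2 <= (2 * kap)^-1 * nrm2 a b F.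
  apply: le_trans c1 _; rewrite mulrC; apply: ler_wpM2r => //; exact: le_trans nE.
rewrite -/Cc.
have c2' : B ^+ 2 <= Cc * (2 * kap)^-1 * nrm2 a b u.
  apply: le_trans c2 _; rewrite mulrC; apply: ler_wpM2r => //; apply: le_trans n2' _; exact: ler_wpM2l.
set Y := u e * (s * (2 + kap * eta)) in bd.
(* The coefficient of u(e) is psi'(e) = s (2 + kap eta), of modulus at least kap because |s| eta =
   1. *)
have Yk : kap ^+ 2 * u e ^+ 2 <= Y ^+ 2.
  rewrite /Y !exprMn mulrC; apply: ler_wpM2l; first exact: sqr_ge0.
  have -> : kap ^+ 2 = s ^+ 2 * (kap * eta) ^+ 2 by rewrite exprMn mulrCA s2e mulr1.
  apply: ler_wpM2l; first exact: sqr_ge0.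
  have ke : 0 < kap * eta by rewrite mulr_gt0.
  by rewrite ler_sqr ?nnegrE ?addr_ge0 ?lerDr ?(ltW ke).
have three (p' q' r' : R) : (p' + q' + r') ^+ 2 <= 3 * p' ^+ 2 + 3 * q' ^+ 2 + 3 * r' ^+ 2.
  have := sqr_ge0 (p' - q'); have := sqr_ge0 (q' - r'); have := sqr_ge0 (p' - r'); lra.
have h3 : Y ^+ 2 <= 3 * u1 e ^+ 2 + 3 * A ^+ 2 + 3 * B ^+ 2.
  move/esym/eqP: bd; rewrite eqf_sqr => /orP[] /eqP h.
    have -> : Y = u1 e + - A + B by lra.
    by apply: le_trans (three _ _ _) _; rewrite sqrrN.
  have -> : Y = u1 e + A + - B by lra.
  by apply: le_trans (three _ _ _) _; rewrite sqrrN.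
lra.
Qed.

End Exponential.
End Endpoint.
End TestFunctions.

Section ComplexParts.
Variable R : realType.
Implicit Types (z w : R[i]) (k om : R).

Lemma ReIM om z : Re ((0 +i* om) * z) = - (om * Im z).
Proof. by case: z => p q /=; ring. Qed.
Lemma ImIM om z : Im ((0 +i* om) * z) = om * Re z.
Proof. by case: z => p q /=; ring. Qed.
Lemma ReD z w : Re (z + w) = Re z + Re w. Proof. by case: z w => ? ? []. Qed.
Lemma ImD z w : Im (z + w) = Im z + Im w. Proof. by case: z w => ? ? []. Qed.
Lemma ReN z : Re (- z) = - Re z. Proof. by case: z. Qed.
Lemma ImN z : Im (- z) = - Im z. Proof. by case: z. Qed.
Lemma ReZ k z : Re (k%:C * z) = k * Re z. Proof. by case: z => p q /=; ring. Qed.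
Lemma ImZ k z : Im (k%:C * z) = k * Im z. Proof. by case: z => p q /=; ring. Qed.
Definition ReImE := (ReIM, ImIM, ReD, ImD, ReN, ImN, ReZ, ImZ).

Lemma sqmodD2 z w : sqmod (z + w) <= 2 * sqmod z + 2 * sqmod w.
Proof.
rewrite /sqmod !ReImE; have := sqr_ge0 (Re z - Re w); have := sqr_ge0 (Im z - Im w); lra.
Qed.

Lemma sqmodN z : sqmod (- z) = sqmod z. Proof. by rewrite /sqmod !ReImE !sqrrN. Qed.

Lemma sqmodI om z : sqmod ((0 +i* om) * z) = om ^+ 2 * sqmod z.
Proof. by rewrite /sqmod !ReImE; ring. Qed.

Lemma sqmodZ k z : sqmod (k%:C * z) = k ^+ 2 * sqmod z.
Proof. by rewrite /sqmod !ReImE; ring. Qed.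

End ComplexParts.

(** * Poincare inequalities, Green's formula and boundary estimates for complex functions *)

Section Poincare.
Variable R : realType.
Implicit Types (a b x : R) (u v : R -> R[i]).

Lemma sup_n2 a b x u u1 : a <= x <= b -> cac a b u u1 -> L2c a b u1 -> u a = 0 ->
  sqmod (u x) <= (b - a) * n2 a b u1.
Proof.
move=> /andP[ax xb] [h1 h2] [l1 l2] ua.
have key (p P : R -> R) : acont a b P p -> L2r a b p -> P a = 0 -> P x ^+ 2 <= (b - a) * nrm2 a b p.
  move=> hP lp P0.
  have := AC_diff hP (lexx a) ax xb; rewrite P0 subr0 => ->.
  apply: le_trans (II_sqr_le ax (L2S (lexx a) xb lp)) _.
  apply: ler_pM; [by rewrite subr_ge0|exact: nrm2_ge0|by rewrite lerD2r|].
  by apply: nrm2S.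
rewrite (n2E (conj l1 l2)) mulrDr.
by apply: lerD; [apply: (key _ (Re \o u) h1 l1)|apply: (key _ (Im \o u) h2 l2)]; rewrite /= ua.
Qed.

Lemma poincare a b u u1 : a <= b -> cac a b u u1 -> L2c a b u1 -> u a = 0 ->
  n2 a b u <= (b - a) ^+ 2 * n2 a b u1.
Proof.
move=> ab h l1 ua; have hu := L2c_cac ab h.
rewrite expr2 -mulrA [leRHS]mulrC; apply: n2_bnd => // x /andP[ax xb].
by apply: sup_n2 h l1 ua; rewrite !ltW.
Qed.

Lemma dot_green a b u u1 u2 v v1 v2 : a <= b -> cac a b u u1 -> cac a b u1 u2 -> L2c a b u2 ->
  cac a b v v1 -> cac a b v1 v2 -> L2c a b v2 -> v a = 0 -> v1 a = 0 -> v b = 0 -> v1 b = 0 ->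
  II a b (fun x => dot (u x) (v2 x)) = II a b (fun x => dot (u2 x) (v x)).
Proof.
move=> ab h1 h2 l2 k1 k2 m2 e1 e2 e3 e4.
have [_ E1] := AC_HI ab (AC_sub (AC_dot ab h2 k1) (AC_dot ab h1 k2)).
have [_ E2] := HI_sub (dot_HI l2 (L2c_cac ab k1)) (dot_HI (L2c_cac ab h1) m2).
move: E1; rewrite e1 e2 e3 e4.
have -> : II a b (fun x => dot (u2 x) (v x) + dot (u1 x) (v1 x) - (dot (u1 x) (v1 x) + dot (u x) (v2 x))) =
  II a b (fun x => dot (u2 x) (v x) - dot (u x) (v2 x)) by apply: II_eq => x _; ring.
by rewrite E2 /dot !mulr0 => h; lra.
Qed.

Lemma L2c_i a b u : L2c a b u -> L2c a b (fun x => (0 +i* 1) * u x).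
Proof.
move=> hu; have h0 : L2c a b (fun=> 0 : R[i]) by split; exact: L2_cst.
by apply: L2c_ext (L2c_comb (0 +i* 1) hu h0) => x _; rewrite addr0.
Qed.

Lemma II_crs_le a b t u v : a <= b -> 0 < t -> L2c a b u -> L2c a b v ->
  2 * `|II a b (fun x => crs (u x) (v x))| <= t * n2 a b u + t^-1 * n2 a b v.
Proof.
move=> ab t0 hu hv; have lI := L2c_i hv.
have n1 x : a < x < b -> `|1 : R| <= 1 by rewrite normr1.
have := II_dot_le ab t0 ler01 hu lI (dot_L1 (one_ess a b) hu lI) n1.
have -> : II a b (fun x => 1 * dot (u x) ((0 +i* 1) * v x)) = II a b (fun x => crs (u x) (v x)).
  by apply: II_eq => x _; rewrite mul1r crsE.
have -> : n2 a b (fun x => (0 +i* 1) * v x) = n2 a b v by apply: II_eq => x _; rewrite sqmod_i.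
by rewrite mul1r.
Qed.

Lemma endpoint_interpolation_c a b p e s u u1 u2 : a < b -> endpoints a b p e s ->
  cac a b u u1 -> cac a b u1 u2 -> L2c a b u2 ->
  sqmod (u1 e) <= 2 * (b - a) * n2 a b u2 + 72 * ((b - a) ^+ 3)^-1 * n2 a b u /\
  sqmod (u e) <= 2 * (b - a) ^+ 3 * n2 a b u2 + 32 * (b - a)^-1 * n2 a b u.
Proof.
move=> ab pe h1 h2 l2; have lu := L2c_cac (ltW ab) h1.
rewrite (n2E l2) (n2E lu); case: h1 h2 l2 => h1 h1' [h2 h2'] [l2 l2'].
have [i1 i2] := endpoint_interpolation ab pe h1 h2 l2.
have [i3 i4] := endpoint_interpolation ab pe h1' h2' l2'.
move: i1 i2 i3 i4; rewrite /sqmod /=.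
set x1 := nrm2 _ _ _; set x2 := nrm2 _ _ _; set x3 := nrm2 _ _ _; set x4 := nrm2 _ _ _.
set y1 := (_ ^+ 3)^-1; set y2 := (_ - _)^-1; set y3 := _ ^+ 3 => i1 i2 i3 i4.
by split; rewrite !mulrDr; lra.
Qed.

Lemma endpoint_decay_c a b p e s kap u u1 u2 F : a < b -> endpoints a b p e s -> 0 < kap ->
  cac a b u u1 -> cac a b u1 u2 -> L2c a b F ->
  (forall x, a < x < b -> u2 x = (kap ^+ 2)%:C * u x + F x) ->
  kap ^+ 2 * sqmod (u e) <= 3 * sqmod (u1 e) + 3 * ((2 * kap)^-1 * n2 a b F) +
    3 * ((2 * ((b - a) ^+ 2)^-1 + 4 * kap * (b - a)^-1) ^+ 2 * (2 * kap)^-1 * n2 a b u).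
Proof.
move=> ab pe k0 c1 c2 lF E; rewrite (n2E lF) (n2E (L2c_cac (ltW ab) c1)).
have eR x : a < x < b -> Re (u2 x) = kap ^+ 2 * Re (u x) + Re (F x) by move=> /E ->; rewrite !ReImE.
have eI x : a < x < b -> Im (u2 x) = kap ^+ 2 * Im (u x) + Im (F x) by move=> /E ->; rewrite !ReImE.
have := endpoint_decay ab pe k0 (proj1 c1) (proj1 c2) (proj1 lF) eR.
have := endpoint_decay ab pe k0 (proj2 c1) (proj2 c2) (proj2 lF) eI.
rewrite /sqmod !mulrDr /=; move: (nrm2 _ _ _) (nrm2 _ _ _) (nrm2 _ _ _) (nrm2 _ _ _) => z1 z2 z3 z4.
move: (_ * (2 * kap)^-1) => z5; move: (2 * kap)^-1 => z6; lra.
Qed.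

End Poincare.

(** * The resolvent estimate *)

Section Apriori.
Variables (R : realType) (L c0 Q : R) (qq DD : R -> R).
Hypotheses (L0 : 0 < L) (c00 : 0 < c0).
Hypotheses (mqq : measurable_fun `]0, L[ qq) (qq_b : forall t, c0 <= qq t <= Q).
Hypotheses (mDD : measurable_fun `]0, L[ DD) (DD_b : forall t, 0 <= DD t <= Q).

(** An element of the domain with its representatives, a frequency [om] and a Young weight [tt].
    With these bundled, a bound uniform in all of them is stated as [forall r]. *)
Record rdata := RData {
  om : R; tt : R;
  rW : R -> R[i]; rW1 : R -> R[i]; rW2 : R -> R[i];
  rV : R -> R[i]; rV1 : R -> R[i]; rV2 : R -> R[i];
  rS : R -> R[i]; rS1 : R -> R[i]; rS2 : R -> R[i];
  tt_01 : 0 < tt <= 1;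
  rWh : H20 L rW rW1 rW2; rVh : H20 L rV rV1 rV2; rSh : H2c L rS rS1 rS2;
  rSE : forall t, 0 < t < L -> rS t = (qq t)%:C * rW2 t + (DD t)%:C * rV2 t }.

Implicit Type r : rdata.

(* (rf, rg) = (i om - A) (W, V). *)
Definition rf r t := (0 +i* om r) * rW r t - rV r t.
Definition rf1 r t := (0 +i* om r) * rW1 r t - rV1 r t.
Definition rf2 r t := (0 +i* om r) * rW2 r t - rV2 r t.
Definition rg r t := (0 +i* om r) * rV r t + rS2 r t.

Definition wnorm u v := II 0 L (fun t => qq t * sqmod (u t)) + n2 0 L v.
Definition X r := wnorm (rW2 r) (rV r).
Definition d r := wnorm (rf2 r) (rg r).
(* Every Young inequality below splits with the same weight, so the final estimate follows from a
   bound by [A] with a constant that does not depend on [tt]. *)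
Definition A r := tt r * X r + (tt r)^-1 * d r.

Let Q0 : 0 < Q.
Proof. by have /andP[h1 h2] := qq_b 0; exact: lt_le_trans c00 (le_trans h1 h2). Qed.

Lemma L2c_rW2 r : L2c 0 L (rW2 r). Proof. by case: (rWh r) => -[]. Qed.
Lemma L2c_rV2 r : L2c 0 L (rV2 r). Proof. by case: (rVh r) => -[]. Qed.
Lemma L2c_rS2 r : L2c 0 L (rS2 r). Proof. by case: (rSh r). Qed.
Lemma cac_rW r : cac 0 L (rW r) (rW1 r). Proof. by case: (rWh r) => -[]. Qed.
Lemma cac_rW1 r : cac 0 L (rW1 r) (rW2 r). Proof. by case: (rWh r) => -[]. Qed.
Lemma cac_rV r : cac 0 L (rV r) (rV1 r). Proof. by case: (rVh r) => -[]. Qed.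
Lemma cac_rV1 r : cac 0 L (rV1 r) (rV2 r). Proof. by case: (rVh r) => -[]. Qed.
Lemma cac_rS r : cac 0 L (rS r) (rS1 r). Proof. by case: (rSh r). Qed.
Lemma cac_rS1 r : cac 0 L (rS1 r) (rS2 r). Proof. by case: (rSh r). Qed.
Lemma L2c_rW r : L2c 0 L (rW r). Proof. exact: L2c_cac (ltW L0) (cac_rW r). Qed.
Lemma L2c_rW1 r : L2c 0 L (rW1 r). Proof. exact: L2c_cac (ltW L0) (cac_rW1 r). Qed.
Lemma L2c_rV r : L2c 0 L (rV r). Proof. exact: L2c_cac (ltW L0) (cac_rV r). Qed.
Lemma L2c_rS r : L2c 0 L (rS r). Proof. exact: L2c_cac (ltW L0) (cac_rS r). Qed.

Lemma H20_rf r : H20 L (rf r) (rf1 r) (rf2 r).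
Proof.
have h0 : H20 L (fun=> 0 : R[i]) (fun=> 0) (fun=> 0).
  by split=> //; split; [split; exact: AC_cst (ltW L0)|split; exact: AC_cst (ltW L0)|split; exact: L2_cst].
have h := H20_comb (0 +i* om r) (rWh r) (H20_comb (-1) (rVh r) h0).
by congr H20: h; apply/funext => t; rewrite /rf /rf1 /rf2 mulN1r addr0.
Qed.

Lemma L2c_rf2 r : L2c 0 L (rf2 r). Proof. by case: (H20_rf r) => -[]. Qed.
Lemma cac_rf r : cac 0 L (rf r) (rf1 r). Proof. by case: (H20_rf r) => -[]. Qed.
Lemma cac_rf1 r : cac 0 L (rf1 r) (rf2 r). Proof. by case: (H20_rf r) => -[]. Qed.
Lemma L2c_rf1 r : L2c 0 L (rf1 r). Proof. exact: L2c_cac (ltW L0) (cac_rf1 r). Qed.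
Lemma L2c_rf r : L2c 0 L (rf r). Proof. exact: L2c_cac (ltW L0) (cac_rf r). Qed.
Lemma L2c_rg r : L2c 0 L (rg r). Proof. exact: L2c_comb (L2c_rV r) (L2c_rS2 r). Qed.

Lemma qq_gt0 t : 0 < qq t.
Proof. by have /andP[h _] := qq_b t; exact: lt_le_trans h. Qed.

Let qq_e : ess_bounded 0 L qq := qq_ess c00 mqq qq_b (lexx 0) (lexx L).
Let DD_e : ess_bounded 0 L DD := DD_ess mDD DD_b (lexx 0) (lexx L).

Lemma wnorm_ge0 u v : 0 <= wnorm u v.
Proof.
apply: addr_ge0; last exact: n2_ge0.
by apply: II_ge0 => t _; rewrite mulr_ge0 ?sqmod_ge0 // ltW // qq_gt0.
Qed.

Lemma X_ge0 r : 0 <= X r. Proof. exact: wnorm_ge0. Qed.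
Lemma d_ge0 r : 0 <= d r. Proof. exact: wnorm_ge0. Qed.

Lemma tt_gt0 r : 0 < tt r. Proof. by case/andP: (tt_01 r). Qed.

Lemma d_le_A r : d r <= A r.
Proof.
have /andP[t0 t1] := tt_01 r; rewrite /A.
have h1 : 0 <= tt r * X r by rewrite mulr_ge0 ?X_ge0 // ltW.
have h2 : d r <= (tt r)^-1 * d r by rewrite ler_peMl ?d_ge0 // invf_ge1.
lra.
Qed.

Lemma A_ge0 r : 0 <= A r. Proof. exact: le_trans (d_ge0 r) (d_le_A r). Qed.

Lemma wnorm_n2 u v : L2c 0 L u -> n2 0 L u <= c0^-1 * wnorm u v /\ n2 0 L v <= wnorm u v.
Proof.
move=> hu; have I := L1_HI (sqmod_L1 qq_e hu); split.
  apply: (@le_trans _ _ (c0^-1 * II 0 L (fun t => qq t * sqmod (u t)))).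
    apply: HI_le (n2_HI hu) (HI_scale c0^-1 I) _ => t _ /=.
    rewrite mulrA ler_peMl ?sqmod_ge0 // mulrC ler_pdivlMr // mul1r.
    by case/andP: (qq_b t).
  apply: ler_wpM2l; first by rewrite invr_ge0 ltW.
  by rewrite lerDl n2_ge0.
rewrite lerDr; apply: II_ge0 => t _; by rewrite mulr_ge0 ?sqmod_ge0 // ltW // qq_gt0.
Qed.

Lemma n2_rW2 r : n2 0 L (rW2 r) <= c0^-1 * X r.
Proof. exact: (proj1 (wnorm_n2 _ (L2c_rW2 r))). Qed.
Lemma n2_rV r : n2 0 L (rV r) <= X r.
Proof. exact: (proj2 (wnorm_n2 _ (L2c_rW2 r))). Qed.
Lemma n2_rf2 r : n2 0 L (rf2 r) <= c0^-1 * d r.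
Proof. exact: (proj1 (wnorm_n2 _ (L2c_rf2 r))). Qed.
Lemma n2_rg r : n2 0 L (rg r) <= d r.
Proof. exact: (proj2 (wnorm_n2 _ (L2c_rf2 r))). Qed.

Lemma H20_sup u u1 u2 x : H20 L u u1 u2 -> 0 <= x <= L -> sqmod (u1 x) <= L * n2 0 L u2.
Proof.
move=> [[h1 h2 l2] [_ e _ _]] xL.
by have := sup_n2 xL h2 l2 e; rewrite subr0.
Qed.

Lemma H20_n2_1 u u1 u2 : H20 L u u1 u2 -> n2 0 L u1 <= L ^+ 2 * n2 0 L u2.
Proof.
move=> [[h1 h2 l2] [_ e _ _]].
by have := poincare (ltW L0) h2 l2 e; rewrite subr0.
Qed.

Lemma H20_n2 u u1 u2 : H20 L u u1 u2 -> n2 0 L u <= L ^+ 4 * n2 0 L u2.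
Proof.
move=> h; have h' := H20_n2_1 h; move: h => [[h1 h2 l2] [e _ _ _]].
have l1 := L2c_cac (ltW L0) h2.
have := poincare (ltW L0) h1 l1 e; rewrite subr0 => /le_trans; apply.
have -> : L ^+ 4 = L ^+ 2 * L ^+ 2 by ring.
by rewrite -mulrA; apply: ler_wpM2l; rewrite ?sqr_ge0.
Qed.

(** Cauchy-Schwarz and Young with the weight [tt]: one factor has the size of the solution, the
    other that of the data, and [A] measures the product. *)
Lemma dot_A a b h M C u v r : a <= b -> 0 <= M -> 0 <= C -> L2c a b u -> L2c a b v ->
  ess_bounded a b h -> (forall x, a < x < b -> `|h x| <= M) ->
  n2 a b u <= C * X r -> n2 a b v <= C * d r ->
  `|II a b (fun x => h x * dot (u x) (v x))| <= M * C * A r.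
Proof.
move=> ab M0 C0 hu hv he hM h1 h2.
have := II_dot_le ab (tt_gt0 r) M0 hu hv (dot_L1 he hu hv) hM.
have t0 := tt_gt0 r.
have e1 : tt r * n2 a b u + (tt r)^-1 * n2 a b v <= C * A r.
  rewrite /A mulrDr mulrCA [C * (_ * d r)]mulrCA; apply: lerD; apply: ler_wpM2l => //; first exact: ltW.
  by rewrite invr_ge0 ltW.
have e2 := ler_wpM2l M0 e1.
have e3 : 0 <= M * C * A r by rewrite !mulr_ge0 // A_ge0.
rewrite mulrA in e2; set N := `|_|; have N0 : 0 <= N by exact: normr_ge0.
move=> hh; have := le_trans hh e2; lra.
Qed.

Lemma dot_A1 a b C u v r : a <= b -> 0 <= C -> L2c a b u -> L2c a b v ->
  n2 a b u <= C * X r -> n2 a b v <= C * d r ->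
  `|II a b (fun x => dot (u x) (v x))| <= C * A r.
Proof.
move=> ab C0 hu hv h1 h2.
have := dot_A ab ler01 C0 hu hv (one_ess a b) _ h1 h2; rewrite mul1r.
rewrite (_ : II a b _ = II a b (fun x => dot (u x) (v x))); last by apply: II_eq => x _; rewrite mul1r.
by apply => x _; rewrite normr1.
Qed.

Definition CA : R := 1 + c0^-1.

Lemma CA_bounds : [/\ 0 < CA, 1 <= CA & c0^-1 <= CA].
Proof.
have h : 0 < c0^-1 by rewrite invr_gt0.
by rewrite /CA; split; lra.
Qed.

(** The real part of the inner product of the data [(rf, rg)] with [(W, V)]: the frequency drops out
    and Green's formula leaves the damping. *)
Lemma dissipation r : II 0 L (fun t => DD t * sqmod (rV2 r t)) <= (1 + Q) * CA * A r.
Proof.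
have [C0 C1 C2] := CA_bounds; have LL := ltW L0.
have X0 := X_ge0 r; have d0 := d_ge0 r.
have E : II 0 L (fun t => DD t * sqmod (rV2 r t)) =
  II 0 L (fun t => dot (rV r t) (rg r t)) + II 0 L (fun t => qq t * dot (rW2 r t) (rf2 r t)).
  have [_ [v1 v2 v3 v4]] := rVh r.
  have G := dot_green LL (cac_rS r) (cac_rS1 r) (L2c_rS2 r) (cac_rV r) (cac_rV1 r) (L2c_rV2 r) v1 v2 v3 v4.
  have -> : II 0 L (fun t => dot (rV r t) (rg r t)) = II 0 L (fun t => dot (rS r t) (rV2 r t)).
    rewrite G; apply: II_eq => t _; rewrite /rg /dot !ReImE; ring.
  have [_ <-] := HI_add (dot_HI (L2c_rS r) (L2c_rV2 r)) (L1_HI (dot_L1 qq_e (L2c_rW2 r) (L2c_rf2 r))).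
  apply: II_eq => t tL; rewrite (rSE r tL) /rf2 /dot /sqmod !ReImE; ring.
rewrite E.
have i1 : `|II 0 L (fun t => dot (rV r t) (rg r t))| <= CA * A r.
  apply: dot_A1 => //; [exact: ltW|exact: L2c_rV|exact: L2c_rg| |].
    by apply: le_trans (n2_rV r) _; rewrite ler_peMl.
  by apply: le_trans (n2_rg r) _; rewrite ler_peMl.
have i2 : `|II 0 L (fun t => qq t * dot (rW2 r t) (rf2 r t))| <= Q * CA * A r.
  apply: dot_A => //; [exact: ltW|exact: ltW|exact: L2c_rW2|exact: L2c_rf2| | |].
  - by move=> x _; rewrite gtr0_norm ?qq_gt0 //; case/andP: (qq_b x).
  - by apply: le_trans (n2_rW2 r) _; apply: ler_wpM2r.
  - by apply: le_trans (n2_rf2 r) _; apply: ler_wpM2r.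
have := ler_norm (II 0 L (fun t => dot (rV r t) (rg r t))).
have := ler_norm (II 0 L (fun t => qq t * dot (rW2 r t) (rf2 r t))).
lra.
Qed.

(** Testing the equation with [W] gives the coercive term. Since V = i om W - f, the terms with the
    velocity carry powers of the small [|om|], and Poincare bounds W by its second derivative. *)
Lemma small_frequency : exists o1 C, [/\ 0 < o1, 0 <= C & forall r, `|om r| <= o1 -> X r <= C * A r].
Proof.
have [C0 C1 C2] := CA_bounds; have LL := ltW L0.
have L4 : 0 <= L ^+ 4 by exact: exprn_ge0.
pose C3 := (1 + L ^+ 4) * CA.
have C31 : CA <= C3 by rewrite /C3 ler_peMl ?(ltW C0) // lerDl.
have C30 : 0 < C3 by exact: lt_le_trans C31.
have C3L : L ^+ 4 * c0^-1 <= C3.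
  by rewrite /C3; apply: ler_pM => //; [by rewrite invr_ge0 ltW|rewrite lerDr].
(* The terms proportional to [X] total 3 o1 C3, which has to stay below 1/2. *)
pose o1 := (1 + 6 * C3)^-1.
have o10 : 0 < o1 by rewrite invr_gt0; lra.
have o1C : o1 * (1 + 6 * C3) = 1 by rewrite mulVf // gt_eqF //; lra.
have o11 : o1 <= 1 by nra.
exists o1, (4 * (C3 + Q * CA + C3)); split => //.
  have := mulr_gt0 Q0 C0; lra.
move=> r omr; have X0 := X_ge0 r; have d0 := d_ge0 r.
have nW : n2 0 L (rW r) <= C3 * X r.
  apply: le_trans (H20_n2 (rWh r)) _; apply: le_trans (ler_wpM2l L4 (n2_rW2 r)) _.
  by rewrite mulrA; apply: ler_wpM2r.
have nf : n2 0 L (rf r) <= C3 * d r.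
  apply: le_trans (H20_n2 (H20_rf r)) _; apply: le_trans (ler_wpM2l L4 (n2_rf2 r)) _.
  by rewrite mulrA; apply: ler_wpM2r.
have nV : n2 0 L (rV r) <= C3 * X r.
  by apply: le_trans (n2_rV r) _; rewrite ler_peMl // (le_trans C1).
have ng : n2 0 L (rg r) <= C3 * d r.
  by apply: le_trans (n2_rg r) _; rewrite ler_peMl // (le_trans C1).
have om2 : om r ^+ 2 <= o1.
  rewrite -[om r ^+ 2]ger0_norm ?sqr_ge0 // normrX.
  have := normr_ge0 (om r); nra.
have i0 : n2 0 L (rV r) <= 2 * o1 * C3 * X r + 2 * C3 * A r.
  have h : n2 0 L (rV r) <= (2 * om r ^+ 2) * n2 0 L (rW r) + 2 * n2 0 L (rf r).
    apply: n2_le2; [exact: L2c_rV|exact: L2c_rW|exact: L2c_rf|move=> x _].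
    have -> : rV r x = (0 +i* om r) * rW r x + - rf r x by rewrite /rf opprB addrC subrK.
    by apply: le_trans (sqmodD2 _ _) _; rewrite sqmodI sqmodN mulrA.
  have h1 : om r ^+ 2 * n2 0 L (rW r) <= o1 * (C3 * X r).
    by apply: ler_pM => //; [exact: sqr_ge0|exact: n2_ge0].
  have h2 : C3 * d r <= C3 * A r by apply: ler_wpM2l (d_le_A r); exact: ltW.
  lra.
have E : II 0 L (fun t => qq t * sqmod (rW2 r t)) =
  II 0 L (fun t => dot (rW r t) (rg r t)) + II 0 L (fun t => DD t * dot (rW2 r t) (rf2 r t))
  + om r * II 0 L (fun t => crs (rV r t) (rW r t)).
  have [_ [v1 v2 v3 v4]] := rWh r.
  have G := dot_green LL (cac_rS r) (cac_rS1 r) (L2c_rS2 r) (cac_rW r) (cac_rW1 r) (L2c_rW2 r) v1 v2 v3 v4.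
  have I1 := dot_HI (L2c_rW r) (L2c_rg r); have I2 := HI_scale (om r) (crs_HI (L2c_rV r) (L2c_rW r)).
  have -> : II 0 L (fun t => dot (rW r t) (rg r t)) + II 0 L (fun t => DD t * dot (rW2 r t) (rf2 r t))
  + om r * II 0 L (fun t => crs (rV r t) (rW r t)) = II 0 L (fun t => dot (rS r t) (rW2 r t)) + II 0 L (fun t => DD t * dot (rW2 r t) (rf2 r t)).
    rewrite addrAC G; congr (_ + _); have [_ <-] := HI_add I1 I2.
    by apply: II_eq => t _; rewrite /rg /dot /crs !ReImE; ring.
  have [_ <-] := HI_add (dot_HI (L2c_rS r) (L2c_rW2 r)) (L1_HI (dot_L1 DD_e (L2c_rW2 r) (L2c_rf2 r))).
  by apply: II_eq => t tL; rewrite (rSE r tL) /rf2 /dot /sqmod !ReImE; ring.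
have i1 : `|II 0 L (fun t => dot (rW r t) (rg r t))| <= C3 * A r.
  by apply: dot_A1 => //; [exact: ltW|exact: L2c_rW|exact: L2c_rg].
have i2 : `|II 0 L (fun t => DD t * dot (rW2 r t) (rf2 r t))| <= Q * CA * A r.
  apply: dot_A => //; [exact: ltW|exact: ltW|exact: L2c_rW2|exact: L2c_rf2| | |].
  - by move=> x _; case/andP: (DD_b x) => h1 h2; rewrite ger0_norm.
  - by apply: le_trans (n2_rW2 r) _; apply: ler_wpM2r.
  - by apply: le_trans (n2_rf2 r) _; apply: ler_wpM2r.
have i3 : `|om r * II 0 L (fun t => crs (rV r t) (rW r t))| <= o1 * (C3 * X r).
  rewrite normrM; apply: ler_pM => //.
  have := II_crs_le LL ltr01 (L2c_rV r) (L2c_rW r).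
  rewrite invr1 !mul1r => h; lra.
have j1 := ler_norm (II 0 L (fun t => dot (rW r t) (rg r t))).
have j2 := ler_norm (II 0 L (fun t => DD t * dot (rW2 r t) (rf2 r t))).
have j3 := ler_norm (om r * II 0 L (fun t => crs (rV r t) (rW r t))).
have EX : X r = II 0 L (fun t => qq t * sqmod (rW2 r t)) + n2 0 L (rV r) by [].
have key : X r <= (C3 + Q * CA + 2 * C3) * A r + 3 * o1 * C3 * X r by rewrite {1}EX E; lra.
have o3 : 3 * o1 * C3 <= 2^-1 by lra.
have := ler_wpM2r X0 o3.
have : 0 <= Q * CA * A r by rewrite !mulr_ge0 ?A_ge0 // ltW.
have : 0 <= C3 * A r by rewrite mulr_ge0 ?A_ge0 // ltW.
lra.
Qed.

Lemma n2_sub a b u : 0 <= a -> a <= b -> b <= L -> L2c 0 L u -> n2 a b u <= n2 0 L u.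
Proof. by move=> h1 h2 h3; exact: n2S. Qed.

Lemma II_sub a b h : 0 <= a -> a <= b -> b <= L -> L1 0 L h -> (forall x, 0 < x < L -> 0 <= h x) ->
  II a b h <= II 0 L h.
Proof.
move=> a0 ab bL I h0.
have aL := le_trans ab bL; have b0 := le_trans a0 ab.
rewrite (II_cat a0 aL I) (II_cat ab bL (L1S a0 (lexx L) I)).
have g1 : 0 <= II 0 a h by apply: II_ge0 => x /andP[x0 xa]; apply: h0; rewrite x0 (lt_le_trans xa).
have g2 : 0 <= II b L h by apply: II_ge0 => x /andP[x0 xa]; apply: h0; rewrite xa (le_lt_trans b0).
lra.
Qed.

(** * High frequencies: estimates in the damped interval *)

Section HighFrequency.
Variables (al be k1 : R).
Hypotheses (al0 : 0 <= al) (albe : al < be) (beL : be < L) (k10 : 0 < k1) (k11 : k1 <= 1).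
Hypotheses (DD_pos : forall t, al < t < be -> c0 <= DD t).

Definition kk r := Num.sqrt (Num.sqrt `|om r|).
Definition hi r := k1 <= kk r.
(** This is [|om|] times |v|^2 over the damped interval, the quantity that the flux identity
    produces and that is to be bounded by [A]. *)
Definition zz r := kk r ^+ 4 * n2 al be (rV r).

Let al_be := ltW albe.
Let be_L := ltW beL.
Let Ls u : L2c 0 L u -> L2c al be u. Proof. exact: L2cS. Qed.

Lemma kk4 r : kk r ^+ 4 = `|om r|.
Proof. by rewrite (exprM _ 2 2) /kk !sqr_sqrtr ?sqrtr_ge0 //. Qed.

Lemma om2 r : om r ^+ 2 = kk r ^+ 8.
Proof. by rewrite (exprM _ 4 2) kk4 real_normK ?num_real. Qed.

Lemma kk0 r : hi r -> 0 < kk r. Proof. exact: lt_le_trans. Qed.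

Lemma kkV r n : hi r -> (kk r ^+ n)^-1 <= (k1 ^+ n)^-1.
Proof.
move=> h; have k0 := kk0 h; rewrite lef_pV2 ?posrE ?exprn_gt0 //.
by apply: lerXn2r => //; rewrite nnegrE ltW.
Qed.

Lemma zz_ge0 r : 0 <= zz r.
Proof. by rewrite /zz mulr_ge0 ?n2_ge0 // exprn_ge0 // sqrtr_ge0. Qed.

Definition CV := c0^-1 * ((1 + Q) * CA).

Lemma CV0 : 0 < CV.
Proof.
have [h _ _] := CA_bounds.
by apply: mulr_gt0; [rewrite invr_gt0|apply: mulr_gt0 => //; exact: addr_gt0].
Qed.

Lemma damped_V2 r : n2 al be (rV2 r) <= CV * A r.
Proof.
have I := sqmod_L1 DD_e (L2c_rV2 r).
have I' := L1S al0 be_L I.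
rewrite /CV -mulrA; apply: (@le_trans _ _ (c0^-1 * II al be (fun t => DD t * sqmod (rV2 r t)))).
  apply: HI_le (n2_HI (Ls (L2c_rV2 r))) (HI_scale c0^-1 (L1_HI I')) _ => t tt /=.
  by rewrite mulrA ler_peMl ?sqmod_ge0 // mulrC ler_pdivlMr // mul1r DD_pos.
apply: ler_wpM2l; first by rewrite invr_ge0 ltW.
apply: le_trans (dissipation r); apply: II_sub => // x _.
by rewrite mulr_ge0 ?sqmod_ge0 //; case/andP: (DD_b x).
Qed.

(** From i om w'' = v'' + f'', divided by om^2 >= k1^8. *)
Lemma W2_rf2 r t : hi r -> sqmod (rW2 r t) <= 2 * (k1 ^+ 8)^-1 * sqmod (rV2 r t) + 2 * (k1 ^+ 8)^-1 * sqmod (rf2 r t).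
Proof.
move=> h; have k0 := exprn_gt0 8 (kk0 h); have := kkV 8 h; set K := (k1 ^+ 8)^-1 => hK.
have e : kk r ^+ 8 * sqmod (rW2 r t) <= 2 * sqmod (rV2 r t) + 2 * sqmod (rf2 r t).
  by rewrite -om2 -sqmodI -(subrK (rV2 r t) (_ * rW2 r t)) addrC; exact: sqmodD2.
have e2 : sqmod (rW2 r t) <= (kk r ^+ 8)^-1 * (2 * sqmod (rV2 r t) + 2 * sqmod (rf2 r t)).
  by rewrite ler_pdivlMl.
apply: le_trans e2 _; have := sqmod_ge0 (rV2 r t); have := sqmod_ge0 (rf2 r t) => s1 s2.
have s3 : 0 <= 2 * sqmod (rV2 r t) + 2 * sqmod (rf2 r t) by lra.
have := ler_wpM2r s3 hK; lra.
Qed.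

Lemma W1_rf1 r t : hi r -> kk r ^+ 8 * sqmod (rW1 r t) <= 2 * sqmod (rV1 r t) + 2 * sqmod (rf1 r t).
Proof.
by move=> h; rewrite -om2 -sqmodI -(subrK (rV1 r t) (_ * rW1 r t)) addrC; exact: sqmodD2.
Qed.

Definition K8 := (k1 ^+ 8)^-1.
Lemma K8_gt0 : 0 < K8. Proof. by rewrite invr_gt0 exprn_gt0. Qed.

Lemma rf2_sub r : n2 al be (rf2 r) <= c0^-1 * A r.
Proof.
apply: le_trans (n2_sub al0 al_be be_L (L2c_rf2 r)) _; apply: le_trans (n2_rf2 r) _.
by apply: ler_wpM2l (d_le_A r); rewrite invr_ge0 ltW.
Qed.

Lemma rg_sub r : n2 al be (rg r) <= d r.
Proof. exact: le_trans (n2_sub al0 al_be be_L (L2c_rg r)) (n2_rg r). Qed.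

Lemma damped_W2 : exists2 C, 0 <= C & forall r, hi r -> n2 al be (rW2 r) <= C * A r.
Proof.
have k8 := K8_gt0; have cv := CV0.
have ci : 0 < c0^-1 by rewrite invr_gt0.
exists (2 * K8 * CV + 2 * K8 * c0^-1).
  by have := mulr_gt0 k8 cv; have := mulr_gt0 k8 ci; lra.
move=> r h.
have := n2_le2 (Ls (L2c_rW2 r)) (Ls (L2c_rV2 r)) (Ls (L2c_rf2 r)) (fun t _ => W2_rf2 t h).
rewrite -/K8 => hh; apply: le_trans hh _.
have := ler_wpM2l (ltW k8) (damped_V2 r); have := ler_wpM2l (ltW k8) (rf2_sub r); lra.
Qed.

Lemma damped_S : exists2 C, 0 <= C & forall r, hi r -> n2 al be (rS r) <= C * A r.
Proof.
have [C C0 HC] := damped_W2; have cv := CV0.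
exists (2 * Q ^+ 2 * C + 2 * Q ^+ 2 * CV).
  by have := mulr_ge0 (sqr_ge0 Q) C0; have := mulr_ge0 (sqr_ge0 Q) (ltW cv); lra.
move=> r h.
have e t : al < t < be -> sqmod (rS r t) <= 2 * Q ^+ 2 * sqmod (rW2 r t) + 2 * Q ^+ 2 * sqmod (rV2 r t).
  move=> /andP[t1 t2]; rewrite rSE; last by rewrite (le_lt_trans al0) ?(lt_trans t2).
  apply: le_trans (sqmodD2 _ _) _; rewrite !sqmodZ.
  have /andP[q1 q2] := qq_b t; have /andP[d1 d2] := DD_b t.
  have a1 : qq t ^+ 2 <= Q ^+ 2 by rewrite ler_sqr ?nnegrE ?(ltW (qq_gt0 t)) ?(ltW Q0).
  have a2 : DD t ^+ 2 <= Q ^+ 2 by rewrite ler_sqr ?nnegrE ?(ltW Q0).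
  have b1 := ler_wpM2r (sqmod_ge0 (rW2 r t)) a1; have b2 := ler_wpM2r (sqmod_ge0 (rV2 r t)) a2.
  lra.
have := n2_le2 (Ls (L2c_rS r)) (Ls (L2c_rW2 r)) (Ls (L2c_rV2 r)) e.
have h1 := HC r h; have h2 := damped_V2 r.
have Q2 : 0 <= 2 * Q ^+ 2 by rewrite mulr_ge0 ?sqr_ge0.
have := ler_wpM2l Q2 h1; have := ler_wpM2l Q2 h2; lra.
Qed.

Definition is_end (e : R) := e = al \/ e = be.

(** Interpolation on the subinterval of length [eta] adjacent to [e]; its norms are then enlarged to
    the whole damped interval. *)
Lemma end_interp e eta u u1 u2 : is_end e -> 0 < eta -> eta <= be - al ->
  cac 0 L u u1 -> cac 0 L u1 u2 -> L2c 0 L u2 ->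
  sqmod (u1 e) <= 2 * eta * n2 al be u2 + 72 * (eta ^+ 3)^-1 * n2 al be u /\
  sqmod (u e) <= 2 * eta ^+ 3 * n2 al be u2 + 32 * eta^-1 * n2 al be u.
Proof.
move=> he e0 eta_le h1 h2 l2; have lu := L2c_cac (ltW L0) h1.
have gen a b s p : al <= a -> a < b -> b <= be -> b - a = eta -> endpoints a b p e s ->
    sqmod (u1 e) <= 2 * eta * n2 al be u2 + 72 * (eta ^+ 3)^-1 * n2 al be u /\
    sqmod (u e) <= 2 * eta ^+ 3 * n2 al be u2 + 32 * eta^-1 * n2 al be u.
  move=> aa ab bb be_eta pe; have a0 := le_trans al0 aa; have bL := le_trans bb be_L.
  have [] := endpoint_interpolation_c ab pe (cacS a0 bL h1) (cacS a0 bL h2) (L2cS a0 bL l2).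
  rewrite be_eta; have m1 := n2S aa (ltW ab) bb (Ls l2); have m2 := n2S aa (ltW ab) bb (Ls lu).
  have e3 := exprn_gt0 3 e0; have e4 : 0 < (eta ^+ 3)^-1 by rewrite invr_gt0.
  have e5 : 0 < eta^-1 by rewrite invr_gt0.
  have w1 := ler_wpM2l (ltW e0) m1; have w2 := ler_wpM2l (ltW e4) m2.
  have w3 := ler_wpM2l (ltW e3) m1; have w4 := ler_wpM2l (ltW e5) m2.
  move=> i1 i2; split; [apply: (le_trans i1)|apply: (le_trans i2)];
  by apply: lerD; rewrite -[leLHS]mulrA -[leRHS]mulrA ler_wpM2l.
case: he => ee.
  apply: (gen al (al + eta) (- (al + eta - al)^-1) (al + eta)); rewrite ?lexx //; [lra|lra|ring|].
  by right; rewrite ee.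
apply: (gen (be - eta) be (be - (be - eta))^-1 (be - eta)); rewrite ?lexx //; [lra|lra|ring|].
by left; rewrite ee.
Qed.

(** At the length th / k, the weights k and k^3 turn both interpolation inequalities into
    combinations of N2 and k^4 N0. *)
Lemma end_scaled (th k x1 x0 N2 N0 : R) : 0 < th -> 0 < k ->
  x1 <= 2 * (th / k) * N2 + 72 * ((th / k) ^+ 3)^-1 * N0 ->
  x0 <= 2 * (th / k) ^+ 3 * N2 + 32 * (th / k)^-1 * N0 ->
  k * x1 <= 2 * th * N2 + 72 * (th ^+ 3)^-1 * (k ^+ 4 * N0) /\
  k ^+ 3 * x0 <= 2 * th ^+ 3 * N2 + 32 * th^-1 * (k ^+ 4 * N0).
Proof.
move=> th0 kp h1 h2; have tn : th != 0 by rewrite gt_eqF.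
have kn : k != 0 by rewrite gt_eqF.
split.
  apply: le_trans (ler_wpM2l (ltW kp) h1) _; rewrite le_eqVlt; apply/orP; left; apply/eqP; field.
  by rewrite tn kn.
apply: le_trans (ler_wpM2l (ltW (exprn_gt0 3 kp)) h2) _; rewrite le_eqVlt; apply/orP; left; apply/eqP; field.
by rewrite tn kn.
Qed.

(** Chosen so that the length th0 / k fits into the damped interval for every k >= k1, and so that
    th0 <= 1. *)
Definition th0 := k1 * Num.min 1 (be - al).

Lemma th0_gt0 : 0 < th0.
Proof. by rewrite mulr_gt0 // lt_min ltr01 subr_gt0. Qed.

Lemma th0_le1 : th0 <= 1.
Proof.
have h : Num.min 1 (be - al) <= 1 by rewrite ge_min lexx.
have h' : 0 < Num.min 1 (be - al) by rewrite lt_min ltr01 subr_gt0.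
by rewrite /th0 mulr_ile1 // ltW.
Qed.

Lemma th0_kk r th : hi r -> th <= th0 -> th / kk r <= be - al.
Proof.
move=> h tl; have k0 := kk0 h; rewrite ler_pdivrMr //; apply: le_trans tl _; rewrite /th0 mulrC.
apply: ler_pM => //; [by rewrite le_min ler01 subr_ge0 al_be|exact: ltW|by rewrite ge_min lexx orbT].
Qed.

Lemma V_end : exists2 C, 0 <= C & forall r e, hi r -> is_end e ->
  kk r * sqmod (rV1 r e) <= C * (A r + zz r) /\ kk r ^+ 3 * sqmod (rV r e) <= C * (A r + zz r).
Proof.
have t0 := th0_gt0; have t1 := th0_le1; have cv := CV0.
have t3 : 0 < (th0 ^+ 3)^-1 by rewrite invr_gt0 exprn_gt0.
have t5 : 0 < th0^-1 by rewrite invr_gt0.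
have t6 : th0 ^+ 3 <= 1 by exact: exprn_ile1 (ltW t0) t1.
have t7 := exprn_gt0 3 t0.
exists (2 * CV + 72 * (th0 ^+ 3)^-1 + 32 * th0^-1); first lra.
move=> r e h he; have k0 := kk0 h; have hA := A_ge0 r; have hz := zz_ge0 r.
have [i1 i2] := end_interp he (divr_gt0 t0 k0) (th0_kk h (lexx _)) (cac_rV r) (cac_rV1 r) (L2c_rV2 r).
have [] := end_scaled t0 k0 i1 i2; rewrite -/(zz r); have v2 := damped_V2 r.
have nv := n2_ge0 al be (rV2 r).
have f1 : th0 * n2 al be (rV2 r) <= CV * A r by apply: le_trans v2; rewrite ler_piMl.
have f2 : th0 ^+ 3 * n2 al be (rV2 r) <= CV * A r by apply: le_trans v2; rewrite ler_piMl.
have f3 : 0 <= (th0 ^+ 3)^-1 * A r by rewrite mulr_ge0 // ltW.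
have f4 : 0 <= th0^-1 * A r by rewrite mulr_ge0 // ltW.
have f5 : 0 <= CV * zz r by rewrite mulr_ge0 // ltW.
have f6 : 0 <= (th0 ^+ 3)^-1 * zz r by rewrite mulr_ge0 // ltW.
have f7 : 0 <= th0^-1 * zz r by rewrite mulr_ge0 // ltW.
have f8 : 0 <= CV * A r by rewrite mulr_ge0 // ltW.
by move=> j1 j2; split; lra.
Qed.

(** S'' = g - i om v, and om^2 = k^8 makes the velocity contribute k^4 zz. *)
Lemma S2_end r : hi r -> n2 al be (rS2 r) <= kk r ^+ 4 * (2 * (k1 ^+ 4)^-1 * d r + 2 * zz r).
Proof.
move=> h; have k0 := kk0 h.
have e t : al < t < be -> sqmod (rS2 r t) <= 2 * sqmod (rg r t) + 2 * kk r ^+ 8 * sqmod (rV r t).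
  move=> _; have -> : rS2 r t = rg r t + - ((0 +i* om r) * rV r t) by rewrite /rg addrC addrA addNr add0r.
  by apply: le_trans (sqmodD2 _ _) _; rewrite sqmodN sqmodI om2 mulrA.
have := n2_le2 (Ls (L2c_rS2 r)) (Ls (L2c_rg r)) (Ls (L2c_rV r)) e.
have hg := rg_sub r; have d0 := d_ge0 r.
have e4 : 1 <= kk r ^+ 4 * (k1 ^+ 4)^-1.
  by rewrite ler_pdivlMr ?exprn_gt0 // mul1r; apply: lerXn2r => //; rewrite nnegrE ltW.
have := ler_wpM2r d0 e4; rewrite /zz (_ : kk r ^+ 8 = kk r ^+ 4 * kk r ^+ 4); last by ring.
lra.
Qed.

(** The length th / k is kept free: zz enters only through S'' and carries the small factor th,
    while the large powers of 1 / th multiply |S|^2, which [A] already bounds. The small factor lets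
    [zz_le] absorb zz. *)
Lemma S_end th : 0 < th -> th <= th0 -> exists2 C, 0 <= C & forall r e, hi r -> is_end e ->
  kk r * sqmod (rS1 r e) <= kk r ^+ 4 * (4 * th * zz r + C * A r) /\
  kk r ^+ 3 * sqmod (rS r e) <= kk r ^+ 4 * (4 * th * zz r + C * A r).
Proof.
move=> t0 tl; have [C C0 HC] := damped_S; have t1 := le_trans tl th0_le1.
have t3 : 0 < (th ^+ 3)^-1 by rewrite invr_gt0 exprn_gt0.
have t5 : 0 < th^-1 by rewrite invr_gt0.
have t7 := exprn_gt0 3 t0.
have t6 : th ^+ 3 <= th by rewrite exprSr ler_piMl ?(ltW t0) // exprn_ile1 // ltW.
have k4 : 0 < (k1 ^+ 4)^-1 by rewrite invr_gt0 exprn_gt0.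
have g1 : 0 <= (th ^+ 3)^-1 * C by rewrite mulr_ge0 // ltW.
have g2 : 0 <= th^-1 * C by rewrite mulr_ge0 // ltW.
exists (4 * (k1 ^+ 4)^-1 + 72 * (th ^+ 3)^-1 * C + 32 * th^-1 * C); first lra.
move=> r e h he; have k0 := kk0 h; have hA := A_ge0 r; have hz := zz_ge0 r; have k40 := exprn_gt0 4 k0.
have [i1 i2] := end_interp he (divr_gt0 t0 k0) (th0_kk h tl) (cac_rS r) (cac_rS1 r) (L2c_rS2 r).
have [] := end_scaled t0 k0 i1 i2; have s2 := S2_end h; have s0 := HC r h; have dA := d_le_A r; have d0 := d_ge0 r.
set K4 := kk r ^+ 4 in k40 s2 *; set k4' := (k1 ^+ 4)^-1 in k4 s2 *; set t3' := (th ^+ 3)^-1 in t3 g1 *.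
set B := 2 * k4' * d r + 2 * zz r in s2.
have B0 : 0 <= k4' * d r by rewrite mulr_ge0 // ltW.
have B1 : k4' * d r <= k4' * A r by rewrite ler_wpM2l // ltW.
have B2 : 0 <= B by rewrite /B; lra.
have n2s := n2_ge0 al be (rS2 r).
have f1 : th * n2 al be (rS2 r) <= K4 * (th * B) by rewrite mulrCA ler_wpM2l // ltW.
have f2 : th ^+ 3 * n2 al be (rS2 r) <= K4 * (th * B).
  by apply: le_trans f1; rewrite ler_wpM2r.
have tB : th * B <= 2 * k4' * A r + 2 * th * zz r.
  have : th * (k4' * d r) <= k4' * d r by rewrite ler_piMl.
  by rewrite /B; lra.
have f3 := ler_wpM2l (ltW k40) tB.
have f4 : t3' * (K4 * n2 al be (rS r)) <= K4 * (t3' * (C * A r)).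
  by rewrite mulrCA ler_wpM2l ?(ltW k40) // ler_wpM2l // ltW.
have f5 : th^-1 * (K4 * n2 al be (rS r)) <= K4 * (th^-1 * (C * A r)).
  by rewrite mulrCA ler_wpM2l ?(ltW k40) // ler_wpM2l // ltW.
have f6 : 0 <= K4 * (t3' * (C * A r)) by rewrite mulr_ge0 ?(ltW k40) // mulrA mulr_ge0.
have f7 : 0 <= K4 * (th^-1 * (C * A r)) by rewrite mulr_ge0 ?(ltW k40) // mulrA mulr_ge0.
have f8 : 0 <= K4 * (k4' * A r) by rewrite mulr_ge0 ?(ltW k40) // mulr_ge0 // ltW.
move: f1 f2 f3 f4 f5 f6 f7; move: (_ * B) f8 => tb f8 f1 f2 f3 f4 f5 f6 f7 j1 j2.
by split; [apply: le_trans j1 _|apply: le_trans j2 _]; clear i1 i2 s2 s0 dA d0 B0 B1 B2 n2s tB HC; lra.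
Qed.

Lemma crs_weighted (ta m B E : R) (z z' : R[i]) : 0 < ta -> 0 < m -> sqmod z <= m * B ->
  m * sqmod z' <= E -> 2 * `|crs z z'| <= ta^-1 * B + ta * E.
Proof.
move=> t0 m0 h1 h2; have tm : 0 < (ta * m)^-1 by rewrite invr_gt0 mulr_gt0.
apply: le_trans (crs_le z z' tm) _; rewrite invrK; apply: lerD.
  have -> : ta^-1 * B = (ta * m)^-1 * (m * B) by field; rewrite !gt_eqF.
  by rewrite ler_wpM2l // ltW.
by rewrite -mulrA ler_wpM2l // ltW.
Qed.

(* Integrate the derivative of Im (S1 V^* - S V1^* ). *)
Lemma zz_flux r : zz r <= `|II al be (fun t => crs (rg r t) (rV r t))| +
  `|II al be (fun t => crs (rS r t) (rV2 r t))| +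
  (`|crs (rS1 r be) (rV r be)| + `|crs (rS r be) (rV1 r be)| +
   (`|crs (rS1 r al) (rV r al)| + `|crs (rS r al) (rV1 r al)|)).
Proof.
have res u u1 : cac 0 L u u1 -> cac al be u u1 by exact: cacS.
have H := AC_HI al_be (AC_sub (AC_crs al_be (res _ _ (cac_rS1 r)) (res _ _ (cac_rV r)))
  (AC_crs al_be (res _ _ (cac_rS r)) (res _ _ (cac_rV1 r)))).
have H2 := HI_sub (HI_sub (crs_HI (Ls (L2c_rg r)) (Ls (L2c_rV r))) (HI_scale (om r) (n2_HI (Ls (L2c_rV r)))))
  (crs_HI (Ls (L2c_rS r)) (Ls (L2c_rV2 r))).
case: H => _ E; case: H2 => _ E2.
have {}E := etrans (esym E) (etrans (II_eq _) E2).
rewrite /zz kk4 -[X in _ * X]ger0_norm ?n2_ge0 // -normrM.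
set I1 := II _ _ _ in E *; set I2 := II _ _ _ in E *.
set p1 := crs (rS1 r be) _ in E *; set p2 := crs _ _ in E *; set p3 := crs _ _ in E *; set p4 := crs _ _ in E *.
have -> : om r * n2 al be (rV r) = I1 - I2 - (p1 - p2 - (p3 - p4)).
  rewrite E; first by ring.
  by move=> t _; rewrite /rg /crs /sqmod !ReImE; ring.
apply: le_trans (ler_normB _ _) _; apply: lerD; first exact: ler_normB.
by apply: le_trans (ler_normB _ _) _; apply: lerD; exact: ler_normB.
Qed.

(** The boundary products pair S' with v and S with v', and the powers of k cancel in each pair.
    Weighted Young inequalities leave small multiples of zz on the right, which are absorbed. *)
Lemma zz_le : exists2 C, 0 <= C & forall r, hi r -> zz r <= C * A r.
Proof.
have [Cv Cv0 HV] := V_end; have [Cs Cs0 HS] := damped_S.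
(* Per endpoint, [ta] leaves zz / 8 from the velocity and [th] leaves zz / 8 from S; the two
   endpoints total zz / 2. *)
pose ta := (8 * Cv + 8)^-1.
have ta0 : 0 < ta by rewrite invr_gt0; lra.
have tav : ta * (8 * Cv + 8) = 1 by rewrite mulVf // gt_eqF //; lra.
have taC : ta * Cv <= 8^-1 by lra.
pose th := Num.min (ta / 32) th0.
have th_0 : 0 < th by rewrite lt_min th0_gt0 divr_gt0.
have th_1 : th <= th0 by rewrite ge_min lexx orbT.
have th_2 : th <= ta / 32 by rewrite ge_min lexx.
have [Ct Ct0 HT] := S_end th_0 th_1.
have tai : 0 < ta^-1 by rewrite invr_gt0.
have tat : ta^-1 * th <= 32^-1 by rewrite mulrC ler_pdivrMr // mulrC.
have cv := CV0; have [Ca0 Ca1 Ca2] := CA_bounds.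
exists (4 * (1 + Cs + CV + ta^-1 * Ct + 1)).
  by have := mulr_ge0 (ltW tai) Ct0; lra.
move=> r h; have k0 := kk0 h; have hA := A_ge0 r; have hz := zz_ge0 r.
have pt e : is_end e -> `|crs (rS1 r e) (rV r e)| + `|crs (rS r e) (rV1 r e)| <=
    ta^-1 * (4 * th * zz r + Ct * A r) + ta * (Cv * (A r + zz r)).
  move=> he; have [v1 v0] := HV r e h he; have [s1 s0] := HT r e h he.
  have k3 := exprn_gt0 3 k0.
  have s1' : sqmod (rS1 r e) <= kk r ^+ 3 * (4 * th * zz r + Ct * A r).
    by rewrite -(ler_pM2l k0) mulrA -exprS.
  have s0' : sqmod (rS r e) <= kk r * (4 * th * zz r + Ct * A r).
    by rewrite -(ler_pM2l k3) mulrA -exprSr.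
  have := crs_weighted ta0 k3 s1' v0; have := crs_weighted ta0 k0 s0' v1; lra.
have p1 := pt _ (or_introl erefl); have p2 := pt _ (or_intror erefl).
have i1 := II_crs_le al_be ltr01 (Ls (L2c_rg r)) (Ls (L2c_rV r)).
have i2 := II_crs_le al_be ltr01 (Ls (L2c_rS r)) (Ls (L2c_rV2 r)).
have i1' : `|II al be (fun t => crs (rg r t) (rV r t))| <= A r.
  have t0 := tt_gt0 r; have ti : 0 < (tt r)^-1 by rewrite invr_gt0.
  have := II_crs_le al_be ti (Ls (L2c_rg r)) (Ls (L2c_rV r)); rewrite invrK.
  have := ler_wpM2l (ltW ti) (rg_sub r).
  have := ler_wpM2l (ltW t0) (le_trans (n2_sub al0 al_be be_L (L2c_rV r)) (n2_rV r)).
  move: hA; rewrite /A; lra.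
have i3 := HS r h; have i4 := damped_V2 r.
rewrite invr1 !mul1r in i2.
have q1 : ta^-1 * (4 * th * zz r + Ct * A r) <= 8^-1 * zz r + ta^-1 * Ct * A r.
  have := ler_wpM2r hz tat; lra.
have q2 : ta * (Cv * (A r + zz r)) <= 8^-1 * zz r + 8^-1 * A r.
  by have := ler_wpM2r hz taC; have := ler_wpM2r hA taC; lra.
have := zz_flux r.
set x1 := `|II _ _ _| in i1' *; set x2 := `|II _ _ _| in i2 *.
set P1 := _ + _ in p1; set P2 := _ + _ in p2; rewrite -/P1 -/P2 => hh.
have : 0 <= Cs * A r by exact: mulr_ge0.
have : 0 <= CV * A r by apply: mulr_ge0 => //; exact: ltW.
have : 0 <= ta^-1 * Ct * A r by rewrite !mulr_ge0 // ltW.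
lra.
Qed.

(** Consequences of the bound of zz by [A]. The factor k in the bound of |S|^2 is the loss that the
    undamped side has to repair. *)
Lemma ends : exists2 C, 0 <= C & forall r, hi r -> n2 al be (rV r) <= C * A r /\
  forall e, is_end e -> [/\ sqmod (rS1 r e) <= kk r ^+ 3 * (C * A r), sqmod (rS r e) <= kk r * (C * A r),
    sqmod (rV r e) <= C * A r, sqmod (rV1 r e) <= C * A r & kk r ^+ 8 * sqmod (rW1 r e) <= C * A r].
Proof.
have [Cz Cz0 HZ] := zz_le; have [Cv Cv0 HV] := V_end; have [Ct Ct0 HT] := S_end th0_gt0 (lexx _).
have kn n : 0 < (k1 ^+ n)^-1 by rewrite invr_gt0 exprn_gt0.
have t1 := th0_le1; have t0 := th0_gt0; have ci : 0 < c0^-1 by rewrite invr_gt0.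
pose C1 := (k1 ^+ 4)^-1 * Cz; pose C2 := 4 * Cz + Ct; pose C3 := (k1 ^+ 3)^-1 * (Cv * (1 + Cz)).
pose C4 := (k1 ^+ 1)^-1 * (Cv * (1 + Cz)); pose C5 := 2 * (L * c0^-1).
have C10 : 0 <= C1 by rewrite mulr_ge0 // ltW.
have C20 : 0 <= C2 by rewrite /C2; lra.
have C30 : 0 <= C3 by rewrite mulr_ge0 ?mulr_ge0 ?(ltW (kn _)) //; lra.
have C40 : 0 <= C4 by rewrite mulr_ge0 ?mulr_ge0 ?(ltW (kn _)) //; lra.
have C50 : 0 <= C5 by rewrite !mulr_ge0 // ltW.
exists (C1 + C2 + C3 + 3 * C4 + C5); first lra.
move=> r h; have k0 := kk0 h; have hA := A_ge0 r; have hz := zz_ge0 r; have Z := HZ r h.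
have A1 : 0 <= C1 * A r by exact: mulr_ge0.
have A2 : 0 <= C2 * A r by exact: mulr_ge0.
have A3 : 0 <= C3 * A r by exact: mulr_ge0.
have A4 : 0 <= C4 * A r by exact: mulr_ge0.
have A5 : 0 <= C5 * A r by exact: mulr_ge0.
have w : Cv * (A r + zz r) <= Cv * (1 + Cz) * A r by have := ler_wpM2l Cv0 Z; lra.
have w0 : 0 <= Cv * (1 + Cz) * A r by rewrite !mulr_ge0 //; lra.
split.
  apply: (@le_trans _ _ (C1 * A r)); last lra.
  apply: (@le_trans _ _ ((kk r ^+ 4)^-1 * zz r)).
    by rewrite /zz mulKf // gt_eqF // exprn_gt0.
  rewrite /C1 -mulrA; apply: ler_pM => //; [by rewrite invr_ge0 exprn_ge0 // ltW|exact: kkV].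
move=> e he; have [v1 v0] := HV r e h he; have [s1 s0] := HT r e h he.
have k3 := exprn_gt0 3 k0.
have sB : 4 * th0 * zz r + Ct * A r <= C2 * A r.
  by have : th0 * zz r <= zz r; [rewrite ler_piMl|rewrite /C2; lra].
have V1b : sqmod (rV1 r e) <= C4 * A r.
  apply: (@le_trans _ _ ((kk r ^+ 1)^-1 * (Cv * (A r + zz r)))).
    by rewrite ler_pdivlMl ?exprn_gt0 // expr1.
  rewrite /C4 -mulrA; apply: ler_pM => //; [by rewrite invr_ge0 exprn_ge0 // ltW|by rewrite mulr_ge0 // addr_ge0|exact: kkV].
have CC : C2 * A r <= (C1 + C2 + C3 + 3 * C4 + C5) * A r by lra.
split.
- apply: le_trans (ler_wpM2l (ltW k3) CC).
  by rewrite -(ler_pM2l k0) mulrA -exprS; apply: le_trans s1 _; rewrite ler_wpM2l // exprn_ge0 // ltW.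
- apply: le_trans (ler_wpM2l (ltW k0) CC).
  by rewrite -(ler_pM2l k3) mulrA -exprSr; apply: le_trans s0 _; rewrite ler_wpM2l // exprn_ge0 // ltW.
- apply: (@le_trans _ _ (C3 * A r)); last lra.
  apply: (@le_trans _ _ ((kk r ^+ 3)^-1 * (Cv * (A r + zz r)))).
    by rewrite ler_pdivlMl ?exprn_gt0.
  rewrite /C3 -mulrA; apply: ler_pM => //; [by rewrite invr_ge0 exprn_ge0 // ltW|by rewrite mulr_ge0 // addr_ge0|exact: kkV].
- by apply: le_trans V1b _; lra.
- apply: le_trans (W1_rf1 e h) _.
  have eL : 0 <= e <= L.
    by case: he => ->; rewrite ?al0 ?be_L ?(le_trans al0 al_be) ?(le_trans al_be be_L).
  have f1 : sqmod (rf1 r e) <= L * c0^-1 * A r.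
    apply: le_trans (H20_sup (H20_rf r) eL) _; rewrite -mulrA; apply: ler_wpM2l; first exact: ltW.
    by apply: le_trans (n2_rf2 r) _; apply: ler_wpM2l (d_le_A r); exact: ltW.
  by rewrite /C5 in A5 *; lra.
Qed.

Lemma decay_arith (rho v v1 ei U U1 NF NU : R) : 0 < rho -> 0 < v -> v <= v1 -> 0 <= ei ->
  0 <= NF -> 0 <= NU ->
  (rho / v) ^+ 2 * U <= 3 * U1 + 3 * ((2 * (rho / v))^-1 * NF) +
    3 * ((2 * ei ^+ 2 + 4 * (rho / v) * ei) ^+ 2 * (2 * (rho / v))^-1 * NU) ->
  U <= 3 * rho^-1 ^+ 2 * (v ^+ 2 * U1) + 3 / 2 * rho^-1 ^+ 3 * v1 ^+ 3 * NF +
    3 / 2 * rho^-1 ^+ 3 * (2 * ei ^+ 2 * v1 + 4 * rho * ei) ^+ 2 * (v * NU).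
Proof.
move=> r0 v0 vv e0 F0 N0 h.
have rn : rho != 0 by rewrite gt_eqF.
have vn : v != 0 by rewrite gt_eqF.
have ri : 0 < rho^-1 by rewrite invr_gt0.
have r3 : 0 < 3 / 2 * rho^-1 ^+ 3 by rewrite mulr_gt0 // exprn_gt0.
have h2 : U <= 3 * rho^-1 ^+ 2 * (v ^+ 2 * U1) + 3 / 2 * rho^-1 ^+ 3 * v ^+ 3 * NF +
    3 / 2 * rho^-1 ^+ 3 * (2 * ei ^+ 2 * v + 4 * rho * ei) ^+ 2 * (v * NU).
  have c0' : 0 < (v / rho) ^+ 2 by rewrite exprn_gt0 // divr_gt0.
  have := ler_wpM2l (ltW c0') h.
  have -> : (v / rho) ^+ 2 * ((rho / v) ^+ 2 * U) = U by field; rewrite rn vn.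
  move=> /le_trans; apply; rewrite le_eqVlt; apply/orP; left; apply/eqP; field; by rewrite rn vn.
apply: le_trans h2 _.
have v3 : v ^+ 3 <= v1 ^+ 3 by apply: lerXn2r => //; rewrite nnegrE ?(ltW v0) // (le_trans (ltW v0)).
have w : (2 * ei ^+ 2 * v + 4 * rho * ei) ^+ 2 <= (2 * ei ^+ 2 * v1 + 4 * rho * ei) ^+ 2.
  have x1 : 0 <= 2 * ei ^+ 2 * v by rewrite !mulr_ge0 ?sqr_ge0 // ltW.
  have x2 : 0 <= 4 * rho * ei by rewrite !mulr_ge0 // ltW.
  have x3 : 2 * ei ^+ 2 * v <= 2 * ei ^+ 2 * v1 by rewrite ler_wpM2l // mulr_ge0 ?sqr_ge0.
  rewrite ler_sqr ?nnegrE; lra.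
apply: lerD; first apply: lerD => //.
  by apply: ler_wpM2r => //; apply: ler_wpM2l => //; exact: ltW.
apply: ler_wpM2r; first by rewrite mulr_ge0 // ltW.
by apply: ler_wpM2l => //; exact: ltW.
Qed.

Lemma weighted_sum_le (a1 a2 a3 a4 x1 x2 x3 x4 : R) : 0 <= a1 -> 0 <= a2 -> 0 <= a3 -> 0 <= a4 ->
  0 <= x1 -> 0 <= x2 -> 0 <= x3 -> 0 <= x4 ->
  a1 * x1 + a2 * x2 + a3 * x3 + a4 * x4 <= (a1 + a2 + a3 + a4) * (x1 + x2 + x3 + x4).
Proof.
move=> h1 h2 h3 h4 g1 g2 g3 g4.
have w (a x : R) : 0 <= a -> a <= a1 + a2 + a3 + a4 -> 0 <= x -> a * x <= (a1 + a2 + a3 + a4) * x.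
  by move=> a0 aa x0; exact: ler_wpM2r.
by rewrite !mulrDr; apply: lerD; [apply: lerD; [apply: lerD|]|]; apply: w => //; lra.
Qed.

(** * Undamped media of constant stiffness *)

Definition medium a b q := [/\ 0 <= a, a < b, b <= L, 0 < q & forall t, a < t < b -> qq t = q /\ DD t = 0].

Lemma medium_S a b q r t : medium a b q -> a < t < b -> rS r t = q%:C * rW2 r t.
Proof.
move=> [a0 ab bL q0 H] /andP[t1 t2]; have [h1 h2] := H t (introT andP (conj t1 t2)).
rewrite rSE; last by rewrite (le_lt_trans a0 t1) (lt_le_trans t2 bL).
by rewrite h1 h2 mul0r addr0.
Qed.

(** In the medium v'' = i om S / q - f'' and S'' = g - i om v. The two relations between [kap] and
    [m] make i m v + S an eigenvector of this coupling with eigenvalue kap^2. *)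
Lemma decay_ode a b q kap m r t : medium a b q -> kap ^+ 2 * m = - om r -> kap ^+ 2 * q = - (m * om r) ->
  a < t < b -> (0 +i* m) * rV2 r t + rS2 r t =
  (kap ^+ 2)%:C * ((0 +i* m) * rV r t + rS r t) + ((0 +i* (- m)) * rf2 r t + rg r t).
Proof.
move=> md e1 e2 tab; apply/eqP; rewrite eq_complex; apply/andP; rewrite /rf2 /rg (medium_S r md tab) !ReImE.
have p1 z : kap ^+ 2 * m * z = - om r * z by rewrite e1.
have p2 z : kap ^+ 2 * q * z = - (m * om r) * z by rewrite e2.
by split; apply/eqP; [have := p1 (Im (rV r t)); have := p2 (Re (rW2 r t))|
  have := p1 (Re (rV r t)); have := p2 (Im (rW2 r t))]; lra.
Qed.

Lemma decay_sum (g1 g2 g3 v2 v p1 p2 p3 z1 z2 z3 z4 z5 z6 z7 z8 : R) :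
  z4 <= g1 * (v2 * z3) + g2 * z1 + g3 * (v * z2) -> g1 * (v2 * z3) <= g1 * (v2 * (p1 * z6)) ->
  g2 * z1 <= g2 * (p2 * z7) -> g3 * (v * z2) <= g3 * (v * (p3 * z8)) ->
  2 * z4 + z5 <= 2 * g1 * p1 * (v2 * z6) + z5 + 2 * g2 * p2 * z7 + 2 * g3 * p3 * (v * z8).
Proof. by move=> h1 h2 h3 h4; lra. Qed.

Lemma decay_data a b q m e r : medium a b q -> m ^+ 2 = q ->
  [/\ n2 a b (fun t => (0 +i* (- m)) * rf2 r t + rg r t) <= (2 * q * c0^-1 + 2) * d r,
    n2 a b (fun t => (0 +i* m) * rV r t + rS r t) <= (2 * q + 2 * q ^+ 2 * c0^-1) * X r,
    sqmod ((0 +i* m) * rV1 r e + rS1 r e) <= (2 + 2 * q) * (sqmod (rS1 r e) + sqmod (rV1 r e)) &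
    sqmod (rS r e) <= 2 * sqmod ((0 +i* m) * rV r e + rS r e) + 2 * q * sqmod (rV r e)].
Proof.
move=> md m2; have [a0 ab bL q0 H] := md.
have b2 : 0 <= 2 * q by rewrite mulr_ge0 // ltW.
have res f : L2c 0 L f -> n2 a b f <= n2 0 L f by move=> hf; apply: n2_sub => //; exact: ltW.
have lF : L2c a b (fun t => (0 +i* (- m)) * rf2 r t + rg r t).
  exact: L2cS a0 bL (L2c_comb _ (L2c_rf2 r) (L2c_rg r)).
have lu : L2c a b (fun t => (0 +i* m) * rV r t + rS r t).
  exact: L2cS a0 bL (L2c_comb _ (L2c_rV r) (L2c_rS r)).
split.
- have h1 := n2_le2 (k := 2 * q) (k' := 2) lF (L2cS a0 bL (L2c_rf2 r)) (L2cS a0 bL (L2c_rg r)).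
  apply: le_trans (h1 _) _ => [t _|].
    by apply: le_trans (sqmodD2 _ _) _; rewrite sqmodI sqrrN m2 mulrA.
  apply: (@le_trans _ _ (2 * q * (c0^-1 * d r) + 2 * d r)); last by rewrite !mulrA -mulrDl.
  apply: lerD; apply: ler_wpM2l => //; first exact: le_trans (res _ (L2c_rf2 r)) (n2_rf2 r).
  exact: le_trans (res _ (L2c_rg r)) (n2_rg r).
- have h1 := n2_le2 (k := 2 * q) (k' := 2 * q ^+ 2) lu (L2cS a0 bL (L2c_rV r)) (L2cS a0 bL (L2c_rW2 r)).
  apply: le_trans (h1 _) _ => [t tab|].
    by apply: le_trans (sqmodD2 _ _) _; rewrite sqmodI m2 (medium_S r md tab) sqmodZ !mulrA.
  apply: (@le_trans _ _ (2 * q * X r + 2 * q ^+ 2 * (c0^-1 * X r))); last by rewrite [_ * (_ * X r)]mulrA -mulrDl.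
  apply: lerD; first by apply: ler_wpM2l => //; exact: le_trans (res _ (L2c_rV r)) (n2_rV r).
  apply: ler_wpM2l; first by rewrite mulr_ge0 ?sqr_ge0.
  exact: le_trans (res _ (L2c_rW2 r)) (n2_rW2 r).
- have := sqmodD2 ((0 +i* m) * rV1 r e) (rS1 r e); rewrite sqmodI m2.
  by have := sqmod_ge0 (rV1 r e); have := mulr_ge0 b2 (sqmod_ge0 (rS1 r e)); lra.
- have -> : rS r e = (0 +i* m) * rV r e + rS r e + - ((0 +i* m) * rV r e) by rewrite addrC addrA addNr add0r.
  apply: le_trans (sqmodD2 _ _) _; rewrite sqmodN sqmodI m2 mulrA.
  by have -> : (0 +i* m) * rV r e + rS r e - (0 +i* m) * rV r e = rS r e by rewrite addrC addrA addNr add0r.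
Qed.

(* In the medium [u = S - i sgn(om) sqrt q V] solves [u'' = kap^2 u + F] with [kap^2 = |om| / sqrt q]
   and [F = g + i sgn(om) sqrt q f'']. *)
Lemma decay_medium a b q p e s : medium a b q -> endpoints a b p e s ->
  exists2 C, 0 <= C & forall r, hi r -> sqmod (rS r e) <= C * ((kk r ^+ 4)^-1 * (sqmod (rS1 r e) + sqmod (rV1 r e))
     + sqmod (rV r e) + d r + (kk r ^+ 2)^-1 * X r).
Proof.
move=> md pe; have [a0 ab bL q0 H] := md.
pose sq := Num.sqrt q; have sq0 : 0 < sq by rewrite sqrtr_gt0.
have sqq : sq ^+ 2 = q by rewrite sqr_sqrtr // ltW.
pose rho := (Num.sqrt sq)^-1; have rho0 : 0 < rho by rewrite invr_gt0 sqrtr_gt0.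
have rho2 : rho ^+ 2 * sq = 1 by rewrite exprVn sqr_sqrtr ?(ltW sq0) // mulVf // gt_eqF.
pose v1 := (k1 ^+ 2)^-1; pose ei := (b - a)^-1.
have ei0 : 0 < ei by rewrite invr_gt0 subr_gt0.
have v10 : 0 < v1 by rewrite invr_gt0 exprn_gt0.
have ci : 0 < c0^-1 by rewrite invr_gt0.
pose g1 := 3 * rho^-1 ^+ 2; pose g2 := 3 / 2 * rho^-1 ^+ 3 * v1 ^+ 3.
pose g3 := 3 / 2 * rho^-1 ^+ 3 * (2 * ei ^+ 2 * v1 + 4 * rho * ei) ^+ 2.
have ri : 0 < rho^-1 by rewrite invr_gt0.
have g10 : 0 <= g1 by rewrite mulr_ge0 ?sqr_ge0.
have g20 : 0 <= g2 by rewrite !mulr_ge0 ?exprn_ge0 // ltW.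
have g30 : 0 <= g3.
  by apply: mulr_ge0; [apply: mulr_ge0; [lra|apply: exprn_ge0; exact: ltW]|exact: sqr_ge0].
have cF0 : 0 <= 2 * q * c0^-1 + 2 by rewrite addr_ge0 // !mulr_ge0 // ltW.
have cU0 : 0 <= 2 * q + 2 * q ^+ 2 * c0^-1 by rewrite addr_ge0 ?mulr_ge0 ?sqr_ge0 // ltW.
have b1 : 0 <= 2 * g1 * (2 + 2 * q) by apply: mulr_ge0; lra.
have b2 : 0 <= 2 * q by rewrite mulr_ge0 // ltW.
have b3 : 0 <= 2 * g2 * (2 * q * c0^-1 + 2) by apply: mulr_ge0 => //; lra.
have b4 : 0 <= 2 * g3 * (2 * q + 2 * q ^+ 2 * c0^-1) by apply: mulr_ge0 => //; lra.
exists (2 * g1 * (2 + 2 * q) + 2 * q + 2 * g2 * (2 * q * c0^-1 + 2) + 2 * g3 * (2 * q + 2 * q ^+ 2 * c0^-1)).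
  by rewrite !addr_ge0.
move=> r h; have k0 := kk0 h; have k2 := exprn_gt0 2 k0; have k4 := exprn_gt0 4 k0.
pose v := (kk r ^+ 2)^-1; have v0 : 0 < v by rewrite invr_gt0.
have vv : v <= v1 by exact: kkV.
have om0 : om r != 0 by rewrite -normr_gt0 -kk4.
(* The opposite sign belongs to the eigenvalue - kap^2, that is, to an oscillation, for which a
   decaying exponential is no test function. *)
pose m := - (Num.sg (om r) * sq).
have sg2 : Num.sg (om r) ^+ 2 = 1 by rewrite sqr_sg om0.
have m2 : m ^+ 2 = q by rewrite sqrrN exprMn sg2 mul1r.
have sgo : Num.sg (om r) * om r = kk r ^+ 4 by rewrite kk4 normrEsg.
pose kap := rho / v.
have kap2 : kap ^+ 2 * sq = kk r ^+ 4.
  rewrite /kap exprMn /v invrK -exprM mulrAC rho2 mul1r //.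
have kap0 : 0 < kap by rewrite divr_gt0.
have e1 : kap ^+ 2 * m = - om r.
  rewrite /m mulrN mulrCA kap2 -sgo mulrA -expr2 sg2 mul1r //.
have e2 : kap ^+ 2 * q = - (m * om r).
  by rewrite -sqq expr2 mulrA kap2 -sgo /m; ring.
pose u t := (0 +i* m) * rV r t + rS r t.
pose u1 t := (0 +i* m) * rV1 r t + rS1 r t.
pose u2 t := (0 +i* m) * rV2 r t + rS2 r t.
pose F t := (0 +i* (- m)) * rf2 r t + rg r t.
have c1 : cac a b u u1 := cacS a0 bL (cac_comb (0 +i* m) (cac_rV r) (cac_rS r)).
have c2 : cac a b u1 u2 := cacS a0 bL (cac_comb (0 +i* m) (cac_rV1 r) (cac_rS1 r)).
have lF : L2c a b F := L2cS a0 bL (L2c_comb (0 +i* (- m)) (L2c_rf2 r) (L2c_rg r)).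
have ode t : a < t < b -> u2 t = (kap ^+ 2)%:C * u t + F t by exact: decay_ode md e1 e2.
have D := endpoint_decay_c ab pe kap0 c1 c2 lF ode.
have eiE : ((b - a) ^+ 2)^-1 = ei ^+ 2 by rewrite -exprVn.
rewrite eiE -/ei in D.
have [NF NU us Su] : [/\ n2 a b F <= (2 * q * c0^-1 + 2) * d r, n2 a b u <= (2 * q + 2 * q ^+ 2 * c0^-1) * X r,
  sqmod (u1 e) <= (2 + 2 * q) * (sqmod (rS1 r e) + sqmod (rV1 r e)) &
  sqmod (rS r e) <= 2 * sqmod (u e) + 2 * q * sqmod (rV r e)] := decay_data e r md m2.
have F0 := n2_ge0 a b F; have U0 := n2_ge0 a b u.
have {}D := decay_arith rho0 v0 vv (ltW ei0) F0 U0 D.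
rewrite -/g1 -/g2 -/g3 in D.
have v2 : v ^+ 2 = (kk r ^+ 4)^-1 by rewrite exprVn -exprM.
rewrite -v2.
have v20 : 0 <= v ^+ 2 by exact: sqr_ge0.
have j1 := ler_wpM2l g10 (ler_wpM2l v20 us).
have j2 := ler_wpM2l g20 NF.
have j3 := ler_wpM2l g30 (ler_wpM2l (ltW v0) NU).
apply: (le_trans Su); have Su2 : 2 * sqmod (u e) + 2 * q * sqmod (rV r e) <=
   2 * g1 * (2 + 2 * q) * (v ^+ 2 * (sqmod (rS1 r e) + sqmod (rV1 r e))) + 2 * q * sqmod (rV r e) +
   2 * g2 * (2 * q * c0^-1 + 2) * d r + 2 * g3 * (2 * q + 2 * q ^+ 2 * c0^-1) * (v * X r).
  exact: decay_sum D j1 j2 j3.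
apply: (le_trans Su2); apply: weighted_sum_le => //.
- by rewrite mulr_ge0 // addr_ge0 ?sqmod_ge0.
- exact: sqmod_ge0.
- exact: d_ge0.
- by rewrite mulr_ge0 ?X_ge0 // ltW.
Qed.

(* Flux of the multiplier (x - x0) W1. *)
Definition Phi x0 q r x := 2^-1 * (x - x0) * (sqmod (rV r x) + q^-1 * sqmod (rS r x))
  - (x - x0) * dot (rS1 r x) (rW1 r x) + dot (rS r x) (rW1 r x).

(** The derivative of [Phi] is |v|^2 / 2 + 3 |S|^2 / (2 q) up to terms with the data: multiplication
    by i is skew, so the terms in [om] cancel, and the last term of [Phi] removes the product of S'
    and w'. *)
Lemma multiplier : exists2 C, 0 <= C & forall a b q x0 r, medium a b q -> 0 <= x0 <= L ->
  2^-1 * (II a b (fun t => qq t * sqmod (rW2 r t)) + n2 a b (rV r)) <=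
  Phi x0 q r b - Phi x0 q r a + C * A r.
Proof.
have [Ca0 Ca1 Ca2] := CA_bounds; have L2' : 0 <= L ^+ 2 by exact: sqr_ge0.
pose C := (1 + L ^+ 2) * CA.
have CC : CA <= C by rewrite /C ler_peMl ?(ltW Ca0) // lerDl.
have C0 : 0 < C by exact: lt_le_trans CC.
have CL : L ^+ 2 * c0^-1 <= C.
  by rewrite /C; apply: ler_pM => //; [by rewrite invr_ge0 ltW|rewrite lerDr].
exists (2 * (L * C)); first by have := mulr_gt0 L0 C0; lra.
move=> a b q x0 r md /andP[x00 x0L]; have [a0 ab bL q0 H] := md; have ab' := ltW ab.
have qi : 0 < q^-1 by rewrite invr_gt0.
have qn : q != 0 by rewrite gt_eqF.
have X0 := X_ge0 r; have d0 := d_ge0 r.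
have res u u1 : cac 0 L u u1 -> cac a b u u1 by exact: cacS.
have resL u : L2c 0 L u -> L2c a b u by exact: L2cS.
have ap : acont a b (fun x => x - x0) (fun=> 1).
  split; first by have [] := HI_cst 1 ab'.
  by move=> x /andP[ax xb]; have [_ ->] := HI_cst 1 ax; ring.
have W2E t : a < t < b -> rW2 r t = (q^-1)%:C * rS r t.
  move=> tab; rewrite (medium_S r md tab) mulrA -rmorphM mulVf // mul1r //.
have cV := res _ _ (cac_rV r); have cS := res _ _ (cac_rS r); have cS1 := res _ _ (cac_rS1 r).
have cW1 := res _ _ (cac_rW1 r).
have aPhi := AC_add (AC_sub (AC_mul ab' ap (AC_add (AC_scale 2^-1 (AC_dot ab' cV cV)) (AC_scale (2^-1 * q^-1) (AC_dot ab' cS cS))))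
  (AC_mul ab' ap (AC_dot ab' cS1 cW1))) (AC_dot ab' cS cW1).
have [_ E] := AC_HI ab' aPhi.
have mp : ess_bounded a b (fun x => x - x0).
  split; first exact: AC_meas ab' ap.
  exists L; apply: aeW => x /=; rewrite in_itv /= => /andP[xa xb].
  by rewrite ler_norml; apply/andP; split; lra.
have pL x : a < x < b -> `|x - x0| <= L by move=> /andP[xa xb]; rewrite ler_norml; apply/andP; split; lra.
have I1 := L1_HI (dot_L1 mp (resL _ (L2c_rV r)) (resL _ (L2c_rf1 r))).
have I2 := L1_HI (dot_L1 mp (resL _ (L2c_rW1 r)) (resL _ (L2c_rg r))).
have I3 := n2_HI (resL _ (L2c_rV r)); have I4 := HI_scale q^-1 (n2_HI (resL _ (L2c_rS r))).
have [_ E2] := HI_sub (HI_sub (HI_add (HI_scale 2^-1 I3) (HI_scale (3 / 2) I4)) I1) I2.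
have {}E := etrans (esym E2) (etrans (II_eq _) E).
have E4 : q^-1 * n2 a b (rS r) = II a b (fun t => qq t * sqmod (rW2 r t)).
  case: I4 => _ <-; apply: II_eq => t tab; by rewrite (W2E t tab) sqmodZ; have [-> _] := H t tab; field.
have i1 : `|II a b (fun x => (x - x0) * dot (rV r x) (rf1 r x))| <= L * C * A r.
  apply: dot_A => //; rewrite ?(ltW L0) ?(ltW C0) //.
  - exact: resL (L2c_rV r). - exact: resL (L2c_rf1 r).
  - apply: le_trans (n2_sub a0 ab' bL (L2c_rV r)) _; apply: le_trans (n2_rV r) _.
    by rewrite ler_peMl // (le_trans Ca1).
  - apply: le_trans (n2_sub a0 ab' bL (L2c_rf1 r)) _; apply: le_trans (H20_n2_1 (H20_rf r)) _.
    apply: le_trans (ler_wpM2l L2' (n2_rf2 r)) _; by rewrite mulrA; apply: ler_wpM2r.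
have i2 : `|II a b (fun x => (x - x0) * dot (rW1 r x) (rg r x))| <= L * C * A r.
  apply: dot_A => //; rewrite ?(ltW L0) ?(ltW C0) //.
  - exact: resL (L2c_rW1 r). - exact: resL (L2c_rg r).
  - apply: le_trans (n2_sub a0 ab' bL (L2c_rW1 r)) _; apply: le_trans (H20_n2_1 (rWh r)) _.
    apply: le_trans (ler_wpM2l L2' (n2_rW2 r)) _; by rewrite mulrA; apply: ler_wpM2r.
  - apply: le_trans (n2_sub a0 ab' bL (L2c_rg r)) _; apply: le_trans (n2_rg r) _.
    by rewrite ler_peMl // (le_trans Ca1).
rewrite -E4.
have PhiE x : Phi x0 q r x = (x - x0) * (2^-1 * dot (rV r x) (rV r x) + 2^-1 * q^-1 * dot (rS r x) (rS r x)) -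
   (x - x0) * dot (rS1 r x) (rW1 r x) + dot (rS r x) (rW1 r x).
  by rewrite /Phi !dotzz; ring.
rewrite !PhiE; move: E => /(_ _)/esym ->; last first.
  by move=> t tab; rewrite /rf1 /rg (W2E t tab) /dot /sqmod !ReImE; field.
have n1 := ler_norm (II a b (fun x => (x - x0) * dot (rV r x) (rf1 r x))).
have n2' := ler_norm (II a b (fun x => (x - x0) * dot (rW1 r x) (rg r x))).
have S0 : 0 <= q^-1 * n2 a b (rS r) by rewrite mulr_ge0 ?n2_ge0 // ltW.
lra.
Qed.

(** At the ends everything is bounded by [A] except |S|^2, which is kept explicit. In the product of
    S' and w' the bound k^3 A of |S'|^2 is compensated by the factor k^-8 in that of |w'|^2. *)
Lemma Phi_end : exists2 C, 0 <= C & forall r e x0 q, hi r -> is_end e -> 0 <= x0 <= L -> c0 <= q ->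
  `|Phi x0 q r e| <= C * (A r + sqmod (rS r e)).
Proof.
have [Ce Ce0 HE] := ends; have ci : 0 < c0^-1 by rewrite invr_gt0.
have kn n : 0 < (k1 ^+ n)^-1 by rewrite invr_gt0 exprn_gt0.
pose C := L * Ce + L * c0^-1 + L * ((1 + (k1 ^+ 5)^-1) * Ce) + 1 + (k1 ^+ 8)^-1 * Ce.
have g1 : 0 <= L * Ce by rewrite mulr_ge0 // ltW.
have g2 : 0 <= L * c0^-1 by rewrite mulr_ge0 // ltW.
have g3 : 0 <= L * ((1 + (k1 ^+ 5)^-1) * Ce) by rewrite !mulr_ge0 ?addr_ge0 // ltW.
have g4 : 0 <= (k1 ^+ 8)^-1 * Ce by rewrite mulr_ge0 // ltW.
exists C; first by rewrite /C; lra.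
move=> r e x0 q h he /andP[x00 x0L] cq; have [_ /(_ e he)[s1 s0 v0 v1 w1]] := HE r h.
have k0 := kk0 h; have k3 := exprn_gt0 3 k0; have k5 := exprn_gt0 5 k0; have k8 := exprn_gt0 8 k0.
have hA := A_ge0 r; set B := Ce * A r in s1 s0 v0 v1 w1; have B0 : 0 <= B by rewrite mulr_ge0.
have /andP[e0 eL] : 0 <= e <= L.
  by case: he => ->; rewrite ?al0 ?be_L ?(le_trans al0 al_be) ?(le_trans al_be be_L).
have xL : `|e - x0| <= L by rewrite ler_norml; apply/andP; split; lra.
have W3 : kk r ^+ 3 * sqmod (rW1 r e) <= (k1 ^+ 5)^-1 * B.
  apply: (@le_trans _ _ ((kk r ^+ 5)^-1 * (kk r ^+ 8 * sqmod (rW1 r e)))).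
    by rewrite ler_pdivlMl // mulrA -exprD.
  apply: ler_pM; [by rewrite invr_ge0 ltW|by rewrite mulr_ge0 ?sqmod_ge0 // ltW|exact: kkV|by []].
have W0 : sqmod (rW1 r e) <= (k1 ^+ 8)^-1 * B.
  apply: (@le_trans _ _ ((kk r ^+ 8)^-1 * (kk r ^+ 8 * sqmod (rW1 r e)))).
    by rewrite ler_pdivlMl.
  apply: ler_pM; [by rewrite invr_ge0 ltW|by rewrite mulr_ge0 ?sqmod_ge0 // ltW|exact: kkV|by []].
have k3i : 0 < (kk r ^+ 3)^-1 by rewrite invr_gt0.
have D1 := dot_le (rS1 r e) (rW1 r e) k3i; rewrite invrK in D1.
have D1' : (kk r ^+ 3)^-1 * sqmod (rS1 r e) <= B by rewrite ler_pdivrMl.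
have D2 := dot_le (rS r e) (rW1 r e) ltr01; rewrite invr1 !mul1r in D2.
have q0 : 0 < q by exact: lt_le_trans cq.
have qi : q^-1 <= c0^-1 by rewrite lef_pV2 // posrE.
have S0 := sqmod_ge0 (rS r e); have V0 := sqmod_ge0 (rV r e).
have T1 : `|2^-1 * (e - x0) * (sqmod (rV r e) + q^-1 * sqmod (rS r e))| <= L * (B + c0^-1 * sqmod (rS r e)).
  have n0 : 0 <= sqmod (rV r e) + q^-1 * sqmod (rS r e) by rewrite addr_ge0 // mulr_ge0 // invr_ge0 ltW.
  rewrite normrM (ger0_norm n0); apply: ler_pM => //.
    by rewrite normrM ger0_norm ?invr_ge0 //; have := normr_ge0 (e - x0); lra.
  by apply: lerD => //; apply: ler_wpM2r.
have T2 : `|(e - x0) * dot (rS1 r e) (rW1 r e)| <= L * ((1 + (k1 ^+ 5)^-1) * B).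
  rewrite normrM; apply: ler_pM => //; rewrite mulrDl mul1r.
  by have := normr_ge0 (dot (rS1 r e) (rW1 r e)); lra.
have T3 : `|dot (rS r e) (rW1 r e)| <= sqmod (rS r e) + (k1 ^+ 8)^-1 * B.
  by have := normr_ge0 (dot (rS r e) (rW1 r e)); lra.
have h1 := ler_normD (2^-1 * (e - x0) * (sqmod (rV r e) + q^-1 * sqmod (rS r e)) - (e - x0) * dot (rS1 r e) (rW1 r e)) (dot (rS r e) (rW1 r e)).
have h2 := ler_normB (2^-1 * (e - x0) * (sqmod (rV r e) + q^-1 * sqmod (rS r e))) ((e - x0) * dot (rS1 r e) (rW1 r e)).
apply: (le_trans h1); apply: (@le_trans _ _ (L * (B + c0^-1 * sqmod (rS r e)) + L * ((1 + (k1 ^+ 5)^-1) * B) + (sqmod (rS r e) + (k1 ^+ 8)^-1 * B))).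
  by apply: lerD => //; apply: (le_trans h2); exact: lerD.
have m1 := mulr_ge0 g1 S0; have m2 := mulr_ge0 g2 hA; have m3 := mulr_ge0 g3 S0; have m4 := mulr_ge0 g4 S0.
by move: m1 m2 m3 m4; rewrite /C /B; lra.
Qed.

(** In [decay_medium] the derivative S' comes with k^-4, which beats its bound k^3 A; the loss of k
    in [ends] is thereby traded for X / k^2. *)
Lemma S_decay a b q p e s : medium a b q -> endpoints a b p e s -> is_end e ->
  exists2 C, 0 <= C & forall r, hi r -> sqmod (rS r e) <= C * (A r + (kk r ^+ 2)^-1 * X r).
Proof.
move=> md pe he; have [C C0 H] := decay_medium md pe; have [Ce Ce0 HE] := ends.
have kn n : 0 < (k1 ^+ n)^-1 by rewrite invr_gt0 exprn_gt0.
pose K := (k1 ^+ 1)^-1 * Ce + (k1 ^+ 4)^-1 * Ce + Ce + 1.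
have K1 : 1 <= K.
  by have := mulr_ge0 (ltW (kn 1%N)) Ce0; have := mulr_ge0 (ltW (kn 4%N)) Ce0; rewrite /K; lra.
exists (C * K); first by rewrite mulr_ge0 // (le_trans ler01).
move=> r h; have [_ /(_ e he)[s1 s0 v0 v1 w1]] := HE r h.
have k0 := kk0 h; have k4 := exprn_gt0 4 k0; have k2 := exprn_gt0 2 k0; have hA := A_ge0 r; have X0 := X_ge0 r.
have B0 : 0 <= Ce * A r by rewrite mulr_ge0.
have k4i : 0 < (kk r ^+ 4)^-1 by rewrite invr_gt0.
have T1 : (kk r ^+ 4)^-1 * sqmod (rS1 r e) <= (k1 ^+ 1)^-1 * (Ce * A r).
  apply: (@le_trans _ _ ((kk r ^+ 1)^-1 * (Ce * A r))); last by apply: ler_wpM2r => //; exact: kkV.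
  rewrite ler_pdivrMl //; apply: le_trans s1 _; rewrite le_eqVlt; apply/orP; left; apply/eqP; field.
  by rewrite gt_eqF.
have T2 : (kk r ^+ 4)^-1 * sqmod (rV1 r e) <= (k1 ^+ 4)^-1 * (Ce * A r).
  apply: ler_pM => //; [exact: ltW|exact: sqmod_ge0|exact: kkV].
apply: (le_trans (H r h)); rewrite -mulrA; apply: ler_wpM2l => //.
have T3 : (kk r ^+ 2)^-1 * X r <= K * ((kk r ^+ 2)^-1 * X r).
  by rewrite ler_peMl // mulr_ge0 // invr_ge0 ltW.
have dA := d_le_A r; move: T1 T2 T3; rewrite /K.
set i1 := (k1 ^+ 1)^-1; set i4 := (k1 ^+ 4)^-1; set j4 := (kk r ^+ 4)^-1; set z := (kk r ^+ 2)^-1 * X r.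
clearbody i1 i4 j4 z => T1 T2 T3; lra.
Qed.

(** * Energy in the undamped parts *)

Definition En a b r := II a b (fun t => qq t * sqmod (rW2 r t)) + n2 a b (rV r).

Lemma En_cat a b c r : 0 <= a -> a <= c -> c <= b -> b <= L -> En a b r = En a c r + En c b r.
Proof.
move=> a0 ac cb bL; have I1 := L1S a0 bL (sqmod_L1 qq_e (L2c_rW2 r)).
have I2 := L1S a0 bL (L2c_sqmod_L1 (L2c_rV r)).
by rewrite /En /n2 (II_cat ac cb I1) (II_cat ac cb I2) addrACA.
Qed.

Lemma En_nil a r : En a a r = 0.
Proof. by rewrite /En /n2 !II_nil addr0. Qed.

Lemma damped_En : exists2 C, 0 <= C & forall r, hi r -> En al be r <= C * A r.
Proof.
have [C1 C10 H1] := damped_W2; have [C2 C20 H2] := ends.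
exists (Q * C1 + C2); first by have := mulr_ge0 (ltW Q0) C10; lra.
move=> r h; have [v _] := H2 r h; rewrite mulrDl; apply: lerD => //.
have I1 := L1S al0 be_L (sqmod_L1 qq_e (L2c_rW2 r)).
apply: (@le_trans _ _ (Q * n2 al be (rW2 r))).
  apply: HI_le (L1_HI I1) (HI_scale Q (n2_HI (Ls (L2c_rW2 r)))) _ => t _ /=.
  by apply: ler_wpM2r; [exact: sqmod_ge0|case/andP: (qq_b t)].
by have := ler_wpM2l (ltW Q0) (H1 r h); rewrite mulrA.
Qed.

Lemma medium_c0 a b q : medium a b q -> c0 <= q.
Proof.
move=> [a0 ab bL q0 H]; have [|<- _] := H ((a + b) / 2); first by apply/andP; split; lra.
by case/andP: (qq_b ((a + b) / 2)).
Qed.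

Variables (l qc : R).
Hypotheses (left_medium : 0 < al -> exists q, medium 0 al q) (be_l : be <= l)
  (right_medium : medium l L qc)
  (middle_medium : be < l -> exists2 q, medium be l q & q <= qc).

(** The multiplier x has no flux at 0 because w'(0) = 0. The two bounds come from the two estimates
    of |S|^2 at [al] and are played against each other in [bootstrap]. *)
Lemma left_En : exists2 C, 0 <= C & forall r, hi r ->
  En 0 al r <= C * (A r + (kk r ^+ 2)^-1 * X r) /\ En 0 al r <= C * ((1 + kk r) * A r).
Proof.
have [Ce Ce0 HE] := ends; have [Cp Cp0 HP] := Phi_end; have [Cm Cm0 HM] := multiplier.
have [alp|alz] := ltP 0 al; last first.
  exists 0 => // r h; have -> : al = 0 by apply/eqP; rewrite eq_le alz al0.
  by rewrite En_nil !mul0r.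
have [q md] := left_medium alp.
have [|Cd Cd0 HD] := @S_decay 0 al q 0 al (al - 0)^-1 md _ (or_introl erefl); first by left.
pose C := 2 * (Cp * (1 + Ce + Cd) + Cm).
have g1 := mulr_ge0 Cp0 Ce0; have g2 := mulr_ge0 Cp0 Cd0.
exists C; first by rewrite /C; lra.
move=> r h; have [_ /(_ al (or_introl erefl))[_ s0 _ _ _]] := HE r h.
have D := HD r h; have k0 := kk0 h; have hA := A_ge0 r; have X0 := X_ge0 r.
have xx : 0 <= (0 : R) <= L by rewrite lexx (ltW L0).
have P := HP r al 0 q h (or_introl erefl) xx (medium_c0 md).
have M := HM 0 al q 0 r md xx.
have P0 : Phi 0 q r 0 = 0.
  by rewrite /Phi subrr mulr0 !mul0r; case: (rWh r) => _ [_ -> _ _]; rewrite /dot /= !mulr0; ring.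
rewrite P0 -/(En 0 al r) in M.
have P' := le_trans (ler_norm _) P.
have Pd := ler_wpM2l Cp0 D; have Pe := ler_wpM2l Cp0 s0.
set vX := _ * X r in D Pd *; have vX0 : 0 <= vX by rewrite mulr_ge0 // invr_ge0 exprn_ge0 // ltW.
have kA : 0 <= kk r * A r by rewrite mulr_ge0 // ltW.
split.
  have t1 := mulr_ge0 Cp0 vX0; have t2 := mulr_ge0 g1 vX0; have t3 := mulr_ge0 Cm0 vX0.
  have t4 := mulr_ge0 g1 hA.
  by move: M P' Pd t1 t2 t3 t4; rewrite /C; lra.
have t1 := mulr_ge0 Cp0 kA; have t2 := mulr_ge0 g2 kA; have t3 := mulr_ge0 Cm0 kA.
have t4 := mulr_ge0 g1 hA; have t5 := mulr_ge0 g2 hA.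
by move: M P' Pe t1 t2 t3 t4 t5; rewrite /C; lra.
Qed.

(** Multiplier x - L on both pieces. Across [l] the functions v, S, S' and w' are continuous, so
    only |S|^2 / q jumps, and its factor x - L is negative. *)
Lemma right_En_flux : exists2 C, 0 <= C & forall r, hi r -> En be L r <= C * (A r + sqmod (rS r be)).
Proof.
have [Cp Cp0 HP] := Phi_end; have [Cm Cm0 HM] := multiplier.
exists (2 * Cp + 4 * Cm); first lra.
move=> r h; have hA := A_ge0 r; have S0 := sqmod_ge0 (rS r be).
have xx : 0 <= L <= L by rewrite lexx (ltW L0).
have PL q : Phi L q r L = 0.
  by rewrite /Phi subrr mulr0 !mul0r; case: (rWh r) => _ [_ _ _ ->]; rewrite /dot /= !mulr0; ring.
have M2 := HM l L qc L r right_medium xx; rewrite PL -/(En l L r) in M2.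
have mA := mulr_ge0 Cm0 hA; have mS := mulr_ge0 Cm0 S0.
have [bl|lb] := ltP be l; last first.
  have e : l = be by apply/eqP; rewrite eq_le lb be_l.
  have rm := right_medium; rewrite e in M2 rm.
  have P := HP r be L qc h (or_intror erefl) xx (medium_c0 rm).
  by have := ler_norm (- Phi L qc r be); rewrite normrN; lra.
have [q md qle] := middle_medium bl.
have M1 := HM be l q L r md xx; rewrite -/(En be l r) in M1.
have P := HP r be L q h (or_intror erefl) xx (medium_c0 md).
have [_ _ lL _ _] := md.
have J : Phi L q r l <= Phi L qc r l.
  have q0 : 0 < q by exact: lt_le_trans (medium_c0 md).
  have qi : qc^-1 <= q^-1 by rewrite lef_pV2 // posrE // (lt_le_trans q0).
  have w : 0 <= 2^-1 * (L - l) by rewrite mulr_ge0 ?subr_ge0.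
  have := ler_wpM2l w (ler_wpM2r (sqmod_ge0 (rS r l)) qi); rewrite /Phi; lra.
have [l0 lL' _ _ _] := right_medium.
rewrite (En_cat r (le_trans al0 al_be) be_l lL (lexx L)).
by have := ler_norm (- Phi L q r be); rewrite normrN; lra.
Qed.

(** The medium next to [be] is (be, l), or (l, L) when be = l. *)
Lemma right_En : exists2 C, 0 <= C & forall r, hi r ->
  En be L r <= C * (A r + (kk r ^+ 2)^-1 * X r) /\ En be L r <= C * ((1 + kk r) * A r).
Proof.
have [Ce Ce0 HE] := ends; have [Cf Cf0 HF] := right_En_flux.
have [Cd Cd0 HD] : exists2 C, 0 <= C & forall r, hi r -> sqmod (rS r be) <= C * (A r + (kk r ^+ 2)^-1 * X r).
  have [bl|lb] := ltP be l.
    have [q md _] := middle_medium bl.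
    by apply: (@S_decay be l q l be (- (l - be)^-1) md); [right|right].
  have e : l = be by apply/eqP; rewrite eq_le lb be_l.
  have md := right_medium; rewrite e in md.
  by apply: (@S_decay be L qc L be (- (L - be)^-1) md); [right|right].
pose C := Cf * (1 + Ce + Cd).
have g1 := mulr_ge0 Cf0 Ce0; have g2 := mulr_ge0 Cf0 Cd0.
exists C; first by rewrite /C; lra.
move=> r h; have [_ /(_ be (or_intror erefl))[_ s0 _ _ _]] := HE r h.
have D := HD r h; have k0 := kk0 h; have hA := A_ge0 r; have X0 := X_ge0 r.
have M := HF r h.
have Pd := ler_wpM2l Cf0 D; have Pe := ler_wpM2l Cf0 s0.
set vX := _ * X r in D Pd *; have vX0 : 0 <= vX by rewrite mulr_ge0 // invr_ge0 exprn_ge0 // ltW.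
have kA : 0 <= kk r * A r by rewrite mulr_ge0 // ltW.
split.
  have t1 := mulr_ge0 Cf0 vX0; have t2 := mulr_ge0 g1 vX0.
  have t4 := mulr_ge0 g1 hA.
  by move: M Pd t1 t2 t4; rewrite /C; lra.
have t1 := mulr_ge0 Cf0 kA; have t2 := mulr_ge0 g2 kA.
have t4 := mulr_ge0 g1 hA; have t5 := mulr_ge0 g2 hA.
by move: M Pe t1 t2 t4 t5; rewrite /C; lra.
Qed.

(** Either C / k^2 <= 1/2 and the term in x is absorbed, or k^2 < 2 C, so that k is bounded and the
    second inequality suffices. *)
Lemma bootstrap (C k x y : R) : 0 <= C -> 0 < k -> 0 <= y -> 0 <= x ->
  x <= C * (y + (k ^+ 2)^-1 * x) -> x <= C * ((1 + k) * y) -> x <= (2 * C + C * (2 + 2 * C)) * y.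
Proof.
move=> C0 k0 y0 x0 h1 h2; have k2 := exprn_gt0 2 k0; have Cy := mulr_ge0 C0 y0; have CCy := mulr_ge0 C0 Cy.
have [vs|vb] := leP (C * (k ^+ 2)^-1) 2^-1.
  have := ler_wpM2r x0 vs; lra.
have kb : k <= 1 + 2 * C.
  have k2' : k ^+ 2 <= 2 * C by move: vb; rewrite ltr_pdivlMr // => vb; lra.
  by have := sqr_ge0 (k - 1); lra.
have := ler_wpM2r Cy kb; lra.
Qed.

Lemma high_frequency : exists2 C, 0 <= C & forall r, hi r -> X r <= C * A r.
Proof.
have [C1 C10 H1] := left_En; have [C2 C20 H2] := right_En; have [C3 C30 H3] := damped_En.
pose C := C1 + C2 + C3; have C0 : 0 <= C by rewrite /C; lra.
exists (2 * C + C * (2 + 2 * C)); first by rewrite addr_ge0 ?mulr_ge0 ?addr_ge0 // mulr_ge0.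
move=> r h; have [a1 a2] := H1 r h; have [b1 b2] := H2 r h; have c1 := H3 r h.
have k0 := kk0 h; have k2 := exprn_gt0 2 k0; have hA := A_ge0 r; have X0 := X_ge0 r.
have E : X r = En 0 al r + (En al be r + En be L r).
  rewrite -(En_cat r al0 al_be be_L (lexx L)) -(En_cat r (lexx 0) al0 (le_trans al_be be_L) (lexx L)) //.
set v := (kk r ^+ 2)^-1 in a1 b1; have v0 : 0 < v by rewrite invr_gt0.
have vX : 0 <= v * X r by rewrite mulr_ge0 // ltW.
have kA : 0 <= kk r * A r by rewrite mulr_ge0 // ltW.
have CE x y : En 0 al r <= C1 * (x + y) -> En be L r <= C2 * (x + y) -> En al be r <= C3 * x -> 0 <= y ->
    X r <= C * (x + y).
  move=> p1 p2 p3 y0; rewrite {1}E /C !mulrDl [leRHS]addrAC addrA; apply: lerD => //; apply: lerD => //.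
  by apply: (le_trans p3); rewrite ler_wpM2l // lerDl.
have X1 := CE _ _ a1 b1 c1 vX.
have X2 : X r <= C * ((1 + kk r) * A r).
  have e1 : (1 + kk r) * A r = A r + kk r * A r by rewrite mulrDl mul1r.
  by rewrite e1 in a2 b2 *; exact: CE.
exact: (bootstrap C0 k0 hA X0 X1 X2).
Qed.

End HighFrequency.

(** * All frequencies and the choice of the Young weight *)

Section AllFrequencies.
Variables (al be l qc : R).
Hypotheses (al0 : 0 <= al) (albe : al < be) (beL : be < L).
Hypotheses (DD_pos : forall t, al < t < be -> c0 <= DD t).
Hypotheses (left_medium : 0 < al -> exists q, medium 0 al q) (be_l : be <= l)
  (right_medium : medium l L qc)
  (middle_medium : be < l -> exists2 q, medium be l q & q <= qc).

Lemma all_frequencies : exists2 C, 0 <= C & forall r, X r <= C * A r.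
Proof.
have [w [C1 [w0 C10 H1]]] := small_frequency.
(* Frequencies above [w] have a fourth root of at least k1, so the two regimes cover all
   frequencies. *)
pose k1 := Num.min 1 (Num.sqrt (Num.sqrt w)).
have k10 : 0 < k1 by rewrite lt_min ltr01 !sqrtr_gt0.
have k11 : k1 <= 1 by rewrite ge_min lexx.
have [C2 C20 H2] := high_frequency al0 albe beL k10 k11 DD_pos left_medium be_l right_medium middle_medium.
exists (C1 + C2); first exact: addr_ge0.
move=> r; have hA := A_ge0 r; have p1 := mulr_ge0 C10 hA; have p2 := mulr_ge0 C20 hA.
have [h|h] := leP `|om r| w; first by have := H1 r h; lra.
have : hi k1 r by rewrite /hi /kk ge_min; apply/orP; right; rewrite !ler_sqrt ?sqrtr_ge0 ?ltW // ?(lt_trans w0) // ler_sqrt.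
by move=> /H2; lra.
Qed.

(** The constant of [all_frequencies] does not depend on [tt], so the same solution is considered
    anew with a weight t such that C t <= 1/2, and the term in [X] is absorbed. *)
Lemma resolvent_bound : exists2 M, 0 < M & forall r, X r <= M * d r.
Proof.
have [C C0 H] := all_frequencies.
pose t := (1 + 2 * C)^-1.
have t0 : 0 < t by rewrite invr_gt0; lra.
have tC : t * (1 + 2 * C) = 1 by rewrite mulVf // gt_eqF //; lra.
have t1 : t <= 1 by nra.
exists (2 * (C + 1) * t^-1); first by rewrite !mulr_gt0 ?invr_gt0 //; lra.
move=> r; have t01 : 0 < t <= 1 by rewrite t0.
have := H (RData (om r) t01 (rWh r) (rVh r) (rSh r) (@rSE r)).
rewrite /A /= -[X (RData _ _ _ _ _ _)]/(X r) -[d (RData _ _ _ _ _ _)]/(d r).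
have X0 := X_ge0 r; have d0 := d_ge0 r.
have tC2 : C * t <= 2^-1 by lra.
have ti : 0 <= t^-1 * d r by rewrite mulr_ge0 // invr_ge0 ltW.
have := ler_wpM2r X0 tC2; move: ti; lra.
Qed.

End AllFrequencies.
End Apriori.

(** * Density of the domain *)

Section Approximation.
Variable R : realType.
Local Notation mu := (@lebesgue_measure R).
Implicit Types (a b e x : R) (c f g h : R -> R).

Lemma primitive_derive a c x : (forall y, a <= y -> {for y, continuous c}) -> a < x ->
  is_derive x 1 (fun y => II a y c) (c x).
Proof.
move=> hc ax.
have I y : L1 a y c.
  have [ay|ya] := leP a y.
    by apply: continuous_L1 => //; apply: within_of_for => z /andP[az _]; exact: hc.
  have : L1 a (a + 1) c.
    by apply: continuous_L1; [rewrite lerDl|apply: within_of_for => z /andP[az _]; exact: hc].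
  by apply: L1S => //; rewrite (le_trans (ltW ya)) // lerDl.
have E : (fun y => II a y c) = (fun y => \int[mu]_(t in [set` Interval (BRight a) (BRight y)]) c t).
  by apply/funext => y; exact: Rintegral_itv_bndo_bndc (I y).
have Io : mu.-integrable [set` Interval (BRight a) (BRight (x + 1))] (EFin \o c).
  apply: (@integrableS _ _ _ mu `[a, x + 1]); [exact: mitv|exact: mitv|exact: subset_itv_oc_cc|].
  apply: continuous_compact_integrable; first exact: segment_compact.
  by apply: within_of_for => z /andP[az _]; exact: hc.
have xx1 : x < x + 1 by rewrite ltrDl.
have [||d1 d2] := @continuous_FTC1 R c (BRight a) x (x + 1) xx1 Io.
- by rewrite [X in is_true X](_ : _ = (BRight a < BRight x)%O) // bnd_simp.
- by apply: hc; exact: ltW.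
rewrite E; apply: DeriveDef; first exact: d1.
by rewrite -derive1E.
Qed.

Lemma is_derive_cont F x (v : R) : is_derive x 1 F v -> {for x, continuous F}.
Proof. by move=> [h _]; apply: differentiable_continuous; rewrite -derivable1_diffP. Qed.

Lemma dominated_small a b (F : nat -> R -> R) g e : (forall n, measurable_fun `]a, b[ (F n)) ->
  L1 a b g -> (forall n x, a < x < b -> `|F n x| <= g x) ->
  (forall x, a < x < b -> F n x @[n --> \oo] --> 0) -> 0 < e -> exists n, `|II a b (F n)| <= e.
Proof.
move=> mF Ig Fg F0 e0.
have mI := mitv `]a, b[.
have [|||||_ _ h] := @dominated_convergence _ _ R mu `]a, b[%classic mI (fun n => EFin \o F n) (EFin \o cst 0) (EFin \o g).
- by move=> n; apply/measurable_EFinP; exact: mF.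
- by apply/measurable_EFinP; exact: measurable_cst.
- apply: aeW => x /=; rewrite in_itv /= => xab; apply: cvg_EFin; first exact: nearW.
  exact: F0.
- exact: Ig.
- by apply: aeW => x n /=; rewrite in_itv /= => xab; rewrite lee_fin; exact: Fg.
have e1 : (\int[mu]_(x in `]a, b[) (EFin \o cst (0%R : R)) x = (0%R : R)%:E)%E by apply: integral0_eq.
rewrite e1 in h.
have [N _ /(_ N (leqnn _)) hN] := cvgr0_norm_le _ (fine_cvg h) _ e0.
by exists N.
Qed.

(** Projection onto [-n, n] for n >= 0, written with absolute values so that continuity and
    measurability are immediate. *)
Definition clamp (n x : R) : R := (`|x + n| - `|x - n|) / 2.

Lemma clamp_le n x : 0 <= n -> `|clamp n x| <= n.
Proof.
move=> n0; rewrite /clamp ler_norml.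
by case: (ger0P (x + n)) => h1; case: (ger0P (x - n)) => h2; apply/andP; split; lra.
Qed.

Lemma clamp_id n x : `|x| <= n -> clamp n x = x.
Proof.
rewrite ler_norml => /andP[h1 h2]; rewrite /clamp ger0_norm; last lra.
rewrite ler0_norm; lra.
Qed.

Lemma clamp_dist n x y : `|y| <= n -> `|y - clamp n x| <= `|y - x|.
Proof.
rewrite ler_norml => /andP[h1 h2]; rewrite /clamp.
by case: (ger0P (x + n)) => h3; case: (ger0P (x - n)) => h4; case: (ger0P (y - x)) => h5; rewrite ler_norml; apply/andP; split; lra.
Qed.

Lemma clamp_cont n (f : R -> R) : continuous f -> continuous (fun x => clamp n (f x)).
Proof.
move=> cf x; apply: cvgMl; apply: cvgB; apply: cvg_norm.
  by apply: cvgD; [exact: cf|exact: cvg_cst].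
by apply: cvgB; [exact: cf|exact: cvg_cst].
Qed.

Lemma clamp_meas (A : set R) n (f : R -> R) : measurable_fun A f -> measurable_fun A (fun x => clamp n (f x)).
Proof.
move=> mf; apply: measurable_funM; last exact: measurable_cst.
apply: measurable_funB.
  by apply: measurableT_comp => //; apply: measurable_funD => //; exact: measurable_cst.
by apply: measurableT_comp => //; apply: measurable_funB => //; exact: measurable_cst.
Qed.

Lemma nrm2_tri a b f g h e e' : L2r a b f -> L2r a b g -> L2r a b h ->
  nrm2 a b (fun x => f x - g x) <= e -> nrm2 a b (fun x => g x - h x) <= e' ->
  nrm2 a b (fun x => f x - h x) <= 2 * e + 2 * e'.
Proof.
move=> hf hg hh h1 h2.
apply: (@le_trans _ _ (2 * nrm2 a b (fun x => f x - g x) + 2 * nrm2 a b (fun x => g x - h x))); last lra.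
apply: HI_le (nrm2_HI (L2_sub hf hh)) (HI_add (HI_scale 2 (nrm2_HI (L2_sub hf hg))) (HI_scale 2 (nrm2_HI (L2_sub hg hh)))) _ => x _ /=.
have := sqr_ge0 (f x - g x - (g x - h x)); lra.
Qed.

Lemma approx_bounded a b f e : L2r a b f -> 0 < e ->
  exists n g, [/\ 0 <= n, measurable_fun `]a, b[ g, forall x, `|g x| <= n & nrm2 a b (fun x => f x - g x) <= e].
Proof.
move=> [mf If] e0.
have [|||n h] := @dominated_small a b (fun n x => (f x - clamp n%:R (f x)) ^+ 2) (fun x => f x ^+ 2) e _ If _ _ e0.
- by move=> n; apply: measurable_funX; apply: measurable_funB => //; exact: clamp_meas.
- move=> n x _; rewrite ger0_norm ?sqr_ge0 // /clamp.
  have n0 : 0 <= n%:R :> R by [].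
  set N := n%:R in n0 *; set y := f x.
  by case: (ger0P (y + N)) => h1; case: (ger0P (y - N)) => h2; nra.
- move=> x _; apply: cvg_near_cst; near=> n.
  rewrite clamp_id; first by rewrite subrr expr0n.
  by near: n; exact: nbhs_infty_ger.
exists n%:R, (fun x => clamp n%:R (f x)); split=> //.
- exact: clamp_meas. - by move=> x; exact: clamp_le.
- by apply: le_trans h; exact: ler_norm.
Unshelve. all: by end_near. Qed.

(** Approximation in L^1 suffices: after clamping, both functions are bounded by n, so |g - c|^2 is
    at most 2 n times the unclamped distance. *)
Lemma approx_continuous a b n g e : 0 <= n -> measurable_fun `]a, b[ g -> (forall x, `|g x| <= n) -> 0 < e ->
  exists c, [/\ continuous c, forall x, `|c x| <= n & nrm2 a b (fun x => g x - c x) <= e].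
Proof.
move=> n0 mg gn e0.
have Ig : L1 a b g by exact: L1_bnd.
have [G [G1 G2 G3]] := approximation_continuous_integrable (mitv `]a, b[) (mu_oo_fin a b) Ig.
have e1 : 0 < e / (2 * n + 1) by rewrite divr_gt0 //; lra.
have [N _ /(_ N (leqnn _))/= h] := cvgr0_norm_le _ (fine_cvg G3) _ e1.
exists (fun x => clamp n (G N x)); split.
- exact: clamp_cont. - by move=> x; exact: clamp_le.
have lg : L2r a b g by exact: L2_bnd.
have mc : measurable_fun `]a, b[ (fun x => clamp n (G N x)).
  by apply: clamp_meas; exact: L1_meas (G2 N).
have lc : L2r a b (fun x => clamp n (G N x)) by apply: L2_bnd mc _ => x _; exact: clamp_le.
have Id := HI_abs (HI_sub (L1_HI Ig) (L1_HI (G2 N))).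
apply: (@le_trans _ _ (2 * n * II a b (fun x => `|g x - G N x|))).
  apply: HI_le (nrm2_HI (L2_sub lg lc)) (HI_scale (2 * n) Id) _ => x _ /=.
  have d1 := clamp_dist (G N x) (gn x).
  have d2 : `|g x - clamp n (G N x)| <= 2 * n.
    by apply: le_trans (ler_normB _ _) _; have := gn x; have := @clamp_le n (G N x) n0; lra.
  by rewrite -[leLHS]ger0_norm ?sqr_ge0 // normrX expr2; apply: ler_pM.
have I0 : 0 <= II a b (fun x => `|g x - G N x|) by apply: II_ge0.
have hh : II a b (fun x => `|g x - G N x|) <= e / (2 * n + 1) by exact: le_trans (ler_norm _) h.
move: hh; rewrite ler_pdivlMr; lra.
Qed.

Lemma shift_cont (c : R -> R) (h x : R) : {for x + h, continuous c} -> {for x, continuous (fun y => c (y + h))}.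
Proof.
move=> hc; apply: (@continuous_comp _ _ _ (fun y => y + h) c) => //.
by apply: cvgD; [exact: cvg_id|exact: cvg_cst].
Qed.

Lemma shift_derive (c : R -> R) (h x v : R) : is_derive (x + h) 1 c v -> is_derive x 1 (fun y => c (y + h)) v.
Proof.
move=> d; have s : is_derive x 1 (fun y => y + h) 1.
  by apply: (is_derive_quad (f := fun=> 1) (C := 0)) => y; rewrite mul0r (_ : _ - _ = 0) ?normr0 //; ring.
by have := @is_derive1_comp R c (fun y => y + h) x _ _ d s; rewrite mulr1.
Qed.

Lemma quotient_derive (F G : R -> R) (h x u v : R) : is_derive x 1 F u -> is_derive x 1 G v ->
  is_derive x 1 (fun y => (F y - G y) / h) ((u - v) / h).
Proof.
move=> d1 d2; have := is_deriveZ h^-1 (is_deriveB d1 d2).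
rewrite (_ : _ \*: _ = (fun y => (F y - G y) / h)); last by apply/funext => y; rewrite mulrC.
by rewrite /GRing.scale /= mulrC.
Qed.

Lemma quotient_cont (F G : R -> R) (h x : R) : {for x, continuous F} -> {for x, continuous G} ->
  {for x, continuous (fun y => (F y - G y) / h)}.
Proof. by move=> cF cG; apply: cvgMl; apply: cvgB. Qed.

(* [C] is the average of [c] over [x, x + h]. *)
Lemma steklov a b (n : R) c e : a < 0 -> 0 <= b -> (forall x, a <= x -> {for x, continuous c}) ->
  (forall x, a <= x -> `|c x| <= n) -> 0 < e ->
  exists (h : R) (C : R -> R), [/\ 0 < h, forall x, a / 2 <= x -> is_derive x 1 C ((c (x + h) - c x) / h),
    forall x, a / 2 <= x -> `|C x| <= n & nrm2 0 b (fun x => c x - C x) <= e].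
Proof.
move=> a0 b0 hc cn e0.
pose P x := II a x c.
have dP x : a < x -> is_derive x 1 P (c x) by move=> ax; exact: primitive_derive.
pose H (k : nat) : R := k.+1%:R^-1.
have H0 k : 0 < H k by rewrite invr_gt0.
pose C k x := (P (x + H k) - P x) / H k.
have aa : a < a / 2 by lra.
(* By the mean value theorem the average is a value of [c] on [x, x + H k], which yields both the
   bound by [n] and the pointwise convergence. *)
have mean k x : a / 2 <= x -> exists2 y, x <= y <= x + H k & C k x = c y.
  move=> ax; have xx : x < x + H k by rewrite ltrDl.
  have ay y : x <= y -> a < y by move=> h; apply: lt_le_trans aa (le_trans ax h).
  have [||y] := @MVT R P c x (x + H k) xx.
  - by move=> y; rewrite in_itv /= => /andP[h _]; apply: dP; apply: ay; exact: ltW.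
  - by apply: within_of_for => y /andP[h _]; apply: is_derive_cont (dP y (ay _ h)).
  rewrite in_itv /= => /andP[h1 h2] E; exists y; first by rewrite !ltW.
  by rewrite /C E addrAC subrr add0r mulfK // gt_eqF.
have dC k x : a / 2 <= x -> is_derive x 1 (C k) ((c (x + H k) - c x) / H k).
  move=> ax; have ax' : a < x by lra.
  have d1 := dP x ax'.
  apply: quotient_derive => //; apply: shift_derive; apply: dP.
  by rewrite (lt_trans ax') // ltrDl.
have Cn k x : a / 2 <= x -> `|C k x| <= n.
  by move=> ax; have [y /andP[h _] ->] := mean k x ax; apply: cn; rewrite (le_trans (ltW aa)) // (le_trans ax).
have ap x : 0 < x -> a / 2 <= x by move=> x0; lra.
have mc : measurable_fun `]0, b[ c.
  by apply: L1_meas; apply: continuous_L1 => //; apply: within_of_for => x /andP[x0 _]; apply: hc; lra.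
have mC k : measurable_fun `]0, b[ (C k).
  apply: L1_meas; apply: continuous_L1 => //; apply: within_of_for => x /andP[x0 _].
  by apply: is_derive_cont (dC k x _); lra.
have Ig : L1 0 b (fun=> (2 * n) ^+ 2) by have [] := HI_cst ((2 * n) ^+ 2) b0.
have [|||k hk] := @dominated_small 0 b (fun k x => (c x - C k x) ^+ 2) _ e _ Ig _ _ e0.
- by move=> k; apply: measurable_funX; exact: measurable_funB.
- move=> k x /andP[x0 _]; rewrite normrX; apply: lerXn2r; rewrite ?nnegrE //.
    by have := cn x (ltW (lt_trans a0 x0)); have := normr_ge0 (c x); lra.
  apply: le_trans (ler_normB _ _) _.
  by have := cn x (ltW (lt_trans a0 x0)); have := Cn k x (ap x x0); lra.
- move=> x /andP[x0 _]; have cx := hc x (ltW (lt_trans a0 x0)).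
  apply/cvgr0Pnorm_le => eps eps0.
  have q0 : 0 < Num.min 1 eps by rewrite lt_min ltr01.
  have /cvgr_dist_le/(_ _ q0) := cx => /nbhs_ballP[r /= r0 hr].
  near=> k; have [y /andP[y1 y2] ->] := mean k x (ap x x0).
  have : `|c x - c y| <= Num.min 1 eps.
    apply: hr; rewrite /ball /= distrC ger0_norm ?subr_ge0 // ltrBlDl (le_lt_trans y2) // ltrD2l.
    rewrite /H invf_plt ?posrE //; near: k.
    have [N _ HN] := nbhs_infty_gtr r^-1.
    by exists N => // m /= Nm; apply: (lt_trans (HN m Nm)); rewrite ltr_nat.
  rewrite le_min => /andP[l1 l2]; rewrite normrX expr2.
  by apply: le_trans l2; rewrite ler_piMl.
exists (H k), (C k); split=> //.
- by move=> x; exact: dC. - by move=> x; exact: Cn.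
- by apply: le_trans hk; exact: ler_norm.
Unshelve. all: by end_near. Qed.

Lemma continuous_L2 a b c : a <= b -> (forall x, a <= x <= b -> {for x, continuous c}) -> L2r a b c.
Proof.
move=> ab hc; have hw := within_of_for hc.
have [M HM] := within_bounded ab hw.
apply: (@L2_bnd _ a b c M); first exact: L1_meas (continuous_L1 ab hw).
by move=> x /andP[xa xb]; apply: HM; rewrite !ltW.
Qed.

(** Two successive averages of a continuous function are C^2. Each one moves the left end of the
    half line from a to a / 2; starting at -2, the point 0 stays in the interior. *)
Lemma approx_C2 (b n : R) c e : 0 <= b -> continuous c -> (forall x, `|c x| <= n) -> 0 < e ->
  exists C C1 C2, [/\ acont 0 b C C1, acont 0 b C1 C2, L2r 0 b C2 & nrm2 0 b (fun x => c x - C x) <= e].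
Proof.
move=> b0 cc cn e0; have e4 : 0 < e / 4 by rewrite divr_gt0.
have m2 : (-2 : R) < 0 by lra. have m1 : (-1 : R) < 0 by lra.
have [h [c1 [h0 d1 n1 E1]]] := steklov m2 b0 (fun x _ => cc x) (fun x _ => cn x) e4.
have {}d1 x : -1 <= x -> is_derive x 1 c1 ((c (x + h) - c x) / h) by move=> hx; apply: d1; lra.
have c1c x : -1 <= x -> {for x, continuous c1} by move=> /d1; exact: is_derive_cont.
have [h' [c2 [h'0 d2 n2 E2]]] := steklov m1 b0 c1c (fun x (hx : -1 <= x) => n1 x ltac:(lra)) e4.
have {}d2 x : 0 <= x -> is_derive x 1 c2 ((c1 (x + h') - c1 x) / h') by move=> hx; apply: d2; lra.
pose D1 x := (c1 (x + h') - c1 x) / h'.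
pose D2 x := ((c (x + h' + h) - c (x + h')) / h - (c (x + h) - c x) / h) / h'.
have d3 x : 0 <= x -> is_derive x 1 D1 (D2 x).
  move=> hx; apply: quotient_derive; last by apply: d1; lra.
  by apply: shift_derive; apply: d1; lra.
have D2c x : {for x, continuous D2}.
  have s1 : {for x, continuous (fun y => c (y + h'))} by apply: shift_cont; exact: cc.
  have s2 : {for x, continuous (fun y => c (y + h' + h))}.
    by apply: (@shift_cont (fun y => c (y + h))); apply: shift_cont; exact: cc.
  have s3 : {for x, continuous (fun y => c (y + h))} by apply: shift_cont; exact: cc.
  by apply: quotient_cont; apply: quotient_cont => //; exact: cc.
exists c2, D1, D2; split.
- apply: AC_C1_within => //; first by move=> x /andP[x0 _]; exact: d2.
  by apply: within_of_for => x /andP[x0 _]; exact: is_derive_cont (d3 x x0).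
- apply: AC_C1_within => //; first by move=> x /andP[x0 _]; exact: d3.
  by apply: within_of_for => x _; exact: D2c.
- exact: continuous_L2.
- have -> : e = 2 * (e / 4) + 2 * (e / 4) by lra.
  apply: nrm2_tri E1 E2; apply: continuous_L2 => //.
  - by move=> x _; exact: cc.
  - by move=> x /andP[x0 _]; apply: c1c; lra.
  - by move=> x /andP[x0 _]; exact: is_derive_cont (d2 x x0).
Qed.

(* The factor [m = (x (L - x))^2] provides the boundary values. *)
Lemma H20r_dense (L : R) f e : 0 < L -> L2r 0 L f -> 0 < e ->
  exists h h1 h2, [/\ acont 0 L h h1, acont 0 L h1 h2, L2r 0 L h2,
    [/\ h 0 = 0, h1 0 = 0, h L = 0 & h1 L = 0] & nrm2 0 L (fun x => f x - h x) <= e].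
Proof.
move=> L0 lf e0; have L0' := ltW L0.
pose m (x : R) := (x * (L - x)) ^+ 2.
pose m1 (x : R) := 2 * (x * (L - x)) * (L - 2 * x).
pose m2 (x : R) := 2 * (L - 2 * x) ^+ 2 - 4 * (x * (L - x)).
have aid : acont 0 L (fun x => x) (fun=> 1).
  split; first by have [] := HI_cst 1 L0'.
  by move=> x /andP[x0 _]; have [_ ->] := HI_cst 1 x0; ring.
have aq : acont 0 L (fun x => x * (L - x)) (fun x => L - 2 * x).
  by apply: AC_ext (AC_mul L0' aid (AC_sub (AC_cst L L0') aid)) => x _; ring.
have am : acont 0 L m m1.
  by apply: AC_ext (AC_mul L0' aq aq) => x _; rewrite /m /m1; ring.
have am1 : acont 0 L m1 m2.
  have := AC_mul L0' (AC_scale 2 aq) (AC_sub (AC_cst L L0') (AC_scale 2 aid)).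
  by apply: AC_ext => x _; rewrite /m1 /m2; ring.
have mL x : 0 < x < L -> 0 < m x <= L ^+ 4.
  move=> /andP[x0 xL]; have q0 : 0 < x * (L - x) by rewrite mulr_gt0 // subr_gt0.
  rewrite /m exprn_gt0 //= (exprM L 2 2); apply: lerXn2r; rewrite ?nnegrE ?sqr_ge0 ?(ltW q0) //.
  by rewrite expr2; apply: ler_pM; lra.
have mm := AC_meas L0' am.
pose dk (k : nat) : R := k.+1%:R^-1.
have dk0 k : 0 < dk k by rewrite invr_gt0.
have pos k x : 0 < m x ^+ 2 + dk k by rewrite ltr_wpDl ?sqr_ge0.
(* A regularized inverse of [m]: m w = m^2 / (m^2 + dk) tends to 1 inside (0, L), while w stays
   bounded for each k. *)
pose w k x := m x * (m x ^+ 2 + dk k)^-1.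
have mi k : measurable_fun `]0, L[ (fun x => (m x ^+ 2 + dk k)^-1).
  apply: measurable_invr; first by apply: measurable_funD; [exact: measurable_funX|exact: measurable_cst].
  by move=> x; rewrite gt_eqF.
have mw k : measurable_fun `]0, L[ (w k) by exact: measurable_funM.
have r01 k x : 0 <= dk k * (m x ^+ 2 + dk k)^-1 <= 1.
  apply/andP; split; first by rewrite mulr_ge0 ?invr_ge0 // ltW // pos.
  by rewrite ler_pdivrMr ?pos // mul1r lerDr sqr_ge0.
have e4 : 0 < e / 4 by rewrite divr_gt0.
have [|||k hk] := @dominated_small 0 L (fun k x => (f x * (dk k * (m x ^+ 2 + dk k)^-1)) ^+ 2) (fun x => f x ^+ 2) (e / 4) _ (proj2 lf) _ _ e4.
- move=> k; apply: measurable_funX; apply: measurable_funM; first exact: (proj1 lf).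
  by apply: measurable_funM; [exact: measurable_cst|exact: mi].
- move=> k x _; rewrite ger0_norm ?sqr_ge0 // exprMn ler_piMr ?sqr_ge0 //.
  by have /andP[r0 r1] := r01 k x; exact: exprn_ile1.
- move=> x xL; apply/cvgr0Pnorm_le => eps eps0; have /andP[mx _] := mL x xL.
  have m20 : 0 < m x ^+ 2 by rewrite exprn_gt0.
  have p0 : 0 < m x ^+ 2 * eps by rewrite mulr_gt0.
  near=> k; rewrite ger0_norm ?sqr_ge0 // exprMn.
  have /andP[r0 r1] := r01 k x.
  have r2 : (dk k * (m x ^+ 2 + dk k)^-1) ^+ 2 <= dk k / m x ^+ 2.
    apply: (@le_trans _ _ (dk k * (m x ^+ 2 + dk k)^-1)); first by rewrite expr2 ler_piMl.
    apply: ler_wpM2l; first exact: ltW.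
    by rewrite lef_pV2 ?posrE ?pos // lerDl ltW.
  apply: le_trans (ler_wpM2l (sqr_ge0 (f x)) r2) _.
  rewrite mulrA ler_pdivrMr // mulrC ler_pdivrMl ?ltr0Sn //.
  have : f x ^+ 2 / (m x ^+ 2 * eps) <= k.+1%:R.
    near: k; have [N _ HN] := nbhs_infty_ger (f x ^+ 2 / (m x ^+ 2 * eps)).
    by exists N => // j /= Nj; apply: (le_trans (HN j Nj)); rewrite ler_nat.
  by rewrite ler_pdivrMr // => h; rewrite [eps * _]mulrC.
pose g x := w k x * f x.
have lg : L2r 0 L g.
  apply: (@L2_mulb _ 0 L f (w k) (L ^+ 4 / dk k) lf (mw k)) => x xL.
  have /andP[mx mxL] := mL x xL; rewrite ger0_norm; last by rewrite mulr_ge0 ?invr_ge0 ?ltW ?pos.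
  apply: ler_pM; [exact: ltW|by rewrite invr_ge0 ltW ?pos|by []|].
  by rewrite lef_pV2 ?posrE ?pos // lerDr sqr_ge0.
have E1 : nrm2 0 L (fun x => f x - m x * g x) <= e / 4.
  rewrite (nrm2_eq (g := fun x => f x * (dk k * (m x ^+ 2 + dk k)^-1))).
    by apply: le_trans hk; exact: ler_norm.
  move=> x _; rewrite /g /w; field; by rewrite gt_eqF ?pos.
(* The three approximations add up to 10 eta; multiplied by m^2 <= L^8 this stays below e / 4. *)
pose eta := e / (40 * (L ^+ 8 + 1)).
have L8 : 0 < L ^+ 8 by exact: exprn_gt0.
have eta0 : 0 < eta by rewrite divr_gt0 // mulr_gt0 //; lra.
have [n [g1 [n0 mg1 g1n E2]]] := approx_bounded lg eta0.
have [c [cc cn E3]] := approx_continuous n0 mg1 g1n eta0.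
have [C [C1 [C2 [a1 a2 l2 E4]]]] := approx_C2 L0' cc cn eta0.
have lC := L2_AC L0' a1.
have lg1 : L2r 0 L g1 by exact: L2_bnd.
have lc : L2r 0 L c by apply: continuous_L2 => // x _; exact: cc.
have E5 : nrm2 0 L (fun x => g x - C x) <= 2 * eta + 2 * (2 * eta + 2 * eta).
  by apply: nrm2_tri E2 _ => //; apply: nrm2_tri E3 E4.
exists (fun x => m x * C x), (fun x => m1 x * C x + m x * C1 x),
  (fun x => m2 x * C x + m1 x * C1 x + (m1 x * C1 x + m x * C2 x)); split.
- exact: AC_mul. - exact: AC_add (AC_mul L0' am1 a1) (AC_mul L0' am a2).
- apply: L2_add; apply: L2_add.
  + apply: (@L2_mulAC _ 0 L C m2 (fun x => - (12 * (L - 2 * x)) )) => //.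
    have := AC_sub (AC_scale 2 (AC_mul L0' (AC_sub (AC_cst L L0') (AC_scale 2 aid)) (AC_sub (AC_cst L L0') (AC_scale 2 aid)))) (AC_scale 4 aq).
    by apply: AC_ext => x _; rewrite /m2; ring.
  + exact: L2_mulAC L0' (L2_AC L0' a2) am1.
  + exact: L2_mulAC L0' (L2_AC L0' a2) am1.
  + exact: L2_mulAC L0' l2 am.
- by rewrite /m /m1; split; ring.
- have lmg : L2r 0 L (fun x => m x * g x) by exact: L2_mulAC L0' lg am.
  have lmC : L2r 0 L (fun x => m x * C x) by exact: L2_mulAC L0' lC am.
  have E6 : nrm2 0 L (fun x => m x * g x - m x * C x) <= L ^+ 8 * nrm2 0 L (fun x => g x - C x).
    apply: HI_le (nrm2_HI (L2_sub lmg lmC)) (HI_scale (L ^+ 8) (nrm2_HI (L2_sub lg lC))) _ => x xL /=.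
    rewrite -mulrBr exprMn; apply: ler_wpM2r; first exact: sqr_ge0.
    have /andP[mx mxL] := mL x xL; rewrite (exprM L 4 2).
    by apply: lerXn2r; rewrite ?nnegrE ?(ltW mx) ?exprn_ge0.
  have E7 : L ^+ 8 * nrm2 0 L (fun x => g x - C x) <= e / 4.
    apply: le_trans (ler_wpM2l (ltW L8) E5) _.
    have h1 : eta * (40 * (L ^+ 8 + 1)) = e by rewrite divfK // gt_eqF // mulr_gt0 //; lra.
    move: h1 eta0; generalize (L ^+ 8) => z; clear; lra.
  apply: le_trans (nrm2_tri lf lmg lmC E1 (le_trans E6 E7)) _; lra.
Unshelve. all: by end_near. Qed.

(** Second derivatives of H^2_0 functions are exactly the square integrable functions orthogonal to
    affine functions. This is necessity, by integration by parts; [H20r_primitive] is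
    sufficiency. *)
Lemma H20r_moments (L : R) (W W1 w : R -> R) : 0 < L -> acont 0 L W W1 -> acont 0 L W1 w ->
  W 0 = 0 -> W1 0 = 0 -> W L = 0 -> W1 L = 0 -> HI 0 L w 0 /\ HI 0 L (fun x => x * w x) 0.
Proof.
move=> L0 h1 h2 e1 e2 e3 e4; have L0' := ltW L0.
have aid : acont 0 L (fun x => x) (fun=> 1).
  split; first by have [] := HI_cst 1 L0'.
  by move=> x /andP[x0 _]; have [_ ->] := HI_cst 1 x0; ring.
have i1 := AC_HI L0' h1; have i2 := AC_HI L0' h2.
rewrite e3 e1 subrr in i1; rewrite e4 e2 subrr in i2; split=> //.
have := HI_sub (AC_HI L0' (AC_mul L0' aid h2)) i1; rewrite e4 mul0r mulr0 !subrr.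
by apply: HI_eq => x _; ring.
Qed.

(** The double primitive from 0: the first moment condition gives W'(L) = 0, and integrating x W''
    by parts then gives W(L) = 0. *)
Lemma H20r_primitive (L : R) (w : R -> R) : 0 < L -> L2r 0 L w -> II 0 L w = 0 ->
  II 0 L (fun x => x * w x) = 0 ->
  exists W W1, [/\ acont 0 L W W1, acont 0 L W1 w & [/\ W 0 = 0, W1 0 = 0, W L = 0 & W1 L = 0]].
Proof.
move=> L0 lw e1 e2; have L0' := ltW L0.
have aid : acont 0 L (fun x => x) (fun=> 1).
  split; first by have [] := HI_cst 1 L0'.
  by move=> x /andP[x0 _]; have [_ ->] := HI_cst 1 x0; ring.
pose W1 x := II 0 x w; have a1 : acont 0 L W1 w by exact: AC_prim (L2_L1 lw).
pose W x := II 0 x W1; have a : acont 0 L W W1 by exact: AC_prim (L2_L1 (L2_AC L0' a1)).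
exists W, W1; split => //; split; [exact: II_nil|exact: II_nil| |exact: e1].
have lid := L2_AC L0' aid.
have [_ E] := HI_sub (AC_HI L0' (AC_mul L0' aid a1)) (L1_HI (L2_mul_L1 lid lw)).
move: E; rewrite e2 (_ : W1 L = 0) // mulr0 mul0r !subrr => <-.
by apply: II_eq => x _; ring.
Qed.

(* The affine function is minus the orthogonal projection of [r] with weight [p]. *)
Lemma affine_correction (L pm pM : R) (p r : R -> R) : 0 < L -> 0 < pm -> measurable_fun `]0, L[ p ->
  (forall x, pm <= p x <= pM) -> L2r 0 L r ->
  exists k0 k1 : R, [/\ II 0 L (fun x => p x * (r x + (k0 + k1 * x))) = 0,
    II 0 L (fun x => x * (p x * (r x + (k0 + k1 * x)))) = 0 &
    nrm2 0 L (fun x => r x + (k0 + k1 * x)) <= pM / pm * nrm2 0 L r].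
Proof.
move=> L0 pm0 mp pb lr; have L0' := ltW L0.
have pM0 : 0 < pM by have /andP[h1 h2] := pb 0; exact: lt_le_trans pm0 (le_trans h1 h2).
have pabs x : `|p x| <= pM by have /andP[h1 h2] := pb x; rewrite ger0_norm // (le_trans (ltW pm0)).
have pl f : L2r 0 L f -> L2r 0 L (fun x => p x * f x) by move=> hf; apply: L2_mulb hf mp _ => x _; exact: pabs.
have aid : acont 0 L (fun x => x) (fun=> 1).
  split; first by have [] := HI_cst 1 L0'.
  by move=> x /andP[x0 _]; have [_ ->] := HI_cst 1 x0; ring.
have lid := L2_AC L0' aid; have l1 := @L2_cst _ 0 L 1.
pose J f g := II 0 L (fun x => p x * f x * g x).
have HJ f g : L2r 0 L f -> L2r 0 L g -> HI 0 L (fun x => p x * f x * g x) (J f g).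
  by move=> hf hg; apply: L1_HI; exact: L2_mul_L1 (pl f hf) hg.
pose m0 := J (fun=> 1) (fun=> 1).
have m00 : 0 < m0.
  apply: (@lt_le_trans _ _ (pm * (L - 0))); first by rewrite subr0 mulr_gt0.
  apply: HI_le (HI_cst pm L0') (HJ _ _ l1 l1) _ => x _; rewrite !mulr1.
  by case/andP: (pb x).
(* The weighted mean of x, so that t = x - xi is orthogonal to the constants. *)
pose xi := J (fun x => x) (fun=> 1) / m0.
pose t (x : R) := x - xi; have lt' : L2r 0 L t by exact: L2_sub lid (L2_cst 0 L xi).
have Jt1 : J t (fun=> 1) = 0.
  have [_ E] := HI_sub (HJ _ _ lid l1) (HI_scale xi (HJ _ _ l1 l1)).
  transitivity (J (fun x => x) (fun=> 1) - xi * m0); last by rewrite /xi divfK ?subrr // gt_eqF.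
  by rewrite -E; apply: II_eq => x _; rewrite /t; ring.
pose m2 := J t t.
have m20 : 0 < m2.
  (* A cubic primitive computes the unweighted integral of t^2, which is positive; [pm] bounds the
     weight from below. *)
  have at3 : acont 0 L (fun x => 3^-1 * (t x * (t x * t x))) (fun x => t x ^+ 2).
    have a0 : acont 0 L t (fun=> 1 - 0) by exact: AC_sub aid (AC_cst xi L0').
    apply: AC_ext (AC_scale 3^-1 (AC_mul L0' a0 (AC_mul L0' a0 a0))) => x _; [by []|by field].
  have [It E] := AC_HI L0' at3.
  have pos : 0 < 3^-1 * (t L * (t L * t L)) - 3^-1 * (t 0 * (t 0 * t 0)).
    have -> : 3^-1 * (t L * (t L * t L)) - 3^-1 * (t 0 * (t 0 * t 0)) = L * ((L / 2 - xi) ^+ 2 + L ^+ 2 / 12).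
      by rewrite /t; field.
    by rewrite mulr_gt0 // ltr_wpDl ?sqr_ge0 // divr_gt0 // exprn_gt0.
  apply: (lt_le_trans (mulr_gt0 pm0 pos)).
  apply: HI_le (HI_scale pm (conj It E)) (HJ _ _ lt' lt') _ => x _ /=.
  by rewrite -mulrA -expr2; apply: ler_wpM2r; [exact: sqr_ge0|case/andP: (pb x)].
pose c0 := - (J r (fun=> 1) / m0); pose c1 := - (J r t / m2).
exists (c0 - c1 * xi), c1.
pose u x := r x + (c0 + c1 * t x).
have lu : L2r 0 L u by exact: L2_add lr (L2_add (L2_cst 0 L c0) (L2_scale c1 lt')).
have uE x : r x + (c0 - c1 * xi + c1 * x) = u x by rewrite /u /t; ring.
have expand g : L2r 0 L g -> J u g = J r g + c0 * J (fun=> 1) g + c1 * J t g.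
  move=> hg; have [_ <-] := HI_add (HI_add (HJ _ _ lr hg) (HI_scale c0 (HJ _ _ l1 hg))) (HI_scale c1 (HJ _ _ lt' hg)).
  by apply: II_eq => x _; rewrite /u; ring.
have Jsym f g : J f g = J g f by apply: II_eq => x _; ring.
have u1 : J u (fun=> 1) = 0.
  by rewrite expand // Jt1 -/m0 /c0 mulNr divfK ?gt_eqF //; ring.
have ut : J u t = 0.
  have e1 : c1 * m2 = - J r t by rewrite /c1 mulNr divfK // gt_eqF.
  by rewrite expand // (Jsym (fun=> 1) t) Jt1 -/m2 e1; ring.
have ux : J u (fun x => x) = 0.
  have [_ E] := HI_add (HJ _ _ lu lt') (HI_scale xi (HJ _ _ lu l1)).
  transitivity (J u t + xi * J u (fun=> 1)); last by rewrite ut u1; ring.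
  by rewrite -E; apply: II_eq => x _; rewrite /t; ring.
split.
- by rewrite -[RHS]u1; apply: II_eq => x _; rewrite uE mulr1.
- by rewrite -[RHS]ux; apply: II_eq => x _; rewrite uE mulrC.
- rewrite (nrm2_eq (g := u)); last by move=> x _; exact: uE.
  (* Pythagoras in the weighted space; passing between weighted and plain norms costs pM / pm. *)
  have Juu : J u u <= J r r.
    have -> : J r r = J u u + c0 ^+ 2 * m0 + c1 ^+ 2 * m2.
      have lr' : r = (fun x => u x - (c0 + c1 * t x)) by apply/funext => x; rewrite /u; ring.
      have e1 := expand r lr; rewrite (Jsym (fun=> 1) r) (Jsym t r) in e1.
      have e2 : J r (fun=> 1) = - c0 * m0 by rewrite /c0 opprK divfK // gt_eqF.
      have e3 : J r t = - c1 * m2 by rewrite /c1 opprK divfK // gt_eqF.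
      have e4 : J u u = J r u.
        by rewrite expand // (Jsym (fun=> 1) u) u1 (Jsym t u) ut; ring.
      by rewrite e4 (Jsym r u) e1 e2 e3; ring.
    have := mulr_ge0 (sqr_ge0 c0) (ltW m00); have := mulr_ge0 (sqr_ge0 c1) (ltW m20); lra.
  have low : pm * nrm2 0 L u <= J u u.
    apply: HI_le (HI_scale pm (nrm2_HI lu)) (HJ _ _ lu lu) _ => x _ /=.
    by rewrite -mulrA -expr2; apply: ler_wpM2r; [exact: sqr_ge0|case/andP: (pb x)].
  have up : J r r <= pM * nrm2 0 L r.
    apply: HI_le (HJ _ _ lr lr) (HI_scale pM (nrm2_HI lr)) _ => x _ /=.
    by rewrite -mulrA -expr2; apply: ler_wpM2r; [exact: sqr_ge0|case/andP: (pb x)].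
  by rewrite mulrAC ler_pdivlMr // mulrC; exact: le_trans low (le_trans Juu up).
Qed.

End Approximation.

Section Density.
Variables (R : realType) (l L : R).
Hypotheses (l0 : 0 < l) (lL : l < L).
Variables (q1 q2 D qq DD : R -> R) (c0 Q : R).
Hypotheses (c00 : 0 < c0) (q1_b : ess_bounded 0 l q1) (q2_b : ess_bounded l L q2)
  (D_b : ess_bounded 0 l D).
Hypotheses (mqq : measurable_fun `]0, L[ qq) (qq_b : forall t, c0 <= qq t <= Q).
Hypotheses (mDD : measurable_fun `]0, L[ DD) (DD_b : forall t, 0 <= DD t <= Q).
Local Notation mu := (@lebesgue_measure R).
Hypotheses (qq1 : {ae mu, forall t, `]0, l[%classic t -> q1 t = qq t})
  (qq2 : {ae mu, forall t, `]l, L[%classic t -> q2 t = qq t})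
  (DD1 : {ae mu, forall t, `]0, l[%classic t -> D t = DD t})
  (DD2 : forall t, l < t -> DD t = 0).

Let L0 : 0 < L := lt_trans l0 lL.

Lemma H20_dense (f : R -> R[i]) (e : R) : L2c 0 L f -> 0 < e ->
  exists h h1 h2, H20 L h h1 h2 /\ nrm2 0 L (fun x => Re (f x) - Re (h x)) <= e /\
    nrm2 0 L (fun x => Im (f x) - Im (h x)) <= e.
Proof.
move=> [lr li] e0.
have [a [a1 [a2 [x1 x2 x3 [x4 x5 x6 x7] x8]]]] := H20r_dense L0 lr e0.
have [b [b1 [b2 [y1 y2 y3 [y4 y5 y6 y7] y8]]]] := H20r_dense L0 li e0.
exists (fun x => a x +i* b x), (fun x => a1 x +i* b1 x), (fun x => a2 x +i* b2 x).
by split => //; split; [split; split|rewrite x4 x5 x6 x7 y4 y5 y6 y7].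
Qed.

(* Approximate [V] in H^2_0, then [q w'' + D V''] in H^2 with an affine correction that keeps
   [w'' = (S - D V'') / q] orthogonal to the affine functions. *)
Lemma domA1_dense x e : energy_space l L x -> 0 < e ->
  exists2 y, domA1 q1 q2 D y & energy_norm q1 q2 (x - y) <= e.
Proof.
move=> /(E_rep l0 lL)[w0 [V0 hx]] e0; have [w [w1 [hw lV0 xE ewE]]] := hx.
have Q0 : 0 < Q by have /andP[h1 h2] := qq_b 0; exact: lt_le_trans c00 (le_trans h1 h2).
have qp t : 0 < qq t by have /andP[h1 _] := qq_b t; exact: lt_le_trans h1.
pose p t := (qq t)^-1.
have mp : measurable_fun `]0, L[ p by apply: measurable_invr => // t; rewrite gt_eqF.
have pb t : Q^-1 <= p t <= c0^-1.
  by have /andP[h1 h2] := qq_b t; rewrite !lef_pV2 ?posrE // h1 h2.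
have Qi : 0 < Q^-1 by rewrite invr_gt0.
have ci : 0 < c0^-1 by rewrite invr_gt0.
(* In the energy error, [Q] bounds the weight, c0^-2 the division by [qq], and the last factor is
   the bound of [affine_correction] for the weight 1 / qq. *)
pose K := Q * (c0^-1 ^+ 2 * (c0^-1 / Q^-1)).
have K0 : 0 < K by rewrite !mulr_gt0 ?invrK ?exprn_gt0.
pose eta := e ^+ 2 / (4 * (K + 1)).
have e20 : 0 < e ^+ 2 by rewrite exprn_gt0.
have eta0 : 0 < eta by rewrite divr_gt0 // mulr_gt0 //; lra.
have etaE : 2 * (K * eta) + 2 * eta <= e ^+ 2.
  have : eta * (4 * (K + 1)) = e ^+ 2 by rewrite divfK // gt_eqF // mulr_gt0 //; lra.
  by move=> h; have := mulr_gt0 K0 eta0; lra.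
have [V [V1 [V2 [hV [EVr EVi]]]]] := H20_dense lV0 eta0.
have lw0 : L2c 0 L w0 by case: hw => -[].
have lV2 : L2c 0 L V2 by case: hV => -[].
have lV : L2c 0 L V by case: hV => -[h _ _] _; exact: L2c_cac (ltW L0) h.
have lqw := L2c_bmul mqq (qq_abs c00 qq_b) lw0.
have lDV := L2c_bmul mDD (DD_abs DD_b) lV2.
(* The given velocity is only square integrable, so S0 uses the second derivative of its
   approximation [V]. *)
pose S0 t := (qq t)%:C * w0 t + (DD t)%:C * V2 t.
have lS0 : L2c 0 L S0 by apply: L2c_ext (L2c_comb 1 lqw lDV) => t _; rewrite mul1r.
have [T [T1 [T2 [[[hT1 hT2 lT2] _] [ETr ETi]]]]] := H20_dense lS0 eta0.
have lT := L2c_cac (ltW L0) hT1.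
have lr1 : L2r 0 L (fun t => Re (T t) - Re (S0 t)) by exact: L2_sub (proj1 lT) (proj1 lS0).
have lr2 : L2r 0 L (fun t => Im (T t) - Im (S0 t)) by exact: L2_sub (proj2 lT) (proj2 lS0).
have [a0 [a1 [A1e A2 A3]]] := affine_correction L0 Qi mp pb lr1.
have [b0 [b1 [B1 B2 B3]]] := affine_correction L0 Qi mp pb lr2.
have sym (f g : R -> R) : nrm2 0 L (fun t => f t - g t) = nrm2 0 L (fun t => g t - f t).
  by apply: II_eq => t _; ring.
rewrite sym in ETr; rewrite sym in ETi.
pose S t := T t + ((a0 + a1 * t) +i* (b0 + b1 * t)).
pose S1 t := T1 t + (a1 +i* b1).
have aff (k0 k1 : R) : acont 0 L (fun t => k0 + k1 * t) (fun=> k1).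
  have aid : acont 0 L (fun x : R => x) (fun=> 1).
    split; first by have [] := HI_cst 1 (ltW L0).
    by move=> t /andP[t0 _]; have [_ ->] := HI_cst 1 t0; ring.
  by apply: AC_ext (AC_add (AC_cst k0 (ltW L0)) (AC_scale k1 aid)) => t _; ring.
have hS : H2c L S S1 T2.
  split=> //.
    split; [apply: AC_ext (AC_add (proj1 hT1) (aff a0 a1)) | apply: AC_ext (AC_add (proj2 hT1) (aff b0 b1))];
    by move=> t _ /=; rewrite /S /S1; case: (T t) (T1 t) => ? ? [].
  split; [apply: AC_ext (AC_add (proj1 hT2) (AC_cst a1 (ltW L0))) | apply: AC_ext (AC_add (proj2 hT2) (AC_cst b1 (ltW L0)))];
  by move=> t _ /=; rewrite /S1 ?addr0; case: (T1 t).
(* The change (S - S0) / qq of w'', by real and imaginary parts; the affine correction makes it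
   orthogonal to affine functions, so that the new w'' again comes from H^2_0. *)
pose zr t := p t * (Re (T t) - Re (S0 t) + (a0 + a1 * t)).
pose zi t := p t * (Im (T t) - Im (S0 t) + (b0 + b1 * t)).
have pl (f : R -> R) : L2r 0 L f -> L2r 0 L (fun t => p t * f t).
  move=> hf; apply: (@L2_mulb _ 0 L f p c0^-1 hf mp) => t _; have /andP[h1 h2] := pb t.
  by rewrite ger0_norm // (le_trans (ltW Qi)).
have lur := L2_add lr1 (L2_AC (ltW L0) (aff a0 a1)).
have lui := L2_add lr2 (L2_AC (ltW L0) (aff b0 b1)).
have lzr : L2r 0 L zr by exact: pl lur.
have lzi : L2r 0 L zi by exact: pl lui.
have [[hw1 hw2 _] [v1 v2 v3 v4]] := hw.
have reE (z : R[i]) : z = 0 -> Re z = 0 by move=> ->.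
have imE (z : R[i]) : z = 0 -> Im z = 0 by move=> ->.
have [mr1 mr2] := H20r_moments L0 (proj1 hw1) (proj1 hw2) (reE _ v1) (reE _ v2) (reE _ v3) (reE _ v4).
have [mi1 mi2] := H20r_moments L0 (proj2 hw1) (proj2 hw2) (imE _ v1) (imE _ v2) (imE _ v3) (imE _ v4).
have aid : acont 0 L (fun x : R => x) (fun=> 1).
  split; first by have [] := HI_cst 1 (ltW L0).
  by move=> t /andP[t0 _]; have [_ ->] := HI_cst 1 t0; ring.
have mom (z u : R -> R) : HI 0 L u 0 -> HI 0 L (fun t => t * u t) 0 -> L2r 0 L z -> II 0 L z = 0 ->
    II 0 L (fun t => t * z t) = 0 -> II 0 L (fun t => u t + z t) = 0 /\ II 0 L (fun t => t * (u t + z t)) = 0.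
  move=> i1 i2 lz e1 e2.
  have [_ E1] := HI_add i1 (L1_HI (L2_L1 lz)).
  have [_ E2] := HI_add i2 (L1_HI (L2_mul_L1 (L2_AC (ltW L0) aid) lz)).
  rewrite e1 addr0 in E1; rewrite e2 addr0 in E2; split => //.
  by rewrite -[RHS]E2; apply: II_eq => t _; ring.
have [mR1 mR2] := mom zr _ mr1 mr2 lzr A1e A2.
have [mI1 mI2] := mom zi _ mi1 mi2 lzi B1 B2.
pose W2 t := w0 t + (zr t +i* zi t).
have lWr : L2r 0 L (Re \o W2).
  apply: L2_ext (L2_add (proj1 lw0) lzr) => t _ /=; by rewrite /W2; case: (w0 t).
have lWi : L2r 0 L (Im \o W2).
  apply: L2_ext (L2_add (proj2 lw0) lzi) => t _ /=; by rewrite /W2; case: (w0 t).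
have W2r t : Re (W2 t) = (Re \o w0) t + zr t by rewrite /W2 /=; case: (w0 t).
have W2i t : Im (W2 t) = (Im \o w0) t + zi t by rewrite /W2 /=; case: (w0 t).
have [||P [P1 [cP cP1 [g1 g2 g3 g4]]]] := H20r_primitive L0 lWr.
- by rewrite -[RHS]mR1; apply: II_eq => t _; exact: W2r.
- by rewrite -[RHS]mR2; apply: II_eq => t _; rewrite /= W2r.
have [||U [U1 [cU cU1 [k1 k2 k3 k4]]]] := H20r_primitive L0 lWi.
- by rewrite -[RHS]mI1; apply: II_eq => t _; exact: W2i.
- by rewrite -[RHS]mI2; apply: II_eq => t _; rewrite /= W2i.
pose W t := P t +i* U t; pose W1 t := P1 t +i* U1 t.
have hW : H20 L W W1 W2.
  by split; [split; split|rewrite /W /W1 g1 g2 g3 g4 k1 k2 k3 k4].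
have SE t : 0 < t < L -> S t = (qq t)%:C * W2 t + (DD t)%:C * V2 t.
  move=> _; apply/eqP; rewrite eq_complex /S /W2 /zr /zi /S0 /p.
  have qn : qq t != 0 by rewrite gt_eqF.
  case: (T t) (w0 t) (V2 t) => [? ?] [? ?] [? ?] /=.
  by apply/andP; split; apply/eqP; field.
have dr : drep qq DD (clH l L W, clH l L V) W W1 W2 V V1 V2 S S1 T2 by split.
exists (clH l L W, clH l L V); first by exact: (drep_dom l0 lL c00 q1_b q2_b D_b mqq qq_b mDD DD_b qq1 qq2 DD1 DD2 dr).
have hy := rep_intro l0 lL hW lV.
have hxy := rep_comb l0 lL (-1) hy hx; rewrite scaleN1r addrC in hxy.
have N2 := energy_norm_sq l0 lL c00 q1_b q2_b mqq qq_b qq1 qq2 (x - (clH l L W, clH l L V)).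
rewrite (ipE_rep l0 lL c00 mqq qq_b hxy hxy) in N2.
suff : energy_norm q1 q2 (x - (clH l L W, clH l L V)) ^+ 2 <= e ^+ 2.
  by rewrite ler_sqr // ?nnegrE ?energy_norm_ge0 ?(ltW e0).
rewrite N2; apply: le_trans etaE; apply: lerD.
  have [Hf _] := rep_L2 hxy.
  have I1 := L1_HI (dot_L1 (qq_ess c00 mqq qq_b (lexx 0) (lexx L)) Hf Hf).
  have I2 := HI_add (nrm2_HI lur) (nrm2_HI lui).
  apply: (@le_trans _ _ (Q * c0^-1 ^+ 2 * (nrm2 0 L (fun t => Re (T t) - Re (S0 t) + (a0 + a1 * t)) + nrm2 0 L (fun t => Im (T t) - Im (S0 t) + (b0 + b1 * t))))).
    apply: HI_le I1 (HI_scale (Q * c0^-1 ^+ 2) I2) _ => t _ /=.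
    have /andP[q1' q2'] := qq_b t; have /andP[p1 p2] := pb t.
    have -> : dot (-1 * W2 t + w0 t) (-1 * W2 t + w0 t) = zr t ^+ 2 + zi t ^+ 2.
      by rewrite /W2 /dot; case: (w0 t) => ? ? /=; ring.
    rewrite /zr /zi !exprMn -mulrDr mulrA; apply: ler_wpM2r; first by rewrite addr_ge0 ?sqr_ge0.
    apply: ler_pM; [exact: ltW|exact: sqr_ge0|by []|].
    by apply: lerXn2r; rewrite ?nnegrE ?(ltW ci) // (le_trans (ltW Qi)).
  have t0 : 0 <= Q * c0^-1 ^+ 2 by rewrite mulr_ge0 ?sqr_ge0 // ltW.
  have t1 : 0 <= c0^-1 / Q^-1 by rewrite divr_ge0 ?(ltW ci) ?(ltW Qi).
  have u1 := le_trans A3 (ler_wpM2l t1 ETr); have u2 := le_trans B3 (ler_wpM2l t1 ETi).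
  have -> : 2 * (K * eta) = Q * c0^-1 ^+ 2 * (c0^-1 / Q^-1 * eta + c0^-1 / Q^-1 * eta) by rewrite /K; ring.
  by apply: ler_wpM2l => //; exact: lerD.
have [_ HU] := rep_L2 hxy.
have I1 := L1_HI (dot_L1 (one_ess 0 L) HU HU).
have I2 := HI_add (nrm2_HI (L2_sub (proj1 lV0) (proj1 lV))) (nrm2_HI (L2_sub (proj2 lV0) (proj2 lV))).
have -> : 2 * eta = eta + eta by rewrite mulr_natl mulr2n.
apply: le_trans (lerD EVr EVi); apply: HI_le I1 I2 _ => t _ /=.
by rewrite /dot; case: (V t) (V0 t) => ? ? [? ?] /=; rewrite le_eqVlt; apply/orP; left; apply/eqP; ring.
Qed.

End Density.

(** * Stability *)

Section Stability.
Variables (R : realType) (l L : R).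
Hypotheses (l0 : 0 < l) (lL : l < L).
Variables (q1 q2 D qq DD : R -> R) (c0 Q : R).
Hypotheses (c00 : 0 < c0) (q1_b : ess_bounded 0 l q1) (q2_b : ess_bounded l L q2)
  (D_b : ess_bounded 0 l D).
Hypotheses (mqq : measurable_fun `]0, L[ qq) (qq_b : forall t, c0 <= qq t <= Q).
Hypotheses (mDD : measurable_fun `]0, L[ DD) (DD_b : forall t, 0 <= DD t <= Q).
Local Notation mu := (@lebesgue_measure R).
Hypotheses (qq1 : {ae mu, forall t, `]0, l[%classic t -> q1 t = qq t})
  (qq2 : {ae mu, forall t, `]l, L[%classic t -> q2 t = qq t})
  (DD1 : {ae mu, forall t, `]0, l[%classic t -> D t = DD t})
  (DD2 : forall t, l < t -> DD t = 0).
Variables (al be qc : R).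
Hypotheses (al0 : 0 <= al) (albe : al < be) (be_l : be <= l).
Hypotheses (DD_pos : forall t, al < t < be -> c0 <= DD t).
Hypotheses (left_medium : 0 < al -> exists q, medium L qq DD 0 al q)
  (right_medium : medium L qq DD l L qc)
  (middle_medium : be < l -> exists2 q, medium L qq DD be l q & q <= qc).

Let L0 : 0 < L := lt_trans l0 lL.
Local Notation E := (energy_space l L).
Local Notation N := (energy_norm q1 q2).
Local Notation dom := (domA1 q1 q2 D).
Local Notation A := (A1 q1 q2 D).

Lemma domA1_E (x : Hsp l L * Hsp l L) : dom x -> E x.
Proof. by case. Qed.

Lemma A1_E (x : Hsp l L * Hsp l L) : dom x -> E (A x).
Proof. by case. Qed.

Lemma A1_rep (x : Hsp l L * Hsp l L) : dom x -> exists W W1 W2 V V1 V2 S S1 S2,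
  [/\ H20 L W W1 W2, H20 L V V1 V2, H2c L S S1 S2,
    (forall t, 0 < t < L -> S t = (qq t)%:C * W2 t + (DD t)%:C * V2 t) &
    rep x W2 V /\ rep (A x) V2 (fun t => - S2 t)].
Proof.
move=> /(dom_drep l0 lL c00 q1_b q2_b D_b mqq qq_b mDD DD_b qq1 qq2 DD1 DD2).
move=> [W [W1 [W2 [V [V1 [V2 [S [S1 [S2 [[hW hV hS hE ex] eA]]]]]]]]]].
exists W, W1, W2, V, V1, V2, S, S1, S2; split; [exact: hW|exact: hV|exact: hS|exact: hE|].
have lV : L2c 0 L V by case: hV => -[h _ _] _; exact: L2c_cac (ltW L0) h.
have lS2 : L2c 0 L (fun t => - S2 t).
  have z : L2c 0 L (fun=> 0 : R[i]) by split; exact: L2_cst.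
  by case: hS => _ _ h; apply: L2c_ext (L2c_comb (-1) h z) => t _; rewrite mulN1r addr0.
split; first by rewrite ex; exact: (rep_intro l0 lL hW lV).
by rewrite eA; exact: (rep_intro l0 lL hV lS2).
Qed.

(** By Green's formula the real part equals minus the integral of [DD] times |v''|^2. *)
Lemma A1_dissipative (x : Hsp l L * Hsp l L) : dom x -> ipE qq (A x) x <= 0.
Proof.
move=> /A1_rep[W [W1 [W2 [V [V1 [V2 [S [S1 [S2 [hW hV hS hE [hx hA]]]]]]]]]]].
rewrite (ipE_rep l0 lL c00 mqq qq_b hA hx).
have lW2 : L2c 0 L W2 by case: hW => -[].
have [[cV cV1 lV2] [v1 v2 v3 v4]] := hV; have [cS cS1 lS2] := hS.
have lV := L2c_cac (ltW L0) cV; have lS := L2c_cac (ltW L0) cS.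
have G := dot_green (ltW L0) cS cS1 lS2 cV cV1 lV2 v1 v2 v3 v4.
have [_ E1] := HI_add (L1_HI (dot_L1 (qq_ess c00 mqq qq_b (lexx 0) (lexx L)) lV2 lW2))
  (L1_HI (sqmod_L1 (DD_ess mDD DD_b (lexx 0) (lexx L)) lV2)).
have [_ E2] := HI_opp (dot_HI lS2 lV).
have -> : II 0 L (fun t => 1 * dot (- S2 t) (V t)) = - II 0 L (fun t => dot (S2 t) (V t)).
  by rewrite -E2; apply: II_eq => t _; rewrite /dot !ReImE; ring.
have {}G : II 0 L (fun t => qq t * dot (V2 t) (W2 t)) + II 0 L (fun t => DD t * sqmod (V2 t)) =
    II 0 L (fun t => dot (S2 t) (V t)).
  by rewrite -G -E1; apply: II_eq => t tL; rewrite (hE t tL) /dot /sqmod !ReImE; ring.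
have : 0 <= II 0 L (fun t => DD t * sqmod (V2 t)).
  by apply: II_ge0 => t _; rewrite mulr_ge0 ?sqmod_ge0 //; case/andP: (DD_b t).
by rewrite -G; lra.
Qed.

Lemma wnorm_rep (x : Hsp l L * Hsp l L) f g : rep x f g -> N x ^+ 2 = wnorm L qq f g.
Proof.
move=> h; rewrite (energy_norm_sq l0 lL c00 q1_b q2_b mqq qq_b qq1 qq2) (ipE_rep l0 lL c00 mqq qq_b h h).
by congr (_ + _); apply: II_eq => t _; rewrite dotzz ?mul1r.
Qed.

Lemma A1_resolvent : exists2 M, 0 < M & forall (om : R) (x : Hsp l L * Hsp l L), dom x -> N x <= M * N ((0 +i* om) *: x - A x).
Proof.
have [M M0 HM] := resolvent_bound L0 c00 mqq qq_b mDD DD_b al0 albe (le_lt_trans be_l lL) DD_pos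
  left_medium be_l right_medium middle_medium.
(* [X] and [d] are squared norms, and 1 + M bounds the square root of [M]. *)
have M2 : M <= (1 + M) ^+ 2 by have := sqr_ge0 M; lra.
exists (1 + M) => [|om x dx]; first by rewrite addr_gt0.
have [W [W1 [W2 [V [V1 [V2 [S [S1 [S2 [hW hV hS hE [hx hA]]]]]]]]]]] := A1_rep dx.
have t01 : 0 < (1 : R) <= 1 by rewrite ltr01 lexx.
pose r := RData om t01 hW hV hS hE.
have hy := rep_comb l0 lL (0 +i* om) hx (rep_scale l0 lL (-1) hA); rewrite scaleN1r in hy.
have Ex : N x ^+ 2 = X r by exact: wnorm_rep hx.
have Ed : N ((0 +i* om) *: x - A x) ^+ 2 = d r.
  rewrite (wnorm_rep hy) /d /wnorm; congr (_ + _); apply: II_eq => t _.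
    by rewrite /rf2 /= mulN1r.
  by rewrite /rg /= mulN1r opprK.
have h := HM r; rewrite -Ex -Ed in h.
have n1 := energy_norm_ge0 q1 q2 x; have n2 := energy_norm_ge0 q1 q2 ((0 +i* om) *: x - A x).
rewrite -ler_sqr ?nnegrE ?n1 //; last by rewrite mulr_ge0 // addr_ge0 // ltW.
apply: (le_trans h); rewrite exprMn; apply: ler_wpM2r; first exact: sqr_ge0.
exact: M2.
Qed.

Lemma beam_stable (T : R -> Hsp l L * Hsp l L -> Hsp l L * Hsp l L) : C0_semigroup E N T ->
  generates E N dom A T -> exponentially_stable E N T.
Proof.
move=> sg gen; have [M M0 HM] := A1_resolvent.
apply: (@gearhart_pruss R _ E N (ipE qq) _ _ _ _ _ _ dom A T _ _ _ _ sg gen M M0 HM).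
- exact: (E_comb l0 lL).
- exact: energy_norm_ge0.
- move=> x _; exact: (energy_norm_sq l0 lL c00 q1_b q2_b mqq qq_b qq1 qq2).
- exact: (ipE_sym l0 lL c00 mqq qq_b).
- exact: (ipE_comb l0 lL c00 mqq qq_b).
- exact: (ipE_scale l0 lL c00 mqq qq_b).
- exact: domA1_E.
- exact: A1_E.
- exact: A1_dissipative.
- exact: (domA1_dense l0 lL c00 q1_b q2_b D_b mqq qq_b mDD DD_b qq1 qq2 DD1 DD2).
Qed.

End Stability.

(** * Coefficients with bounds at every point *)

Section Truncation.
Variable R : realType.
Implicit Types (c Q x y : R).

(** Projection onto [c, Q]. It turns essential bounds into bounds at every point, and its
    monotonicity preserves the order of the two stiffness constants at [l]. *)
Definition truncate c Q x : R := (c + Q) / 2 + clamp ((Q - c) / 2) (x - (c + Q) / 2).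

Lemma truncate_bounds c Q x : c <= Q -> c <= truncate c Q x <= Q.
Proof.
move=> cQ; have n0 : 0 <= (Q - c) / 2 by rewrite divr_ge0 ?subr_ge0.
have := clamp_le (x - (c + Q) / 2) n0; rewrite ler_norml /truncate => /andP[h1 h2].
by apply/andP; split; lra.
Qed.

Lemma truncate_id c Q x : c <= x -> x <= Q -> truncate c Q x = x.
Proof.
move=> h1 h2; rewrite /truncate clamp_id; first lra.
by rewrite ler_norml; apply/andP; split; lra.
Qed.

Lemma truncate_mono c Q x y : c <= Q -> x <= y -> truncate c Q x <= truncate c Q y.
Proof.
move=> cQ xy; rewrite /truncate lerD2l /clamp.
set n := (Q - c) / 2; set m := (c + Q) / 2; have n0 : 0 <= n by rewrite divr_ge0 ?subr_ge0.
case: (ger0P (x - m + n)) => h1; case: (ger0P (x - m - n)) => h2;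
case: (ger0P (y - m + n)) => h3; case: (ger0P (y - m - n)) => h4; lra.
Qed.

Lemma truncate_meas (B : set R) c Q (f : R -> R) : measurable_fun B f -> measurable_fun B (fun x => truncate c Q (f x)).
Proof.
move=> mf; apply: measurable_funD; first exact: measurable_cst.
apply: clamp_meas; apply: measurable_funB => //; exact: measurable_cst.
Qed.

(** Measurability passes through integrability, where [L1_cat] takes care of the point [c]; the
    bound makes the pieces integrable. *)
Lemma measurable_cat (a b c M : R) (f : R -> R) : a <= c -> c <= b -> measurable_fun `]a, c[ f ->
  measurable_fun `]c, b[ f -> (forall x, `|f x| <= M) -> measurable_fun `]a, b[ f.
Proof.
move=> ac cb m1 m2 fM; apply: L1_meas; apply: (L1_cat ac cb).
  exact: L1_bnd m1 (fun x _ => fM x).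
exact: L1_bnd m2 (fun x _ => fM x).
Qed.

End Truncation.

Theorem theorem2p1 (R : realType) (alpha beta l L c0 : R) (q1 q2 b : R -> R)
  (h_alpha : 0 <= alpha) (h_alpha_beta : alpha < beta) (h_beta_l : beta <= l)
  (h_l_L : l < L) (h_c0 : 0 < c0)
  (q1_bounded : ess_bounded 0 l q1) (q2_bounded : ess_bounded l L q2)
  (q1_ge : ess_ge 0 l c0 q1) (q2_ge : ess_ge l L c0 q2)
  (Db_bounded : ess_bounded 0 l (damping alpha beta b))
  (b_ge : ess_ge alpha beta c0 b)
  (q1_cst_left : exists k : R, forall x, 0 < x < alpha -> q1 x = k)
  (q1_cst_right : exists k : R, forall x, beta < x < l -> q1 x = k)
  (q2_cst : exists k : R, forall x, l < x < L -> q2 x = k)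
  (b_cont : {within `[alpha, beta], continuous b})
  (q1_cont : {within `[alpha, beta], continuous q1})
  (q1_q2_at_l : lim (q1 x @[x --> l^'-]) <= lim (q2 x @[x --> l^'+]))
  (T : R -> Hsp l L * Hsp l L -> Hsp l L * Hsp l L)
  (T_semigroup : C0_semigroup (energy_space l L) (energy_norm q1 q2) T)
  (T_generated : generates (energy_space l L) (energy_norm q1 q2)
     (domA1 q1 q2 (damping alpha beta b)) (A1 q1 q2 (damping alpha beta b)) T) :
  exponentially_stable (energy_space l L) (energy_norm q1 q2) T.
Proof.
have l0 : 0 < l by exact: le_lt_trans h_alpha (lt_le_trans h_alpha_beta h_beta_l).
have [mq1 [M1 B1]] := q1_bounded; have [mq2 [M2 B2]] := q2_bounded; have [mD [M3 B3]] := Db_bounded.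
(* Dominates the three essential bounds and [c0], so that truncation to [c0, Q] alters the
   coefficients only on null sets. *)
pose Q := c0 + `|M1| + `|M2| + `|M3|.
have n1 := normr_ge0 M1; have n2 := normr_ge0 M2; have n3 := normr_ge0 M3.
have cQ : c0 <= Q by rewrite /Q; lra.
have Q0 : 0 < Q by exact: lt_le_trans cQ.
have b1 : M1 <= Q by have := ler_norm M1; rewrite /Q; lra.
have b2 : M2 <= Q by have := ler_norm M2; rewrite /Q; lra.
have b3 : M3 <= Q by have := ler_norm M3; rewrite /Q; lra.
pose inside (t : R) := (alpha < t) && (t < beta).
pose qq t := truncate c0 Q (if t < l then q1 t else q2 t).
(* Truncation from below at c0 makes the damping positive at every point of the damped interval;
   outside it the coefficient is exactly 0. *)
pose DD t := if inside t then truncate c0 Q (damping alpha beta b t) else 0.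
have qq_b t : c0 <= qq t <= Q by exact: truncate_bounds.
have DD_b t : 0 <= DD t <= Q.
  rewrite /DD; case: (inside t); last by rewrite lexx ltW.
  by have /andP[h1 ->] := truncate_bounds (damping alpha beta b t) cQ; rewrite (le_trans (ltW h_c0)).
have mqq : measurable_fun `]0, L[ qq.
  apply: (measurable_cat (ltW l0) (ltW h_l_L) (M := Q)).
  - apply: truncate_meas; apply: eq_measurable_fun mq1 => t; rewrite inE /= in_itv /= => /andP[_ tl].
    by rewrite tl.
  - apply: truncate_meas; apply: eq_measurable_fun mq2 => t; rewrite inE /= in_itv /= => /andP[tl _].
    by rewrite ltNge ltW.
  - by move=> t; have /andP[h1 h2] := qq_b t; rewrite ger0_norm // (le_trans (ltW h_c0)).
have damping_in t : inside t -> damping alpha beta b t = b t.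
  by move=> it; rewrite /damping indicE mem_set ?mulr1 //= in_itv.
have damping_out t : ~~ inside t -> damping alpha beta b t = 0.
  by move=> it; rewrite /damping indicE memNset ?mulr0 //= in_itv /=; apply/negP.
have outside_l t : l < t -> ~~ inside t.
  by move=> lt; rewrite negb_and -!leNgt orbC (le_trans h_beta_l) // ltW.
have mDD : measurable_fun `]0, L[ DD.
  apply: (measurable_cat (ltW l0) (ltW h_l_L) (M := Q)).
  - have mi : measurable_fun (`]0, l[%classic : set R) (\1_(`]alpha, beta[%classic) : R -> R).
      apply: measurable_funTS; apply: measurable_indic; exact: mitv.
    have := measurable_funM mi (truncate_meas c0 Q mD).
    apply: eq_measurable_fun => t _ /=; rewrite /DD indicE.
    case: (boolP (inside t)) => it; first by rewrite mem_set ?mul1r //= in_itv.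
    by rewrite memNset ?mul0r //= in_itv /=; apply/negP.
  - apply: eq_measurable_fun (measurable_cst (0 : R)) => t; rewrite inE /= in_itv /= => /andP[lt _].
    by rewrite /DD (negbTE (outside_l t lt)).
  - by move=> t; have /andP[h1 h2] := DD_b t; rewrite ger0_norm.
have qq1 : {ae @lebesgue_measure R, forall t, `]0, l[%classic t -> q1 t = qq t}.
  apply: aeS2 B1 q1_ge => t h1 h2 ht; have /= := ht; rewrite in_itv /= => /andP[_ tl].
  rewrite /qq tl truncate_id //; first exact: h2.
  exact: le_trans (ler_norm _) (le_trans (h1 ht) b1).
have qq2 : {ae @lebesgue_measure R, forall t, `]l, L[%classic t -> q2 t = qq t}.
  apply: aeS2 B2 q2_ge => t h1 h2 ht; have /= := ht; rewrite in_itv /= => /andP[tl _].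
  rewrite /qq ltNge ltW //= truncate_id //; first exact: h2.
  exact: le_trans (ler_norm _) (le_trans (h1 ht) b2).
have DD1 : {ae @lebesgue_measure R, forall t, `]0, l[%classic t -> damping alpha beta b t = DD t}.
  apply: aeS2 B3 b_ge => t h1 h2 ht; rewrite /DD; case: (boolP (inside t)) => it; last exact: damping_out.
  rewrite truncate_id //; last exact: le_trans (ler_norm _) (le_trans (h1 ht) b3).
  by rewrite damping_in //; apply: h2; rewrite /= in_itv.
have DD2 t : l < t -> DD t = 0 by move=> lt; rewrite /DD (negbTE (outside_l t lt)).
have DD_pos t : alpha < t < beta -> c0 <= DD t.
  by move=> it; rewrite /DD /inside it; case/andP: (truncate_bounds (damping alpha beta b t) cQ).
have trunc_gt0 x : 0 < truncate c0 Q x.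
  by have /andP[h _] := truncate_bounds x cQ; exact: lt_le_trans h.
have [k2 hk2] := q2_cst; have [k1 hk1] := q1_cst_right.
have left_medium : 0 < alpha -> exists q, medium L qq DD 0 alpha q.
  move=> a0; have [k hk] := q1_cst_left; exists (truncate c0 Q k); split=> //.
    by rewrite (le_trans (ltW h_alpha_beta)) // (le_trans h_beta_l) // ltW.
  move=> t /andP[t0 ta]; have tl : t < l by rewrite (lt_trans ta) // (lt_le_trans h_alpha_beta).
  by rewrite /qq tl hk ?t0 // /DD /inside ltNge ltW.
have right_medium : medium L qq DD l L (truncate c0 Q k2).
  split=> //; first exact: ltW.
  by move=> t /andP[lt tL]; rewrite /qq ltNge ltW //= hk2 ?lt // DD2.
have middle_medium : beta < l -> exists2 q, medium L qq DD beta l q & q <= truncate c0 Q k2.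
  move=> bl; exists (truncate c0 Q k1).
    split=> //; [by rewrite (le_trans h_alpha) // ltW|exact: ltW|].
    by move=> t /andP[bt tl]; rewrite /qq tl hk1 ?bt // /DD /inside (ltNge t) (ltW bt) andbF.
  (* Since beta < l, both coefficients are constant near [l] on their own sides, so the one-sided
     limits are k1 and k2. *)
  apply: truncate_mono => //.
  have e1 : lim (q1 x @[x --> l^'-]) = k1.
    apply/cvg_lim => //; apply: cvg_near_cst; near=> t; apply: hk1; apply/andP; split.
      by near: t; exact: nbhs_left_gt.
    by near: t; exact: nbhs_left_lt.
  have e2 : lim (q2 x @[x --> l^'+]) = k2.
    apply/cvg_lim => //; apply: cvg_near_cst; near=> t; apply: hk2; apply/andP; split.
      by near: t; exact: nbhs_right_gt.
    by near: t; exact: nbhs_right_lt.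
  by move: q1_q2_at_l; rewrite e1 e2.
exact: (beam_stable l0 h_l_L h_c0 q1_bounded q2_bounded Db_bounded mqq qq_b mDD DD_b qq1 qq2 DD1 DD2
  h_alpha h_alpha_beta h_beta_l DD_pos left_medium right_medium middle_medium T_semigroup T_generated).
Unshelve. all: by end_near. Qed.
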